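(* For every integer $t>0$ there exists an integer $c=c(t)$ such that every graph in $\mathcal{F}_t$ with treewidth more than $c$ and with no star cutset contains a subdivision of $W_{t\times t}$ as an induced subgraph.
   Context: A hole is an induced cycle of length at least four. $G$ is sparse if for every hole $H$ and vertex $v\notin V(H)$ there is an edge $ab$ of $H$ with $N(v)\cap V(H)\subseteq\{a,b\}$. A pyramid consists of a vertex $a$, a triangle $\{b_1,b_2,b_3\}$ and three paths $P_i$ from $a$ to $b_i$ of length at least one such that for $i\neq j$ the sets $P_i\setminus\{a\},P_j\setminus\{a\}$ are disjoint with the only edge between them being $b_ib_j$, and at most one $P_i$ has length one. A prism consists of two disjoint triangles $\{a_1,a_2,a_3\},\{b_1,b_2,b_3\}$ and three pairwise disjoint paths $P_i$ from $a_i$ to $b_i$ of length at least one such that for $i\ne j$ the only edges between $P_i$ and $P_j$ are $a_ia_j,b_ib_j$. A graph is very sparse if it is sparse and has no induced pyramid or prism; $\mathcal{F}_t$ is the class of very sparse graphs with no clique of size $t+1$. A separation is a partition $(A,C,B)$ of $V(G)$ with $A$ anticomplete to $B$; it is a star separation if some $v\in C$ has $C\subseteq N[v]$, proper if $A,B\neq\emptyset$; $G$ has a star cutset if it has a proper star separation. Walls: $\Gamma_k$ has vertex set $\{(i,j):1\le i\le k,0\le j\le 2k-1\}$, $(i,j)\sim(i,j+1)$ for $0\le j\le 2k-2$, $(i,j)\sim(i+1,j)$ when $1\le i\le k-1$ and $i+j$ odd; $W_{k\times k}$ is obtained by deleting degree-one vertices and suppressing each remaining vertex of row $1$ or $k$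 with no neighbor in another row. A subdivision replaces edges by paths. *)

(* Defs.v *)
From mathcomp Require Import all_boot.
From mathcomp Require Import boolp.

Set Implicit Arguments.
Unset Strict Implicit.
Unset Printing Implicit Defensive.

(* Finite simple graphs. *)
Record sgraph := SGraph {
  svertex :> finType;
  sedge : rel svertex;
  sedge_sym : symmetric sedge;
  sedge_irrefl : irreflexive sedge }.

Arguments sedge {_}.

Notation "x -- y" := (sedge x y) (at level 30).

Definition neighb (G : sgraph) (v : G) : {set G} := [set u | v -- u].
Definition cneighb (G : sgraph) (v : G) : {set G} := v |: neighb v.

Definition clique (G : sgraph) (K : {set G}) : Prop :=
  {in K &, forall x y, x != y -> x -- y}.

Definition induced_subgraph (H G : sgraph) : Prop :=
  exists f : H -> G, injective f /\ forall x y, f x -- f y = x -- y.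

(* The vertex sequence [x :: p] is a chordless path of G from x to y; its
   length is [size p]. *)
Definition induced_path (G : sgraph) (x : G) (p : seq G) (y : G) : Prop :=
  [/\ path sedge x p, last x p = y, uniq (x :: p)
    & {in x :: p &, forall u v, u -- v ->
         index v (x :: p) = (index u (x :: p)).+1 \/
         index u (x :: p) = (index v (x :: p)).+1}].

Definition hole (G : sgraph) (p : seq G) : Prop :=
  [/\ ucycle sedge p, 4 <= size p
    & {in p &, forall u v, u -- v -> v = next p u \/ u = next p v}].

Definition sparse (G : sgraph) : Prop :=
  forall (p : seq G) (v : G), hole p -> v \notin p ->
    exists a b : G, [/\ a \in p, b \in p, a -- b
      & neighb v :&: [set x in p] \subset [set a; b]].

(* Since [a :: P i] is the vertex sequence of the i-th path, [P i] lists the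
   vertices of that path other than a. *)
Definition induced_pyramid (G : sgraph) (a : G) (b : 'I_3 -> G)
    (P : 'I_3 -> seq G) : Prop :=
  [/\ forall i j, i != j -> b i -- b j,
      forall i, induced_path a (P i) (b i) /\ 1 <= size (P i),
      forall i j, i != j ->
        {in P i & P j, forall x y,
           x <> y /\ (x -- y <-> x = b i /\ y = b j)}
    & forall i j, size (P i) = 1 -> size (P j) = 1 -> i = j].

Definition induced_prism (G : sgraph) (a b : 'I_3 -> G)
    (P : 'I_3 -> seq G) : Prop :=
  [/\ forall i j, i != j -> a i -- a j /\ b i -- b j,
      forall i j, a i <> b j,
      forall i, induced_path (a i) (P i) (b i) /\ 1 <= size (P i)
    & forall i j, i != j ->
        {in a i :: P i & a j :: P j, forall x y,
           x <> y /\
           (x -- y <-> (x = a i /\ y = a j) \/ (x = b i /\ y = b j))}].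

Definition very_sparse (G : sgraph) : Prop :=
  [/\ sparse G,
      ~ (exists a b P, @induced_pyramid G a b P)
    & ~ (exists a b P, @induced_prism G a b P)].

Definition classF (t : nat) (G : sgraph) : Prop :=
  very_sparse G /\ ~ (exists K : {set G}, clique K /\ #|K| = t.+1).

Definition separation (G : sgraph) (A C B : {set G}) : Prop :=
  [/\ A :|: C :|: B = setT,
      [/\ [disjoint A & C], [disjoint C & B] & [disjoint A & B]]
    & {in A & B, forall x y, ~~ x -- y}].

Definition star_separation (G : sgraph) (A C B : {set G}) : Prop :=
  separation A C B /\ exists2 v, v \in C & C \subset cneighb v.

Definition proper_separation (G : sgraph) (A C B : {set G}) : Prop :=
  [/\ separation A C B, A != set0 & B != set0].

Definition has_star_cutset (G : sgraph) : Prop :=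
  exists A C B : {set G}, star_separation A C B /\ proper_separation A C B.

Definition connected_set (G : sgraph) (S : {set G}) : Prop :=
  {in S &, forall x y,
     connect [rel u v : G | [&& u \in S, v \in S & u -- v]] x y}.

Definition is_tree (T : sgraph) : Prop :=
  [/\ 0 < #|T|, connected_set [set: T]
    & forall p : seq T, ucycle sedge p -> size p < 3].

Definition tree_decomposition (G T : sgraph) (B : T -> {set G}) : Prop :=
  [/\ is_tree T,
      forall v : G, exists i, v \in B i,
      forall u v : G, u -- v -> exists i, u \in B i /\ v \in B i
    & forall v : G, connected_set [set i | v \in B i]].

Definition width (G T : sgraph) (B : T -> {set G}) : nat :=
  (\max_(i : T) #|B i|).-1.

Definition has_width (G : sgraph) (w : nat) : Prop :=
  exists (T : sgraph) (B : T -> {set G}), tree_decomposition B /\ width B = w.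

Definition unit_graph : sgraph :=
  @SGraph unit (fun _ _ => false) (fun _ _ => erefl) (fun _ => erefl).

Lemma has_width_ex (G : sgraph) : exists w, `[< has_width G w >].
Proof.
exists (width (fun _ : unit_graph => [set: G])); apply/asboolP.
exists unit_graph, (fun=> setT); split=> //; split.
- split; first by rewrite card_unit.
  + by move=> [] [] _ _; exact: connect0.
  + by case=> [|x [|y p]] //; rewrite /ucycle /=; case.
- by move=> v; exists tt; rewrite inE.
- by move=> u v _; exists tt; rewrite !inE.
- by move=> v [] [] _ _; exact: connect0.
Qed.

(* In [nat], the null graph gets treewidth 0 rather than -1. *)
Definition treewidth (G : sgraph) : nat := ex_minn (has_width_ex G).

(* S is a subdivision of H: [f] embeds the vertices of H, and the edge xy of H
   is replaced by the path [f x :: rcons (P x y) (f y)], so that [P x y] lists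
   its internal vertices.  [P x y] is meaningless when x and y are not
   adjacent. *)
Definition is_subdivision (H S : sgraph) : Prop :=
  exists (f : H -> S) (P : H -> H -> seq S),
  let Q x y := f x :: rcons (P x y) (f y) in
  [/\ injective f,
      forall x y, x -- y ->
        [/\ path sedge (f x) (rcons (P x y) (f y)), uniq (Q x y),
            P y x = rev (P x y) & forall z, f z \notin P x y],
      forall x y x' y' u, x -- y -> x' -- y' ->
        u \in P x y -> u \in P x' y' ->
        (x' = x /\ y' = y) \/ (x' = y /\ y' = x),
      forall u, (exists x, u = f x) \/
                (exists x y, x -- y /\ u \in P x y)
    & forall u v, u -- v -> exists x y, x -- y /\ infix [:: u; v] (Q x y)].

Section Wall.
Variable k : nat.

Definition gvertex : finType := ('I_k * 'I_(2 * k))%type.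

(* Rows are numbered 1, ..., k and columns 0, ..., 2k - 1. *)
Definition row (x : gvertex) : nat := x.1.+1.
Definition col (x : gvertex) : nat := x.2.

Definition garc (x y : gvertex) : bool :=
  (row y == row x) && (col y == (col x).+1)
  || [&& row y == (row x).+1, col y == col x & odd (row x + col x)].

Definition gedge (x y : gvertex) : bool := garc x y || garc y x.

Lemma gedge_sym : symmetric gedge.
Proof. by move=> x y; rewrite /gedge orbC. Qed.

Lemma gedge_irrefl : irreflexive gedge.
Proof. by move=> x; rewrite /gedge /garc !(ltn_eqF (ltnSn _)) andbF. Qed.

Definition Gamma : sgraph := SGraph gedge_sym gedge_irrefl.

Definition remaining : {set Gamma} := [set x : Gamma | #|neighb x| != 1].

Definition suppressed : {set Gamma} :=
  [set x in remaining | ((row x == 1) || (row x == k))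
    && [forall y in remaining, x -- y ==> (row y == row x)]].

Definition wvertex : finType := {x : Gamma | x \in remaining :\: suppressed}.

(* No two suppressed vertices are adjacent, so suppressing all of them amounts
   to joining the two neighbours of each one. *)
Definition wedge (x y : wvertex) : bool :=
  (x != y) && (val x -- val y
               || [exists z in suppressed, val x -- z && z -- val y]).

Lemma wedge_sym : symmetric wedge.
Proof.
move=> x y; rewrite /wedge eq_sym sedge_sym; congr (_ && (_ || _)).
apply: eq_existsb => z; congr (_ && _).
by rewrite andbC [z -- _]sedge_sym [val x -- _]sedge_sym.
Qed.

Lemma wedge_irrefl : irreflexive wedge.
Proof. by move=> x; rewrite /wedge eqxx. Qed.

Definition wall : sgraph := SGraph wedge_sym wedge_irrefl.

End Wall.

(* Main.v *)
(* Without a star cutset, a sparse graph has no diamond, so a vertex outside a maximal clique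
   has at most one neighbour in it; a minimal connected set attached to three vertices of such
   a clique then gives an induced pyramid or prism.  Hence G is triangle-free, unless it is
   complete, and every vertex outside a hole has at most one neighbour on the hole.

   Large treewidth gives a bramble of large order; we pass to the subgraph induced on the cover
   of a bramble whose cover is smallest.  There, any two neighbours of a vertex v are separated
   by v together with a clique of size at most two, and the part containing no bramble set is
   thin: an edge vx between vertices of degree at least three belongs to a matching M, or x is
   the middle of a path with inner degrees two attached at its ends to an edge pq of M, or the
   same holds with v and x exchanged.  Contracting M preserves the order of the bramble up to a
   factor two, so the grid theorem gives a model of a brick graph in which no edge of M joins
   two branch sets.  In a smallest such model the edges between interior branch sets are all
   needed, since an unneeded one would allow us to remove a vertex of degree two or a whole
   claw.  Merging the branch sets of suppressed vertices into those of their left neighbours and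
   shrinking, every branch set becomes a spider, and their union is a subdivision of the wall.

   The grid theorem follows from Menger's theorem.  A path hitting the whole bramble yields
   disjoint connected sets with many disjoint paths between any two of them inside a connected
   part; either we can select one path for each pair, which gives a complete minor, or two
   linkages cross.  If the second linkage uses as few edges as possible outside the first, then
   many paths of the first meet the paths of the second in the same order, and these form the
   grid. *)
Require Import Defs.
From mathcomp Require Import all_boot zify boolp.

Set Implicit Arguments.
Unset Strict Implicit.
Unset Printing Implicit Defensive.

(** * Connectivity *)

(** The obstacle is that a grid model may have edges between branch sets that it does not use, so
    that the union of its branch sets need not be an induced subdivision. Thinness removes them.
    That is why M must not join two branch sets: [pq] belongs to M. Two neighbours of [v] are
    separated as stated because a hole through both of them that avoids [v] would contain two
    neighbours of [v]. Bramble sets touch, so one of the two sides contains none of them; shrinking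
    that side to a minimal connector between [v] and the clique keeps the order of the bramble, and
    minimality of the cover shows that the side was such a connector from the start. Interior branch
    sets are needed because a connected piece of the path of a claw sees at most two vertices around
    it, which contradicts a degree of three in the brick graph. *)

Lemma disjP (T : finType) (A B : {set T}) :
  reflect (forall x, x \in A -> x \in B -> False) [disjoint A & B].
Proof.
apply: (iffP idP) => [d x xA xB|H].
  by move: (disjointFr d xA); rewrite xB.
by apply/pred0P => x /=; apply/negP => /andP[xA xB]; apply: (H x).
Qed.

Section Connectivity.
Variable G : sgraph.
Implicit Types (x y z u v : G) (A B C S : {set G}).

Definition inS S : rel G := [rel u v : G | [&& u \in S, v \in S & u -- v]].
Definition conn S x y := connect (inS S) x y.

Lemma conn_sym S x y : conn S x y = conn S y x.
Proof.
by apply: sym_connect_sym => u v; rewrite /inS /= sedge_sym andbCA.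
Qed.

Lemma conn0 S x : conn S x x. Proof. exact: connect0. Qed.
Hint Resolve conn0 : core.

Lemma conn_trans S y x z : conn S x y -> conn S y z -> conn S x z.
Proof. exact: connect_trans. Qed.

Lemma conn1 S x y : x \in S -> y \in S -> x -- y -> conn S x y.
Proof. by move=> xS yS xy; apply: connect1; rewrite /inS /= xS yS. Qed.

Lemma connS S S' x y : S \subset S' -> conn S x y -> conn S' x y.
Proof.
move/subsetP=> sSS'; apply: connect_sub => u v /and3P[uS vS uv].
by apply: conn1; rewrite ?sSS'.
Qed.

Lemma conn_in S x y : conn S x y -> x != y -> (x \in S) /\ (y \in S).
Proof.
move=> xy ne; split.
  case/connectP: xy ne => [[|u p]] /=; first by move=> _ ->; rewrite eqxx.
  by case/andP=> /andP[].
move: xy; rewrite conn_sym; case/connectP=> [[|u p]] /=.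
  by move=> _ e; rewrite e eqxx in ne.
by case/andP=> /andP[].
Qed.

Lemma conn_closed S (P : {pred G}) x y :
  (forall u v, u \in P -> u \in S -> v \in S -> u -- v -> v \in P) ->
  conn S x y -> x \in P -> y \in P.
Proof.
move=> cl /connectP[p pp ->]; elim: p x pp => //= u p IH x /andP[/and3P[xS uS xu] pp] xP.
by apply: IH => //; apply: cl xu.
Qed.

Lemma conn_exit S (P : {pred G}) x y : conn S x y -> x \in P -> y \notin P ->
  exists u v, [/\ u \in P, v \notin P, u \in S, v \in S & u -- v].
Proof.
move=> xy xP; apply: contraNP => H; apply: conn_closed xy xP => u v uP uS vS uv.
by apply: contraT => vP; case: H; exists u, v.
Qed.

Lemma path_conn S x p : path sedge x p -> {subset x :: p <= S} -> conn S x (last x p).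
Proof.
elim: p x => //= y p IH x /andP[xy pp] sub.
apply: (conn_trans (y := y)).
  by apply: conn1 => //; apply: sub; rewrite !inE eqxx ?orbT.
by apply: IH => // z zp; apply: sub; rewrite inE zp orbT.
Qed.

Definition cset S : bool := [forall x in S, forall y in S, conn S x y].

Lemma csetP S : reflect (connected_set S) (cset S).
Proof.
apply: (iffP idP) => [/forall_inP H x y xS yS | H].
  by have /forall_inP := H x xS; apply.
by apply/forall_inP => x xS; apply/forall_inP => y yS; apply: H.
Qed.

Lemma csetE S x y : cset S -> x \in S -> y \in S -> conn S x y.
Proof. by move/csetP=> H xS yS; apply: H. Qed.

Lemma csetI S : {in S &, forall x y, conn S x y} -> cset S.
Proof. by move=> H; apply/csetP. Qed.

Lemma cset_star S x : {in S, forall y, conn S x y} -> cset S.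
Proof. by move=> H; apply: csetI => u v /H; rewrite conn_sym => ux /H; apply: conn_trans. Qed.

Lemma cset1 x : cset [set x].
Proof. by apply: csetI => u v /set1P-> /set1P->. Qed.

Lemma csetU A B a b : cset A -> cset B -> a \in A -> b \in B ->
  (a == b) || (a -- b) -> cset (A :|: B).
Proof.
move=> cA cB aA bB ab; apply: (@cset_star _ a) => y /setUP[yA|yB].
  by apply: connS (csetE cA aA yA); apply: subsetUl.
apply: (conn_trans (y := b)).
  case/orP: ab => [/eqP->//|ab]; by apply: conn1; rewrite // inE ?aA ?bB ?orbT.
by apply: connS (csetE cB bB yB); apply: subsetUr.
Qed.

Lemma csetU1 A a x : cset A -> a \in A -> a -- x -> cset (x |: A).
Proof.
move=> cA aA ax; apply: (csetU (cset1 x) cA (set11 x) aA).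
by rewrite sedge_sym ax orbT.
Qed.

Definition ccomp S x := [set y in S | conn S x y].

Lemma comp_sub S x : ccomp S x \subset S.
Proof. by apply/subsetP => y; rewrite inE => /andP[]. Qed.

Lemma mem_comp S x : x \in S -> x \in ccomp S x.
Proof. by move=> xS; rewrite inE xS conn0. Qed.

Lemma comp_step S x u v : u \in ccomp S x -> v \in S -> u -- v -> v \in ccomp S x.
Proof.
rewrite !inE => /andP[uS xu] vS uv; rewrite vS /=.
by apply: conn_trans xu _; apply: conn1.
Qed.

Lemma conn_comp S x y : x \in S -> conn S x y -> conn (ccomp S x) x y.
Proof.
move=> xS /connectP[p pp {y}->]; apply: path_conn.
  by apply: sub_path pp => u v /and3P[].
move=> z; rewrite inE => /orP[/eqP->|]; first exact: mem_comp.
elim: p x xS pp z => //= y p IH x xS /andP[/and3P[_ yS xy] pp] z.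
have yc : y \in ccomp S x by apply: comp_step xy => //; apply: mem_comp.
rewrite inE => /orP[/eqP->//|zp].
have := IH y yS pp z zp; rewrite !inE => /andP[-> yz] /=.
by apply: conn_trans yz; move: yc; rewrite inE => /andP[].
Qed.

Lemma cset_comp S x : cset (ccomp S x).
Proof.
apply: (@cset_star _ x) => y; rewrite inE => /andP[yS xy].
have [xS|xS] := boolP (x \in S); first exact: conn_comp.
have [->//|ne] := eqVneq x y; by have [] := conn_in xy ne; rewrite (negPf xS).
Qed.

Lemma sub_comp S A x : cset A -> A \subset S -> x \in A -> A \subset ccomp S x.
Proof.
move=> cA sAS xA; apply/subsetP => y yA; rewrite inE (subsetP sAS) //=.
by apply: connS (csetE cA xA yA).
Qed.

Lemma comp_eq S x y : conn S x y -> ccomp S x = ccomp S y.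
Proof.
move=> xy; apply/setP => z; rewrite !inE; congr andb; apply/idP/idP.
  by apply: conn_trans; rewrite conn_sym.
exact: conn_trans.
Qed.

(** A maximal connected proper subset of [A] containing [a] misses exactly one vertex. *)
Lemma noncut A a : cset A -> a \in A -> 1 < #|A| ->
  exists x, [/\ x \in A, x != a & cset (A :\ x)].
Proof.
move=> cA aA A1.
pose P (C : {set G}) := [&& a \in C, cset C & C \proper A].
have P0 : P [set a].
  rewrite /P set11 cset1 properE sub1set aA /=.
  by apply: contraTN A1 => /subset_leq_card; rewrite cards1 -leqNgt.
have [C /and3P[aC cC /andP[sCA nCA]] mC] := arg_maxnP (fun C : {set G} => #|C|) P0.
have [z zA zC] := subsetPn nCA.
have {z zA zC} [x [y [xC yC xA yA xy]]] := conn_exit (csetE cA aA zA) aC zC.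
have cyC : cset (y |: C) by apply: csetU1 xy.
have E : y |: C = A.
  apply/eqP; rewrite eqEsubset; apply/andP; split; first by rewrite subUset sub1set yA.
  apply: contraT => n; have := mC (y |: C).
  rewrite /P inE aC orbT cyC properE n subUset sub1set yA sCA /= => /(_ isT).
  by rewrite cardsU1 yC add1n ltnn.
exists y; split=> //; first by apply: contraNneq yC => ->.
by rewrite -E setU1K.
Qed.

Definition nbs A : {set G} := [set y | (y \notin A) && [exists x in A, x -- y]].

Lemma nbsP A y : reflect (y \notin A /\ exists2 x, x \in A & x -- y) (y \in nbs A).
Proof.
rewrite inE; apply: (iffP andP) => -[-> H]; split=> //.
  by have [x /andP[]] := existsP H; exists x.
by case: H => x xA xy; apply/existsP; exists x; rewrite xA.
Qed.

Definition hits A x : bool := [exists y in A, x -- y].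
Lemma hitsP A x : reflect (exists2 y, y \in A & x -- y) (hits A x).
Proof.
apply: (iffP existsP) => [[y /andP[]]|[y yA xy]]; first by exists y.
by exists y; rewrite yA.
Qed.

Lemma hitsS A B x : A \subset B -> hits A x -> hits B x.
Proof. by move/subsetP=> s /hitsP[y /s yB xy]; apply/hitsP; exists y. Qed.

End Connectivity.
#[export] Hint Resolve conn0 : core.

(** * Induced paths and holes *)

Lemma split_first (T : eqType) (P : pred T) (s : seq T) : has P s ->
  exists s1 x s2, [/\ s = s1 ++ x :: s2, P x & ~~ has P s1].
Proof.
elim: s => //= y s IH; have [Py _|nPy /= /IH[s1 [x [s2 [-> Px n1]]]]] := boolP (P y).
  by exists [::], y, s.
by exists (y :: s1), x, s2; split=> //=; rewrite negb_or nPy.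
Qed.

Lemma split_last (T : eqType) (P : pred T) (s : seq T) : has P s ->
  exists s1 x s2, [/\ s = s1 ++ x :: s2, P x & ~~ has P s2].
Proof.
elim: s => //= y s IH; have [/IH[s1 [x [s2 [-> Px n1]]]] _|nh] := boolP (has P s).
  by exists (y :: s1), x, s2.
by rewrite orbF => Py; exists [::], y, s.
Qed.

Section Induced.
Variable G : sgraph.
Implicit Types (x y z u v : G) (A B C S : {set G}) (s p q : seq G).

Definition nadj x : pred G := fun z => (z != x) && ~~ x -- z.

(* The sequence [s] is a chordless path. *)
Fixpoint ich s : bool :=
  if s is x :: s' then
    (if s' is y :: s'' then x -- y && all (nadj x) s'' else true) && ich s'
  else true.

Arguments ich : simpl never.

Lemma ichE x y s : ich (x :: y :: s) = x -- y && all (nadj x) s && ich (y :: s).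
Proof. by []. Qed.

Lemma ich_behead x s : ich (x :: s) -> ich s.
Proof. by case: s => // y s; rewrite ichE => /andP[]. Qed.

Lemma nadjC x y : nadj x y = nadj y x.
Proof. by rewrite /nadj eq_sym sedge_sym. Qed.

Lemma sedge_neq x y : x -- y -> x != y.
Proof. by apply: contraTneq => ->; rewrite sedge_irrefl. Qed.

Lemma ich_uniq s : ich s -> uniq s.
Proof.
elim: s => // x [|y s] // IH; rewrite ichE cons_uniq => /andP[/andP[xy al] h].
rewrite IH // andbT inE negb_or sedge_neq //=.
by apply/negP => /(allP al); rewrite /nadj eqxx.
Qed.

Lemma ich_path x p : ich (x :: p) -> path sedge x p.
Proof. by elim: p x => // y p IH x; rewrite ichE => /andP[/andP[xy _] /IH] /=; rewrite xy. Qed.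

Lemma ich_catl s1 s2 : ich (s1 ++ s2) -> ich s1.
Proof.
elim: s1 => // x [|y s1] IH //; rewrite !cat_cons !ichE => /andP[/andP[-> al] /IH ->].
by move: al; rewrite all_cat => /andP[->].
Qed.

Lemma ich_catr s1 s2 : ich (s1 ++ s2) -> ich s2.
Proof. by elim: s1 => // x s1 IH /ich_behead/IH. Qed.

Lemma ich_cat x p y q : ich (x :: p) -> ich (y :: q) -> last x p -- y ->
  (forall u v, u \in x :: p -> v \in y :: q ->
     (u = last x p /\ v = y) \/ nadj u v) ->
  uniq (x :: p ++ y :: q) -> ich (x :: p ++ y :: q).
Proof.
elim: p x => [|z p IH] x.
  rewrite [last _ _]/= [_ ++ _]/= ichE => _ -> -> H /andP[xq /andP[yq _]]; rewrite andbT /=.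
  apply/allP => v vq; case: (H x v) => [||[_ vy]|//]; rewrite ?inE ?eqxx ?vq ?orbT //.
  by rewrite -vy vq in yq.
rewrite ichE => /andP[/andP[xz al] icp] icq ly H.
rewrite cons_uniq => /andP[xn un].
rewrite cat_cons ichE xz all_cat al -cat_cons IH ?andbT //=; last first.
  by move=> u v up vq; apply: H => //; rewrite inE up orbT.
have lz : x != last z p.
  apply: contraNneq xn => ->.
  by rewrite mem_cat mem_last.
have Hx v : v \in y :: q -> nadj x v.
  by move=> vq; case: (H x v) => [||[xl _]|//]; rewrite ?mem_head //; rewrite xl eqxx in lz.
rewrite Hx ?mem_head //=; apply/allP => v vq; apply: Hx; by rewrite inE vq orbT.
Qed.

Lemma ich_nadj s1 x s2 y s3 z : ich (s1 ++ x :: s2 ++ y :: s3) ->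
  z \in s3 -> nadj x z.
Proof.
move=> /ich_catr; case: s2 => [|a s2]; rewrite ?cat_cons ?cat0s ichE.
  by case/andP=> /andP[_ /allP H] _ /H.
case/andP=> /andP[_ /allP H] _ zs; apply: H.
by rewrite mem_cat inE zs !orbT.
Qed.

Lemma ich_rev s : ich (rev s) = ich s.
Proof.
suff H t : ich t -> ich (rev t).
  by apply/idP/idP => [/H|/H //]; rewrite revK.
elim: t => // x [|y t] // IH; rewrite ichE => /andP[/andP[xy al] h].
have {}IH := IH h; move: (IH) (ich_uniq h); rewrite -(rev_uniq (y :: t)).
case E: (rev (y :: t)) => [|a b]; first by move/(congr1 size): E; rewrite size_rev.
move=> ib ub; have lb : last a b = y by rewrite -[last a b]/(last x (a :: b)) -E rev_cons last_rcons.
have mE v : (v \in a :: b) = (v \in y :: t) by rewrite -E mem_rev.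
rewrite [rev (x :: _)]rev_cons E -cats1; apply: ich_cat => //.
- by rewrite lb sedge_sym.
- move=> u v; rewrite lb !inE => ub' /eqP->; move: ub'; rewrite -in_cons mE inE.
  by case/orP=> [/eqP->|/(allP al)]; [left | rewrite nadjC; right].
- rewrite -cat_cons cats1 rcons_uniq ub andbT mE inE negb_or sedge_neq //=.
  by apply/negP => /(allP al); rewrite /nadj eqxx.
Qed.

Lemma ich_edge s u v : ich s -> u \in s -> v \in s -> u -- v ->
  index v s = (index u s).+1 \/ index u s = (index v s).+1.
Proof.
elim: s u v => // x s IH u v h; have h2 := ich_behead h.
have key w : w \in s -> x -- w -> index w s = 0.
  case: s h {IH h2} => // y s; rewrite ichE => /andP[/andP[_ /allP al] _].
  by rewrite inE /= => /orP[/eqP->|/al /andP[_ /negPf->] //]; rewrite eqxx.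
have nx w : w \in s -> x != w.
  by move=> ws; apply: contraTneq ws => <-; have := ich_uniq h; case/andP.
rewrite !inE /= => /orP[/eqP->|us] /orP[/eqP->|vs] uv.
- by rewrite sedge_irrefl in uv.
- by rewrite eqxx (negPf (nx v vs)) key //; left.
- by rewrite eqxx (negPf (nx u us)) key 1?sedge_sym //; right.
- rewrite (negPf (nx v vs)) (negPf (nx u us)).
  by case: (IH u v h2 us vs uv) => ->; [left|right].
Qed.

Lemma ich_of_index x p : path sedge x p -> uniq (x :: p) ->
  {in x :: p &, forall u v, u -- v ->
         index v (x :: p) = (index u (x :: p)).+1 \/
         index u (x :: p) = (index v (x :: p)).+1} -> ich (x :: p).
Proof.
elim: p x => // y p IH x /andP[xy pp] /andP[xn un] H.
rewrite ichE xy; apply/andP; split.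
  have yp : y \notin p by case/andP: un.
  apply/allP => z zp; have zx : x != z by apply: contraNneq xn => ->; rewrite inE zp orbT.
  have zy : y != z by apply: contraNneq yp => ->.
  rewrite /nadj eq_sym zx; apply/negP => xz.
  have zI : z \in x :: y :: p by rewrite !inE zp !orbT.
  by have [] := H x z (mem_head _ _) zI xz; rewrite /= eqxx (negPf zx) (negPf zy).
apply: IH => // u v uy vy uv.
have ux : x != u by apply: contraNneq xn => ->.
have vx : x != v by apply: contraNneq xn => ->.
move: (H u v); rewrite !(in_cons x) uy vy !orbT /= (negPf ux) (negPf vx) => /(_ isT isT uv).
by case=> [[->]|[->]]; [left|right].
Qed.

Lemma ich_induced x p : ich (x :: p) -> induced_path x p (last x p).
Proof.
move=> h; split; [exact: ich_path | by [] | exact: ich_uniq |].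
by move=> u v; apply: ich_edge.
Qed.

Lemma shortcut x p : path sedge x p ->
  exists q, [/\ ich (x :: q), last x q = last x p & {subset q <= p}].
Proof.
elim: p x => [|y p IH] x /=; first by exists [::].
case/andP=> xy /IH[q [iq lq sq]].
have : has (fun z => (z == x) || x -- z) (y :: q) by rewrite /= xy orbT.
case/split_last => s1 [z [s2 [E Pz ns2]]].
have iz : ich (z :: s2) by apply: (@ich_catr s1); rewrite -E.
have lz : last z s2 = last y p.
  by rewrite -lq -[last y q]/(last x (y :: q)) E last_cat.
have sz : {subset z :: s2 <= y :: p}.
  move=> w ws; have : w \in y :: q by rewrite E mem_cat ws orbT.
  by rewrite !inE => /orP[->//|/sq ->]; rewrite orbT.
have al : all (nadj x) s2.
  by apply/allP => w ws; have := hasPn ns2 w ws; rewrite negb_or.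
move: Pz => /orP[/eqP zx|xz].
  by subst z; exists s2; split=> // w ws; apply: sz; rewrite inE ws orbT.
by exists (z :: s2); split=> //; rewrite ichE xz al.
Qed.

Lemma path_cset x p : path sedge x p -> cset [set u in x :: p].
Proof.
move=> pp; apply: (@cset_star _ _ x) => y; rewrite inE => yp.
have [->|yx] := eqVneq y x; first exact: conn0.
move: yp; rewrite inE (negPf yx) => /= yp.
case/splitPr: yp pp => p1 p2; rewrite -cat_rcons cat_path => /andP[pp _].
rewrite -[y](last_rcons x p1 y); apply: path_conn => // u.
by rewrite last_rcons in_set -cat_cons mem_cat => ->.
Qed.

Lemma ich_cset s : ich s -> cset [set u in s].
Proof.
case: s => [|x p]; last by move/ich_path/path_cset.
by move=> _; apply: csetI => x y; rewrite inE.
Qed.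

(** Make the path chordless, start it at its last vertex in [A] and stop it at the first later
    vertex in [B]. [last_only] restates the clause on prefixes: a vertex of the path in [B] is the
    last one. *)
Lemma short_path S A B a b : conn S a b -> a \in S -> a \in A -> b \in B ->
  exists x p, [/\ ich (x :: p), {subset x :: p <= S}, x \in A, last x p \in B
    & (forall u, u \in p -> u \notin A) /\
      (forall s1 s2, x :: p = s1 ++ s2 -> s2 != [::] -> forall u, u \in s1 -> u \notin B)].
Proof.
case/connectP=> p pp -> aS aA bB.
have ps : {subset a :: p <= S}.
  elim: p a aS pp {aA bB} => [|y p IH] a aS /=; first by move=> _ u; rewrite inE => /eqP->.
  case/andP=> /and3P[_ yS ay] pp u; rewrite inE => /orP[/eqP->//|]; exact: IH.
have {}pp : path sedge a p by apply: sub_path pp => u v /and3P[].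
have [q [iq lq sq]] := shortcut pp.
have qS : {subset a :: q <= S}.
  by move=> w; rewrite inE => /orP[/eqP->//|/sq wp]; apply: ps; rewrite inE wp orbT.
have : has (mem A) (a :: q) by rewrite /= aA.
case/split_last=> s1 [x [s2 [E xA ns2]]].
have i2 : ich (x :: s2) by apply: (@ich_catr s1); rewrite -E.
have l2 : last x s2 \in B.
  by have <- : last a q = last x s2; [rewrite -[last a q]/(last a (a :: q)) E last_cat | rewrite lq].
have : has (mem B) (x :: s2) by apply/hasP; exists (last x s2) => //; apply: mem_last.
case/split_first=> t1 [y [t2 [E2 yB nt1]]].
have i3 : ich (t1 ++ [:: y]) by apply: (@ich_catl _ t2); rewrite -catA -E2.
have nA u : u \in s2 -> u \notin A by move=> us; apply: (hasPn ns2).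
have memE u : u \in t1 ++ [:: y] -> u \in x :: s2.
  by rewrite E2 !mem_cat !inE => /orP[->//|/eqP->]; rewrite eqxx orbT.
have qS' u : u \in x :: s2 -> u \in S by move=> us; apply: qS; rewrite E mem_cat us orbT.
case: t1 E2 nt1 i3 memE => [|c t1] /= [ex es] nt1 i3 memE.
  exists x, [::]; split=> //=; rewrite ?ex //.
    by move=> u; rewrite inE => /eqP->; rewrite -ex; apply: qS'; rewrite mem_head.
  by split=> // -[|d [|e s1']] // s2' [_ <-].
subst c; exists x, (t1 ++ [:: y]); split=> //; rewrite ?last_cat //.
  by move=> u /memE /qS'.
split.
  move=> u ut; apply: nA; rewrite es; move: ut; rewrite !mem_cat !inE.
  by case/orP=> [->//|/eqP->]; rewrite eqxx orbT.
move=> s1' s2' E3 n2 u us; have : u \in x :: t1.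
  have := congr1 (take (size s1')) E3; rewrite take_size_cat // => Eu.
  have Hs : size s1' <= size (x :: t1).
    move: (congr1 size E3) n2; rewrite /= !size_cat /= -size_eq0.
    by case: (size s2') => // m; rewrite addn1 addnS => -[->] _; rewrite leq_addr.
  by move: us; rewrite -Eu -cat_cons takel_cat // => /mem_take.
by move=> ut; exact: (hasPn (nt1 : ~~ has (mem B) (x :: t1)) u ut).
Qed.

(** [hole_of] and [hole_at] pass between a hole as a cyclic sequence and a vertex [z] with a
    chordless path joining its two neighbours on the hole, the form in which holes are built and cut
    open below. *)
Lemma hole_of z x p : ich (x :: p) -> z -- x -> z -- last x p -> 1 < size p ->
  z \notin x :: p -> (forall u, u \in x :: p -> z -- u -> u = x \/ u = last x p) ->
  hole (z :: x :: p).
Proof.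
move=> ip zx zl sp zn H; split=> //.
  rewrite /ucycle (cons_uniq z) zn ich_uniq //= zx rcons_path ich_path //=.
  by rewrite sedge_sym zl.
have nE u : u \in x :: p -> next (z :: x :: p) u = nth z (x :: p) (index u (x :: p)).+1.
  move=> uq; rewrite next_nth inE uq orbT.
  by have /negPf zu : z != u by [apply: contraNneq zn => ->]; rewrite [index _ (z :: _)]/= zu.
have nz : next (z :: x :: p) z = x by rewrite /= eqxx.
have nl : next (z :: x :: p) (last x p) = z.
  by rewrite nE ?mem_last // index_last ?ich_uniq //= nth_default.
have zcase u : u \in x :: p -> z -- u -> u = next (z :: x :: p) z \/ z = next (z :: x :: p) u.
  by move=> uq zu; case: (H u uq zu) => ->; [left; rewrite nz | right; rewrite nl].
move=> u v; rewrite (in_cons z) => /orP[/eqP->|uq]; rewrite (in_cons z) => /orP[/eqP->|vq].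
- by rewrite sedge_irrefl.
- exact: zcase.
- by rewrite sedge_sym => /(zcase u uq)[]; [right|left].
- move=> uv; case: (ich_edge ip uq vq uv) => E; [left|right]; by rewrite nE // -E nth_index.
Qed.

Lemma hole_at z c : hole c -> z \in c ->
  exists x p, [/\ ich (x :: p), z -- x, z -- last x p, 1 < size p
    & [/\ z \notin x :: p, (forall u, u \in x :: p -> z -- u -> u = x \/ u = last x p)
      & c =i z :: x :: p]].
Proof.
case=> uc sc ch zc; have [i q E] := rot_to zc.
have cE : c =i z :: q by move=> u; rewrite -E mem_rot.
move: uc; rewrite -(rot_ucycle i) E; case/andP=> cy; rewrite cons_uniq => /andP[zn un].
have uc : uniq c by rewrite -(rot_uniq i) E cons_uniq zn.
have nxE u : next c u = next (z :: q) u by rewrite -E next_rot.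
have : size c = (size q).+1 by rewrite -(size_rot i) E.
case: q E cE cy zn un nxE => [|x p]; first by move=> _ _ _ _ _ _ e; rewrite e in sc.
move=> E cE cy zn un nxE Ec; rewrite Ec /= in sc.
have {cy} [zx pp lz] : [/\ z -- x, path sedge x p & last x p -- z].
  by move: cy; rewrite /= rcons_path => /and3P[].
have nE u : u \in x :: p -> next (z :: x :: p) u = nth z (x :: p) (index u (x :: p)).+1.
  move=> uq; rewrite next_nth inE uq orbT.
  by have /negPf zu : z != u by [apply: contraNneq zn => ->]; rewrite [index _ (z :: _)]/= zu.
have nz : next (z :: x :: p) z = x by rewrite /= eqxx.
have adj u v : u \in x :: p -> v \in x :: p -> v = next (z :: x :: p) u ->
    index v (x :: p) = (index u (x :: p)).+1.
  move=> uq vq Ev; rewrite Ev nE // index_uniq // ltnNge; apply: contraNN zn => le.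
  by rewrite -[z](nth_default z le) -nE // -Ev.
exists x, p; split=> //; last 1 first.
- split=> // u uq zu; have uc' : u \in c by rewrite cE (in_cons z) uq orbT.
  have [] := ch z u zc uc' zu; first by rewrite nxE nz; left.
  rewrite nxE nE // => Ez; right.
  have le : size (x :: p) <= (index u (x :: p)).+1.
    rewrite leqNgt; apply: contraNN zn => lt; by rewrite Ez mem_nth.
  move: uq; rewrite -index_mem => lt.
  have -> : u = nth z (x :: p) (index u (x :: p)) by rewrite nth_index // -index_mem.
  have -> : index u (x :: p) = (size (x :: p)).-1.
    by move: le lt; move: (index u (x :: p)) (size (x :: p)) => i' j; lia.
  by rewrite nth_last.
- apply: ich_of_index => // u v uq vq uv.
  have inc w : w \in x :: p -> w \in c by rewrite cE (in_cons z) => ->; rewrite orbT.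
  by have [] := ch u v (inc _ uq) (inc _ vq) uv; rewrite nxE => Ev; [left|right]; exact: adj.
- by rewrite sedge_sym.
Qed.

(** Once triangles are excluded, sparsity is used only in this form. *)
Definition sp1 := forall (c : seq G) v a b, hole c -> v \notin c ->
  a \in c -> b \in c -> v -- a -> v -- b -> a = b.

Definition tfree := forall x y z : G, x -- y -> y -- z -> x -- z -> False.

Lemma sparse_sp1 : sparse G -> tfree -> sp1.
Proof.
move=> sp tf c v a b hc vn ac bc va vb.
have [a' [b' [_ _ ab' /subsetP sub]]] := sp c v hc vn.
have Ha : a \in [set a'; b'] by apply: sub; rewrite !inE va.
have Hb : b \in [set a'; b'] by apply: sub; rewrite !inE vb.
move: Ha Hb; rewrite !inE => /orP[]/eqP ea /orP[]/eqP eb; subst a b => //.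
- by case: (tf v a' b').
- by case: (tf v a' b').
Qed.

End Induced.
Arguments ich {G} s : simpl never.

(** * Holes through two vertices, or a clique separating them *)

Section Cuts.
Variable G : sgraph.
Hypothesis tf : tfree G.
Hypothesis sp : sp1 G.
Implicit Types (x y z u v w : G) (A B C S K : {set G}) (s p q e m : seq G).

(** As there are no triangles, this says that [S] is connected and has no clique cutset. *)
Definition nocut S : Prop := forall K, K \subset S -> clique K -> #|K| <= 2 -> cset (S :\: K).

Lemma clique1 x : clique [set x].
Proof. by move=> u v /set1P-> /set1P->; rewrite eqxx. Qed.

Lemma clique2 x y : x -- y -> clique [set x; y].
Proof. by move=> xy u v /set2P[]-> /set2P[]->; rewrite ?eqxx // sedge_sym. Qed.

Lemma nocut0 S : nocut S -> cset S.
Proof.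
move=> /(_ set0); rewrite setD0 => H; apply: H; rewrite ?sub0set ?cards0 //.
by move=> u v; rewrite inE.
Qed.

Lemma nocut1 S x : nocut S -> x \in S -> cset (S :\ x).
Proof. by move=> H xS; apply: H; rewrite ?sub1set ?cards1 //; apply: clique1. Qed.

Lemma nocut2 S x y : nocut S -> x \in S -> y \in S -> x -- y -> cset (S :\: [set x; y]).
Proof.
move=> H xS yS xy; apply: H; rewrite ?subUset ?sub1set ?xS ?yS ?cards2 //; last by case: (_ != _).
exact: clique2.
Qed.

Definition far S z := S :\: cneighb z.

Lemma farE S z u : (u \in far S z) = [&& u \in S, u != z & ~~ z -- u].
Proof. by rewrite !inE negb_or andbC. Qed.

(** Otherwise, as [z] is no cutvertex, some neighbour [n] of [z] has neighbours in two components.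
    The edge [zn] is no cutset either, so a shortest path between two such neighbours of [n] avoids
    [z] and [n] and closes through [n] to a hole. Leaving a component, it meets the neighbourhood of
    [z], so [z] has a second neighbour on the hole besides [n]. *)
Lemma far_conn S z : nocut S -> z \in S -> cset (far S z).
Proof.
move=> nS zS; apply: csetI => u v uR vR; apply: contraT => ncuv.
set R := far S z in uR vR ncuv *; pose Y := ccomp R u.
have uY : u \in Y by apply: mem_comp.
have vY : v \notin Y by rewrite in_set vR.
pose Y' := Y :|: [set n | z -- n & hits Y n].
have vY' : v \notin Y'.
  by rewrite in_setU (negPf vY) in_set; move: vR; rewrite farE => /and3P[_ _ /negPf->].
have RSz w : w \in R -> w \in S :\ z by rewrite farE !inE => /and3P[-> -> _].
have cuv := csetE (nocut1 nS zS) (RSz _ uR) (RSz _ vR).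
have uY' : u \in Y' by rewrite in_setU uY.
have [n [b [nY' bY' nS' bS' nb]]] := conn_exit cuv uY' vY'.
have toR w : w \in S :\ z -> z -- w || (w \in R).
  by rewrite farE !inE => /andP[-> ->] /=; case: (z -- w).
have nY : n \notin Y.
  apply: contra bY' => nY; rewrite in_setU in_set; case/orP: (toR b bS') => [zb|bR].
    by rewrite zb; apply/orP; right; apply/hitsP; exists n; rewrite // sedge_sym.
  by rewrite (comp_step nY).
move: nY'; rewrite in_setU (negPf nY) in_set => /andP[zn hn].
have zb : ~~ z -- b by apply/negP => zb; apply: (tf zn nb zb).
have bR : b \in R by have := toR b bS'; rewrite (negPf zb).
have bY : b \notin Y by apply: contra bY' => h; rewrite in_setU h.
have nS0 : n \in S by move: nS'; rewrite !inE => /andP[].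
case/hitsP: hn => y yY ny.
have yR : y \in R by apply: (subsetP (comp_sub R u)).
have ne_z w : w \in R -> w != z by rewrite farE => /and3P[].
have R2 w : w \in R -> w \in S :\: [set z; n].
  move=> wR; move: (wR) (ne_z _ wR); rewrite farE => /and3P[wS _ zw] wz.
  by rewrite !inE wS negb_or wz andbT; apply: contraNneq zw => ->.
have c2 := csetE (nocut2 nS zS nS0 zn) (R2 _ yR) (R2 _ bR).
have [||x [p [ip sub xA lB [HA HB]]]] := @short_path _ _ (neighb n :&: Y) (neighb n :\: Y) _ _ c2 (R2 _ yR).
- by rewrite in_setI yY in_set ny.
- by rewrite in_setD bY inE.
move: xA; rewrite in_setI => /andP[nx xY]; rewrite inE in nx.
move: lB; rewrite in_setD => /andP[lY nl]; rewrite inE in nl.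
have h : hole (n :: x :: p).
  apply: hole_of => //.
  - case: p ip {sub HA HB} lY nl => [|c [|]] //=; first by rewrite xY.
    by rewrite ichE => /andP[/andP[xc _] _] _ nc; case: (tf nx xc nc).
  - by apply/negP => /sub; rewrite !inE eqxx orbT.
  move=> w wp nw; have [wY|wY] := boolP (w \in Y).
    by move: wp; rewrite inE => /orP[/eqP|/HA]; [left | rewrite in_setI wY inE nw].
  right; case/lastP: p wp ip sub lY nl HA HB => [|p c] wp ip sub lY nl HA HB.
    by move: wp; rewrite inE => /eqP.
  rewrite last_rcons; move: wp; rewrite -rcons_cons mem_rcons inE => /orP[/eqP//|wp].
  by have := HB (x :: p) [:: c]; rewrite -rcons_cons -cats1 => /(_ erefl isT w wp); rewrite in_setD wY inE nw.
have [w wp zw] : exists2 w, w \in x :: p & z -- w.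
  apply: contrapT => nex; case/negP: lY.
  rewrite /Y (@comp_eq _ R u x); last by move: xY; rewrite inE => /andP[].
  have subR : {subset x :: p <= R}.
    move=> w wp; rewrite farE; move: (sub w wp); rewrite !inE negb_or => /andP[/andP[-> _] ->] /=.
    by apply/negP => zw; case: nex; exists w.
  by rewrite inE subR ?mem_last //=; apply: path_conn => //; apply: ich_path.
have zn' : z \notin n :: x :: p.
  rewrite in_cons negb_or sedge_neq //=; apply/negP => /sub.
  by rewrite !inE eqxx.
have wc : w \in n :: x :: p by rewrite in_cons wp orbT.
have nw : n = w by apply: (sp h zn' (mem_head _ _) wc).
by have := sub w wp; rewrite !inE nw eqxx orbT.
Qed.

Lemma far_hit S z n y : nocut S -> z \in S -> n \in S -> z -- n ->
  y \in S -> y != z -> y != n -> hits (far S z) n.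
Proof.
move=> nS zS nS' zn yS yz yn.
have c := csetE (nocut1 nS zS) (x := n) (y := y).
rewrite !inE nS' yS yz eq_sym sedge_neq // in c.
have [||u [v [/set1P-> vn uS vS uv]]] := conn_exit (c isT isT) (P := mem [set n]).
- by rewrite inE.
- by rewrite inE.
move: vS; rewrite !inE => /andP[vz vS].
apply/hitsP; exists v => //; rewrite farE vS vz /=; apply/negP => zv; exact: (tf zn uv zv).
Qed.

(** As [w] is no cutvertex, [z] has another neighbour; as [z] is none, [w] is joined to it off [z].
    A shortest path from [w] to the other neighbours of [z] closes to a hole. *)
Lemma edge_hole S z w y : nocut S -> z \in S -> w \in S -> z -- w ->
  y \in S -> y != z -> y != w -> exists c, [/\ hole c, {subset c <= S}, z \in c & w \in c].
Proof.
move=> nS zS wS zw yS yz yw.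
have zNw := sedge_neq zw.
have c := csetE (nocut1 nS wS) (x := z) (y := y).
rewrite !inE zS yS yw zNw in c.
have [||u [v [/set1P-> vz _ vS uv]]] := conn_exit (c isT isT) (P := mem [set z]).
- by rewrite inE.
- by rewrite inE.
rewrite !inE in vz vS; case/andP: vS => vw vS.
have wS' : w \in S :\ z by rewrite !inE wS eq_sym zNw.
have c2 := csetE (nocut1 nS zS) wS' (_ : v \in S :\ z).
have [|||x [p [ip sub xA lB [HA HB]]]] := @short_path _ _ [set w] (neighb z :\ w) _ _ (c2 _) wS'.
- by rewrite !inE vz vS.
- by rewrite inE.
- by rewrite !inE vw.
move: xA => /set1P ex; subst x; move: lB; rewrite !inE => /andP[lw zl].
exists (z :: w :: p); split.
- apply: hole_of => //.
  + case: p ip {sub HA HB} lw zl => [|c' [|]] //=; first by rewrite eqxx.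
    by rewrite ichE => /andP[/andP[xc _] _] _ nc; case: (tf zw xc nc).
  + by apply/negP => /sub; rewrite !inE eqxx.
  move=> w' wp nw; have [wY|wY] := eqVneq w' w; first by left.
  right; case/lastP: p wp ip sub lw zl HA HB => [|p c'] wp ip sub lY nl HA HB.
    by move: wp; rewrite inE => /eqP.
  rewrite last_rcons; move: wp; rewrite -rcons_cons mem_rcons inE => /orP[/eqP//|wp].
  by have := HB (w :: p) [:: c']; rewrite -rcons_cons -cats1 => /(_ erefl isT w' wp); rewrite !inE wY nw.
- move=> u'; rewrite inE => /orP[/eqP->//|/sub]; by rewrite !inE => /andP[].
- exact: mem_head.
- by rewrite !inE eqxx orbT.
Qed.

Lemma half_hole z w a b d m1 m2 e :
  ich (a :: m1 ++ d :: m2 ++ [:: b]) -> ich (w :: e) -> e != [::] ->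
  uniq (z :: w :: e ++ a :: m1 ++ d :: m2 ++ [:: b]) ->
  z -- w -> z -- b -> last w e -- d ->
  (forall u, u \in e -> ~~ z -- u) ->
  (forall u, u \in m1 ++ d :: m2 -> ~~ z -- u) ->
  (forall u, u \in a :: m1 ++ d :: m2 ++ [:: b] -> ~~ w -- u) ->
  (forall u v, u \in e -> v \in m1 ++ d :: m2 -> u -- v -> u = last w e /\ v = d) ->
  (forall u, u \in e -> ~~ u -- b) ->
  hole (z :: w :: e ++ d :: m2 ++ [:: b]).
Proof.
move=> ic ie en un zw zb ld ze zm wc em eb.
have un2 : uniq (z :: w :: e ++ d :: m2 ++ [:: b]).
  apply: subseq_uniq un; rewrite /= !eqxx; apply: cat_subseq => //.
  rewrite -[d :: _]cat0s -[a :: _ ++ _]/((a :: m1) ++ _); apply: cat_subseq => //; exact: sub0seq.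
have icd : ich (d :: m2 ++ [:: b]) by apply: (@ich_catr _ (a :: m1)).
have lb : last w (e ++ d :: m2 ++ [:: b]) = b by rewrite !last_cat /= last_cat.
have [dm db] : (forall v, v \in d :: m2 -> v \in m1 ++ d :: m2) /\ true.
  by split=> // v vd; rewrite mem_cat vd orbT.
apply: hole_of => //; first last.
- move=> u; rewrite !(inE, mem_cat) => /or4P[/eqP->|ue|/eqP->|]; first by left.
  + by rewrite (negPf (ze _ ue)).
  + by rewrite (negPf (zm d _)) // dm ?mem_head.
  + case/orP=> [um|/eqP->]; last by rewrite lb; right.
    by rewrite (negPf (zm u _)) // dm // inE um orbT.
- by case/andP: un2.
- by rewrite size_cat /= size_cat; case: (e) en => //= *; rewrite addnS.
- by rewrite lb.
apply: ich_cat => //; last by case/andP: un2.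
move=> u v; rewrite inE => /orP[/eqP->|ue].
  move=> vd; right; rewrite nadjC /nadj sedge_sym wc ?andbT; last first.
    by rewrite inE mem_cat vd !orbT.
  apply: contraTneq un2 => ->; rewrite !cons_uniq mem_cat vd orbT /= andbF //.
rewrite -cat_cons mem_cat => /orP[vd|].
  have [uv|uv] := boolP (u -- v); first by left; apply: em => //; apply: dm.
  right; rewrite /nadj uv andbT; apply: contraTneq un2 => vu.
  move: ue vd; rewrite -vu => ve vd; rewrite !cons_uniq cat_uniq.
  suff -> : has (mem e) (d :: m2 ++ [:: b]) by rewrite !andbF.
  by apply/hasP; exists v => //; rewrite -cat_cons mem_cat vd.
rewrite inE => /eqP->; right; rewrite /nadj eb // andbT; apply: contraTneq un2 => ->.
rewrite !cons_uniq cat_uniq.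
suff -> : has (mem e) (d :: m2 ++ [:: u]) by rewrite !andbF.
by apply/hasP; exists u => //; rewrite -cat_cons mem_cat mem_seq1 eqxx orbT.
Qed.

(** A cycle [z a m1 d m2 b], a neighbour [w] of [z] off it, and a path [e] from [w] whose last
    vertex is attached to the cycle at [d] only. Edges between other vertices of [e] and the
    neighbours [a], [b] of [z] are not excluded here; that is the content of [cfg_no]. *)
Definition cfg z w a b d m1 m2 e : Prop :=
  [/\ ich (a :: m1 ++ d :: m2 ++ [:: b]), ich (w :: e), e != [::],
      uniq (z :: w :: e ++ a :: m1 ++ d :: m2 ++ [:: b]) &
  [/\ z -- w, z -- a, z -- b & last w e -- d] /\
  [/\ (forall u, u \in e -> ~~ z -- u),
  (forall u, u \in m1 ++ d :: m2 -> ~~ z -- u),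
  (forall u, u \in a :: m1 ++ d :: m2 ++ [:: b] -> ~~ w -- u),
  (forall u v, u \in e -> v \in m1 ++ d :: m2 -> u -- v -> u = last w e /\ v = d) &
  (forall v, v \in a :: m1 ++ d :: m2 ++ [:: b] -> last w e -- v -> v = d)]].

Lemma rev_cfg a b d m1 m2 :
  b :: rev m2 ++ d :: rev m1 ++ [:: a] = rev (a :: m1 ++ d :: m2 ++ [:: b]).
Proof. by rewrite rev_cons !(rev_cat, rev_cons) -!cats1 /= -!catA. Qed.

Lemma cfg_rev z w a b d m1 m2 e : cfg z w a b d m1 m2 e ->
  cfg z w b a d (rev m2) (rev m1) e.
Proof.
have E := rev_cfg a b d m1 m2.
have E2 : rev m2 ++ d :: rev m1 = rev (m1 ++ d :: m2).
  by rewrite rev_cat rev_cons -cats1 -catA.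
case=> ic ie en un [[zw za zb ld] [h1 h2 h3 h4 h5]].
split=> //; first by rewrite E ich_rev.
  rewrite E (perm_uniq (_ : perm_eq _ (z :: w :: e ++ a :: m1 ++ d :: m2 ++ [:: b]))) //.
  by rewrite !perm_cons perm_cat2l perm_rev.
split=> //; split=> //; rewrite ?E ?E2.
- by move=> u; rewrite mem_rev; apply: h2.
- by move=> u; rewrite mem_rev; apply: h3.
- by move=> u v ue; rewrite mem_rev; apply: h4.
- by move=> u; rewrite mem_rev; apply: h5.
Qed.

Lemma cfg_hole z w a b d m1 m2 e : cfg z w a b d m1 m2 e ->
  (forall u, u \in e -> ~~ u -- b) -> hole (z :: w :: e ++ d :: m2 ++ [:: b]).
Proof. by case=> ic ie en un [[zw za zb ld] [h1 h2 h3 h4 _]]; apply: (half_hole ic). Qed.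

(** Otherwise [z w e d m2 b] is a hole on which [a] has the two neighbours [z] and [u]. *)
Lemma cfg_ab z w a b d m1 m2 e u : cfg z w a b d m1 m2 e -> u \in e -> u -- a ->
  exists2 u', u' \in e & u' -- b.
Proof.
move=> H ue ua; apply: contrapT => nex.
have hh : hole (z :: w :: e ++ d :: m2 ++ [:: b]).
  by apply: (cfg_hole H) => u' u'e; apply/negP => ub; apply: nex; exists u'.
case: H => _ _ _ un [[zw za zb ld] _].
have aH : a \notin z :: w :: e ++ d :: m2 ++ [:: b].
  have : uniq (a :: z :: w :: e ++ d :: m2 ++ [:: b]); last by case/andP.
  have -> : uniq (a :: z :: w :: e ++ d :: m2 ++ [:: b]) =
         uniq (z :: w :: e ++ a :: d :: m2 ++ [:: b]).
    by apply: perm_uniq; apply/permPl; exact: (perm_catCA [:: a] (z :: w :: e) (d :: m2 ++ [:: b])).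
  apply: subseq_uniq un; rewrite /= !eqxx; apply: cat_subseq => //.
  rewrite -[a :: d :: _]cat1s -[a :: _ ++ _]cat1s; apply: cat_subseq => //.
  exact: suffix_subseq.
have zu : z = u.
  apply: (sp hh aH) => //; rewrite ?mem_head // 1?sedge_sym //.
  by rewrite !in_cons mem_cat ue !orbT.
by move: un; rewrite cons_uniq zu !in_cons mem_cat ue /= !orbT.
Qed.

(** By [cfg_ab], both [a] and [b] would have neighbours on [e]. A shortest stretch of [e] between
    such neighbours closes through [a], [m1], [d], [m2], [b] to a hole that contains two neighbours
    of [z] but not [z]. *)
Lemma cfg_no z w a b d m1 m2 e u : cfg z w a b d m1 m2 e -> u \in e -> ~~ u -- a.
Proof.
move=> H ue; apply/negP => ua.
have [u' u'e ub] := cfg_ab H ue ua.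
case: H => ic ie en un [[zw za zb ld] [h1 h2 h3 h4 h5]].
case/lastP: e en ie ld un h1 h4 h5 ue u'e => // e0 ek _ ie ld un h1 h4 h5 ue u'e.
rewrite !last_rcons in ld h4 h5.
have dis x : x \in rcons e0 ek -> x \notin a :: m1 ++ d :: m2 ++ [:: b].
  move=> xe; move: un; rewrite 2!cons_uniq cat_uniq => /and3P[_ _ /and3P[_ /hasPn h _]].
  by apply/negP => /h /=; rewrite xe.
have inE0 x c : c \in [:: a; b] -> x \in rcons e0 ek -> x -- c -> x \in e0.
  move=> cab; rewrite mem_rcons inE => /orP[/eqP->|//] ec.
  have cc : c \in a :: m1 ++ d :: m2 ++ [:: b].
    by move: cab; rewrite !inE !mem_cat !inE !mem_cat !inE => /orP[->//|->]; rewrite !orbT.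
  move: (ich_uniq ic) cab; rewrite -(h5 _ cc ec) !inE => uL /orP[]/eqP ecd; move: uL; rewrite ecd.
    by rewrite cons_uniq mem_cat mem_head orbT.
  rewrite cons_uniq cat_uniq (cons_uniq b).
  by have -> : b \in m2 ++ [:: b]; [rewrite mem_cat mem_seq1 eqxx orbT | rewrite !andbF].
(* The last vertex of [e] sees only [d], so both attachments lie in [e0], whose vertices have no
   neighbours in [m1], [d], [m2]. *)
have {}ue := inE0 u a _ ue ua; rewrite mem_head in ue; move: (ue isT) => {}ue.
have {}u'e := inE0 u' b _ u'e ub; rewrite !inE eqxx orbT in u'e; move: (u'e isT) => {}u'e.
have ie0 : ich e0 by move: (ich_behead ie); rewrite -cats1 => /ich_catl.
have uS : u \in [set x in e0] by rewrite inE.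
have u'S : u' \in [set x in e0] by rewrite inE.
have cu := csetE (ich_cset ie0) uS u'S.
have [||f [g [ifg sub fA lB [HA HB]]]] := @short_path _ _ (neighb a) (neighb b) _ _ cu uS.
- by rewrite inE sedge_sym.
- by rewrite inE sedge_sym.
rewrite inE in fA; rewrite inE in lB.
pose m := m1 ++ d :: m2.
have un3 : uniq (z :: a :: rcons e0 ek ++ b :: rev m).
  have : uniq (z :: rcons e0 ek ++ a :: m ++ [:: b]).
    move: un; rewrite -[d :: m2 ++ _]/((d :: m2) ++ _) [m1 ++ _]catA -/m !cons_uniq in_cons negb_or.
    by case/and3P=> /andP[_ ->] _ ->.
  congr (is_true _); apply: perm_uniq; rewrite perm_cons perm_sym.
  have P1 : perm_eq (a :: rcons e0 ek ++ b :: rev m) (rcons e0 ek ++ a :: b :: rev m).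
    by apply/permPl; exact: (perm_catCA [:: a] (rcons e0 ek) _).
  by apply: perm_trans P1 _; rewrite perm_cat2l perm_cons cats1 perm_sym perm_rcons perm_cons perm_sym perm_rev.
have sfg x : x \in f :: g -> x \in e0 by move/sub; rewrite inE.
have ek0 : ek \notin e0.
  by have := ich_uniq (ich_behead ie); rewrite rcons_uniq => /andP[].
have em x v : x \in f :: g -> v \in m -> ~~ x -- v.
  move=> /sfg xe vm; apply/negP => xv.
  have xr : x \in rcons e0 ek by rewrite mem_rcons inE xe orbT.
  have [xk _] := h4 x v xr vm xv.
  by rewrite -xk xe in ek0.
have neq x v : x \in f :: g -> v \in b :: rev m -> x != v.
  move=> /sfg xe vm; apply: contraTneq un3 => xv; rewrite !cons_uniq cat_uniq.
  suff -> : has (mem (rcons e0 ek)) (b :: rev m) by rewrite !andbF.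
  by apply/hasP; exists v => //; rewrite -xv /= mem_rcons inE xe orbT.
have mn : m != [::] by rewrite /m; case: (m1).
have lm : last b (rev m) = head a m.
  by case: (m) mn => // h t _; rewrite rev_cons last_rcons.
have icm : ich (b :: rev m).
  have -> : b :: rev m = rev (m ++ [:: b]) by rewrite rev_cat.
  by rewrite ich_rev; move: (ich_behead ic); rewrite /m -catA.
have am v : v \in m ++ [:: b] -> a -- v -> v = head a m.
  move=> vm av; move: ic; rewrite -[d :: m2 ++ _]/((d :: m2) ++ _) [m1 ++ _]catA -/m.
  case: (m) mn vm => // h t _; rewrite cat_cons ichE inE => /orP[/eqP->//|vt] /andP[/andP[_ al] _].
  by have := allP al v vt; rewrite /nadj av andbF.
have ahm : a -- head a m.
  move: ic; rewrite -[d :: m2 ++ _]/((d :: m2) ++ _) [m1 ++ _]catA -/m.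
  by case: (m) mn => // h t _; rewrite cat_cons ichE => /andP[/andP[-> _] _].
have hh : hole (a :: f :: g ++ b :: rev m).
  apply: hole_of => //.
  - apply: ich_cat => //; first by rewrite sedge_sym.
      move=> x v xf; rewrite inE => /orP[/eqP->|]; last first.
        by move=> vm; right; rewrite nadjC /nadj neq ?inE ?vm ?orbT // sedge_sym em // -mem_rev.
      have [xb|xb] := boolP (x -- b); last first.
        by right; rewrite nadjC /nadj neq ?mem_head // sedge_sym xb.
      left; split=> //; case/lastP: g xf {ifg sub fA sfg em neq lB HA} HB => [|g l] xf HB.
        by move: xf; rewrite inE => /eqP.
      rewrite last_rcons; move: xf; rewrite -rcons_cons mem_rcons inE => /orP[/eqP//|xf].
      by have := HB (f :: g) [:: l]; rewrite -rcons_cons -cats1 => /(_ erefl isT x xf); rewrite inE sedge_sym xb.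
    rewrite -cat_cons cat_uniq; apply/and3P; split; [exact: ich_uniq| |exact: ich_uniq].
    apply/hasPn => v vb; apply/negP => vf; by have := neq v v vf vb; rewrite eqxx.
  - by rewrite last_cat /= lm.
  - by rewrite size_cat /= size_rev; case: (m) mn => //= *; rewrite !addnS.
  - apply: contraTN un3 => ain; rewrite !cons_uniq.
    suff -> : a \in rcons e0 ek ++ b :: rev m by rewrite /= andbF.
    move: ain; rewrite -cat_cons !mem_cat => /orP[/sfg ae|->]; last by rewrite orbT.
    by rewrite mem_rcons inE ae orbT.
  move=> x; rewrite -cat_cons mem_cat => /orP[xf|xb] ax.
    by left; move: xf; rewrite inE => /orP[/eqP//|/HA]; rewrite inE ax.
  right; rewrite last_cat /= lm; apply: am => //.
  by move: xb; rewrite in_cons mem_rev (mem_cat x m) mem_seq1 orbC.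
have zH : z \notin a :: f :: g ++ b :: rev m.
  move: un3; rewrite cons_uniq => /andP[zn _]; apply: contra zn; rewrite !(in_cons, mem_cat).
  case/or4P=> [->//|/eqP->|zg|->]; rewrite ?orbT //; rewrite mem_rcons in_cons sfg ?orbT //.
    exact: mem_head.
  by rewrite in_cons zg orbT.
have ab : a = b.
  apply: (sp hh zH) => //; first exact: mem_head.
  by rewrite in_cons -cat_cons mem_cat mem_head !orbT.
move: un3; rewrite ab !cons_uniq mem_cat mem_head !orbT /=; by rewrite andbF.
Qed.

(** If [w] is off the hole, [z] is its only neighbour there. By [far_conn], a path leads from [w] to
    the rest of the hole outside the neighbourhood of [z]; a shortest one gives a [cfg]. Both of its
    halves are holes through [z] and [w], and together they cover [c], so one of them contains
    [x]. *)
Lemma hole_step S x z w c : nocut S -> hole c -> {subset c <= S} -> x \in c ->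
  z \in c -> w \in S -> z -- w ->
  exists c', [/\ hole c', {subset c' <= S}, x \in c' & w \in c'].
Proof.
move=> nS hc cS xc zc wS zw.
have [wc|wc] := boolP (w \in c); first by exists c.
have [a [p [ip za zl sp1' [zn zH cE]]]] := hole_at hc zc.
case/lastP: p ip zl sp1' zn zH cE => // m b; rewrite last_rcons size_rcons ltnS.
move=> ip zb m0 zn zH cE.
have cmem u : u \in a :: rcons m b -> u \in c by move=> h; rewrite cE in_cons h orbT.
have ac : a \in c by apply: cmem; rewrite mem_head.
have zS := cS _ zc.
have [xz|xz] := eqVneq x z.
  subst x; apply: (edge_hole nS zS wS zw (cS _ ac)).
    by rewrite eq_sym sedge_neq.
  by apply: contraNneq wc => <-.
have wN u : u \in a :: rcons m b -> ~~ w -- u.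
  move=> um; apply/negP => wu; have E : z = u by apply: (sp hc wc zc (cmem _ um) _ wu); rewrite sedge_sym.
  by rewrite E um in zn.
have um := ich_uniq ip.
have mR u : u \in m -> u \in far S z.
  move=> um'; have h : u \in a :: rcons m b by rewrite in_cons mem_rcons in_cons um' !orbT.
  rewrite farE cS ?cmem //=; apply/andP; split; first by apply: contraNneq zn => <-.
  apply/negP => zu; case: (zH u h zu) => E; move: um; rewrite cons_uniq rcons_uniq mem_rcons in_cons.
    by rewrite -E um' orbT.
  by rewrite -E um' /= !andbF.
have mC u : u \in m -> u \in a :: rcons m b by move=> h; rewrite in_cons mem_rcons in_cons h !orbT.
have /hitsP[r rR wr] : hits (far S z) w.
  apply: (far_hit nS zS wS zw (cS _ ac)); first by rewrite eq_sym sedge_neq.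
  by apply: contraNneq wc => <-.
have /hasP[m1 m1m _] : has predT m by rewrite has_predT.
pose B := [set u | has (fun v => (u == v) || (u -- v)) m].
have cr := csetE (far_conn nS zS) rR (mR _ m1m).
have [||e1 [e [ie sub wA lB [HA HB]]]] := @short_path _ _ (neighb w) B _ _ cr rR.
- by rewrite inE.
- by rewrite inE; apply/hasP; exists m1 => //; rewrite eqxx.
rewrite inE in wA.
have eNm u : u \in e1 :: e -> u \notin m.
  move=> ue; apply/negP => um'.
  have [s1 [y [s2 [E /eqP Ey _]]]] : exists s1 y s2, [/\ e1 :: e = s1 ++ y :: s2, pred1 u y & ~~ has (pred1 u) s1].
    by apply: split_first; rewrite has_pred1.
  subst y; case/lastP: s1 E => [|s1 l] E.
    by case: E => E _; move: (wN u (mC _ um')); rewrite -E wA.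
  have lu : l -- u.
    by move: ie; rewrite E -cats1 -catA => /ich_catr; rewrite cat1s ichE => /andP[/andP[]].
  have := HB _ _ E isT l; rewrite mem_rcons mem_head inE => /(_ isT)/hasPn/(_ u um') /=.
  by rewrite lu orbT.
have eR u : u \in e1 :: e -> [/\ u \in S, u != z & ~~ z -- u].
  by move/sub; rewrite farE => /and3P.
have eNc u : u \in e1 :: e -> u \notin c.
  move=> ue; have [_ uz zu] := eR u ue; rewrite cE !(inE, mem_rcons) !negb_or uz eNm //= andbT.
  by apply/andP; split; apply: contraNneq zu => ->.
have lastin : last e1 e \in e1 :: e by apply: mem_last.
have [d dm ld] : exists2 d, d \in m & last e1 e -- d.
  move: lB; rewrite inE => /hasP[d dm /orP[/eqP E|]]; last by exists d.
  by move: (eNm _ lastin); rewrite E dm.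
have ldu v : v \in c -> last e1 e -- v -> v = d.
  by move=> vc lv; apply: (sp hc (eNc _ lastin) vc (cmem _ (mC _ dm))).
have em u v : u \in e1 :: e -> v \in m -> u -- v -> u = last e1 e /\ v = d.
  move=> ue vm uv; suff ul : u = last e1 e.
    by split=> //; apply: ldu; rewrite -?ul //; apply: cmem; apply: mC.
  case/lastP: (e) ue HB => [|e' l] ue HB'; first by move: ue; rewrite inE => /eqP.
  rewrite last_rcons; move: ue; rewrite -rcons_cons mem_rcons inE => /orP[/eqP//|ue].
  have := HB' (e1 :: e') [:: l]; rewrite -rcons_cons -cats1 => /(_ erefl isT u ue).
  by rewrite inE => /hasPn/(_ v vm); rewrite uv orbT.
have wz : w != z by rewrite eq_sym sedge_neq.
have we u : u \in e1 :: e -> w != u.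
  by move=> ue; have [_ _ zu] := eR u ue; apply: contraNneq zu => <-.
have iwe : ich (w :: e1 :: e).
  rewrite ichE wA ie andbT; apply/allP => u ue; rewrite /nadj eq_sym we ?inE ?ue ?orbT //=.
  by have := HA u ue; rewrite inE.
case/splitPr: dm => m1' m2 in ip um mR mC em eNm cmem cE zH zn wN *.
have cf : cfg z w a b d m1' m2 (e1 :: e).
  have Em : a :: m1' ++ d :: m2 ++ [:: b] = a :: rcons (m1' ++ d :: m2) b.
    by rewrite -cats1 -catA.
  split=> //; rewrite ?Em //.
    rewrite cons_uniq in_cons mem_cat (negPf zn) orbF negb_or eq_sym wz /=.
    apply/and3P; split.
    - by apply/negP => /eR[_ /eqP].
    - rewrite -cat_cons mem_cat negb_or; apply/andP; split; first by apply/negP => /we/eqP.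
      by apply: contra wc; apply: cmem.
    rewrite -[_ && _]/(uniq ((e1 :: e) ++ _)) cat_uniq; apply/and3P; split; [exact: ich_uniq| |exact: um].
    apply/hasPn => u ua; apply/negP => ue.
    by move: (eNc u ue); rewrite (cmem _ ua).
  split; first by split.
  split=> //; rewrite ?Em //.
  - by move=> u /eR[].
  - by move=> u /mR; rewrite farE => /and3P[].
  - by move=> v va lv; apply: ldu => //; apply: cmem.
have no1 u : u \in e1 :: e -> ~~ u -- a by apply: cfg_no cf.
have no2 u : u \in e1 :: e -> ~~ u -- b by apply: cfg_no (cfg_rev cf).
have h1 := cfg_hole cf no2.
have h2 := cfg_hole (cfg_rev cf) no1.
have subS c' : {subset c' <= c} -> {subset z :: w :: (e1 :: e) ++ c' <= S}.
  move=> sc u; rewrite !in_cons -[_ || (u \in e ++ _)]/(u \in (e1 :: e) ++ c') mem_cat.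
  by case/or4P=> [/eqP->|/eqP->|/eR[]|/sc/cS].
have [m2c m1c] : {subset d :: m2 ++ [:: b] <= c} /\ {subset d :: rev m1' ++ [:: a] <= c}.
  split=> u; rewrite in_cons mem_cat mem_seq1 ?mem_rev => h; apply: cmem.
    by rewrite in_cons mem_rcons in_cons mem_cat in_cons; case/or3P: h => ->; rewrite !orbT.
  by rewrite in_cons mem_rcons in_cons mem_cat in_cons; case/or3P: h => ->; rewrite ?orbT.
have wI c' : w \in z :: w :: c' by rewrite in_cons mem_head orbT.
move: xc; rewrite cE in_cons (negPf xz) in_cons mem_rcons in_cons mem_cat in_cons /=.
case/or3P=> [xa|xb|]; last case/orP=> [x1|x2].
- exists (z :: w :: (e1 :: e) ++ d :: rev m1' ++ [:: a]); split=> //; first exact: subS.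
  by rewrite 2!in_cons mem_cat in_cons mem_cat mem_seq1 xa !orbT.
- exists (z :: w :: (e1 :: e) ++ d :: m2 ++ [:: b]); split=> //; first exact: subS.
  by rewrite 2!in_cons mem_cat in_cons mem_cat mem_seq1 xb !orbT.
- exists (z :: w :: (e1 :: e) ++ d :: rev m1' ++ [:: a]); split=> //; first exact: subS.
  by rewrite 2!in_cons mem_cat in_cons mem_cat mem_rev x1 !orbT.
- exists (z :: w :: (e1 :: e) ++ d :: m2 ++ [:: b]); split=> //; first exact: subS.
  by rewrite 2!in_cons mem_cat in_cons mem_cat; case/orP: x2 => ->; rewrite !orbT.
Qed.

Lemma common_hole S x y : nocut S -> x \in S -> y \in S -> x != y -> ~~ x -- y ->
  exists c, [/\ hole c, {subset c <= S}, x \in c & y \in c].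
Proof.
move=> nS xS yS xy nxy.
pose T : pred G := fun u => (u == x) || `[< exists c, [/\ hole c, {subset c <= S}, x \in c & u \in c] >].
suff key u v : T u -> u \in S -> v \in S -> u -- v -> T v.
  have : T y by apply: (conn_closed (P := T) key (csetE (nocut0 nS) xS yS)); rewrite unfold_in /T eqxx.
  by rewrite /T eq_sym (negPf xy) /= => /asboolP.
rewrite /T => /orP[/eqP->|/asboolP[c [hc cS xc uc]]] uS vS uv.
  have [//|vx] := eqVneq v x; apply/asboolP.
  apply: (edge_hole nS xS vS uv yS); first by rewrite eq_sym.
  by apply: contraNneq nxy => ->.
by apply/orP; right; apply/asboolP; apply: hole_step hc cS xc uc vS uv.
Qed.

(** An excursion of the path outside [S'] leaves and returns through the clique [K], so it can be
    replaced by an edge of [K]. *)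
Lemma cut_lift S S' K K' x y : S' \subset S -> clique K -> K \subset S' ->
  (forall u v, u \in S' -> v \in S :\: S' -> u -- v -> u \in K) ->
  x \in S' -> y \in S' -> conn (S :\: K') x y -> conn (S' :\: K') x y.
Proof.
move=> sS cK KS anti xS' yS' cxy.
(* Outside [S'] the invariant remembers a vertex of [K] from which the excursion can be
   short-cut. *)
pose P : pred G := fun u => if u \in S' then conn (S' :\: K') x u
  else [exists k in K :\: K', conn (S' :\: K') x k].
suff key u v : P u -> u \in S :\: K' -> v \in S :\: K' -> u -- v -> P v.
  have : P y by apply: (conn_closed (P := P) key cxy); rewrite unfold_in /P xS' conn0.
  by rewrite /P yS'.
rewrite /P !in_setD => Pu /andP[uK uS] /andP[vK vS] uv.
case: ifP => vS'.
  case: ifP Pu => uS' Pu; first by apply: conn_trans Pu _; apply: conn1; rewrite // inE ?uK ?vK.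
  case/existsP: Pu => k /andP[]; rewrite in_setD => /andP[kK' kK] xk.
  have vKK : v \in K by apply: (anti v u); rewrite // ?inE ?uS' // sedge_sym.
  have [<-//|kv] := eqVneq k v; apply: conn_trans xk _; apply: conn1.
  - by rewrite inE kK' (subsetP KS).
  - by rewrite inE vK.
  - exact: cK.
case: ifP Pu => uS' Pu //.
apply/existsP; exists u; rewrite inE uK Pu (anti u v) //.
by rewrite inE vS'.
Qed.

(** Induction on the size of [S]. A clique cutset [K] of [S] either separates [x] from [y], or both
    lie in a smaller part that contains [K], and [cut_lift] carries a separation of this part over
    to [S]. *)
Lemma hole_or_cut S x y : x \in S -> y \in S -> x != y -> ~~ x -- y ->
  (exists c, [/\ hole c, {subset c <= S}, x \in c & y \in c]) \/
  (exists K, [/\ K \subset S, clique K, #|K| <= 2, x \notin K /\ y \notin K & ~~ conn (S :\: K) x y]).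
Proof.
have [n] := ubnP #|S|; elim: n S => // n IH S ltn xS yS xy nxy.
have [nS|nS] := pselect (nocut S); first by left; apply: common_hole.
have [K [KS cK K2 ncK]] : exists K, [/\ K \subset S, clique K, #|K| <= 2 & ~~ cset (S :\: K)].
  apply: contrapT => H; apply: nS => K KS cK K2; apply: contraT => nc; case: H; by exists K.
have [u [v [uSK vSK ncuv]]] : exists u v, [/\ u \in S :\: K, v \in S :\: K & ~~ conn (S :\: K) u v].
  apply: contrapT => H; case/negP: ncK; apply: csetI => u v uK vK; apply: contraT => nc.
  by case: H; exists u, v.
pose A := ccomp (S :\: K) u.
have uA : u \in A by apply: mem_comp.
have vA : v \notin A by rewrite in_set vSK.
have AS : A \subset S :\: K by apply: comp_sub.
have AK w : w \in A -> w \notin K by move/(subsetP AS); rewrite inE => /andP[].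
have AS' : A \subset S by apply: subset_trans AS (subsetDl _ _).
have anti w w' : w \in A -> w' \in S -> w' \notin K -> w -- w' -> w' \in A.
  by move=> wA wS wK; apply: comp_step; rewrite // inE wK.
have rec S' : S' \subset S -> (exists2 w, w \in S & w \notin S') -> K \subset S' ->
   (forall u v, u \in S' -> v \in S :\: S' -> u -- v -> u \in K) -> x \in S' -> y \in S' ->
  (exists c, [/\ hole c, {subset c <= S}, x \in c & y \in c]) \/
  (exists K, [/\ K \subset S, clique K, #|K| <= 2, x \notin K /\ y \notin K & ~~ conn (S :\: K) x y]).
  move=> sS [w wS wS'] KS' an xS' yS'.
  have lt : #|S'| < n.
    rewrite ltnS in ltn; apply: leq_trans ltn; apply: proper_card; rewrite properE sS.
    by apply/subsetPn; exists w.
  case: (IH S' lt xS' yS' xy nxy) => [[c [hc cS xc yc]]|[K' [K'S' cK' K'2 nK nc]]].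
    by left; exists c; split=> // z /cS; apply: (subsetP sS).
  right; exists K'; split=> //; first exact: subset_trans sS.
  by apply: contra nc; apply: cut_lift an _ _.
have [/andP[xAK yAK]|nAK] := boolP ((x \in A :|: K) && (y \in A :|: K)).
  apply: (rec (A :|: K)) => //; rewrite ?subUset ?AS' ?KS ?subsetUr //.
    exists v; first by case/setDP: vSK.
    by rewrite in_setU negb_or vA; case/setDP: vSK.
  move=> w w' /setUP[wA|//]; rewrite in_setD in_setU negb_or => /andP[/andP[w'A w'K] w'S] ww'.
  by rewrite (anti w w') in w'A.
have [/andP[xA yA]|nA] := boolP ((x \notin A) && (y \notin A)).
  apply: (rec (S :\: A)); rewrite ?subsetDl ?in_setD ?xA ?yA //.
  - by exists u; [case/setDP: uSK | rewrite in_setD uA].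
  - by apply/subsetP => w wK; rewrite in_setD (subsetP KS) // andbT; apply: contraL wK => /AK.
  move=> w w'; rewrite !in_setD => /andP[wA wS] /andP[h w'S] ww'.
  rewrite w'S andbT negbK in h; apply: contraT => wK.
  by rewrite (anti w' w h wS wK) // sedge_sym in wA.
right; exists K.
have inAK z : z \in S -> z \notin K -> z \in S :\: K by move=> zS zK; rewrite in_setD zK.
move: nAK nA; rewrite !in_setU; have [xA|xA] := boolP (x \in A); have [yA|yA] := boolP (y \in A) => //=.
  move=> yK _; split=> //; first by split=> //; apply: AK.
  apply: contra yA => cxy; rewrite in_set inAK //.
  by apply: conn_trans cxy; move: xA; rewrite in_set => /andP[].
rewrite andbT => xK _; split=> //; first by split=> //; apply: AK.
  apply: contra xA => cxy; rewrite in_set inAK //.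
by apply: (conn_trans (y := y)); [move: yA; rewrite in_set => /andP[] | rewrite conn_sym].
Qed.

End Cuts.

(** * Brambles *)

Section Brambles.
Variable G : sgraph.
Implicit Types (x y z u v w : G) (A B C D S K T X Y : {set G}) (F : {set {set G}}).

Definition touch A B := exists x y, [/\ x \in A, y \in B & (x == y) || x -- y].

Lemma touchC A B : touch A B -> touch B A.
Proof. by case=> x [y [xA yB h]]; exists y, x; split; rewrite // eq_sym sedge_sym. Qed.

Lemma touch_cset A B : cset A -> cset B -> touch A B -> cset (A :|: B).
Proof. by move=> cA cB [x [y [xA yB h]]]; apply: csetU xA yB h. Qed.

Definition bramble F :=
  (forall A, A \in F -> A != set0 /\ cset A) /\
  (forall A B, A \in F -> B \in F -> touch A B).

(** The order of the bramble [F], the least size of a hitting set, is at least [k]. *)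
Definition border k F := forall Y, #|Y| < k -> exists2 A, A \in F & [disjoint A & Y].

Definition small F D := forall A, A \in F -> ~~ (A \subset D).

Lemma two_small F D A : bramble F -> [disjoint D & A] ->
  (forall x y, x \in D -> y \in A -> ~~ x -- y) -> small F D \/ small F A.
Proof.
move=> [_ bF] dDA anti; apply: contrapT => /not_orP[/existsNP[B /not_implyP[BF /negP]]].
rewrite negbK => BD /existsNP[C /not_implyP[CF /negP]]; rewrite negbK => CA.
have [x [y [/(subsetP BD) xD /(subsetP CA) yA /orP[/eqP xy|xy]]]] := bF _ _ BF CF.
  by case: (disjP _ _ dDA x xD); rewrite xy.
by move: (anti x y xD yA); rewrite xy.
Qed.

(* The separator is a vertex [v] together with a clique [K].  Replacing the
   part [D] that contains no bramble set by a connected [T] which links [v] to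
   [K] keeps the order, since [T] can be contracted to [v]. *)
Lemma bramble_reduce F k D T v K : bramble F -> border k F -> small F D ->
  clique K -> T \subset D -> cset T -> v \notin D ->
  (forall d u, d \in D -> u \notin D -> d -- u -> u \in v |: K) ->
  (T != set0 -> hits T v) ->
  (forall x, x \in K -> [\/ x = v, v -- x | hits T x]) ->
  exists F', [/\ bramble F', border k F' & forall A, A \in F' -> A :&: D \subset T].
Proof.
move=> [cF tF] oF sD cK TD cT vD ND Tv TK.
pose f A := (A :\: D) :|: (if v \in A then T else set0).
pose X := v |: K.
have fD A : A :\: D \subset f A by apply: subsetUl.
have fv A : v \in A -> T \subset f A by rewrite /f => ->; apply: subsetUr.
have inf A x : x \in A -> x \notin D -> x \in f A.
  by move=> xA xD; apply: (subsetP (fD A)); rewrite inE xD.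
have hv x : hits T x -> hits T v.
  by move=> h; apply: Tv; case/hitsP: h => t tT _; apply/set0Pn; exists t.
have Tx x A : v \in A -> hits T x -> x \in f A -> conn (f A) v x.
  move=> vA hx xf; case/hitsP: (hv x hx) => t tT vt; case/hitsP: hx => t' t'T xt'.
  have sT := subsetP (fv A vA).
  apply: (conn_trans (y := t)); first by apply: conn1 => //; [apply: inf | apply: sT].
  apply: (conn_trans (y := t')); first by apply: connS (csetE cT tT t'T); apply: fv.
  by apply: conn1; rewrite ?(sT _ t'T) // sedge_sym.
have XX A w w' : w \in A -> w' \in A -> w \in X -> w' \in X -> w \notin D -> w' \notin D ->
   conn (f A) w w'.
  move=> wA w'A; have vX u : u \in A -> u \in K -> u \notin D -> v \in A -> conn (f A) v u.
    move=> uA uK uD vA; case: (TK u uK) => [->//|vu|h].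
      by apply: conn1 => //; apply: inf.
    by apply: Tx => //; apply: inf.
  move=> wX w'X wD w'D; case/setU1P: wX wA wD => [->|wK] wA wD;
    case/setU1P: w'X w'A w'D => [->|w'K] w'A w'D //.
  - exact: vX.
  - by rewrite conn_sym; apply: vX.
  - have [->//|ww'] := eqVneq w w'; apply: conn1; [exact: inf | exact: inf |].
    exact: cK.
have AX A d : A \in F -> d \in A -> d \in D -> exists w, [/\ w \in A, w \in X & w \notin D].
  move=> AF dA dD; have [c cA cD] := subsetPn (sD _ AF).
  have [_ cAA] := cF _ AF.
  have [u [w [uD wD uA wA uw]]] := conn_exit (csetE cAA dA cA) dD cD.
  by exists w; split=> //; apply: (ND u).
exists (f @: F); split; last first.
- move=> _ /imsetP[A AF ->]; apply/subsetP => x; rewrite in_setI => /andP[]; rewrite !inE.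
  by case/orP=> [/andP[/negPf->]//|]; case: ifP; rewrite ?inE.
- move=> Y ltY.
  have [t|nT] := boolP [exists t, t \in Y :&: T]; last first.
    have [A AF dA] := oF _ ltY; exists (f A); first exact: imset_f.
    apply/disjP => x; rewrite in_setU => /orP[/setDP[xA _] xY|]; first exact: (disjP _ _ dA x).
    case: ifP; rewrite ?inE // => _ xT xY; case/existsP: nT; exists x.
    by rewrite inE xY.
  case/existsP: t => t; rewrite inE => /andP[tY tT].
  (* If [Y] meets [T], trading the vertices of [Y] in [T] for [v] does not increase its size, and a
     set that avoids [v] receives nothing from [T]. *)
  have [|A AF dA] := oF (v |: (Y :\: T)).
    apply: leq_ltn_trans ltY; rewrite cardsU1; apply: leq_trans (_ : 1 + #|Y :\ t| <= _).
      apply: leq_add; first by case: (_ \notin _).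
      by apply: subset_leq_card; apply/subsetP => y; rewrite !inE => /andP[yT ->]; rewrite andbT; apply: contraNneq yT => ->.
    by rewrite (cardsD1 t Y) tY.
  exists (f A); first exact: imset_f.
  have nvA : v \notin A by apply/negP => /(disjP _ _ dA v); rewrite setU11 => /(_ isT).
  apply/disjP => x; rewrite /f (negPf nvA) setU0 inE => /andP[xD xA] xY.
  apply: (disjP _ _ dA x) => //; rewrite in_setU1 in_setD xY andbT; apply/orP; right.
  by apply: contra xD; apply: (subsetP TD).
split=> [_ /imsetP[A AF ->]|_ _ /imsetP[A AF ->] /imsetP[B BF ->]].
  have [_ cA] := cF _ AF; split.
    have [c cA' cD] := subsetPn (sD _ AF); apply/set0Pn; exists c; exact: inf.
  have Dc x y : x \in A -> x \notin D -> y \in A -> y \notin D -> conn (f A) x y.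
    move=> xA xD yA yD.
    (* A walk in [A] enters and leaves [D] through [X]; inside [D] the invariant keeps a vertex of
       [X] already reached, and [XX] joins it to the vertex of exit. *)
    pose P : pred G := fun u => if u \in D then [exists w in A :&: X :\: D, conn (f A) x w]
                                else conn (f A) x u.
    suff key u u' : P u -> u \in A -> u' \in A -> u -- u' -> P u'.
      have : P y by apply: (conn_closed (P := P) key (csetE cA xA yA)); rewrite unfold_in /P (negPf xD) conn0.
      by rewrite /P (negPf yD).
    rewrite /P; case: ifP => uD Pu uA u'A uu'; case: ifP => u'D //.
    - case/existsP: Pu => w /andP[]; rewrite !inE => /and3P[wD wA wX] xw.
      apply: conn_trans xw _; apply: XX; rewrite // ?u'D //.
        by rewrite !inE.
      by apply: ND uu'; rewrite ?u'D.
    - have uX : u \in X by apply: (ND u' u u'D (negbT uD)); rewrite sedge_sym.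
      by apply/existsP; exists u; rewrite Pu andbT in_setD uD in_setI uA uX.
    - by apply: conn_trans Pu _; apply: conn1; rewrite ?inf ?uD ?u'D.
  have [c cA' cD] := subsetPn (sD _ AF).
  apply: (@cset_star _ _ c) => y; rewrite in_setU => /orP[/setDP[yA yD]|]; first exact: Dc.
  case: ifP => vA; rewrite ?inE // => yT.
  apply: (conn_trans (y := v)); first exact: Dc.
  have /hitsP[t tT vt] : hits T v by apply: Tv; apply/set0Pn; exists y.
  apply: (conn_trans (y := t)).
    by apply: conn1 => //; [apply: inf | apply: (subsetP (fv A vA))].
  by apply: connS (csetE cT tT yT); apply: fv.
have tXX w w' : w \in A -> w' \in B -> w \in X -> w' \in X -> w \notin D -> w' \notin D ->
   touch (f A) (f B).
  have half C C' u u' : u \in C -> u' \in C' -> u = v -> u' \in K -> u \notin D -> u' \notin D -> touch (f C) (f C').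
    move=> uC u'C' uv u'K uD u'D; subst u; case: (TK u' u'K) => [e|vu|h].
    - by subst u'; exists v, v; rewrite !inf ?eqxx.
    - by exists v, u'; rewrite !inf ?vu ?orbT.
    - case/hitsP: h => t tT u't; exists t, u'; rewrite (subsetP (fv C uC)) // inf //.
      by rewrite sedge_sym u't orbT.
  move=> wA w'B /setU1P[wv|wK] /setU1P[w'v|w'K] wD w'D.
  - by exists w, w'; split; [exact: inf | exact: inf | rewrite wv w'v eqxx].
  - exact: half wv w'K _ _.
  - by apply: touchC; apply: half w'v wK _ _.
  - exists w, w'; split; [exact: inf | exact: inf |].
    by case: eqVneq => //= ww'; exact: cK.
have [x [y [xA yB xy]]] := tF _ _ AF BF.
have [xD|xD] := boolP (x \in D); have [yD|yD] := boolP (y \in D).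
- have [w [wA wX wD]] := AX _ _ AF xA xD; have [w' [w'A w'X w'D]] := AX _ _ BF yB yD.
  exact: (tXX w w').
- have [w [wA wX wD]] := AX _ _ AF xA xD.
  case/orP: xy => [/eqP xy|xy]; first by rewrite -xy xD in yD.
  exact: (tXX w y wA yB wX (ND _ _ xD yD xy)).
- have [w [wA wX wD]] := AX _ _ BF yB yD.
  case/orP: xy => [/eqP xy|xy]; first by rewrite xy yD in xD.
  by rewrite sedge_sym in xy; apply: (tXX x w xA wA (ND _ _ yD xD xy) wX).
- by exists x, y; rewrite !inf.
Qed.

(** What minimality of the cover gives after passing to the subgraph induced on it: no bramble of
    this order avoids a vertex. *)
Definition critical k := (exists F, bramble F /\ border k F) /\
  (forall F, bramble F -> border k F -> forall x, exists2 A, A \in F & x \in A).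

End Brambles.

(** * Critical graphs *)

Section Critical.
Variables (G : sgraph) (k : nat) (F : {set {set G}}).
Hypothesis tf : tfree G.
Hypothesis sp : sp1 G.
Hypothesis bF : bramble F.
Hypothesis oF : border k F.
Hypothesis crit : forall F, bramble F -> border k F -> forall x : G, exists2 A, A \in F & x \in A.
Implicit Types (x y z u v w p q b d : G) (A B C D S K T X Y : {set G}).

(** [bramble_reduce] yields a bramble of the same order that misses [D] outside [T]; by criticality
    nothing is missed. *)
Lemma thin D T v K : small F D ->
  clique K -> T \subset D -> cset T -> v \notin D ->
  (forall d u, d \in D -> u \notin D -> d -- u -> u \in v |: K) ->
  (T != set0 -> hits T v) ->
  (forall x, x \in K -> [\/ x = v, v -- x | hits T x]) -> D = T.
Proof.
move=> sD cK TD cT vD ND Tv TK; apply/eqP; rewrite eqEsubset TD andbT.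
have [F' [bF' oF' H]] := bramble_reduce bF oF sD cK TD cT vD ND Tv TK.
apply/subsetP => x xD; have [A AF xA] := crit bF' oF' x.
by apply: (subsetP (H A AF)); rewrite inE xA.
Qed.

(** [D] and [A] are two full components of the complement of the separator [v |: K]: every vertex of
    the separator is attached to both. *)
Definition cutpair v K D A : Prop :=
  [/\ [/\ clique K, #|K| <= 2 & v \notin K],
      [/\ cset D, cset A, [disjoint D & A] & [disjoint (D :|: A) & (v |: K)]],
      forall d u, d \in D -> u \notin D -> d -- u -> u \in v |: K,
      forall d u, d \in A -> u \notin A -> d -- u -> u \in v |: K
    & forall x, x \in v |: K -> hits D x /\ hits A x].

Lemma cutpair_sym v K D A : cutpair v K D A -> cutpair v K A D.
Proof.
case=> h1 [cD cA dDA dX] h3 h4 h5; split=> //.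
  by split=> //; [rewrite disjoint_sym | rewrite setUC].
by move=> x /h5[].
Qed.

Lemma cutpair_small v K D A : cutpair v K D A -> small F D \/ small F A.
Proof.
case=> h1 [cD cA dDA dX] h3 h4 h5; apply: (two_small bF dDA) => x y xD yA.
have yD : y \notin D by apply/negP => yD; apply: (disjP _ _ dDA y).
apply/negP => /(h3 x y xD yD) yX; apply: (disjP _ _ dX y) => //; by rewrite inE yA orbT.
Qed.

(** A hole through [x1] and [x2] that avoids [v] would contain two neighbours of [v], so
    [hole_or_cut] gives a clique separating them in the graph without [v]. *)
Lemma exists_cut v x1 x2 : x1 != x2 -> v -- x1 -> v -- x2 ->
  exists K D A, [/\ cutpair v K D A, x1 \in D & x2 \in A].
Proof.
move=> x12 vx1 vx2.
have n12 : ~~ x1 -- x2 by apply/negP => h; apply: (tf vx1 h vx2).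
pose S := ~: [set v].
have inS x : (x \in S) = (x != v) by rewrite !inE.
have xS x : v -- x -> x \in S by rewrite inS eq_sym; apply: sedge_neq.
case: (hole_or_cut tf sp (xS _ vx1) (xS _ vx2) x12 n12) => [[c [hc cS x1c x2c]]|].
  have vc : v \notin c by apply/negP => /cS; rewrite inS eqxx.
  by case/eqP: x12; apply: (sp hc vc).
case=> K [KS cK K2 [x1K x2K] nc].
have stp (Q : {set G}) z d u : d \in ccomp (S :\: Q) z -> u \notin ccomp (S :\: Q) z -> d -- u -> u \in v |: Q.
  move=> dD uD du; apply: contraR uD; rewrite in_setU1 negb_or => /andP[uv uQ].
  by apply: comp_step du => //; rewrite inE uQ inS.
have inn (Q : {set G}) x : v -- x -> x \notin Q -> x \in S :\: Q by move=> vx xQ; rewrite in_setD xQ xS.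
(* Trim the clique to the vertices attached to both sides: first to those seen from the component of
   [x1], then to those seen from the component of [x2], which may have grown. The component of [x1]
   is taken anew at the end. *)
pose D0 := ccomp (S :\: K) x1.
pose K1 := [set k in K | hits D0 k].
pose A := ccomp (S :\: K1) x2.
pose K2' := [set k in K1 | hits A k].
pose D := ccomp (S :\: K2') x1.
have K1K : K1 \subset K by apply/subsetP => u; rewrite inE => /andP[].
have K21 : K2' \subset K1 by apply/subsetP => u; rewrite inE => /andP[].
have x1D0 : x1 \in D0 by apply: mem_comp; apply: inn.
have x1K2 : x1 \notin K2' by apply: contra x1K => /(subsetP K21)/(subsetP K1K).
have x2K1 : x2 \notin K1 by apply: contra x2K => /(subsetP K1K).
have x1D : x1 \in D by apply: mem_comp; apply: inn.
have x2A : x2 \in A by apply: mem_comp; apply: inn.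
have D0D : D0 \subset D.
  apply: sub_comp x1D0; first exact: cset_comp.
  apply/subsetP => u /(subsetP (comp_sub _ _)); rewrite !in_setD => /andP[uK ->]; rewrite andbT.
  by apply: contra uK => /(subsetP K21)/(subsetP K1K).
have x2D0 : x2 \notin D0 by rewrite in_set negb_and orbC nc.
have AD0 u : u \in A -> u \notin D0.
  move=> uA; apply/negP => uD0.
  have cA : conn (S :\: K1) u x2 by rewrite conn_sym; move: uA; rewrite in_set => /andP[].
  have [a [b [aD bD aS bS ab]]] := conn_exit cA uD0 x2D0.
  have := stp _ _ _ _ aD bD ab; rewrite in_setU1 => /orP[/eqP bv|bK].
    by move: bS; rewrite in_setD inS bv eqxx andbF.
  move: bS; rewrite in_setD => /andP[/negP bK1 _]; apply: bK1; rewrite in_set bK.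
  by apply/hitsP; exists a; rewrite // sedge_sym.
have ND d u : d \in D -> u \notin D -> d -- u -> u \in v |: K2' by apply: stp.
have NA d u : d \in A -> u \notin A -> d -- u -> u \in v |: K2'.
  move=> dA uA du; have := stp _ _ _ _ dA uA du; rewrite !in_setU1 => /orP[->//|uK1].
  by rewrite in_set uK1 orbC; apply/orP; left; apply/hitsP; exists d; rewrite // sedge_sym.
have dX (Q : {set G}) z : [disjoint ccomp (S :\: Q) z & v |: Q].
  apply/disjP => u /(subsetP (comp_sub _ _)); rewrite in_setD inS => /andP[uQ uv].
  by rewrite in_setU1 (negPf uv) (negPf uQ).
have dAX : [disjoint A & v |: K2'].
  apply/disjP => u uA; rewrite in_setU1 => uX; apply: (disjP _ _ (dX K1 x2) u uA).
  by rewrite in_setU1; case/orP: uX => [->//|/(subsetP K21)->]; rewrite orbT.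
have dDA : [disjoint D & A].
  apply/disjP => u uD uA.
  have cD : conn (S :\: K2') u x1 by rewrite conn_sym; move: uD; rewrite in_set => /andP[].
  have x1A : x1 \notin A by apply/negP => /AD0; rewrite x1D0.
  have [a [b [aA bA aS bS ab]]] := conn_exit cD uA x1A.
  by have := NA _ _ aA bA ab; rewrite in_setU1; move: bS; rewrite in_setD inS => /andP[/negPf-> /negPf->].
exists K2', D, A; split=> //; split=> //.
- split; last by apply/negP => /(subsetP K21)/(subsetP K1K)/(subsetP KS); rewrite inS eqxx.
    by move=> a b /(subsetP K21)/(subsetP K1K) aK /(subsetP K21)/(subsetP K1K) bK; apply: cK.
  by apply: leq_trans K2; apply: subset_leq_card; apply: subset_trans K1K.
- split=> //; try exact: cset_comp.
  apply/disjP => u; rewrite in_setU => /orP[uD|uA] uX; [exact: (disjP _ _ (dX K2' x1) u) | exact: (disjP _ _ dAX u)].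
move=> x; rewrite in_setU1 => /orP[/eqP->|xK2].
  by split; apply/hitsP; [exists x1 | exists x2].
move: (xK2); rewrite in_set => /andP[xK1 hA]; split=> //.
by move: xK1; rewrite in_set => /andP[_]; apply: hitsS.
Qed.

(* [D] is the path [o1 ++ b :: o2], whose only vertex adjacent to [v] is its
   inner vertex [b], and whose ends are attached to the adjacent vertices
   [p] and [q]. *)
Definition claw v b p q (o1 o2 : seq G) : Prop :=
  [/\ [/\ ich (o1 ++ b :: o2), p -- q, o1 != [::] & o2 != [::]],
      [/\ v -- b, head b o1 -- p & last b o2 -- q],
      [/\ forall d, d \in o1 ++ b :: o2 -> v -- d -> d = b,
          forall d, d \in o1 ++ b :: o2 -> p -- d -> d = head b o1 &
          forall d, d \in o1 ++ b :: o2 -> q -- d -> d = last b o2]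
    & exists A, cutpair v [set p; q] [set d in o1 ++ b :: o2] A].

Lemma claw_sym v b p q o1 o2 : claw v b p q o1 o2 -> claw v b q p (rev o2) (rev o1).
Proof.
have E : rev o2 ++ b :: rev o1 = rev (o1 ++ b :: o2) by rewrite rev_cat rev_cons -cats1 -catA.
have hr (s : seq G) : head b (rev s) = last b s.
  by case/lastP: s => // s x; rewrite rev_rcons last_rcons.
have lr (s : seq G) : last b (rev s) = head b s by rewrite -hr revK.
case=> [[ich0 pq n1 n2] [vb hp lq] [h1 h2 h3] [A cp]]; split.
- by split; rewrite ?E ?ich_rev ?(sedge_sym q) // -size_eq0 size_rev size_eq0.
- by rewrite hr lr.
- by rewrite E hr lr; split=> d; rewrite mem_rev; [apply: h1 | apply: h3 | apply: h2].
exists A; rewrite setUC; have -> // : [set d in rev o2 ++ b :: rev o1] = [set d in o1 ++ b :: o2].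
by apply/setP => d; rewrite !inE E mem_rev.
Qed.

(* A shortest [v]-[q] path through [D] closes up to a hole through [A], so
   [p], being adjacent to [q], has no other neighbour on it. *)
Lemma path_avoid v p q D A e1 e : p -- q -> cutpair v [set p; q] D A ->
  ich (e1 :: e) -> {subset e1 :: e <= D} -> v -- e1 ->
  (forall u, u \in e -> ~~ v -- u) ->
  q -- last e1 e -> (forall u, u \in e1 :: e -> q -- u -> u = last e1 e) ->
  ~~ v -- p /\ (forall u, u \in e1 :: e -> ~~ p -- u).
Proof.
move=> pq cp ie sub ve1 ve ql qe.
have pNq := sedge_neq pq.
case: cp => [[cK _ vK] [cD cA dDA dX] ND NA hX].
have [vp_ vq_] : v != p /\ v != q by move: vK; rewrite !inE negb_or => /andP[].
have nD u : u \in D -> [/\ u != v, u != p, u != q & u \notin A].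
  move=> uD; have uX : u \notin v |: [set p; q].
    by apply/negP => uX; apply: (disjP _ _ dX u); rewrite // inE uD.
  move: uX; rewrite !inE !negb_or => /and3P[-> -> ->]; split=> //.
  by apply/negP => uA; apply: (disjP _ _ dDA u).
have nA u : u \in A -> [/\ u != v, u != p & u != q].
  move=> uA; have uX : u \notin v |: [set p; q].
    by apply/negP => uX; apply: (disjP _ _ dX u); rewrite // inE uA orbT.
  by move: uX; rewrite !inE !negb_or => /and3P[-> -> ->].
have ndq u : u \in e1 :: e -> u != q by move/sub/nD=> [].
have vne : v \notin e1 :: e by apply/negP => /sub/nD[]; rewrite eqxx.
have pne : p \notin e1 :: e by apply/negP => /sub/nD[_]; rewrite eqxx.
have iq : ich (e1 :: e ++ [:: q]).
  apply: ich_cat => //; first by rewrite sedge_sym.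
    move=> u w ue; rewrite mem_seq1 => /eqP->; have [qu|qu] := boolP (q -- u).
      by left; rewrite (qe u ue qu).
    by right; rewrite /nadj eq_sym ndq // sedge_sym.
  rewrite -cat_cons cats1 rcons_uniq (ich_uniq ie) andbT.
  by apply/negP => /ndq; rewrite eqxx.
(* If [v] and [q] are adjacent, the hole closes without passing through [A]. *)
have [vq|vq] := boolP (v -- q).
  have h : hole (v :: e1 :: e ++ [:: q]).
    apply: hole_of => //.
    - by rewrite last_cat.
    - rewrite size_cat addn1; case: (e) ie qe ql => // _ _ qe1.
      by case: (tf ve1 _ vq); rewrite sedge_sym.
    - by rewrite -cat_cons mem_cat mem_seq1 negb_or vne.
    move=> u; rewrite -cat_cons mem_cat mem_seq1 last_cat /= inE.
    case/orP=> [/orP[/eqP->|ue]|/eqP->]; [by left | by rewrite (negPf (ve _ ue)) | by right].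
  have vp : ~~ v -- p by apply/negP => vp; apply: (tf vp pq vq).
  split=> // u ue; apply/negP => pu; case/negP: (ndq u ue); apply/eqP.
  have pH : p \notin v :: e1 :: e ++ [:: q].
    by rewrite (in_cons v) -cat_cons mem_cat mem_seq1 2!negb_or eq_sym vp_ pne pNq.
  apply: (sp h pH); rewrite // (in_cons v) -cat_cons mem_cat ?ue ?mem_seq1 ?eqxx ?orbT //.
have [|_ /hitsP[a aA qa]] := hX q; first by rewrite !inE eqxx !orbT.
have [|_ /hitsP[a' a'A va']] := hX v; first by rewrite !inE eqxx.
have ca := csetE cA aA a'A.
have [||f1 [f [iff subf qf vf [HA HB]]]] := @short_path _ _ (neighb q) (neighb v) _ _ ca aA.
- by rewrite inE.
- by rewrite inE.
rewrite inE in qf; rewrite inE in vf.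
have nf u : u \in f1 :: f -> [/\ u != v, u != p & u != q] by move=> uf; apply: nA; apply: subf.
have qf1 : q \notin f1 :: f by apply/negP => /nf[_ _]; rewrite eqxx.
have eA u w : u \in e1 :: e -> w \in f1 :: f -> nadj u w.
  move=> ue wf; have [_ _ _ uA] := nD u (sub u ue); have wA := subf w wf.
  have [wv wp wq] := nA w wA.
  rewrite /nadj; apply/andP; split; first by apply: contraNneq uA => <-.
  have wD : w \notin D by apply/negP => wD; apply: (disjP _ _ dDA w).
  apply/negP => uw; have := ND u w (sub u ue) wD uw; by rewrite !inE (negPf wv) (negPf wp) (negPf wq).
have lH : last e1 (e ++ q :: f1 :: f) = last f1 f by rewrite last_cat.
have h : hole (v :: e1 :: e ++ q :: f1 :: f).
  apply: hole_of => //.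
  - apply: ich_cat => //; rewrite 1?sedge_sym //.
    + rewrite ichE qf iff andbT; apply/allP => u uf.
      have uf1 : u \in f1 :: f by rewrite inE uf orbT.
      have [_ _ uq] := nA u (subf u uf1).
      by rewrite /nadj uq; have := HA u uf; rewrite inE.
    + move=> u w ue; rewrite in_cons => /orP[/eqP->|wf]; last by right; apply: eA.
      have [qu|qu] := boolP (q -- u); first by left; rewrite (qe u ue qu).
      by right; rewrite /nadj eq_sym ndq // sedge_sym.
    rewrite -cat_cons cat_uniq; apply/and3P; split.
    - exact: ich_uniq.
    - apply/hasPn => u; rewrite in_cons => /orP[/eqP->|uf]; first by apply/negP => /ndq; rewrite eqxx.
      by apply/negP => ue; have := eA u u ue uf; rewrite /nadj eqxx.
    by rewrite cons_uniq qf1 (ich_uniq iff).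
  - by rewrite lH.
  - by rewrite size_cat /= !addnS.
  - rewrite -cat_cons mem_cat negb_or vne (in_cons q) negb_or vq_ /=.
    by apply/negP => /nf[]; rewrite eqxx.
  move=> u; rewrite -cat_cons mem_cat lH in_cons => /orP[/orP[/eqP->|ue]|]; first by left.
    by rewrite (negPf (ve _ ue)).
  rewrite in_cons => /orP[/eqP->|uf]; first by rewrite (negPf vq).
  move=> vu; right; case/lastP: (f) uf HB => [|f' l] uf HB; first by move: uf; rewrite inE => /eqP.
  rewrite last_rcons; move: uf; rewrite -rcons_cons mem_rcons inE => /orP[/eqP//|uf].
  by have := HB (f1 :: f') [:: l]; rewrite -rcons_cons -cats1 => /(_ erefl isT u uf); rewrite inE vu.
have pH : p \notin v :: e1 :: e ++ q :: f1 :: f.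
  rewrite (in_cons v) -cat_cons mem_cat (in_cons q) 3!negb_or eq_sym vp_ pne pNq /=.
  by apply/negP => /nf[_]; rewrite eqxx.
have qH : q \in v :: e1 :: e ++ q :: f1 :: f by rewrite (in_cons v) -cat_cons mem_cat mem_head !orbT.
split=> [|u ue]; apply/negP => pu.
  by case/eqP: vq_; apply: (sp h pH); rewrite ?mem_head // sedge_sym.
case/negP: (ndq u ue); apply/eqP; apply: (sp h pH) => //.
by rewrite (in_cons v) -cat_cons mem_cat ue orbT.
Qed.

End Critical.

(** * The shape of a thin side *)

Section Critical2.
Variables (G : sgraph) (k : nat) (F : {set {set G}}).
Hypothesis tf : tfree G.
Hypothesis sp : sp1 G.
Hypothesis bF : bramble F.
Hypothesis oF : border k F.
Hypothesis crit : forall F, bramble F -> border k F -> forall x : G, exists2 A, A \in F & x \in A.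
Implicit Types (x y z u v w p q b d : G) (A B C D S K T X Y : {set G}).

Lemma ich_head x s u : ich (x :: s) -> u \in s -> x -- u -> u = head x s.
Proof.
case: s => // y s; rewrite ichE inE => /andP[/andP[_ /allP al] _] /orP[/eqP//|/al] /andP[_ /negPf->] //.
Qed.

Lemma deg2 x a b : (forall u, x -- u -> u = a \/ u = b) -> #|neighb x| <= 2.
Proof.
move=> H; apply: leq_trans (_ : #|[set a; b]| <= 2); last by rewrite cards2; case: (_ != _).
by apply: subset_leq_card; apply/subsetP => u; rewrite !inE => /H[]->; rewrite eqxx ?orbT.
Qed.

Lemma deg3 x (s : seq G) : uniq s -> (forall u, u \in s -> x -- u) -> size s <= #|neighb x|.
Proof.
move=> us H; rewrite -(card_uniqP us); apply: subset_leq_card.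
by apply/subsetP => u /H; rewrite inE.
Qed.

Lemma last_only (B : {set G}) e1 e u :
  (forall s1 s2, e1 :: e = s1 ++ s2 -> s2 != [::] -> forall u, u \in s1 -> u \notin B) ->
  u \in e1 :: e -> u \in B -> u = last e1 e.
Proof.
case/lastP: e => [|e l] HB; first by rewrite mem_seq1 => /eqP.
rewrite last_rcons -rcons_cons mem_rcons in_cons => /orP[/eqP//|ue] uB.
by have := HB (e1 :: e) [:: l]; rewrite -rcons_cons -cats1 => /(_ erefl isT u ue); rewrite uB.
Qed.

(** By [thin], any admissible connector inside [D] is all of [D]. If [K] has at most one vertex, a
    shortest path from [v] to it is such a connector and [x] is its first vertex. If [K] is an edge
    [pq], a shortest path through [D] from [p] to [q] closes to a hole, and the cases are whether or
    not [v] has a neighbour on that path. *)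
Lemma thin_claw v K D A x : cutpair v K D A -> small F D -> x \in D -> v -- x ->
  #|neighb x| <= 2 \/ exists p q o1 o2, [/\ K = [set p; q], D = [set d in o1 ++ x :: o2] & claw v x p q o1 o2].
Proof.
move=> cp sD xD vx.
have cp0 := cp; case: cp0 => [[cK K2 vK] [cD cA dDA dX] ND NA hX].
have vD : v \notin D by apply/negP => vD; apply: (disjP _ _ dX v); rewrite ?setU11 // inE vD.
have hp p : p \in K -> exists2 d, d \in D & p -- d.
  by move=> pK; have [|/hitsP[d dD pd] _] := hX p; [rewrite inE pK orbT | exists d].
have [n2|n2] := leqP #|neighb x| 2; [by left | right].
have KE : (exists p q, [/\ p \in K, q \in K & p != q]).
  apply: contrapT => nK.
  have [p pK] : exists p, forall p', p' \in K -> p' = p.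
    have [->|/set0Pn[p pK]] := eqVneq K set0; first by exists x => p'; rewrite inE.
    exists p => p' p'K; apply: contrapT => /eqP ne; apply: nK; by exists p', p.
  have [p0|p0] := boolP (p \in K); last first.
    have K0 : K = set0.
      by apply/setP => p'; rewrite inE; apply/negP => p'K; rewrite -(pK p') // p'K in p0.
    have E : D = [set x].
      apply: (thin bF oF crit sD cK (v := v)); rewrite ?sub1set ?cset1 //.
        by move=> _; apply/hitsP; exists x; rewrite ?inE.
      by move=> u; rewrite K0 inE.
    move: n2; rewrite ltnNge => /negP; apply; apply: (@deg2 _ v v) => u xu; left.
    have uD : u \notin D by rewrite E inE; apply: contraTneq xu => ->; rewrite sedge_irrefl.
    by have := ND x u xD uD xu; rewrite K0 !inE orbF => /eqP.
  have [a aD pa] := hp p p0.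
  have [||e1 [e [ie sub ve pe [HA HB]]]] := @short_path _ _ (neighb v) (neighb p) _ _ (csetE cD xD aD) xD.
  - by rewrite inE.
  - by rewrite inE.
  rewrite inE in ve; rewrite inE in pe.
  have E : D = [set u in e1 :: e].
    apply: (thin bF oF crit sD cK (v := v)) => //.
    - by apply/subsetP => u; rewrite inE; apply: sub.
    - exact: ich_cset.
    - by move=> _; apply/hitsP; exists e1; rewrite ?inE ?eqxx.
    - by move=> u /pK->; constructor 3; apply/hitsP; exists (last e1 e); rewrite ?inE -?in_cons ?mem_last.
  have xe : x = e1.
    have := xD; rewrite E inE in_cons => /orP[/eqP//|/HA]; by rewrite inE vx.
  subst e1; move: n2; rewrite ltnNge => /negP; apply.
  case: e ie sub pe HA HB E => [|h t] ie sub pe HA HB E.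
    apply: (@deg2 _ v p) => u xu.
    have uD : u \notin D by rewrite E !inE; apply: contraTneq xu => ->; rewrite sedge_irrefl.
    by have := ND x u xD uD xu; rewrite inE in_set1 => /orP[/eqP->|/pK->]; [left | right].
  apply: (@deg2 _ v h) => u xu.
  have [uD|uD] := boolP (u \in D).
    right; apply: (ich_head ie) => //; move: uD; rewrite E inE in_cons => /orP[/eqP ux|//].
    by rewrite ux sedge_irrefl in xu.
  have := ND x u xD uD xu; rewrite inE in_set1 => /orP[/eqP->|/pK up]; first by left.
  by have := HB [:: x] (h :: t) erefl isT x; rewrite !inE eqxx -up sedge_sym xu => /(_ isT).
case: KE => p [q [pK qK pq]].
have KE : K = [set p; q].
  apply/eqP; rewrite eq_sym eqEcard subUset !sub1set pK qK cards2 pq; exact: K2.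
have epq : p -- q by apply: cK.
have vpq : v != p /\ v != q by move: vK; rewrite KE !inE negb_or => /andP[].
have nD u : u \in D -> [/\ u != v, u != p & u != q].
  move=> uD; have uX : u \notin v |: K by apply/negP => uX; apply: (disjP _ _ dX u); rewrite // inE uD.
  by move: uX; rewrite KE !inE !negb_or => /and3P[].
have cpq : cutpair v [set p; q] D A by rewrite -KE.
have cqp : cutpair v [set q; p] D A by rewrite setUC -KE.
have NX u w : u \in D -> w \notin D -> u -- w -> [\/ w = v, w = p | w = q].
  move=> uD wD uw; have := ND u w uD wD uw; rewrite KE !inE => /or3P[]/eqP->;
    by [constructor 1|constructor 2|constructor 3].
have [a aD pa] := hp p pK; have [c cD' qc] := hp q qK.
have [||m1 [m [im subm pm qm [HAm HBm]]]] := @short_path _ _ (neighb p) (neighb q) _ _ (csetE cD aD cD') aD.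
- by rewrite inE.
- by rewrite inE.
rewrite inE in pm; rewrite inE in qm.
have qlast u : u \in m1 :: m -> q -- u -> u = last m1 m.
  by move=> um qu; apply: last_only HBm um _; rewrite inE.
have pfirst u : u \in m1 :: m -> p -- u -> u = m1.
  by rewrite in_cons => /orP[/eqP//|/HAm]; rewrite inE => /negPf->.
have mn : m != [::].
  by case: (m) qm => //= qm1; case: (tf epq qm1).
have ndq u : u \in m1 :: m -> u != q by move/subm/nD=> [].
have im2 : ich (m1 :: m ++ [:: q]).
  apply: ich_cat => //; first by rewrite sedge_sym.
    move=> u w ue; rewrite mem_seq1 => /eqP->; have [qu|qu] := boolP (q -- u).
      by left; rewrite (qlast u ue qu).
    by right; rewrite /nadj eq_sym ndq // sedge_sym.
  rewrite -cat_cons cats1 rcons_uniq (ich_uniq im) andbT.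
  by apply/negP => /ndq; rewrite eqxx.
have H : hole (p :: m1 :: m ++ [:: q]).
  apply: hole_of => //.
  - by rewrite last_cat.
  - by rewrite size_cat addn1; case: (m) mn.
  - rewrite -cat_cons mem_cat mem_seq1 negb_or pq andbT.
    by apply/negP => /subm/nD[_]; rewrite eqxx.
  move=> u; rewrite -cat_cons mem_cat mem_seq1 last_cat => /orP[um pu|/eqP->]; last by right.
  by left; apply: pfirst.
have qH : q \in p :: m1 :: m ++ [:: q].
  by rewrite (in_cons p) -cat_cons mem_cat mem_seq1 eqxx !orbT.
have mH u : u \in m1 :: m -> u \in p :: m1 :: m ++ [:: q].
  by move=> um; rewrite (in_cons p) -cat_cons mem_cat um orbT.
have noH w : w \notin m1 :: m -> w != p -> w != q -> w \notin p :: m1 :: m ++ [:: q].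
  move=> wm wp wq; rewrite (in_cons p) -cat_cons mem_cat mem_seq1; by rewrite (negPf wp) (negPf wm) (negPf wq).
have vm : v \notin m1 :: m by apply/negP => /subm/nD[]; rewrite eqxx.
have path_to q' : q' \in K -> exists e1 e, [/\ ich (e1 :: e), {subset e1 :: e <= D}, v -- e1,
   (forall u, u \in e -> ~~ v -- u) & q' -- last e1 e /\ (forall u, u \in e1 :: e -> q' -- u -> u = last e1 e)].
  move=> q'K; have [c' c'D q'c] := hp q' q'K.
  have [||e1 [e [ie sub ve pe [HA HB]]]] := @short_path _ _ (neighb v) (neighb q') _ _ (csetE cD xD c'D) xD.
  - by rewrite inE.
  - by rewrite inE.
  rewrite inE in ve; rewrite inE in pe.
  exists e1, e; split=> //; first by move=> u /HA; rewrite inE.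
  by split=> // u ue q'u; apply: last_only HB ue _; rewrite inE.
(* If [v] sees the path, it does so once, the path is all of [D], and [x] is the vertex seen.
   [path_avoid] keeps [x] away from [p] and [q], so [x] is an inner vertex of the path and this is a
   claw. *)
have [/hasP[o om vo]|nvm] := boolP (has (fun u => v -- u) (m1 :: m)).
  have vuniq u : u \in m1 :: m -> v -- u -> u = o.
    move=> um vu; apply: (sp H (noH v vm _ _) (mH u um) (mH o om)) => //; by case: vpq.
  have DE : D = [set u in m1 :: m].
    apply: (thin bF oF crit sD cK (v := v)) => //.
    - by apply/subsetP => u; rewrite inE; apply: subm.
    - exact: ich_cset.
    - by move=> _; apply/hitsP; exists o; rewrite ?inE -?in_cons.
    move=> u; rewrite KE !inE => /orP[]/eqP->; constructor 3; apply/hitsP.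
      by exists m1; rewrite ?inE ?eqxx.
    by exists (last m1 m); rewrite ?inE -?in_cons ?mem_last.
  have xm : x \in m1 :: m by have := xD; rewrite DE inE.
  have xo := vuniq x xm vx; subst o.
  have [o1 [x' [o2 [E /eqP Ex _]]]] : exists s1 y s2, [/\ m1 :: m = s1 ++ y :: s2, pred1 x y & ~~ has (pred1 x) s1].
    by apply: split_first; rewrite has_pred1.
  subst x'; exists p, q, o1, o2; split=> //; first by rewrite DE E.
  have h1 : head x o1 = m1 by case: (o1) E => [|a1 o1'] [->].
  have l2 : last x o2 = last m1 m.
    by rewrite -[last m1 m]/(last x (m1 :: m)) E last_cat.
  have nq : ~~ q -- x.
    have [e1 [e [ie sub ve ne [le1 le2]]]] := path_to p pK.
    have eqp : q -- p by rewrite sedge_sym.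
    have [_ no] := path_avoid tf sp eqp cqp ie sub ve ne le1 le2.
    have <- : e1 = x by apply: vuniq => //; have := sub e1 (mem_head _ _); rewrite DE inE.
    by apply: no; apply: mem_head.
  have np : ~~ p -- x.
    have [e1 [e [ie sub ve ne [le1 le2]]]] := path_to q qK.
    have [_ no] := path_avoid tf sp epq cpq ie sub ve ne le1 le2.
    have <- : e1 = x by apply: vuniq => //; have := sub e1 (mem_head _ _); rewrite DE inE.
    by apply: no; apply: mem_head.
  split.
  - split; rewrite -?E //.
      by apply: contraNneq np => o10; move: h1; rewrite o10 /= => ->.
    by apply: contraNneq nq => o20; move: l2; rewrite o20 /= => ->.
  - by rewrite h1 l2 ![_ -- p]sedge_sym ![_ -- q]sedge_sym.
  - by rewrite -E h1 l2.
  by exists A; rewrite -E -DE.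
(* Otherwise [D] is the path together with a shortest path from [v] towards it. The vertex [x]
   begins the latter and has only two neighbours: [v], and either the next vertex or the unique
   vertex of the hole that it sees. *)
exfalso.
pose B := [set u | (u \in m1 :: m) || has (fun w => u -- w) (m1 :: m)].
have [||t1 [t [it subt vt tB [HA HB]]]] := @short_path _ _ (neighb v) B _ _ (csetE cD xD (subm _ (mem_head _ _))) xD.
- by rewrite inE.
- by rewrite inE mem_head.
rewrite inE in vt.
have tlast u : u \in t1 :: t -> u \in B -> u = last t1 t by move=> ut; apply: last_only HB ut.
have tm u : u \in t1 :: t -> u \notin m1 :: m.
  move=> ut; apply/negP => um.
  have uB : u \in B by rewrite inE um.
  have ul := tlast u ut uB; case/lastP: (t) ul ut tlast it => [|t' l] ul ut tlast' it'.
    by have := hasPn nvm u um; rewrite ul /= vt.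
  rewrite last_rcons in ul; subst l; rewrite -cats1 in it'.
  have lu : last t1 t' -- u.
    move: it'; rewrite cats1 => /ich_path; by rewrite rcons_path => /andP[].
  have lB : last t1 t' \in B by rewrite inE; apply/orP; right; apply/hasP; exists u.
  have := tlast' (last t1 t'); rewrite last_rcons -rcons_cons mem_rcons in_cons mem_last orbT => /(_ isT lB) e.
  by move: lu; rewrite e sedge_irrefl.
have [w wm lw] : exists2 w, w \in m1 :: m & last t1 t -- w.
  move: tB; rewrite inE (negPf (tm _ (mem_last _ _))) => /hasP[w wm lw]; by exists w.
have DE : D = [set u in m1 :: m] :|: [set u in t1 :: t].
  apply: (thin bF oF crit sD cK (v := v)) => //.
  - by apply/subsetP => u; rewrite in_setU !in_set => /orP[]; [apply: subm | apply: subt].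
  - apply: (@csetU _ _ _ w (last t1 t)); rewrite ?ich_cset ?in_set ?mem_last //.
    by rewrite sedge_sym lw orbT.
  - by move=> _; apply/hitsP; exists t1; rewrite ?in_setU ?in_set ?mem_head ?orbT.
  move=> u; rewrite KE !inE => /orP[]/eqP->; constructor 3; apply/hitsP.
    by exists m1; rewrite ?in_setU ?in_set ?mem_head.
  by exists (last m1 m); rewrite ?in_setU ?in_set ?mem_last.
have vuniq u : u \in D -> v -- u -> u = t1.
  rewrite DE in_setU !in_set => /orP[um|ut] vu; first by have := hasPn nvm u um; rewrite /= vu.
  by move: ut; rewrite in_cons => /orP[/eqP//|/HA]; rewrite inE vu.
have xt : x = t1 by apply: vuniq.
subst t1.
have nq : ~~ q -- x.
  have [e1 [e [ie sub ve ne [le1 le2]]]] := path_to p pK.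
  have eqp : q -- p by rewrite sedge_sym.
  have [_ no] := path_avoid tf sp eqp cqp ie sub ve ne le1 le2.
  have <- : e1 = x by apply: vuniq => //; apply: sub; rewrite mem_head.
  by apply: no; apply: mem_head.
have np : ~~ p -- x.
  have [e1 [e [ie sub ve ne [le1 le2]]]] := path_to q qK.
  have [_ no] := path_avoid tf sp epq cpq ie sub ve ne le1 le2.
  have <- : e1 = x by apply: vuniq => //; apply: sub; rewrite mem_head.
  by apply: no; apply: mem_head.
move: n2; rewrite ltnNge => /negP; apply.
have xnot : x \notin m1 :: m by apply: tm; rewrite mem_head.
have [xv xp xq] := nD x xD.
have out u : x -- u -> u \notin D -> u = v.
  move=> xu uD; case: (NX x u xD uD xu) => [//|up|uq].
    by rewrite up sedge_sym (negPf np) in xu.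
  by rewrite uq sedge_sym (negPf nq) in xu.
case: t it {HA} HB subt tB tlast tm lw DE => [|h t] it HB subt tB tlast tm lw DE.
  apply: (@deg2 _ v w) => u xu.
  have [uD|uD] := boolP (u \in D); last by left; apply: out.
  right; move: uD; rewrite DE in_setU !in_set mem_seq1 => /orP[um|/eqP ux].
    by apply: (sp H (noH x xnot xp xq) (mH u um) (mH w wm)).
  by rewrite ux sedge_irrefl in xu.
apply: (@deg2 _ v h) => u xu.
have [uD|uD] := boolP (u \in D); last by left; apply: out.
right; move: uD; rewrite DE in_setU !in_set => /orP[um|].
  have xB : x \in B by rewrite inE; apply/orP; right; apply/hasP; exists u.
  by have := HB [:: x] (h :: t) erefl isT x (mem_head _ _); rewrite xB.
rewrite in_cons => /orP[/eqP ux|]; first by rewrite ux sedge_irrefl in xu.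
by move=> ut; apply: (ich_head it).
Qed.

End Critical2.

(** * Claws and the matching formed by the other edges between big vertices *)

Section Claws.
Variable G : sgraph.
Hypothesis tf : tfree G.
Implicit Types (x y z u v w p q b d : G) (A B C D S K T X Y : {set G}) (o r s : seq G).

Lemma ich_mid s1 d s2 u : ich (s1 ++ d :: s2) -> u \in s1 ++ d :: s2 -> d -- u ->
  (u \in s1 /\ u = last d s1) \/ (u \in s2 /\ u = head d s2).
Proof.
move=> ic; rewrite mem_cat in_cons => /or3P[u1|/eqP->|u2] du.
- left; split=> //; have ir : ich (d :: rev s1).
    by apply: (@ich_catr _ (rev s2)); rewrite -cat_rcons -rev_cons -rev_cat ich_rev.
  have -> : last d s1 = head d (rev s1) by case/lastP: (s1) => // s x; rewrite rev_rcons last_rcons.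
  by apply: (ich_head ir) => //; rewrite mem_rev.
- by rewrite sedge_irrefl in du.
- by right; split=> //; apply: (@ich_head _ d s2) => //; apply: ich_catr ic.
Qed.

Lemma ich_mid_edge s1 d s2 : ich (s1 ++ d :: s2) -> s2 != [::] -> d -- head d s2.
Proof. by case: s2 => // h t /ich_catr; rewrite ichE => /andP[/andP[]]. Qed.

Definition big x := 2 < #|neighb x|.
Definition isclaw v b := exists p q o1 o2, claw v b p q o1 o2.

Section Claw.
Variables (v b p q : G) (o1 o2 : seq G).
Hypothesis cl : claw v b p q o1 o2.
Let D := [set d in o1 ++ b :: o2].

Lemma claw_uniq : uniq (o1 ++ b :: o2).
Proof. by case: cl => [[/ich_uniq]]. Qed.

Lemma claw_neq d : d \in D -> [/\ d != v, d != p & d != q].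
Proof.
move=> dD; case: cl => _ _ _ [A [[_ _ _] [_ _ _ dX] _ _ _]].
have : d \notin v |: [set p; q] by apply/negP => dX'; apply: (disjP _ _ dX d); rewrite // in_setU dD.
by rewrite !inE !negb_or => /and3P[].
Qed.

Lemma claw_ext d u : d \in D -> u \notin D -> d -- u -> [\/ u = v, u = p | u = q].
Proof.
move=> dD uD du; case: cl => _ _ _ [A [_ _ ND _ _]].
by have := ND d u dD uD du; rewrite !inE => /or3P[]/eqP->; [constructor 1|constructor 2|constructor 3].
Qed.

Lemma claw_v d : d \in D -> v -- d -> d = b.
Proof. by rewrite in_set; case: cl => _ _ [h _ _] _; apply: h. Qed.

Lemma claw_pq : p -- q. Proof. by case: cl => [[]]. Qed.
Lemma claw_vb : v -- b. Proof. by case: cl => _ []. Qed.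

Lemma claw_bD : b \in D. Proof. by rewrite in_set mem_cat mem_head orbT. Qed.

Lemma claw_nq d : d \in o1 ++ b :: o2 -> d \notin o2 -> ~~ q -- d.
Proof.
move=> dD dn; apply/negP => qd; case: cl => [[_ _ _ o2n] _ [_ _ h] _].
move: dn; rewrite (h d dD qd); case: (o2) o2n => // h2 t _; by rewrite [last b _]/= mem_last.
Qed.

Lemma claw_np d : d \in o1 ++ b :: o2 -> d \notin o1 -> ~~ p -- d.
Proof.
move=> dD dn; apply/negP => pd; case: cl => [[_ _ o1n _] _ [_ h _] _].
by move: dn; rewrite (h d dD pd); case: (o1) o1n => // h1 t _; rewrite [head b _]/= mem_head.
Qed.

Lemma claw_b_nb u : b -- u -> [\/ u = v, u \in o1 /\ u = last b o1 | u \in o2 /\ u = head b o2].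
Proof.
move=> bu; have [uD|uD] := boolP (u \in D).
  rewrite in_set in uD; case: cl => [[ic _ _ _] _ _ _].
  by case: (ich_mid ic uD bu); [constructor 2 | constructor 3].
have bL : b \in o1 ++ b :: o2 by rewrite mem_cat mem_head orbT.
have := claw_uniq; rewrite cat_uniq => /and3P[_ /hasPn h]; rewrite cons_uniq => /andP[bo2 _].
have bo1 : b \notin o1 by apply: h; rewrite mem_head.
case: (claw_ext claw_bD uD bu) => [->|up|uq]; first by constructor 1.
  by case/negP: (claw_np bL bo1); rewrite -up sedge_sym.
by case/negP: (claw_nq bL bo2); rewrite -uq sedge_sym.
Qed.

Lemma claw_deg_r d : d \in o2 -> ~~ big d.
Proof.
move=> d2; rewrite /big -leqNgt.
have [s1 [d' [s2 [E /eqP Ed _]]]] : exists s1 y s2, [/\ o2 = s1 ++ y :: s2, pred1 d y & ~~ has (pred1 d) s1].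
  by apply: split_first; rewrite has_pred1.
subst d'; have EL : o1 ++ b :: o2 = (o1 ++ b :: s1) ++ d :: s2 by rewrite E -catA.
have dL : d \in o1 ++ b :: o2 by rewrite mem_cat in_cons d2 !orbT.
have dD : d \in D by rewrite in_set.
have := claw_uniq; rewrite cat_uniq => /and3P[_ /hasPn h]; rewrite cons_uniq => /andP[bo2 _].
have d1 : d \notin o1 by apply: h; rewrite in_cons d2 orbT.
(* The default [q] of [head] is the second neighbour when [d] is the end of the leg. *)
apply: (@deg2 _ d (last b s1) (head q s2)) => u du.
case: cl => [[ic _ _ _] _ [_ _ hq] _].
have [uD|uD] := boolP (u \in D).
  rewrite in_set EL in uD; rewrite EL in ic.
  case: (ich_mid ic uD du) => [[_ ->]|[us ->]]; first by left; rewrite last_cat.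
  by right; case: (s2) us.
case: (claw_ext dD uD du) => [uv|up|uq].
- have db : d = b by apply: claw_v; rewrite // -uv sedge_sym.
  by rewrite -db d2 in bo2.
- by case/negP: (claw_np dL d1); rewrite -up sedge_sym.
right; have := hq d dL; rewrite -uq sedge_sym => /(_ du) dl.
move: dl claw_uniq; rewrite E last_cat /=; case/lastP: (s2) => // s2' l; rewrite last_rcons => <-.
rewrite cat_uniq => /and3P[_ _]; rewrite cons_uniq cat_uniq cons_uniq mem_rcons mem_head.
by rewrite /= !andbF.
Qed.

Lemma claw_head2 : o2 != [::] /\ head b o2 \in o2 /\ b -- head b o2.
Proof.
case: cl => [[ic _ _ o2n] _ _ _]; split=> //; split; last exact: ich_mid_edge ic o2n.
by case: (o2) o2n => // h t _; rewrite [head b _]/= mem_head.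
Qed.

Lemma claw_last2 : last b o2 \in o2 /\ last b o2 -- q.
Proof.
case: cl => [[_ _ _ o2n] [_ _ lq] _ _]; split=> //.
by case: (o2) o2n => // h t _; rewrite [last b _]/= mem_last.
Qed.

Lemma claw_big_q : big q.
Proof.
have [l2 lq] := claw_last2; case: cl => _ _ _ [A [_ [_ _ dDA dX] _ _ hX]].
have [|_ /hitsP[a aA qa]] := hX q; first by rewrite !inE eqxx !orbT.
have lD : last b o2 \in D by rewrite in_set mem_cat in_cons l2 !orbT.
have [_ lp _] := claw_neq lD.
apply: (@deg3 _ q [:: p; last b o2; a]).
  rewrite /= !inE !negb_or eq_sym lp /=; apply/and3P; split=> //.
    apply/eqP => pa; apply: (disjP _ _ dX a); rewrite // !inE -pa ?eqxx ?orbT //.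
    by rewrite pa aA orbT.
  by apply/eqP => la; apply: (disjP _ _ dDA a); rewrite // -la.
by move=> u; rewrite !inE => /or3P[]/eqP->; rewrite // sedge_sym // claw_pq.
Qed.

End Claw.

Lemma claw_deg v b p q o1 o2 d : claw v b p q o1 o2 ->
  d \in [set d in o1 ++ b :: o2] -> d != b -> ~~ big d.
Proof.
move=> cl; rewrite in_set mem_cat in_cons => /or3P[d1|/eqP->|d2] db.
- by apply: (claw_deg_r (claw_sym cl)); rewrite mem_rev.
- by rewrite eqxx in db.
- exact: claw_deg_r cl _ d2.
Qed.

Lemma claw_big_b v b p q o1 o2 : claw v b p q o1 o2 -> big b.
Proof.
move=> cl; have [_ [h2 bh2]] := claw_head2 cl; have [_ [h1 bh1]] := claw_head2 (claw_sym cl).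
rewrite mem_rev in h1; have := claw_uniq cl; rewrite cat_uniq => /and3P[_ /hasPn h _].
have h12 : head b o2 \notin o1 by apply: h; rewrite in_cons h2 orbT.
have D1 : head b (rev o1) \in [set d in o1 ++ b :: o2] by rewrite in_set mem_cat h1.
have D2 : head b o2 \in [set d in o1 ++ b :: o2] by rewrite in_set mem_cat in_cons h2 !orbT.
have [v1 _ _] := claw_neq cl D1; have [v2 _ _] := claw_neq cl D2.
apply: (@deg3 _ b [:: v; head b (rev o1); head b o2]).
  rewrite /= !inE !negb_or eq_sym v1 eq_sym v2 /= andbT.
  by apply: contraNneq h12 => <-.
by move=> u; rewrite !inE => /or3P[]/eqP->; rewrite // sedge_sym (claw_vb cl).
Qed.

(** The path of a claw of [p] at [q] would contain the whole leg [o2], whose vertices are not big,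
    so it would be attached to the big vertex [b]. Its other attachment, a big neighbour of [b], can
    only be [v]. The other side of that claw is then confined to [o1], where [v] has no
    neighbour. *)
Lemma claw_no_q v b p q o1 o2 : claw v b p q o1 o2 -> ~ isclaw p q.
Proof.
move=> cl [p' [q' [r1 [r2 cl']]]].
set D := [set d in o1 ++ b :: o2].
have [l2 lq] := claw_last2 cl; have [_ [h2 bh2]] := claw_head2 cl.
have pD : p \notin D by apply/negP => /(claw_neq cl)[_]; rewrite eqxx.
have qD : q \notin D by apply/negP => /(claw_neq cl)[_ _]; rewrite eqxx.
have o2D u : u \in o2 -> u \in D by move=> u2; rewrite in_set mem_cat in_cons u2 !orbT.
(* Starting from [q], the leg could leave the new path only into [p], which is not on the leg, or
   into [p1] or [q1], which are big. *)
have leg p1 q1 s1 s2 : claw p q p1 q1 s1 s2 -> forall u, u \in o2 -> u \in [set d in s1 ++ q :: s2].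
  move=> c1; set D' := [set d in s1 ++ q :: s2].
  have nb u w : u \in D' -> w \in o2 -> u -- w -> w \in D'.
    move=> uD' w2 uw; apply: contraT => wD'; case: (claw_ext c1 uD' wD' uw) => wE.
    - by rewrite -wE o2D in pD.
    - by move: (claw_deg_r cl w2); rewrite wE (claw_big_q (claw_sym c1)).
    - by move: (claw_deg_r cl w2); rewrite wE (claw_big_q c1).
  have lD' : last b o2 \in D' by apply: (nb q) => //; [exact: claw_bD | rewrite sedge_sym].
  have i2 : ich o2 by case: cl => [[/ich_catr/ich_behead]].
  move=> u u2; have c := csetE (ich_cset i2) (x := last b o2) (y := u).
  rewrite !inE l2 u2 in c.
  apply: (conn_closed (P := mem D')) (c isT isT) lD' => a a' aD' _ a'2 aa'.
  by apply: nb aa' => //; rewrite in_set in a'2.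
(* The side [A'] contains a neighbour of [b], which must lie on [o1]. From there the ways out of
   [o1] lead to [b], [v], [p] or [q], none of which is in [A']; but [v] must have a neighbour in
   [A']. *)
have core q1 s1 s2 : claw p q b q1 s1 s2 -> False.
  move=> c1; set D' := [set d in s1 ++ q :: s2].
  have q1v : q1 = v.
    have := claw_pq c1; case/(claw_b_nb cl) => [//|[e _]|[e _]].
      have := claw_deg_r (claw_sym cl) (d := q1); rewrite mem_rev => /(_ e).
      by rewrite (claw_big_q c1).
    by have := claw_deg_r cl e; rewrite (claw_big_q c1).
  subst q1; case: (c1) => _ _ _ [A' [_ [_ cA' dDA' dX'] _ NA' hX']].
  have nA' u : u \in A' -> [/\ u \notin D', u != p, u != b & u != v].
    move=> uA; split; first by apply/negP => uD'; apply: (disjP _ _ dDA' u).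
    - by apply/eqP => up; apply: (disjP _ _ dX' u); rewrite !inE ?uA ?up ?eqxx ?orbT.
    - by apply/eqP => up; apply: (disjP _ _ dX' u); rewrite !inE ?uA ?up ?eqxx ?orbT.
    - by apply/eqP => up; apply: (disjP _ _ dX' u); rewrite !inE ?uA ?up ?eqxx ?orbT.
  have [|_ /hitsP[a aA ba]] := hX' b; first by rewrite !inE eqxx !orbT.
  have a1 : a \in o1.
    have [aD' _ _ av] := nA' a aA.
    case: (claw_b_nb cl ba) => [E|[//]|[e _]]; first by rewrite E eqxx in av.
    by rewrite (leg _ _ _ _ c1) in aD'.
  have sub1 z : z \in A' -> z \in o1.
    move=> zA; apply: contraT => z1.
    have a1' : a \in [set x in o1] by rewrite inE.
    have z1' : z \notin [set x in o1] by rewrite inE.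
    have [c [e [c1' e1' cA eA ce]]] := conn_exit (csetE cA' aA zA) a1' z1'.
    rewrite inE in c1'; rewrite inE in e1'.
    have [eD' ep eb ev] := nA' e eA.
    have cD : c \in D by rewrite in_set mem_cat c1'.
    have [eD|eD] := boolP (e \in D).
      move: eD; rewrite in_set mem_cat (negPf e1') in_cons (negPf eb) /= => e2.
      by rewrite (leg _ _ _ _ c1) in eD'.
    case: (claw_ext cl cD eD ce) => E.
    - by rewrite E eqxx in ev.
    - by rewrite E eqxx in ep.
    by move: eD'; rewrite E /D' claw_bD.
  have [|_ /hitsP[a' a'A va']] := hX' v; first by rewrite !inE eqxx !orbT.
  have a'D : a' \in D by rewrite in_set mem_cat sub1.
  have [_ _ a'b _] := nA' a' a'A.
  by rewrite (claw_v cl a'D va') eqxx in a'b.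
have hD' := leg _ _ _ _ cl' _ h2.
have bD' : b \notin [set d in r1 ++ q :: r2].
  apply/negP => bD'; have bq : b != q by apply: contraNneq qD => <-; exact: claw_bD.
  by have := claw_deg cl' bD' bq; rewrite (claw_big_b cl).
have hb : head b o2 -- b by rewrite sedge_sym.
case: (claw_ext cl' hD' bD' hb) => E.
- by rewrite -E claw_bD in pD.
- by move: cl'; rewrite -E; apply: core.
- by move: (claw_sym cl'); rewrite -E; apply: core.
Qed.

(* By [mt_inj] these edges form a matching; they are contracted before the grid
   theorem is applied, so that they never join two branch sets. *)
Definition mt u v : bool :=
  [&& u -- v, big u, big v & `[< ~ isclaw u v /\ ~ isclaw v u >] ].

Lemma mt_sym u v : mt u v = mt v u.
Proof.
suff H x y : mt x y -> mt y x by apply/idP/idP; apply: H.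
by case/and4P=> xy bx by' /asboolP[h1 h2]; apply/and4P; split=> //; [rewrite sedge_sym | apply/asboolP].
Qed.

Lemma claw_mt v b p q o1 o2 : claw v b p q o1 o2 -> mt p q.
Proof.
move=> cl; apply/and4P; split; [exact: claw_pq cl | exact: claw_big_q (claw_sym cl) | exact: claw_big_q cl |].
by apply/asboolP; split; [exact: claw_no_q cl | exact: claw_no_q (claw_sym cl)].
Qed.

Lemma big_edge u v : u -- v -> big u -> big v -> [\/ mt u v, isclaw u v | isclaw v u].
Proof.
move=> uv bu bv; have [c|nc] := pselect (isclaw u v); first by constructor 2.
have [c|nc'] := pselect (isclaw v u); first by constructor 3.
by constructor 1; apply/and4P; split=> //; apply/asboolP.
Qed.

(** [exists_cut] separates [x] from [y], one of the two sides contains no bramble set, and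
    [thin_claw] excludes a matching edge from [v] into that side. *)
Lemma mt_inj k (F : {set {set G}}) v x y : sp1 G -> bramble F -> border k F ->
  (forall F : {set {set G}}, bramble F -> border k F -> forall x : G, exists2 A, A \in F & x \in A) ->
  mt v x -> mt v y -> x = y.
Proof.
move=> sp bF oF crit vx vy; apply: contrapT => /eqP xy.
have main K D A z : cutpair v K D A -> small F D -> z \in D -> mt v z -> False.
  move=> cp sD zD /and4P[vz _ bz /asboolP[nc _]].
  have [le|[p [q [o1 [o2 [_ _ cl]]]]]] := thin_claw tf sp bF oF crit cp sD zD vz.
    by move: bz; rewrite /big ltnNge le.
  by apply: nc; exists p, q, o1, o2.
have [evx evy] : v -- x /\ v -- y by case/and4P: vx => ->; case/and4P: vy => ->.
have [K [D [A [cp xD yA]]]] := exists_cut tf sp xy evx evy.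
case: (cutpair_small bF cp) => sm; first exact: main cp sm xD vx.
exact: main (cutpair_sym cp) sm yA vy.
Qed.

End Claws.

(** * Minimal models *)

Definition model (H G : sgraph) (X : H -> {set G}) : Prop :=
  [/\ forall x, X x != set0 /\ cset (X x),
      forall x y, x != y -> [disjoint X x & X y]
    & forall x y, x -- y -> exists a b, [/\ a \in X x, b \in X y & a -- b]].

Lemma model_eq (H G : sgraph) (X : H -> {set G}) x y a : model X -> a \in X x -> a \in X y -> x = y.
Proof.
by move=> [_ dX _] ax ay; apply: contrapT => /eqP/dX/disjP/(_ a ax ay).
Qed.

Section Boundary.
Variable G : sgraph.
Implicit Types (a u w : G) (A X : {set G}).

Lemma cset_leaf A a c : cset A -> (forall u, u \in A -> a -- u -> u = c) -> cset (A :\ a).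
Proof.
move=> cA leaf; have [aA|aA] := boolP (a \in A); last first.
  by rewrite (_ : A :\ a = A) //; apply/setP => u; rewrite !inE; case: eqVneq aA => // -> /negPf.
apply: csetI => u w /setD1P[ua uA] /setD1P[wa wA].
pose P z := if z == a then conn (A :\ a) u c else conn (A :\ a) u z.
suff key z z' : P z -> z \in A -> z' \in A -> z -- z' -> P z'.
  have : P w by apply: (conn_closed (P := P) key (csetE cA uA wA)); rewrite unfold_in /P (negPf ua) conn0.
  by rewrite /P (negPf wa).
rewrite /P; have [->|za] := eqVneq z a; have [->|z'a] := eqVneq z' a => // Pz zA z'A zz'.
- by rewrite (leaf z').
- by rewrite -(leaf z) // sedge_sym.
- by apply: conn_trans Pz _; apply: conn1; rewrite // !inE ?za ?z'a.
Qed.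

(** A connected set of vertices of degree at most two spans a path or a cycle. Induction by removal
    of a vertex [x] that is not a cutvertex: [x] is itself in the boundary of the rest and is
    replaced by at most one vertex. The function [N] stands for [neighb] so that one edge at the
    centre of a claw can be ignored. *)
Lemma boundary2 (N : G -> {set G}) X : cset X -> X != set0 ->
  (forall u, u \in X -> #|N u| <= 2) ->
  (forall u w, u \in X -> w \in X -> u -- w -> w \in N u) ->
  #|(\bigcup_(u in X) N u) :\: X| <= 2.
Proof.
have [n] := ubnP #|X|; elim: n X => // n IH X ltn cX /set0Pn[x0 x0X] N2 NX.
have [X1|X1] := leqP #|X| 1.
  have E : X = [set x0].
    by apply/eqP; rewrite eq_sym eqEcard sub1set x0X cards1.
  rewrite E big_set1; apply: leq_trans (N2 x0 x0X); apply: subset_leq_card; exact: subsetDl.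
have [x [xX xx0 cX']] := noncut cX x0X X1.
have x0X' : x0 \in X :\ x by rewrite !inE eq_sym xx0.
have X'X u : u \in X :\ x -> u \in X by rewrite inE => /andP[].
have {}IH : #|(\bigcup_(u in X :\ x) N u) :\: (X :\ x)| <= 2.
  apply: IH => //.
  - by move: ltn; rewrite (cardsD1 x X) xX ltnS.
  - by apply/set0Pn; exists x0.
  - by move=> u /X'X; apply: N2.
  - by move=> u w /X'X uX /X'X wX; apply: NX.
have [u [w [uX' wX' uX wX uw]]] := conn_exit (csetE cX x0X xX) x0X' (negbT (setD11 x X)).
have {wX'} ew : w = x by apply/eqP; move: wX'; rewrite !inE wX andbT negbK.
subst w; set Y := (_ :\: _) in IH *.
have xY : x \in (\bigcup_(u in X :\ x) N u) :\: (X :\ x).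
  by rewrite !inE eqxx /=; apply/bigcupP; exists u => //; apply: NX.
rewrite (cardsD1 x) xY /= add1n ltnS in IH.
have IH2 : #|N x :\ u| <= 1.
  have := N2 x xX; rewrite (cardsD1 u) (_ : u \in N x) ?add1n //.
  by apply: NX; rewrite // sedge_sym.
apply: leq_trans (_ : #|((\bigcup_(u in X :\ x) N u) :\: (X :\ x)) :\ x :|: (N x :\ u)| <= 2).
  apply: subset_leq_card; apply/subsetP => y; rewrite !inE => /andP[yX /bigcupP[z zX yz]].
  have [zx|zx] := eqVneq z x.
    apply/orP; right; rewrite -zx yz andbT; apply: contraNneq yX => ->; exact: X'X.
  apply/orP; left; rewrite (negPf yX) andbF /=; apply/andP; split; first by apply: contraNneq yX => ->.
  by apply/bigcupP; exists z => //; rewrite !inE zx.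
rewrite cardsU; apply: leq_trans (leq_subr _ _) _; exact: (leq_add IH IH2).
Qed.

End Boundary.

(** * Edges of a smallest model *)

Section Stage1.
Variables (H G : sgraph).
Hypothesis tf : tfree G.
Hypothesis cH : cset [set: H].
Variable X : H -> {set G}.
Implicit Types (x y z : H) (a b c d u v w p q : G).

Definition mclean (X : H -> {set G}) := forall u w x y, mt u w -> u \in X x -> w \in X y -> x = y.
Definition msize (X : H -> {set G}) := \sum_x #|X x|.

Hypothesis mX : model X.
Hypothesis cX : mclean X.
Hypothesis minX : forall X', model X' -> mclean X' -> msize X <= msize X'.

Lemma shrink z (R : {set G}) : R != set0 -> R \subset X z -> X z :\: R != set0 ->
  cset (X z :\: R) ->
  (forall w : H, z -- w -> exists a b, [/\ a \in X z :\: R, b \in X w & a -- b]) -> False.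
Proof.
move=> R0 RX n0 cR adj; case: (mX) => neX dX eX.
pose X' (w : H) := if w == z then X z :\: R else X w.
have sub (w : H) : X' w \subset X w by rewrite /X'; case: eqVneq => [->|//]; apply: subsetDl.
have lt : msize X' < msize X.
  rewrite /msize (bigD1 z) //= [X in _ < X](bigD1 z) //= -addSn; apply: leq_add.
    rewrite /X' eqxx; apply: proper_card; rewrite properE subsetDl /=; apply/subsetPn.
    by case/set0Pn: R0 => r rR; exists r; rewrite ?inE ?rR // (subsetP RX).
  by apply: leq_sum => w wz; rewrite /X' (negPf wz).
suff [h1 h2] : model X' /\ mclean X' by have := minX h1 h2; rewrite leqNgt lt.
split.
- split.
  + by move=> w; rewrite /X'; case: (eqVneq w z) => _; [split | exact: neX].
  + move=> x y xy; apply/disjP => u /(subsetP (sub x)) ux /(subsetP (sub y)) uy.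
    exact: (disjP _ _ (dX x y xy) u).
  + move=> x y xy; rewrite /X'; have [ex|ex] := eqVneq x z; have [ey|ey] := eqVneq y z.
    * by rewrite ex ey sedge_irrefl in xy.
    * by apply: adj; rewrite -ex.
    * have [|a [b [aR bX ab]]] := adj x; first by rewrite sedge_sym -ey.
      by exists b, a; rewrite sedge_sym.
    * exact: eX.
- by move=> u w x y uw /(subsetP (sub x)) ux /(subsetP (sub y)) wy; apply: cX uw ux wy.
Qed.

(** The degrees of the neighbours serve in [case_claw], to exclude branch sets hidden inside the
    path of a claw. *)
Definition good x := 2 < #|neighb x| /\ forall y, x -- y -> 2 < #|neighb y|.

(** Vacuously true when [x] and [y] are not adjacent: then the edge [ab] represents nothing. *)
Definition unneeded x y a b := x -- y ->
  exists a' b', [/\ a' \in X x, b' \in X y, a' -- b' & (a' != a) || (b' != b)].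

Lemma deg_boundary x (B : {set G}) : 
  (forall y, x -- y -> exists2 b, b \in B & b \in X y) -> #|neighb x| <= #|B|.
Proof.
move=> adj; have key y : exists b, y \in neighb x -> (b \in B) && (b \in X y).
  have [xy|xy] := boolP (y \in neighb x).
    by rewrite inE in xy; have [b bB by'] := adj y xy; exists b => _; rewrite bB.
  by have [nX _ _] := mX; have [/set0Pn[b _] _] := nX y; exists b.
have {key} [g Hg] := boolp.choice key.
rewrite -(card_in_imset (f := g) (D := neighb x)).
  by apply: subset_leq_card; apply/subsetP => _ /imsetP[y yx ->]; have /andP[] := Hg y yx.
move=> y y' yx y'x e; have /andP[_ h1] := Hg y yx; have /andP[_ h2] := Hg y' y'x.
by rewrite -e in h2; apply: model_eq mX h1 h2.
Qed.

(** One of the at most two neighbours of [a] is [b]. If [a] is the whole branch set, [x] has degree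
    at most two; otherwise [a] is a leaf of its branch set, which can be removed. *)
Lemma case_small x y a b : x != y -> 2 < #|neighb x| -> a \in X x -> b \in X y -> a -- b ->
  ~~ big a -> unneeded x y a b -> False.
Proof.
move=> xy gx ax by' ab; rewrite /big -leqNgt => a2 un.
case: (mX) => neX dX eX.
have bx : b \notin X x by apply/negP => bx; case/eqP: xy; apply: model_eq mX bx by'.
have [Xa|Xa] := eqVneq (X x) [set a].
  have : #|neighb x| <= #|neighb a|.
    apply: deg_boundary => w xw; have [a1 [b1 [a1x b1w ab1]]] := eX _ _ xw.
    move: a1x; rewrite Xa inE => /eqP e; exists b1; rewrite // inE -e //.
  by move/leq_trans/(_ a2); rewrite leqNgt gx.
have [c cX' ca] : exists2 c, c \in X x & c != a.
  apply: contrapT => nex; case/eqP: Xa; apply/setP => u; rewrite inE; apply/idP/eqP => [ux|->//].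
  by apply: contrapT => /eqP ua; apply: nex; exists u.
have [_ cx] := neX x.
have a1 : a \in [set a] by rewrite inE.
have c1 : c \notin [set a] by rewrite inE.
have [a' [d [/set1P ea da _ dx ad]]] := conn_exit (csetE cx ax cX') a1 c1.
subst a'; rewrite inE in da.
have bd : b != d by apply: contraNneq bx => ->.
have Na u : a -- u -> u = b \/ u = d.
  move=> au; apply: contrapT => /not_orP[/eqP ub /eqP ud].
  have : 2 < #|neighb a|.
    apply: (@deg3 _ a [:: u; b; d]); first by rewrite /= !inE negb_or ub ud bd.
    by move=> w; rewrite !inE => /or3P[]/eqP->.
  by rewrite ltnNge a2.
apply: (@shrink x [set a]).
- by apply/set0Pn; exists a; rewrite inE.
- by rewrite sub1set.
- by apply/set0Pn; exists d; rewrite !inE da.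
- apply: (cset_leaf cx (c := d)) => u ux au; case: (Na u au) => // ub.
  by rewrite ub (negPf bx) in ux.
move=> w xw; have [a' [b' [a'x b'w a'b']]] := eX _ _ xw.
have [ea|ea] := eqVneq a' a; last by exists a', b'; rewrite !inE ea.
subst a'; case: (Na b' a'b') => eb; last first.
  by rewrite eb in b'w; rewrite (model_eq mX dx b'w) sedge_irrefl in xw.
subst b'; have ew : w = y by apply: model_eq mX b'w by'.
subst w; have [a2' [b2' [h1 h2 h3 h4]]] := un xw.
have [ea|ea] := eqVneq a2' a; last by exists a2', b2'; rewrite !inE ea.
subst a2'; case: (Na b2' h3) => eb; first by rewrite eb !eqxx in h4.
by rewrite eb in h2; case/eqP: xy; apply: model_eq mX dx h2.
Qed.

(** The part of [X y] on the path [D] of the claw can be removed: no other branch set meets [D], and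
    the edge [pq] keeps the rest of [X y] connected. *)
Lemma case_claw x y v b p q o1 o2 : x != y -> good y -> v \in X x -> b \in X y ->
  claw v b p q o1 o2 -> unneeded y x b v -> False.
Proof.
move=> xy gy vx by' cl un; case: (mX) => neX dX eX.
set D := [set d in o1 ++ b :: o2].
have vy : v \notin X y by apply/negP => vy; case/eqP: xy; apply: model_eq mX vx vy.
have bD : b \in D by apply: claw_bD.
have [_ cy] := neX y.
pose N u := if u == b then neighb b :\ v else neighb u.
have N2 u : u \in D -> #|N u| <= 2.
  move=> uD; rewrite /N; case: eqVneq => [_|ub]; last first.
    by have := claw_deg cl uD ub; rewrite /big -leqNgt.
  apply: leq_trans (_ : #|[set last b o1; head b o2]| <= 2); last by rewrite cards2; case: (_ != _).
  apply: subset_leq_card; apply/subsetP => u'; rewrite !inE => /andP[u'v bu'].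
  by case: (claw_b_nb cl bu') => [e|[_ ->]|[_ ->]]; rewrite ?eqxx ?orbT //; rewrite e eqxx in u'v.
have vD : v \notin D by apply/negP => /(claw_neq cl)[]; rewrite eqxx.
have NN u w : u \in D -> w \in D -> u -- w -> w \in N u.
  move=> uD wD uw; rewrite /N; case: eqVneq => [e|_]; rewrite !inE // -e uw andbT.
  by apply: contraNneq vD => <-.
have bnd z : X z \subset D -> #|(\bigcup_(u in X z) N u) :\: X z| <= 2.
  move=> /subsetP sz; have [nz cz] := neX z; apply: boundary2 => // [u /sz|u w /sz uD /sz wD]; [exact: N2 | exact: NN].
have need (w : H) : y -- w -> exists a1 b1, [/\ a1 \in X y, b1 \in X w, a1 -- b1 & (a1 != b) || (b1 != v)].
  move=> yw; have [a1 [b1 [h1 h2 h3]]] := eX _ _ yw.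
  have [|] := boolP ((a1 != b) || (b1 != v)) => h; first by exists a1, b1.
  move: h; rewrite negb_or !negbK => /andP[/eqP ea /eqP eb]; subst a1 b1.
  have ew : w = x by apply: model_eq mX h2 vx.
  by subst w; have := un yw.
(* Apart from [v], which [N] leaves out as the edge [bv] can be spared, a connected part of [D] has
   at most two boundary vertices, while [y] has at least three neighbours. *)
have yD : ~~ (X y \subset D).
  apply/negP => sy; have := bnd y sy; rewrite leqNgt => /negP; apply.
  apply: leq_trans gy.1 _; apply: deg_boundary => w yw.
  have [a1 [b1 [h1 h2 h3 h4]]] := need w yw; exists b1 => //.
  rewrite inE; apply/andP; split.
    by apply/negP => b1y; move: yw; rewrite (model_eq mX b1y h2) sedge_irrefl.
  apply/bigcupP; exists a1 => //; rewrite /N; case: eqVneq h4 => [e|_]; rewrite !inE //=.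
  by move=> ->; rewrite -e.
have [u0 u0y u0D] := subsetPn yD.
have [d [e [dD eD dy ey de]]] := conn_exit (csetE cy by' u0y) bD u0D.
have mpq := claw_mt cl.
have pq := claw_pq cl.
(* Leaving [D], the set [X y] contains [p] or [q], and [mclean] keeps the other of the two out of
   different branch sets. *)
have [py qy] : (forall z, p \in X z -> z = y) /\ (forall z, q \in X z -> z = y).
  case: (claw_ext cl dD eD de) => E; first by rewrite E (negPf vy) in ey.
    rewrite E in ey; split=> z hz; first exact: model_eq mX hz ey.
    by symmetry; apply: cX mpq ey hz.
  rewrite E in ey; split=> z hz; last exact: model_eq mX hz ey.
  by apply: cX mpq hz ey.
(* The ways out of [D] are closed to other branch sets: [v] is reached from [b] only, and [p] and
   [q] can lie in [X y] only. *)
have inD z : z != y -> forall u, u \in X z -> u \in D -> X z \subset D.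
  move=> zy u uz uD; apply/subsetP => w wz; apply: contraT => wD.
  have [_ cz] := neX z.
  have [c [c' [cD c'D cz' c'z cc']]] := conn_exit (csetE cz uz wz) uD wD.
  case: (claw_ext cl cD c'D cc') => E; subst c'.
  - have cb : c = b by apply: (claw_v cl); rewrite // sedge_sym.
    by case/eqP: zy; rewrite cb in cz'; apply: model_eq mX cz' by'.
  - by case/eqP: zy; apply: py.
  - by case/eqP: zy; apply: qy.
(* Otherwise, [H] being connected, some branch set inside [D] belongs to a neighbour of [y]. By
   [boundary2] that neighbour has degree at most two, against [good y]. *)
have noD z u : z != y -> u \in X z -> u \notin D.
  move=> zy uz; apply/negP => uD.
  pose Z : pred H := fun z => (z != y) && (X z \subset D).
  have Zz : z \in Z by rewrite unfold_in /Z zy (inD z zy u).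
  have Zy : y \notin Z by rewrite unfold_in /Z eqxx.
  have [z1 [z2 [Z1 Z2 _ _ z12]]] := conn_exit (csetE cH (in_setT z) (in_setT y)) Zz Zy.
  move: Z1; rewrite unfold_in /Z => /andP[z1y s1].
  have nb a1 b1 (w : H) : a1 \in X z1 -> b1 \in X w -> a1 -- b1 -> w != y -> X w \subset D.
    move=> h1 h2 h3 wy; have a1D := subsetP s1 _ h1.
    have [b1D|b1D] := boolP (b1 \in D); first exact: (inD w wy b1).
    case: (claw_ext cl a1D b1D h3) => E; subst b1.
    - have cb : a1 = b by apply: (claw_v cl); rewrite // sedge_sym.
      by case/eqP: z1y; rewrite cb in h1; apply: model_eq mX h1 by'.
    - by case/eqP: wy; apply: py.
    - by case/eqP: wy; apply: qy.
  have ez : z2 = y.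
    apply: contrapT => /eqP z2y; case/negP: Z2; rewrite unfold_in /Z z2y /=.
    by have [a1 [b1 [h1 h2 h3]]] := eX _ _ z12; apply: nb h1 h2 h3 z2y.
  subst z2; have := gy.2 z1; rewrite sedge_sym => /(_ z12); rewrite ltnNge => /negP; apply.
  apply: leq_trans (bnd z1 s1); apply: deg_boundary => w zw.
  have [a1 [b1 [h1 h2 h3]]] := eX _ _ zw; exists b1 => //; rewrite inE; apply/andP; split.
    by apply/negP => b1z; move: zw; rewrite (model_eq mX b1z h2) sedge_irrefl.
  apply/bigcupP; exists a1 => //; rewrite /N; case: eqVneq => [E|_]; rewrite !inE //.
  by case/eqP: z1y; rewrite E in h1; apply: model_eq mX h1 by'.
have eD' : e \in X y :\: D by rewrite inE eD.
have XD : X y :\: (X y :&: D) = X y :\: D by apply/setP => u; rewrite !inE; case: (u \in X y); rewrite ?andbF.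
have pqU u w : u \in D -> w \in X y -> w \notin D -> u -- w -> w = p \/ w = q.
  move=> uD wy wD uw; case: (claw_ext cl uD wD uw) => E; [|by left|by right].
  by rewrite E (negPf vy) in wy.
apply: (@shrink y (X y :&: D)); rewrite ?XD.
- by apply/set0Pn; exists b; rewrite inE by'.
- exact: subsetIl.
- by apply/set0Pn; exists e.
- apply: (@cset_star _ _ e) => w; rewrite inE => /andP[wD wy].
  (* A walk in [X y] enters and leaves [D] through [p] or [q], which are adjacent. *)
  pose P u := if u \in D then [exists c in X y :\: D, ((c == p) || (c == q)) && conn (X y :\: D) e c]
              else conn (X y :\: D) e u.
  suff key u u' : P u -> u \in X y -> u' \in X y -> u -- u' -> P u'.
    have : P w by apply: (conn_closed (P := P) key (csetE cy ey wy)); rewrite unfold_in /P (negPf eD) conn0.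
    by rewrite /P (negPf wD).
  rewrite /P; have [uD|uD] := boolP (u \in D); have [u'D|u'D] := boolP (u' \in D) => // Pu uy u'y uu'.
  + case/existsP: Pu => c /and3P[]; rewrite in_setD => /andP[cD cy'] cpq ec.
    have [cu'|cu'] := eqVneq c u'; first by rewrite -cu'.
    apply: conn_trans ec _; apply: conn1; rewrite ?in_setD ?cD ?u'D //.
    have qp : q -- p by rewrite sedge_sym.
    by have [eu|eu] := pqU u u' uD u'y u'D uu'; case/orP: cpq => /eqP ec; move: cu'; rewrite ec eu ?eqxx.
  + apply/existsP; exists u; rewrite in_setD uD uy Pu andbT /=.
    by case: (pqU u' u u'D uy uD); rewrite 1?sedge_sym // => ->; rewrite eqxx ?orbT.
  + by apply: conn_trans Pu _; apply: conn1; rewrite ?in_setD ?uD ?u'D.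
move=> w yw; have [a1 [b1 [h1 h2 h3 h4]]] := need w yw.
have wy : w != y by apply: contraTneq yw => ->; rewrite sedge_irrefl.
exists a1, b1; split=> //; rewrite inE h1 andbT; apply/negP => a1D.
have b1D : b1 \notin D by apply: (noD w).
case: (claw_ext cl a1D b1D h3) => E; subst b1.
- by move: h4; rewrite eqxx orbF => /eqP; apply; apply: (claw_v cl); rewrite // sedge_sym.
- by case/eqP: wy; apply: py.
- by case/eqP: wy; apply: qy.
Qed.

(** By [big_edge], an edge either has an end that is not big, or is a matching edge, which [mclean]
    excludes, or is the edge of a claw in one of the two directions. *)
Lemma needed x y a b : x != y -> good x -> good y -> a \in X x -> b \in X y -> a -- b ->
  x -- y /\ forall a' b', a' \in X x -> b' \in X y -> a' -- b' -> a' = a /\ b' = b.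
Proof.
move=> xy gx gy ax by' ab.
have ba : b -- a by rewrite sedge_sym.
have yx : y != x by rewrite eq_sym.
suff nun : ~ unneeded x y a b.
  split; first by apply: contraT => nxy; case: nun => h; rewrite h in nxy.
  move=> a' b' h1 h2 h3; apply: contrapT => ne; apply: nun => _; exists a', b'; split=> //.
  by apply: contraT; rewrite negb_or !negbK => /andP[/eqP ea /eqP eb]; case: ne.
move=> un.
have un' : unneeded y x b a.
  move=> h; have [|a' [b' [h1 h2 h3 h4]]] := un; first by rewrite sedge_sym.
  by exists b', a'; rewrite sedge_sym orbC.
have [ba'|ba'] := boolP (big a); last exact: (case_small xy gx.1 ax by' ab ba' un).
have [bb|bb] := boolP (big b); last exact: (case_small yx gy.1 by' ax ba bb un').
case: (big_edge ab ba' bb) => [m|[p [q [o1 [o2 cl]]]]|[p [q [o1 [o2 cl]]]]].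
- by case/eqP: xy; apply: cX m ax by'.
- exact: case_claw xy gy ax by' cl un'.
- exact: case_claw yx gx by' ax cl un.
Qed.

End Stage1.

(** * Minimal connected sets through three vertices are spiders *)

Section Centers.
Variable G : sgraph.
Hypothesis tf : tfree G.
Implicit Types (x y z u v w : G) (A B C S Z : {set G}) (s p q r o : seq G).

Definition infix2 u v s := infix [:: u; v] s || infix [:: v; u] s.

Lemma ich_infix s u v : ich s -> u \in s -> v \in s -> u -- v -> infix2 u v s.
Proof.
elim: s u v => // x s IH u v ic.
have H w : w \in s -> x -- w -> infix [:: x; w] (x :: s).
  move=> ws xw; have := ich_head ic ws xw; case: (s) ws => // y s' _; rewrite [head x _]/= => ->.
  by apply/infixP; exists [::], s'.
rewrite !in_cons => /orP[/eqP->|us] /orP[/eqP->|vs] uv.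
- by rewrite sedge_irrefl in uv.
- by rewrite /infix2 H.
- by rewrite /infix2 orbC H // sedge_sym.
have := IH u v (ich_behead ic) us vs uv; rewrite /infix2.
by case/orP=> /infix_trans/(_ (infix_cons s x)) ->; rewrite ?orbT.
Qed.

Lemma infix2_split s1 x s2 u v : ich (s1 ++ x :: s2) -> u \in s1 ++ x :: s2 ->
  v \in s1 ++ x :: s2 -> u -- v -> infix2 u v (x :: rev s1) \/ infix2 u v (x :: s2).
Proof.
move=> ic; have i1 : ich (x :: rev s1).
  by apply: (@ich_catr _ (rev s2)); rewrite -cat_rcons -rev_cons -rev_cat ich_rev.
have i2 : ich (x :: s2) by apply: ich_catr ic.
have no a b : a \in s1 -> b \in s2 -> a -- b -> False.
  move=> a1 b2 ab.
  have [t1 [a' [t2 [E /eqP Ea _]]]] : exists t1 y t2, [/\ s1 = t1 ++ y :: t2, pred1 a y & ~~ has (pred1 a) t1].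
    by apply: split_first; rewrite has_pred1.
  subst a'; have := @ich_nadj _ t1 a t2 x s2 b; rewrite /nadj ab andbF => /(_ _ b2); move: ic.
  by rewrite E -catA /= => ic /(_ ic).
rewrite !mem_cat => /orP[u1|u2] /orP[v1|v2] uv.
- by left; apply: ich_infix; rewrite // in_cons mem_rev ?u1 ?v1 orbT.
- move: v2; rewrite in_cons => /orP[/eqP vx|v2]; last by case: (no u v).
  by left; apply: ich_infix; rewrite // in_cons ?mem_rev ?u1 ?vx ?eqxx ?orbT.
- move: u2; rewrite in_cons => /orP[/eqP ux|u2]; last by case: (no v u); rewrite // sedge_sym.
  by left; apply: ich_infix; rewrite // in_cons ?mem_rev ?v1 ?ux ?eqxx ?orbT.
- by right; apply: ich_infix.
Qed.

Definition spoke A f p t := [/\ path sedge f p, last f p = t, uniq (f :: p) & {subset p <= A}].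

Lemma ich_spoke A f s : ich (f :: s) -> {subset s <= A} -> spoke A f s (last f s).
Proof. by move=> ic sub; split=> //; [apply: ich_path | apply: ich_uniq]. Qed.

(** Take a shortest path [o] from [t1] to [t2] and a shortest path from [t3] until it has a
    neighbour on [o]; by minimality they are all of [A]. The centre is that neighbour, or [t3]
    itself when it lies on [o]. *)
Lemma center A t1 t2 t3 : t1 \in A -> t2 \in A -> t3 \in A -> cset A ->
  (forall Z, Z \subset A -> cset Z -> t1 \in Z -> t2 \in Z -> t3 \in Z -> Z = A) ->
  exists f p1 p2 p3, [/\ f \in A,
    [/\ spoke A f p1 t1, spoke A f p2 t2 & spoke A f p3 t3],
    [/\ ~~ has (mem p1) p2, ~~ has (mem p2) p3 & ~~ has (mem p1) p3],
    (forall u, u \in A -> [|| u == f, u \in p1, u \in p2 | u \in p3]) &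
    (forall u v, u \in A -> v \in A -> u -- v ->
       [|| infix2 u v (f :: p1), infix2 u v (f :: p2) | infix2 u v (f :: p3)])].
Proof.
move=> A1 A2 A3 cA minA.
have [||x [p [io sub /set1P xt /set1P lt [_ HB]]]] := @short_path _ _ [set t1] [set t2] _ _ (csetE cA A1 A2) A1.
- by rewrite inE.
- by rewrite inE.
subst x; set o := t1 :: p in io sub HB.
have oe : last t1 o = t2 by [].
have splitO f : f \in o -> exists s1 s2, [/\ o = s1 ++ f :: s2, ich (f :: rev s1), ich (f :: s2),
   last f (rev s1) = t1 & last f s2 = t2].
  move=> fo; have [s1 [f' [s2 [E /eqP Ef _]]]] : exists s1 y s2, [/\ o = s1 ++ y :: s2, pred1 f y & ~~ has (pred1 f) s1].
    by apply: split_first; rewrite has_pred1.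
  subst f'; exists s1, s2; split=> //.
  - by apply: (@ich_catr _ (rev s2)); rewrite -cat_rcons -rev_cons -rev_cat -E ich_rev.
  - by apply: (@ich_catr _ s1); rewrite -E.
  - by case: (s1) E => [|a s1'] [-> _] //; rewrite rev_cons last_rcons.
  - by rewrite -oe E last_cat.
have [t3o|t3o] := boolP (t3 \in o).
  have AE : A = [set u in o].
    symmetry; apply: minA.
    - by apply/subsetP => u; rewrite inE; apply: sub.
    - exact: ich_cset.
    - by rewrite in_set mem_head.
    - by rewrite in_set -lt mem_last.
    - by rewrite in_set.
  have [s1 [s2 [E i1 i2 l1 l2]]] := splitO t3 t3o.
  have s1A : {subset rev s1 <= A}.
    by move=> u; rewrite mem_rev => us; apply: sub; rewrite E mem_cat us.
  have s2A : {subset s2 <= A} by move=> u us; apply: sub; rewrite E mem_cat in_cons us !orbT.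
  exists t3, (rev s1), s2, [::]; split=> //.
  - by split; [rewrite -l1; apply: ich_spoke | rewrite -l2; apply: ich_spoke | split].
  - split=> //; have := ich_uniq io; rewrite E cat_uniq => /and3P[_ /hasPn h _].
    by apply/hasPn => u us; rewrite /= mem_rev; apply: h; rewrite in_cons us orbT.
  - move=> u; rewrite AE in_set E mem_cat in_cons mem_rev.
    by case/or3P=> ->; rewrite ?orbT.
  - move=> u v; rewrite AE !in_set E => uo vo uv; rewrite E in io.
    by case: (infix2_split io uo vo uv) => ->; rewrite ?orbT.
pose B := [set u | (u \in o) || has (fun w => u -- w) o].
have [||x [r [ir subr /set1P xt rB [HA HBr]]]] := @short_path _ _ [set t3] B _ _ (csetE cA A3 A1) A3.
- by rewrite inE.
- by rewrite inE mem_head.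
subst x.
have rlast u : u \in t3 :: r -> u \in B -> u = last t3 r by move=> ut; apply: last_only HBr ut.
have rm u : u \in t3 :: r -> u \notin o.
  move=> ut; apply/negP => um.
  have uB : u \in B by rewrite inE um.
  have ul := rlast u ut uB; case/lastP: (r) ul ut rlast ir => [|t' l] ul ut rlast' ir'.
    by move: um; rewrite ul /= (negPf t3o).
  rewrite last_rcons in ul; subst l.
  have lu : last t3 t' -- u by move: ir' => /ich_path; rewrite rcons_path => /andP[].
  have lB : last t3 t' \in B by rewrite inE; apply/orP; right; apply/hasP; exists u.
  have := rlast' (last t3 t'); rewrite last_rcons -rcons_cons mem_rcons in_cons mem_last orbT => /(_ isT lB) e.
  by move: lu; rewrite e sedge_irrefl.
have rl : last t3 r \in t3 :: r by apply: mem_last.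
have : has (fun w => last t3 r -- w) o by move: rB; rewrite inE (negPf (rm _ rl)).
case/split_first => s1 [f [s2 [E lf nb1]]].
have fo : f \in o by rewrite E mem_cat mem_head orbT.
have io' : ich (s1 ++ f :: s2) by rewrite -E.
have subo : [set u in o] \subset A by apply/subsetP => u; rewrite inE; apply: sub.
have subr' : [set u in t3 :: r] \subset A by apply/subsetP => u; rewrite inE; apply: subr.
have AE : A = [set u in o] :|: [set u in t3 :: r].
  symmetry; apply: minA.
  - by rewrite subUset subo.
  - apply: (@csetU _ _ _ f (last t3 r)); rewrite ?ich_cset ?in_set //.
    by rewrite sedge_sym lf orbT.
  - by rewrite in_setU in_set mem_head.
  - by rewrite in_setU in_set -lt mem_last.
  - by rewrite in_setU !in_set mem_head orbT.
have uniqf w : w \in o -> last t3 r -- w -> w = f.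
  move=> wo lw; apply: contrapT => /eqP wf.
  have ws2 : w \in s2.
    move: wo; rewrite E mem_cat in_cons (negPf wf) => /orP[w1|//].
    by have := hasPn nb1 w w1; rewrite /= lw.
  have [a [w' [b [E2 /eqP Ew _]]]] : exists s1 y s2', [/\ s2 = s1 ++ y :: s2', pred1 w y & ~~ has (pred1 w) s1].
    by apply: split_first; rewrite has_pred1.
  subst w'.
  have ES : o = rcons s1 f ++ a ++ w :: b by rewrite E E2 cat_rcons.
  have ZE : [set u in rcons s1 f] :|: [set u in t3 :: r] :|: [set u in w :: b] = A.
    have c1 : ich (rcons s1 f) by apply: (@ich_catl _ _ (a ++ w :: b)); rewrite -ES.
    have c3 : ich (w :: b) by apply: (@ich_catr _ (rcons s1 f ++ a)); rewrite -catA -ES.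
    apply: minA.
    - apply/subsetP => u; rewrite !in_setU !in_set => /orP[/orP[h|h]|h].
      + by apply: sub; rewrite ES mem_cat h.
      + exact: subr.
      + by apply: sub; rewrite ES mem_cat [u \in a ++ _]mem_cat h !orbT.
    - apply: (@csetU _ _ _ (last t3 r) w).
      + apply: (@csetU _ _ _ f (last t3 r)); rewrite ?ich_cset ?in_set ?mem_rcons ?mem_head //.
        by rewrite sedge_sym lf orbT.
      + exact: ich_cset.
      + by rewrite in_setU !in_set rl orbT.
      + by rewrite in_set mem_head.
      by rewrite lw orbT.
    - rewrite !in_setU !in_set; apply/orP; left; apply/orP; left.
      by case: (s1) ES => [|h s1'] [<- _]; rewrite /= mem_head.
    - rewrite !in_setU !in_set; apply/orP; right.
      rewrite -oe ES !last_cat -[last _ (w :: b)]/(last w b); exact: mem_last.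
    - by rewrite !in_setU !in_set mem_head orbT.
  have a0 : a = [::].
    case: (a) ES => // h a' ES; exfalso.
    have hA : h \in A by rewrite AE in_setU in_set ES mem_cat mem_head orbT.
    move: hA; rewrite -ZE !in_setU !in_set -orbA => /or3P[h1|h1|h1].
    + have := ich_uniq io; rewrite ES cat_uniq => /and3P[_ /hasPn/(_ h) H _].
      by move: H; rewrite mem_head /= h1 => /(_ isT).
    + by have := rm h h1; rewrite ES mem_cat mem_head orbT.
    + have := ich_uniq io; rewrite ES cat_uniq => /and3P[_ _].
      by rewrite cat_cons cons_uniq mem_cat h1 orbT.
  have fw : f -- w.
    by move: io'; rewrite E2 a0 => /ich_catr; rewrite /= ichE => /andP[/andP[]].
  exact: (tf lf fw lw).
have i1 : ich (f :: rev s1).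
  by apply: (@ich_catr _ (rev s2)); rewrite -cat_rcons -rev_cons -rev_cat ich_rev.
have i2 : ich (f :: s2) by apply: ich_catr io'.
have i3 : ich (f :: rev (t3 :: r)).
  have -> : f :: rev (t3 :: r) = rev (t3 :: r ++ [:: f]) by rewrite -cat_cons rev_cat.
  rewrite ich_rev; apply: ich_cat => //.
    move=> u v ur; rewrite mem_seq1 => /eqP->.
    have [e|ul] := eqVneq u (last t3 r); [by left | right].
    have uf : u != f by apply: contraTneq fo => <-; apply: rm.
    rewrite /nadj eq_sym uf; apply: contraNN ul => uf'; apply/eqP; apply: rlast => //.
    by rewrite inE; apply/orP; right; apply/hasP; exists f.
  rewrite -cat_cons cats1 rcons_uniq (ich_uniq ir) andbT.
  by apply/negP => /rm; rewrite fo.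
have l1 : last f (rev s1) = t1.
  by case: (s1) E => [|a s1'] [-> _] //; rewrite rev_cons last_rcons.
have l2 : last f s2 = t2 by rewrite -oe E last_cat.
have l3 : last f (rev (t3 :: r)) = t3 by rewrite rev_cons last_rcons.
have s1A : {subset rev s1 <= A}.
  by move=> u; rewrite mem_rev => us; apply: sub; rewrite E mem_cat us.
have s2A : {subset s2 <= A} by move=> u us; apply: sub; rewrite E mem_cat in_cons us !orbT.
have s3A : {subset rev (t3 :: r) <= A} by move=> u; rewrite mem_rev; apply: subr.
have so u : u \in s1 ++ f :: s2 -> u \in o by rewrite -E.
exists f, (rev s1), s2, (rev (t3 :: r)); split=> //.
- exact: sub.
- by split; [rewrite -l1; apply: ich_spoke | rewrite -l2; apply: ich_spoke | rewrite -[X in spoke _ _ _ X]l3; apply: ich_spoke].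
- split.
  + have := ich_uniq io; rewrite E cat_uniq => /and3P[_ /hasPn h _].
    by apply/hasPn => u us; rewrite /= mem_rev; apply: h; rewrite in_cons us orbT.
  + apply/hasPn => u; rewrite mem_rev => /rm; apply: contra; rewrite /= => us; apply: so.
    by rewrite mem_cat in_cons us !orbT.
  + apply/hasPn => u; rewrite mem_rev => /rm; apply: contra; rewrite /= mem_rev => us; apply: so.
    by rewrite mem_cat us.
- move=> u; rewrite AE in_setU !in_set (mem_rev (t3 :: r)) => /orP[|->]; last by rewrite !orbT.
  by rewrite E mem_cat in_cons mem_rev => /or3P[] ->; rewrite ?orbT.
- move=> u v; rewrite AE !in_setU !in_set => /orP[uo|ur] /orP[vo|vr] uv.
  + rewrite E in uo vo; by case: (infix2_split io' uo vo uv) => ->; rewrite ?orbT.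
  + have vB : v \in B by rewrite inE; apply/orP; right; apply/hasP; exists u; rewrite // sedge_sym.
    have ev := rlast v vr vB; have eu : u = f by apply: uniqf; rewrite // -ev sedge_sym.
    apply/or3P; constructor 3; apply: ich_infix; rewrite // ?in_cons ?eu ?eqxx // mem_rev vr orbT //.
  + have uB : u \in B by rewrite inE; apply/orP; right; apply/hasP; exists v.
    have eu := rlast u ur uB; have ev : v = f by apply: uniqf; rewrite // -eu.
    apply/or3P; constructor 3; apply: ich_infix; rewrite // ?in_cons ?ev ?eqxx // mem_rev ur orbT //.
  + apply/or3P; constructor 3; apply: ich_infix; rewrite // in_cons mem_rev ?ur ?vr orbT //.
Qed.

End Centers.

(** * From a minimal model to a subdivision *)

Section Extract.
Variables (W G : sgraph).
Hypothesis tf : tfree G.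
Variable Y : W -> {set G}.
Hypothesis mY : model Y.
Hypothesis clY : forall w w' a b, w != w' -> a \in Y w -> b \in Y w' -> a -- b ->
  w -- w' /\ forall a' b', a' \in Y w -> b' \in Y w' -> a' -- b' -> a' = a /\ b' = b.
Hypothesis covY : forall u, exists w, u \in Y w.
Hypothesis minY : forall w (Z : {set G}), Z \subset Y w -> Z != set0 -> cset Z ->
  (forall w', w -- w' -> exists a b, [/\ a \in Z, b \in Y w' & a -- b]) -> Z = Y w.
Hypothesis dW : forall w : W, #|neighb w| <= 3.

(** [center] applied to the vertices [tau w'] at which the at most three neighbouring branch sets
    are attached, with the spokes indexed by the neighbours of [w]. *)
Lemma spoke_of w (tau : W -> G) : (forall w', w -- w' -> tau w' \in Y w) ->
  (forall Z : {set G}, Z \subset Y w -> Z != set0 -> cset Z ->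
    (forall w', w -- w' -> tau w' \in Z) -> Z = Y w) ->
  exists f (p : W -> seq G), [/\ f \in Y w,
    (forall w', w -- w' -> spoke (Y w) f (p w') (tau w')),
    (forall w' w'' u, w -- w' -> w -- w'' -> u \in p w' -> u \in p w'' -> w' = w''),
    (forall u, u \in Y w -> u = f \/ exists2 w', w -- w' & u \in p w') &
    (forall u v, u \in Y w -> v \in Y w -> u -- v -> exists2 w', w -- w' & infix2 u v (f :: p w'))].
Proof.
move=> tY minZ.
have [/set0Pn[a0 a0Y] cY] := let: And3 nY _ _ := mY in nY w.
have inN w' : w -- w' -> w' \in enum (neighb w) by rewrite mem_enum inE.
have Nin w' : w' \in enum (neighb w) -> w -- w' by rewrite mem_enum inE.
have sz : size (enum (neighb w)) <= 3 by rewrite -cardE.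
have un := enum_uniq (neighb w).
have [ns [un' E]] : exists ns, uniq ns /\ forall w', w -- w' <-> w' \in ns.
  by exists (enum (neighb w)); split=> // w'; split; [apply: inN | apply: Nin].
(* Missing neighbours are replaced by copies of [t1]. Disjoint spokes with the same end are empty,
   as [nil] shows, so these copies contribute nothing. *)
pose t1 := if enum (neighb w) is a :: _ then tau a else a0.
pose t2 := if enum (neighb w) is _ :: b :: _ then tau b else t1.
pose t3 := if enum (neighb w) is [:: _; _; c] then tau c else t1.
have tm w' : w -- w' -> [|| tau w' == t1, tau w' == t2 | tau w' == t3].
  rewrite /t3 /t2 /t1 => /inN; case: (enum (neighb w)) sz => [|a [|b [|c [|d l]]]] //= _.
  - by rewrite inE => /eqP->; rewrite eqxx.
  - by rewrite !inE => /orP[]/eqP->; rewrite eqxx ?orbT.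
  - by rewrite !inE => /or3P[]/eqP->; rewrite eqxx ?orbT.
have t1Y : t1 \in Y w.
  by rewrite /t1; case: (enum _) Nin => [|a l] // Nin'; apply: tY; apply: Nin'; rewrite mem_head.
have t2Y : t2 \in Y w.
  rewrite /t2; case: (enum _) Nin => [|a [|b l]] // Nin'.
  by apply: tY; apply: Nin'; rewrite !inE eqxx orbT.
have t3Y : t3 \in Y w.
  rewrite /t3; case: (enum _) Nin => [|a [|b [|c [|d l]]]] // Nin'.
  by apply: tY; apply: Nin'; rewrite !inE eqxx !orbT.
have [|f [p1 [p2 [p3 [fY [s1 s2 s3] [d12 d23 d13] cov edg]]]]] := center tf t1Y t2Y t3Y cY.
  move=> Z ZY cZ z1 z2 z3; apply: minZ => //; first by apply/set0Pn; exists t1.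
  by move=> w' /tm /or3P[]/eqP->.
have dis (p q : seq G) u : ~~ has (mem p) q -> u \in p -> u \in q -> False.
  by move=> /hasPn h up uq; have := h u uq; rewrite /= up.
have nil (p q : seq G) t : spoke (Y w) f p t -> spoke (Y w) f q t -> ~~ has (mem p) q -> q = [::].
  move=> [_ lp _ _] [_ lq uq _] h; case/lastP: q uq lq h => // q l; rewrite last_rcons => uq lq h.
  subst l; case/lastP: p lp h => [|p l]; last rewrite last_rcons => ->.
    by move=> /= ft; move: uq; rewrite ft /= mem_rcons mem_head.
  by move=> /negP[]; apply/hasP; exists t; rewrite /= ?mem_rcons ?mem_head.
have hs (p q : seq G) : ~~ has (mem p) q -> ~~ has (mem q) p.
  by move=> h; apply/hasPn => u up; apply/negP => uq; apply: dis h up uq.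
clear E un' ns; move: tm t1Y t2Y t3Y s1 s2 s3; rewrite /t3 /t2 /t1.
case: (enum (neighb w)) sz inN Nin un => [|a [|b [|c [|d l]]]] // _ inN Nin un tm t1Y t2Y t3Y s1 s2 s3.
- have e1 := nil _ _ _ s3 s1 (hs _ _ d13); have e2 := nil _ _ _ s1 s2 d12; have e3 := nil _ _ _ s1 s3 d13.
  subst p1 p2 p3; exists f, (fun=> [::]); split=> //.
  + by move=> w' /inN.
  + by move=> u /cov; rewrite !orbF => /eqP; left.
  + by move=> u v uY vY uv; have := edg u v uY vY uv; rewrite /infix2 /= !andbF.
- have e2 := nil _ _ _ s1 s2 d12; have e3 := nil _ _ _ s1 s3 d13.
  have aN : w -- a by apply: Nin; rewrite mem_head.
  have e1 := nil _ _ _ s3 s1 (hs _ _ d13).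
  subst p1 p2 p3; exists f, (fun=> [::]); split=> //.
  + by move=> w' /inN; rewrite inE => /eqP->.
  + by move=> u /cov; rewrite !orbF => /eqP; left.
  + by move=> u v uY vY uv; have := edg u v uY vY uv; rewrite /infix2 /= !andbF.
- have e3 := nil _ _ _ s1 s3 d13; have e1 := nil _ _ _ s3 s1 (hs _ _ d13); subst p3 p1.
  have [aN bN] : w -- a /\ w -- b by split; apply: Nin; rewrite !inE eqxx ?orbT.
  have ab : a != b by move: un; rewrite /= inE andbT.
  exists f, (fun w' => if w' == b then p2 else [::]); split=> //.
  + move=> w' /inN; rewrite !inE => /orP[]/eqP->; first by rewrite (negPf ab).
    by rewrite eqxx.
  + by move=> w' w'' u _ _; case: eqP => [->|] //; case: eqP => [->|].
  + move=> u /cov; rewrite !orFb orbF => /orP[/eqP|u2]; first by left.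
    by right; exists b; rewrite ?eqxx.
  + move=> u v uY vY uv; exists b => //; rewrite eqxx; have := edg u v uY vY uv.
    by case/or3P=> // ; rewrite /infix2 /= !andbF.
- have [aN bN cN] : [/\ w -- a, w -- b & w -- c] by split; apply: Nin; rewrite !inE eqxx ?orbT.
  have [ab ac bc] : [/\ a != b, a != c & b != c].
    by move: un; rewrite /= !inE negb_or => /and3P[/andP[-> ->] -> _].
  exists f, (fun w' => if w' == a then p1 else if w' == b then p2 else p3); split=> //.
  + move=> w' /inN; rewrite !inE => /or3P[]/eqP->; rewrite ?eqxx //.
      by rewrite eq_sym (negPf ab).
    by rewrite eq_sym (negPf ac) eq_sym (negPf bc).
  + have ca w' : w -- w' -> [\/ w' = a, w' = b | w' = c].
      by move=> /inN; rewrite !inE => /or3P[]/eqP->; [constructor 1|constructor 2|constructor 3].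
    have [ba' ca' cb'] : [/\ b == a = false, c == a = false & c == b = false].
      by split; apply/negbTE; rewrite eq_sym.
    move=> w' w'' u /ca[]-> /ca[]->; rewrite ?eqxx ?ba' ?ca' ?cb' // => h1 h2; exfalso.
    * exact: dis d12 h1 h2.
    * exact: dis d13 h1 h2.
    * exact: dis d12 h2 h1.
    * exact: dis d23 h1 h2.
    * exact: dis d13 h2 h1.
    * exact: dis d23 h2 h1.
  + move=> u /cov/or4P[/eqP->|u1|u2|u3]; first by left.
    * by right; exists a; rewrite ?eqxx.
    * by right; exists b; rewrite // eq_sym (negPf ab) eqxx.
    * by right; exists c; rewrite // eq_sym (negPf ac) eq_sym (negPf bc).
  + move=> u v uY vY uv; case/or3P: (edg u v uY vY uv) => h.
    * by exists a; rewrite ?eqxx.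
    * by exists b; rewrite // eq_sym (negPf ab) eqxx.
    * by exists c; rewrite // eq_sym (negPf ac) eq_sym (negPf bc).
Qed.

(** Branch vertices are the centres of the spiders. The path for an edge [ww'] follows the spoke of
    [w] towards [w'], crosses the only edge between the two branch sets, and returns along the spoke
    of [w']. *)
Lemma extract : is_subdivision W G.
Proof.
have [nY dY eY] := mY.
have tau_ex (ww : W * W) : exists t : G, ww.1 -- ww.2 -> t \in Y ww.1 /\ exists2 t', t' \in Y ww.2 & t -- t'.
  case: ww => w w' /=; have [ww'|ww'] := boolP (w -- w').
    by have [a [b [aY bY ab]]] := eY _ _ ww'; exists a => _; split=> //; exists b.
  by have [/set0Pn[a _] _] := nY w; exists a.
have [tau0 tau0P] := boolp.choice tau_ex.
pose tau w w' := tau0 (w, w').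
have tauP w w' : w -- w' -> tau w w' \in Y w by move=> /(tau0P (w, w'))[].
have wne (x y : W) : x -- y -> x != y by apply: sedge_neq.
have uniq_e w w' a b : w -- w' -> a \in Y w -> b \in Y w' -> a -- b -> a = tau w w'.
  move=> ww' aY bY ab; have /(tau0P (w, w'))[/= tY [t' t'Y tt']] := ww'.
  by have [_ /(_ a b aY bY ab)[-> _]] := clY (wne _ _ ww') tY t'Y tt'.
have tau_e w w' : w -- w' -> tau w w' -- tau w' w.
  move=> ww'; have /(tau0P (w, w'))[/= tY [t' t'Y tt']] := ww'.
  rewrite -(uniq_e w' w t' (tau w w')) // sedge_sym //.
have sp_ex w : exists fp : G * (W -> seq G), [/\ fp.1 \in Y w,
    (forall w', w -- w' -> spoke (Y w) fp.1 (fp.2 w') (tau w w')),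
    (forall w' w'' u, w -- w' -> w -- w'' -> u \in fp.2 w' -> u \in fp.2 w'' -> w' = w''),
    (forall u, u \in Y w -> u = fp.1 \/ exists2 w', w -- w' & u \in fp.2 w') &
    (forall u v, u \in Y w -> v \in Y w -> u -- v -> exists2 w', w -- w' & infix2 u v (fp.1 :: fp.2 w'))].
  have [||f [p H]] := @spoke_of w (tau w).
  - by move=> w' /tauP.
  - move=> Z ZY Z0 cZ tZ; apply: minY => // w' ww'; exists (tau w w'), (tau w' w).
    by split; [exact: tZ | apply: tauP; rewrite sedge_sym | exact: tau_e].
  by exists (f, p).
have [fp fpP] := boolp.choice sp_ex.
pose f w := (fp w).1; pose p w w' := (fp w).2 w'.
have fY w : f w \in Y w by case: (fpP w).
have pS w w' : w -- w' -> spoke (Y w) (f w) (p w w') (tau w w') by case: (fpP w) => _ h _ _ _; apply: h.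
have pY w w' : w -- w' -> {subset p w w' <= Y w} by move=> /pS[].
have fp_ w w' : w -- w' -> f w \notin p w w' by move=> /pS[_ _ /andP[]].
have YE w w' u : u \in Y w -> u \in Y w' -> w = w' by apply: model_eq mY.
pose P w w' := p w w' ++ rev (p w' w).
have PE w w' : P w' w = rev (P w w') by rewrite /P rev_cat revK.
have QE w w' : f w :: rcons (P w w') (f w') = (f w :: p w w') ++ rev (f w' :: p w' w).
  by rewrite /P rev_cons rcons_cat.
have QR w w' : f w' :: rcons (P w' w) (f w) = rev (f w :: rcons (P w w') (f w')).
  by rewrite !QE rev_cat revK.
exists f, P; split.
- by move=> w w' e; apply: YE (fY w) _; rewrite e.
- move=> w w' ww'; have w'w : w' -- w by rewrite sedge_sym.
  have [pp lp up _] := pS _ _ ww'; have [pp' lp' up' _] := pS _ _ w'w.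
  split=> //.
  + rewrite -[path _ _ _]/(path sedge (f w) (behead (f w :: rcons (P w w') (f w')))) QE /= cat_path pp lp /=.
    rewrite lastI rev_rcons /= lp' tau_e //= -lp' rev_path.
    by rewrite (eq_path (e' := sedge)) // => a b; rewrite sedge_sym.
  + rewrite QE cat_uniq rev_uniq up up' andbT /=.
    apply/hasPn => u; rewrite mem_rev => u'; apply/negP => u1.
    have uw : u \in Y w by move: u1; rewrite in_cons => /orP[/eqP->//|/(pY _ _ ww')].
    have uw' : u \in Y w' by move: u'; rewrite in_cons => /orP[/eqP->//|/(pY _ _ w'w)].
    by have := wne _ _ ww'; rewrite (YE _ _ _ uw uw') eqxx.
  + move=> z; rewrite mem_cat mem_rev negb_or; apply/andP; split; apply/negP => zp.
      by have := YE _ _ _ (pY _ _ ww' _ zp) (fY z) => e; subst z; have := fp_ _ _ ww'; rewrite zp.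
    by have := YE _ _ _ (pY _ _ w'w _ zp) (fY z) => e; subst z; have := fp_ _ _ w'w; rewrite zp.
- move=> x y x' y' u xy xy'; have yx : y -- x by rewrite sedge_sym.
  have yx' : y' -- x' by rewrite sedge_sym.
  have key a b a' b' : a -- b -> a' -- b' -> u \in p a b -> u \in p a' b' -> a = a' /\ b = b'.
    move=> ab ab' u1 u2; have e := YE _ _ _ (pY _ _ ab _ u1) (pY _ _ ab' _ u2); subst a'.
    by split=> //; case: (fpP a) => _ _ h _ _; apply: h u1 u2.
  rewrite !mem_cat !mem_rev => /orP[u1|u1] /orP[u2|u2].
  + by have [-> ->] := key _ _ _ _ xy xy' u1 u2; left.
  + by have [-> ->] := key _ _ _ _ xy yx' u1 u2; right.
  + by have [-> ->] := key _ _ _ _ yx xy' u1 u2; right.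
  + by have [-> ->] := key _ _ _ _ yx yx' u1 u2; left.
- move=> u; have [w uw] := covY u; case: (fpP w) => _ _ _ h _.
  case: (h u uw) => [->|[w' ww' up]]; first by left; exists w.
  by right; exists w, w'; rewrite /P mem_cat up.
- move=> u v uv; have [w uw] := covY u; have [w' vw] := covY v.
  have [e|ne] := eqVneq w w'.
    subst w'; case: (fpP w) => _ _ _ _ h; have [w' ww' /orP[i|i]] := h u v uw vw uv.
      by exists w, w'; split=> //; rewrite QE; apply: infix_trans i _; apply: prefix_infix.
    exists w', w; split; first by rewrite sedge_sym.
    rewrite QR -[[:: u; v]]/(rev [:: v; u]) infix_rev QE; apply: infix_trans i _; apply: prefix_infix.
  have [ww' _] := clY ne uw vw uv.
  have w'w : w' -- w by rewrite sedge_sym.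
  exists w, w'; split=> //; rewrite QE.
  have eu := uniq_e _ _ _ _ ww' uw vw uv.
  have ev : v = tau w' w by apply: uniq_e w'w vw uw _; rewrite sedge_sym.
  have [_ lp _ _] := pS _ _ ww'; have [_ lp' _ _] := pS _ _ w'w.
  have -> : f w :: p w w' = rcons (belast (f w) (p w w')) u by rewrite lastI lp eu.
  have -> : f w' :: p w' w = rcons (belast (f w') (p w' w)) v by rewrite lastI lp' ev.
  rewrite rev_rcons -cats1 -catA; apply/infixP.
  by exists (belast (f w) (p w w')), (rev (belast (f w') (p w' w))).
Qed.

End Extract.

(** * Menger's theorem *)

Section Menger.
Variable T : finType.
Implicit Types (e : rel T) (A B S : {set T}) (p q : seq T) (x y z : T).

Definition apath e A B p :=
  if p is x :: q then [&& path e x q, uniq p, x \in A & last x q \in B] else false.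

(* Only the ends of [p] lie in [A] or [B]. *)
Definition tpath e A B p := apath e A B p &&
  if p is x :: q then ~~ has (mem A) q && ~~ has (mem B) (belast x q) else false.

Definition disjp (I : Type) (P : I -> seq T) := forall i j z, z \in P i -> z \in P j -> i = j.

Definition linked e A B k := exists P : 'I_k -> seq T, (forall i, tpath e A B (P i)) /\ disjp P.

Definition sepr e A B S := forall x q, path e x q -> x \in A -> last x q \in B -> has (mem S) (x :: q).

Lemma trim e A B x q : path e x q -> x \in A -> last x q \in B ->
  exists p, tpath e A B p /\ {subset p <= x :: q}.
Proof.
move=> /shortenP[q' pq' uq' sub] xA lB.
have hA : has (mem A) (x :: q') by rewrite /= xA.
have [s1 [y [s2 [E /= yA nA]]]] := split_last hA.
have {}yA : y \in A by [].
have l2 : last y s2 = last x q'.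
  by rewrite -[RHS]/(last x (x :: q')) E last_cat.
have hB : has (mem B) (y :: s2).
  by apply/hasP; exists (last y s2); [exact: mem_last | rewrite /= l2].
have [r1 [z [r2 [E2 zB nB]]]] := split_first hB.
have {}zB : z \in B by [].
have py : path e y s2.
  case: s1 E => [[<- <-]//|a s1 [_ E]]; move: pq'; rewrite E cat_path => /andP[_] /=.
  by case/andP.
have uy : uniq (y :: s2) by move: uq'; rewrite E cat_uniq => /and3P[].
have suby : {subset y :: s2 <= x :: q}.
  move=> u us; have : u \in x :: q' by rewrite E mem_cat us orbT.
  by rewrite !(in_cons x) => /orP[->//|/sub->]; rewrite orbT.
case: r1 E2 nB => [|y' r1] [? E2]; subst.
  move=> _; exists [:: z]; split; last by move=> u; rewrite mem_seq1 => /eqP->; apply: suby; rewrite mem_head.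
  by rewrite /tpath /= yA zB.
move=> nB; exists (y' :: rcons r1 z); split.
  move: py uy nA; rewrite -cat_rcons cat_path -cat_cons cat_uniq has_cat => /andP[py _] /and3P[uy _ _].
  rewrite negb_or => /andP[nA _].
  by rewrite /tpath /apath py uy yA last_rcons belast_rcons nB zB nA.
move=> u us; apply: suby; move: us; rewrite !in_cons mem_rcons mem_cat !in_cons.
by case/or3P => ->; rewrite ?orbT.
Qed.

Lemma tpath_ap e A B p : tpath e A B p -> apath e A B p. Proof. by case/andP. Qed.

Lemma sub_apath e e' A B p : (forall x y, x \in p -> y \in p -> e x y -> e' x y) -> apath e A B p -> apath e' A B p.
Proof.
case: p => // x q h /and4P[pq u xA lB]; apply/and4P; split=> //.
by apply: (@sub_in_path _ (mem (x :: q)) e e') pq => //; apply/allP.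
Qed.

Lemma tpathE e A B p : tpath e A B p -> exists x q, [/\ p = x :: q, path e x q, uniq p, x \in A & last x q \in B].
Proof. by case/andP; case: p => // x q /and4P[? ? ? ?] _; exists x, q. Qed.

Lemma linked_le e A B k k' : k' <= k -> linked e A B k -> linked e A B k'.
Proof.
move=> le [P [tP dP]]; exists (fun i => P (widen_ord le i)); split=> // i j z zi zj.
by have /(congr1 val) /= := dP _ _ _ zi zj => h; apply: val_inj.
Qed.

(* Goering's induction on the number of edges: a separator [S] of size less than [k]
   after deleting the edge [xy] yields separators [x |: S] and [y |: S] of size [k]. *)
Theorem menger e A B k : linked e A B k \/ exists S, #|S| < k /\ sepr e A B S.
Proof.
have [m le] := ubnP #|[set z : T * T | e z.1 z.2]|.
elim: m e A B le => // m IH e A B le.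
have [//|nl] := EM (linked e A B k); [by left | right].
apply: contrapT => nS; apply: nl.
have {}nS S : sepr e A B S -> k <= #|S|.
  by move=> sS; rewrite leqNgt; apply/negP => ltS; apply: nS; exists S.
(* Without edges the paths are the single vertices of [A :&: B], which is itself a separator. *)
have [/existsP[[x y] /= exy]|ne] := boolP [exists z : T * T, e z.1 z.2]; last first.
  have kAB : k <= #|A :&: B|.
    apply: nS => x [|y q] /= => [_ xA xB|/andP[exy]]; first by rewrite in_setI xA xB.
    by move/existsPn: ne => /(_ (x, y)); rewrite /= exy.
  exists (fun i => [:: enum_val (widen_ord kAB i)]); split.
    by move=> i; have := enum_valP (widen_ord kAB i); rewrite in_setI /tpath /= => /andP[-> ->].
  move=> i j z; rewrite !mem_seq1 => /eqP-> /eqP/enum_val_inj/(congr1 val) /= h.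
  exact: val_inj.
pose e' := [rel u v | e u v && ~~ ((u == x) && (v == y))].
have e'e u v : e' u v -> e u v by case/andP.
have IH' A' B' : linked e' A' B' k \/ exists S, #|S| < k /\ sepr e' A' B' S.
  apply: IH; rewrite -ltnS; apply: leq_trans le; rewrite ltnS; apply: proper_card.
  apply/properP; split; first by apply/subsetP => z; rewrite !in_set => /andP[].
  by exists (x, y); rewrite in_set //= !eqxx andbF.
have [[P [tP dP]]|[S [ltS sS]]] := IH' A B.
  have h i : exists p, tpath e A B p /\ {subset p <= P i}.
    have [u [q [-> pq _ uA lB]]] := tpathE (tP i).
    by apply: trim => //; apply: sub_path pq.
  have [Q QP] := boolp.choice h; exists Q; split=> [i|i j z /(proj2 (QP i)) zi /(proj2 (QP j)) zj].
    by case: (QP i).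
  exact: dP zi zj.
have px u q : path e u q -> x \notin belast u q -> path e' u q.
  elim: q u => //= v q IHq u /andP[euv pq]; rewrite in_cons negb_or => /andP[ux xq].
  by rewrite euv eq_sym (negPf ux) /= IHq.
have py u q : path e u q -> y \notin q -> path e' u q.
  elim: q u => //= v q IHq u /andP[euv pq]; rewrite in_cons negb_or => /andP[vy yq].
  by rewrite euv [v == y]eq_sym (negPf vy) andbF /= IHq.
have hx u q : path e u q -> u \in A -> last u q \in B -> has (mem (x |: S)) (u :: q).
  move=> pq uA lB; have [xq|xq] := boolP (x \in belast u q).
    by apply/hasP; exists x; [exact: mem_belast | rewrite /= setU11].
  have /hasP[w wq wS] := sS _ _ (px _ _ pq xq) uA lB.
  by apply/hasP; exists w; rewrite //= in_setU [w \in S]wS orbT.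
have hy u q : path e u q -> u \in A -> last u q \in B -> has (mem (y |: S)) (u :: q).
  move=> pq uA lB; have [yq|yq] := boolP (y \in q).
    by apply/hasP; exists y; [rewrite in_cons yq orbT | rewrite /= setU11].
  have /hasP[w wq wS] := sS _ _ (py _ _ pq yq) uA lB.
  by apply/hasP; exists w; rewrite //= in_setU [w \in S]wS orbT.
(* A path from [A] to [B] reaches [x |: S] before it can use the edge [xy], so a separator of [A]
   from [x |: S] after the deletion separates [A] from [B] before it. *)
have [[P1 [t1 d1]]|[S' [ltS' sS']]] := IH' A (x |: S); last first.
  suff /nS : sepr e A B S' by rewrite leqNgt ltS'.
  move=> u q pq uA lB; have [s1 [w [s2 [E wS nS1]]]] := split_first (hx u q pq uA lB).
  case: s1 E nS1 => [[? ?] _|u' s1 [<- E] nS1].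
    by subst u q; have := sS' w [::] isT uA wS; rewrite /= orbF => ->.
  have := sS' u (rcons s1 w); rewrite last_rcons.
  have pw : path e u (rcons s1 w) by move: pq; rewrite E -cat_rcons cat_path => /andP[].
  have -> : path e' u (rcons s1 w).
    apply: px => //; rewrite belast_rcons; apply: contra nS1 => xs.
    by apply/hasP; exists x; rewrite //= setU11.
  move=> /(_ isT uA wS); by rewrite E -cat_rcons -cat_cons has_cat => ->.
have [[P2 [t2 d2]]|[S' [ltS' sS']]] := IH' (y |: S) B; last first.
  suff /nS : sepr e A B S' by rewrite leqNgt ltS'.
  move=> u q pq uA lB; have [s1 [w [s2 [E wS nS1]]]] := split_last (hy u q pq uA lB).
  have pw : path e w s2.
    case: s1 E => [[<- <-]//|a s1 [_ E]]; move: pq; rewrite E cat_path => /andP[_] /=.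
    by case/andP.
  have := sS' w s2; rewrite -[last w s2](last_cat u s1 (w :: s2)).
  have -> : path e' w s2.
    apply: py => //; apply: contra nS1 => ys.
    by apply/hasP; exists y; rewrite //= setU11.
  rewrite -E /= => /(_ isT wS lB) /orP h; rewrite -[_ || _]/(has (mem S') (u :: q)) E has_cat /=.
  by case: h => ->; rewrite ?orbT.
pose l i := last x (P1 i); pose f j := head y (P2 j).
have lP i : l i \in x |: S.
  by rewrite /l; have [u [q [-> _ _ _ h]]] := tpathE (t1 i).
have fP j : f j \in y |: S.
  by rewrite /f; have [u [q [-> _ _ h _]]] := tpathE (t2 j).
have lm i : l i \in P1 i.
  by rewrite /l; have [u [q [-> _ _ _ h]]] := tpathE (t1 i); rewrite /= mem_last.
have fm j : f j \in P2 j.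
  by rewrite /f; have [u [q [-> _ _ _ h]]] := tpathE (t2 j); rewrite mem_head.
have linj : injective l by move=> i j h; apply: (d1 i j (l i)) => //; rewrite h.
have finj : injective f by move=> i j h; apply: (d2 i j (f i)) => //; rewrite h.
have card_k (g : 'I_k -> T) z : injective g -> (forall i, g i \in z |: S) ->
    z \notin S /\ forall w, w \in z |: S -> exists i, w = g i.
  move=> gi gS; have sub : [set g i | i in 'I_k] \subset z |: S by apply/subsetP => _ /imsetP[i _ ->].
  have ck : #|[set g i | i in 'I_k]| = k by rewrite card_imset // card_ord.
  have := subset_leq_card sub; rewrite ck cardsU1.
  case: (boolP (z \in S)) => zS /= h; first by move: ltS; rewrite ltnNge h.
  split=> // w ws; have E : [set g i | i in 'I_k] = z |: S.
    by apply/eqP; rewrite eqEcard sub ck cardsU1 zS /= add1n.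
  by move: ws; rewrite -E => /imsetP[i _ ->]; exists i.
have [xS _] := card_k _ _ linj lP; have [yS fsur] := card_k _ _ finj fP.
(* As [S] has fewer than [k] elements, both linkages use every vertex of their middle sets. A path
   ending at [x] goes on across the edge [xy], any other at the same vertex of [S]. *)
pose s i := if l i == x then y else l i.
have sP i : exists j, s i = f j.
  apply: fsur; rewrite /s; case: eqP => [|lx]; first by rewrite setU11.
  by have := lP i; rewrite !in_setU !in_set1 => /orP[/eqP//|->]; rewrite orbT.
have [j0 j0P] := boolp.choice sP.
have sinj i i' : s i = s i' -> l i = l i'.
  rewrite /s; case: (eqVneq (l i) x) => lx; case: (eqVneq (l i') x) => lx' h //.
  - by rewrite lx lx'.
  - have := lP i'; rewrite -h in_setU in_set1 (negPf yS) orbF => /eqP e1.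
    exact: etrans lx (esym e1).
  - have := lP i; rewrite h in_setU in_set1 (negPf yS) orbF => /eqP e1.
    exact: etrans e1 (esym lx').
(* A common vertex outside [S] would give a path from [A] to [B] without [xy] that misses [S]; a
   common vertex in [S] is an end of both paths. *)
have cross i j z : z \in P1 i -> z \in P2 j -> [/\ z \in S, z = l i & z = f j].
  move=> z1 z2; have h1 : has (pred1 z) (P1 i) by rewrite has_pred1.
  have h2 : has (pred1 z) (P2 j) by rewrite has_pred1.
  have [l1 [z' [l2 [E1 /eqP ez _]]]] := split_first h1; subst z'.
  have [r1 [z' [r2 [E2 /eqP ez _]]]] := split_first h2; subst z'.
  have zS : z \in S.
    apply: contrapT => /negP zS.
    have [u [q [Eu pq _ uA _]]] := tpathE (t1 i); have [w [r [Ew pr _ _ lB]]] := tpathE (t2 j).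
    have pz : path e' z r2.
      move: Ew pr; rewrite E2; case: (r1) => [|a r1'] [<- <-] //.
      by rewrite cat_path => /andP[_] /= /andP[].
    have lz : last z r2 \in B by move: lB; rewrite -[last w r]/(last x (w :: r)) -Ew E2 last_cat.
    have n2 : ~~ has (mem (y |: S)) r2.
      have /andP[_] := t2 j; rewrite E2; case: (r1) => [|a r1'] /= /andP[] //.
      by rewrite has_cat /= !negb_or => /and3P[].
    have n1 : ~~ has (mem (x |: S)) l1.
      have /andP[_] := t1 i; rewrite E1; case: (l1) => [|a l1'] /= /andP[_] //.
      rewrite belast_cat has_cat /= => h.
      rewrite -[X in ~~ X]/(has (mem (x |: S)) (a :: l1')) lastI -cats1 has_cat /= orbF.
      by apply: contra h => /orP[->|->]; rewrite ?orbT.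
    have n1' : ~~ has (mem S) l1 by apply: contra n1; apply: sub_has => a /= aS; rewrite in_setU aS orbT.
    have n2' : ~~ has (mem S) r2 by apply: contra n2; apply: sub_has => a /= aS; rewrite in_setU aS orbT.
    have [q' [E' pq']] : exists q', l1 ++ z :: r2 = u :: q' /\ path e' u q'.
      move: Eu pq; rewrite E1; case: (l1) => [|a l1'] [<- <-]; first by exists r2.
      rewrite cat_path /= => /and3P[pa la _]; exists (l1' ++ z :: r2); split=> //.
      by rewrite cat_path pa /= pz; apply/andP; split.
    have lq' : last u q' \in B by rewrite -[last u q']/(last x (u :: q')) -E' last_cat.
    have := sS u q' pq' uA lq'; rewrite -E' has_cat (negPf n1') /= -[_ \in mem S]/(z \in S) (negPf zS).
    by rewrite (negPf n2').
  split=> //.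
    have /andP[_] := t1 i; rewrite /l E1; case: (l1) => [|a l1'] /= /andP[_].
      case: (l2) => // b l2' /=; by rewrite in_setU zS orbT.
    rewrite belast_cat has_cat last_cat /=; case: (l2) => // b l2' /=.
    by rewrite [z \in _]in_setU zS !orbT.
  have /andP[_] := t2 j; rewrite /f E2; case: (r1) => [|a r1'] //= /andP[].
  by rewrite has_cat /= in_setU zS !orbT.
pose Q i := if l i == x then P1 i ++ P2 (j0 i) else P1 i ++ behead (P2 (j0 i)).
have Q2 i z : z \in Q i -> z \in P1 i \/ z \in P2 (j0 i) /\ (l i = x \/ z <> f (j0 i)).
  rewrite /Q; case: eqP => lx; rewrite mem_cat => /orP[->|h]; try by left.
    by right; split=> //; left.
  have [u [q [E _ uq0 _ _]]] := tpathE (t2 (j0 i)); right; move: h uq0; rewrite /f E /= => h /andP[uq _].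
  by rewrite in_cons h orbT; split=> //; right => zu; move: uq; rewrite -zu h.
have QT i : exists p, tpath e A B p /\ {subset p <= Q i}.
  have [u [q [Eu pq _ uA lu]]] := tpathE (t1 i); have [w [r [Ew pr _ _ lB]]] := tpathE (t2 (j0 i)).
  have li : l i = last u q by rewrite /l Eu.
  have fi : s i = w by rewrite j0P /f Ew.
  have pq' : path e u q by apply: sub_path pq.
  have pr' : path e w r by apply: sub_path pr.
  rewrite /Q Eu Ew; move: fi; rewrite /s; case: eqP => lx fi; rewrite cat_cons; apply: trim => //.
  - by rewrite cat_path pq' /= -li lx -fi exy fi.
  - by rewrite last_cat.
  - by rewrite cat_path pq' /= -li fi.
  - by rewrite last_cat -li fi.
have [Q' Q'P] := boolp.choice QT; exists Q'; split=> [i|i i' z /(proj2 (Q'P i)) zi /(proj2 (Q'P i')) zi'].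
  by case: (Q'P i).
have key a b : z \in P1 a -> z \in P2 (j0 b) /\ (l b = x \/ z <> f (j0 b)) -> False.
  move=> z1 [z2 h]; have [zS _ zf] := cross _ _ _ z1 z2; case: h => // lb.
  by move: (j0P b); rewrite /s lb eqxx => h; move: yS; rewrite h -zf zS.
case: (Q2 i z zi) (Q2 i' z zi') => [h1|h1] [h2|h2].
- exact: d1 h1 h2.
- by case: (key _ _ h1 h2).
- by case: (key _ _ h2 h1).
- by apply/linj/sinj; rewrite !j0P (d2 _ _ _ (proj1 h1) (proj1 h2)).
Qed.

End Menger.

(** * Crossing linkages *)

Lemma same_on (T : eqType) (R : Type) (P : T -> R) (p : seq T) u u' :
  (forall x y, infix [:: x; y] p -> P x = P y) -> u \in p -> u' \in p -> P u = P u'.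
Proof.
move=> h; suff H x q : p = x :: q -> {in x :: q, forall y, P y = P x}.
  by case: p h H => // x q _ H up up'; rewrite (H x q) // (H x q).
elim: q p x {u u'} h => [|z q IH] p x h E y.
  by rewrite mem_seq1 => /eqP->.
rewrite in_cons => /orP[/eqP->//|yq]; have xz : P x = P z.
  by apply: h; rewrite E; apply/infixP; exists [::], q.
rewrite xz; apply: (IH (z :: q)) => // a b i; apply: h; rewrite E.
exact: infix_trans i (infix_cons _ _).
Qed.

Lemma avoid_set (T : finType) (I : finType) (P : I -> seq T) (C : {set T}) :
  disjp P -> #|C| < #|I| -> exists i, ~~ has (mem C) (P i).
Proof.
move=> dP lt; apply: contrapT => no.
have h i : exists z, z \in C /\ z \in P i.
  apply: contrapT => nz; apply: no; exists i; apply/hasPn => z zP; apply/negP => zC.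
  by apply: nz; exists z.
have [f fP] := boolp.choice h.
have fi : injective f by move=> i j e; apply: (dP i j (f i)); [case: (fP i) | rewrite e; case: (fP j)].
have : #|[set f i | i : I]| <= #|C| by apply/subset_leq_card/subsetP => _ /imsetP[i _ ->]; case: (fP i).
by rewrite card_imset // leqNgt lt.
Qed.

(** * Ordering the paths of one linkage along another *)

Section Order.
Variables (N : sgraph) (W Y Y' : {set N}) (h v : nat).
Variables (H : 'I_h -> seq N) (V : 'I_v -> seq N).

Definition hedge x y := [exists a, infix2 x y (H a)].
(** Each edge outside the paths [H] is counted once in each direction; only comparisons of costs
    matter. *)
Definition cost (V : 'I_v -> seq N) :=
  #|[set z : N * N | [exists j, infix2 z.1 z.2 (V j)] && ~~ hedge z.1 z.2]|.

Hypothesis WH : forall a, {subset H a <= W}.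
Hypothesis pH : forall a x y, infix [:: x; y] (H a) -> x -- y.
Hypothesis dH : disjp H.
Hypothesis tV : forall j, tpath (inS W) Y Y' (V j).
Hypothesis dV : disjp V.
Hypothesis YW : Y \subset W.
Hypothesis minV : forall V', (forall j, tpath (inS W) Y Y' (V' j)) -> disjp V' -> cost V <= cost V'.

Lemma infix_mem (T : eqType) (u w : T) s : infix [:: u; w] s -> u \in s /\ w \in s.
Proof. by case/infixP=> s1 [s2 ->]; rewrite !mem_cat !inE !eqxx !orbT. Qed.

Lemma infix2_mem (u w : N) s : infix2 u w s -> u \in s /\ w \in s.
Proof. by case/orP => /infix_mem[]. Qed.

Lemma path_infix (e : rel N) x q a b : path e x q -> infix [:: a; b] (x :: q) -> e a b.
Proof.
move=> pq /infixP[s1 [s2 E]]; case: s1 E pq => [|y s1] [-> E]; rewrite {}E.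
  by move=> /= /andP[].
by rewrite cat_path /= => /and3P[_ _ /andP[]].
Qed.

Lemma infix_path (e : rel N) x q : (forall a b, infix [:: a; b] (x :: q) -> e a b) -> path e x q.
Proof.
elim: q x => // y q IH x hq; rewrite /=; have -> /= : e x y by apply: hq; apply/infixP; exists [::], q.
by apply: IH => a b i; apply: hq; apply: infix_trans i (infix_cons _ _).
Qed.

Lemma inW e A B p : tpath e A B p -> A \subset W -> (forall x y, e x y -> y \in W) -> {subset p <= W}.
Proof.
move=> /tpathE[x [q [-> pq _ xA _]]] AW eW u; rewrite in_cons => /orP[/eqP->|uq].
  exact: (subsetP AW).
case/splitPr: uq pq => q1 q2; rewrite cat_path /= => /and3P[_ + _]; exact: eW.
Qed.

Lemma VW j : {subset V j <= W}.
Proof. by apply: (inW (tV j)) => // x y /and3P[]. Qed.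

Lemma V_edge j x y : infix [:: x; y] (V j) -> x -- y.
Proof. by have [a [q [-> pq _ _ _]]] := tpathE (tV j) => /(path_infix pq)/and3P[]. Qed.

Lemma hedgeC x y : hedge x y = hedge y x.
Proof. by apply: eq_existsb => a; rewrite /infix2 orbC. Qed.

(* Deleting an edge [wz] of [V j1] outside the paths [H] leaves no [v] disjoint
   paths, by minimality; a separator has exactly one vertex on each [V j] except
   [V j1]. *)
Lemma cut j1 w z : infix [:: w; z] (V j1) -> ~~ hedge w z ->
  exists (C : {set N}) (pos : 'I_v -> nat), [/\ #|C| < v, pos j1 = index z (V j1) &
    forall a, ~~ has (mem C) (H a) ->
      (forall j u, u \in H a -> u \in V j -> index u (V j) < pos j) \/
      (forall j u, u \in H a -> u \in V j -> pos j <= index u (V j))].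
Proof.
move=> wz nwz.
pose ew x y := ((x == w) && (y == z)) || ((x == z) && (y == w)).
pose g := [rel x y | (hedge x y || [exists j, infix2 x y (V j)]) && ~~ ew x y].
have ewC x y : ew x y = ew y x by rewrite /ew orbC ![(_ == w) && _]andbC.
have gC x y : g x y = g y x.
  rewrite /= ewC hedgeC; congr ((_ || _) && _).
  by apply: eq_existsb => j; rewrite /infix2 orbC.
have gW x y : g x y -> inS W x y.
  case/andP=> /orP[/existsP[a]|/existsP[j]] /orP[] i _ /=; have [xm ym] := infix_mem i.
  - by apply/and3P; split; [apply: WH xm | apply: WH ym | exact: pH i].
  - by apply/and3P; split; [apply: WH ym | apply: WH xm | rewrite sedge_sym (pH i)].
  - by apply/and3P; split; [apply: VW xm | apply: VW ym | exact: V_edge i].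
  - by apply/and3P; split; [apply: VW ym | apply: VW xm | rewrite sedge_sym (V_edge i)].
case: (menger g Y Y' v) => [[V' [tV' dV']]|[C [ltC sC]]].
  (* The edges of a linkage in [g] that lie outside the paths [H] are edges of [V] other than [wz],
     so it would cost less than [V]. *)
  have gV' j x y : infix2 x y (V' j) -> g x y.
    have [a [q [E pq _ _ _]]] := tpathE (tV' j).
    by case/orP; rewrite E => /(path_infix pq) //; rewrite gC.
  have : cost V <= cost V'.
    apply: minV => // j; have /andP[ap tr] := tV' j; rewrite /tpath tr andbT.
    by apply: sub_apath ap => x y _ _; apply: gW.
  rewrite leqNgt => /negP[]; apply: proper_card; apply/properP; split.
    apply/subsetP => -[x y]; rewrite !in_set /= => /andP[/existsP[j i] nh]; rewrite nh andbT.
    by have := gV' j x y i; rewrite /= (negPf nh) => /andP[].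
  exists (w, z); first by rewrite in_set /= nwz andbT; apply/existsP; exists j1; rewrite /infix2 wz.
  rewrite in_set /= negb_and; apply/orP; left; apply/existsPn => j; apply/negP => /gV'.
  by rewrite /= /ew !eqxx andbF.
have wV : w \in V j1 by case: (infix_mem wz).
have zV : z \in V j1 by case: (infix_mem wz).
have gV j x y : infix [:: x; y] (V j) -> (j != j1) || ~~ ew x y -> g x y.
  move=> i ne; have ex : [exists j, infix2 x y (V j)] by apply/existsP; exists j; rewrite /infix2 i.
  rewrite /= ex orbT /=; case/orP: ne => // ne; apply: contra ne => e.
  have [xm _] := infix_mem i; case/orP: e => /andP[/eqP e _]; apply/eqP.
    by apply: (dV _ wV); rewrite -e.
  by apply: (dV _ zV); rewrite -e.
have cex j : exists c, j != j1 -> c \in C /\ c \in V j.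
  have [->|jj] := eqVneq j j1; first by exists w.
  have [a [q [E pq _ aY lY]]] := tpathE (tV j).
  have : path g a q by apply: infix_path => x y i; apply: (gV j); rewrite ?E ?jj.
  by move=> /sC/(_ aY lY)/hasP[c cq cC]; exists c => _; rewrite E.
have [c cP] := boolp.choice cex.
have CE : C = [set c j | j in [set~ j1]].
  symmetry; apply/eqP; rewrite eqEcard; apply/andP; split.
    by apply/subsetP => x /imsetP[j jj ->]; move: jj; rewrite in_setC1 => /cP[].
  rewrite card_in_imset ?cardsC1 ?card_ord; first by move: (ltn_ord j1) ltC; lia.
  move=> i j; rewrite !in_setC1 => /cP[_ h1] /cP[_ h2] e; apply: dV h1 _.
  by rewrite e.
have CV j u : u \in C -> u \in V j -> u = c j /\ j != j1.
  rewrite CE => /imsetP[i]; rewrite in_setC1 => ij -> uj.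
  by have [_ h1] := cP i ij; have := dV h1 uj => e; subst j.
pose gc := [rel x y | [&& g x y, x \notin C & y \notin C]].
(* The side of [Y] after deletion of [C]. On a path [V j], off [C], it consists of the vertices
   before the cut, and it contains all or nothing of a path [H a] that avoids [C], because [wz] is
   not an edge of [H a]. *)
pose L u := [exists y, [&& y \in Y, y \notin C & connect gc y u]].
have LE x y : g x y -> x \notin C -> y \notin C -> L x = L y.
  have half a b : g a b -> a \notin C -> b \notin C -> L a -> L b.
    move=> ab aC bC /existsP[y0 /and3P[yY yC cy]]; apply/existsP; exists y0; rewrite yY yC /=.
    by apply: connect_trans cy (connect1 _); rewrite /= -[_ && ~~ _]/(g a b) ab aC.
  by move=> xy xC yC; apply/idP/idP; apply: half; rewrite // gC.
have LY y : y \in Y -> y \notin C -> L y.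
  by move=> yY yC; apply/existsP; exists y; rewrite yY yC connect0.
have LY' y : y \in Y' -> ~~ L y.
  move=> yY; apply/negP => /existsP[y0 /and3P[y0Y y0C /connectP[q pq E]]].
  have : path g y0 q by apply: sub_path pq => a b /and3P[].
  move=> /sC; rewrite -E => /(_ y0Y yY)/hasP[u uq uC].
  move: uq; rewrite in_cons => /orP[/eqP e|uq]; first by move: y0C; rewrite -e [_ \in C]uC.
  case/splitPr: uq pq => q1 q2; rewrite cat_path /= => /and3P[_ /and3P[_ _ uC'] _].
  by move: uC'; rewrite [_ \in C]uC.
exists C, (fun j => if j == j1 then index z (V j1) else index (c j) (V j)).
rewrite eqxx; split=> // a aC.
have Hsame u u' : u \in H a -> u' \in H a -> L u = L u'.
  apply: same_on => x y i; have [xm ym] := infix_mem i; apply: LE.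
  - have hxy : hedge x y by apply/existsP; exists a; rewrite /infix2 i.
    rewrite /= hxy /=; apply: contra nwz; rewrite /ew => /orP[] /andP[/eqP e1 /eqP e2]; subst x y => //.
    by rewrite hedgeC.
  - by apply: (hasPn aC).
  - by apply: (hasPn aC).
have LV j u : u \in H a -> u \in V j -> L u = (index u (V j) < (if j == j1 then index z (V j1) else index (c j) (V j))).
  move=> uH uV; have uC : u \notin C by apply: (hasPn aC).
  have [b [q [E pq un bY lY]]] := tpathE (tV j).
  have UV := un.
  have key s1 m s2 : V j = s1 ++ m ++ s2 -> u \notin m -> (forall y, y \in s1 ++ s2 -> y \notin C) ->
     (forall x y, infix [:: x; y] s1 \/ infix [:: x; y] s2 -> g x y) -> L u = (index u (V j) < size s1).
    move=> Es um nC gi; move: (uV); rewrite Es !mem_cat index_cat (negPf um) /=.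
    case: (boolP (u \in s1)) => us1 /=.
      move=> _; rewrite index_mem us1; have bs : b \in s1.
        by move: Es us1; rewrite E; case: (s1) => // a' s1' [-> _]; rewrite mem_head.
      rewrite (@same_on _ _ L s1 u b) //; first by apply/LY/nC; rewrite // mem_cat bs.
      move=> x y i; have [xm ym] := infix_mem i.
      by apply: LE; [apply: gi; left | apply: nC; rewrite mem_cat xm | apply: nC; rewrite mem_cat ym].
    move=> us2; rewrite ltnNge leq_addr /=; apply/negbTE.
    have ls : last b q \in s2.
      rewrite -[last b q]/(last b (b :: q)) -E Es catA last_cat.
      by case: (s2) us2 => // d s2' _; rewrite /= mem_last.
    rewrite (@same_on _ _ L s2 u (last b q)) //; first exact: LY'.
    move=> x y i; have [xm ym] := infix_mem i.
    by apply: LE; [apply: gi; right | apply: nC; rewrite mem_cat xm orbT | apply: nC; rewrite mem_cat ym orbT].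
  have [ej|nj] := eqVneq j j1.
    subst j; have /infixP[s1 [s2 Es]] := wz.
    have Es' : V j1 = rcons s1 w ++ z :: s2 by rewrite Es cat_rcons.
    have zs1 : z \notin rcons s1 w.
      by move: UV; rewrite Es' cat_uniq => /and3P[_ /hasPn/(_ z (mem_head _ _))].
    have ws2 : w \notin z :: s2.
      move: UV; rewrite Es' cat_uniq => /and3P[_ /hasPn h2 _]; apply/negP => /h2.
      by rewrite /= mem_rcons mem_head.
    rewrite (key (rcons s1 w) [::] (z :: s2)) //.
    - by rewrite [in index z _]Es' index_cat (negPf zs1) /= eqxx addn0.
    - by move=> y ym; apply/negP => yC; have [] := CV j1 y yC; rewrite ?eqxx // Es'.
    - move=> x y i; apply: (gV j1).
        by rewrite Es'; case: i => i; [exact: infix_catr i | exact: infix_catl i].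
      rewrite eqxx /=; apply/negP => /orP[]/andP[/eqP e1 /eqP e2]; subst x y.
        by case: i => /infix_mem[h1 h2]; [move: zs1; rewrite h2 | move: ws2; rewrite h1].
      by case: i => /infix_mem[h1 h2]; [move: zs1; rewrite h1 | move: ws2; rewrite h2].
  have [cC cVj] := cP j nj.
  have hc : has (pred1 (c j)) (V j) by rewrite has_pred1.
  have [s1 [c' [s2 [Es /eqP e n1]]]] := split_first hc; subst c'.
  have cs : c j \notin s1 ++ s2.
    have : uniq (s1 ++ c j :: s2) by rewrite -Es.
    by rewrite -cat_rcons -cats1 -catA uniq_catCA /= => /andP[].
  rewrite (key s1 [:: c j] s2) //.
  - move: cs; rewrite mem_cat negb_or => /andP[cs1 _].
    by rewrite [in index (c j) _]Es index_cat (negPf cs1) /= eqxx addn0.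
  - by rewrite mem_seq1; apply: contraNneq uC => ->.
  - move=> y ym; apply/negP => yC; have yV : y \in V j.
      by move: ym; rewrite Es !mem_cat in_cons => /orP[]->; rewrite ?orbT.
    by have [yc _] := CV j y yC yV; move: cs; rewrite -yc ym.
  - move=> x y i; apply: (gV j); last by rewrite nj.
    rewrite Es; case: i => i; first exact: infix_catr i.
    by rewrite -cat_rcons; apply: infix_catl i.
have [/existsP[u /existsP[j /and3P[uH uV lt]]]|no] := boolP [exists u, [exists j : 'I_v, [&& u \in H a, u \in V j & L u]]].
  left=> j' u' uH' uV'; rewrite -LV // (Hsame u' u) //.
right=> j u uH uV; rewrite leqNgt -LV //; apply: contra no => lu.
by apply/existsP; exists u; apply/existsP; exists j; rewrite uH uV.
Qed.

Lemma card_bigcup_le (T I : finType) (F : I -> {set T}) m : (forall i, #|F i| <= m) ->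
  #|\bigcup_i F i| <= #|I| * m.
Proof.
move=> le; rewrite -sum_nat_const; elim/big_ind2: _ => [|A a B b h1 h2|i _] //; first by rewrite cards0.
exact: leq_trans (leq_card_setU _ _) (leq_add h1 h2).
Qed.

(* Cuts at every [g]-th path in the order of the first vertex on [V j1]; in each group
   some path avoids all the cuts. *)
Lemma ordered s g j1 (A : {set 'I_h}) : (forall a, a \in A -> has (mem (H a)) (V j1)) ->
  s.+1 * v < g -> s.+1 * g <= #|A| ->
  exists tau : 'I_s.+1 -> 'I_h, (forall i, tau i \in A) /\
    forall (i i' : 'I_s.+1) j u u', i < i' -> u \in H (tau i) -> u \in V j -> u' \in H (tau i') -> u' \in V j ->
      index u (V j) < index u' (V j).
Proof.
move=> hA gv gA; pose fst a := find (mem (H a)) (V j1).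
have [a0 a0A] : exists a0, a0 \in A.
  by apply/set0Pn; rewrite -card_gt0; apply: leq_trans gA; rewrite muln_gt0 /=; apply: leq_ltn_trans gv.
have fstP a : a \in A -> exists2 u, u \in H a & u \in V j1 /\ index u (V j1) = fst a.
  move=> /hA ha; have [b [q [E _ un _ _]]] := tpathE (tV j1).
  exists (nth b (V j1) (fst a)); first exact: (nth_find b ha).
  have lt : fst a < size (V j1) by rewrite -has_find.
  by rewrite mem_nth // index_uniq.
pose L := sort (relpre fst leq) (enum A).
have sL : size L = #|A| by rewrite size_sort -cardE.
have LA i : i < #|A| -> nth a0 L i \in A.
  by move=> lt; rewrite -mem_enum -(mem_sort (relpre fst leq)) mem_nth // -/L sL.
have finj : {in A &, injective fst}.
  move=> a b aA bA e; have [u uH [uV iu]] := fstP a aA; have [w wH [wV iw]] := fstP b bA.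
  have uw : u = w by rewrite -(nth_index u uV) iu e -iw nth_index.
  by apply: dH uH _; rewrite uw.
have sortedL : sorted ltn (map fst L).
  rewrite ltn_sorted_uniq_leq map_inj_in_uniq ?sort_uniq ?enum_uniq /=.
    by rewrite sorted_map sort_sorted // => a b; apply: leq_total.
  by move=> a b; rewrite !mem_sort !mem_enum; apply: finj.
have lt_fst i i' : i < i' -> i' < #|A| -> fst (nth a0 L i) < fst (nth a0 L i').
  move=> ii lt; have lti : i < #|A| by apply: ltn_trans lt.
  have := sorted_ltn_nth ltn_trans 0 sortedL; move=> /(_ i i'); rewrite !inE !size_map sL => /(_ lti lt ii).
  by rewrite !(nth_map a0) ?sL.
pose sg i := nth a0 L i.
have bg (b : 'I_s.+1) i : i < g -> b * g + i < #|A|.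
  move=> lt; apply: leq_trans gA; rewrite mulSn addnC; apply: leq_ltn_trans (_ : i + s * g < _).
    by rewrite leq_add2l leq_mul2r -ltnS ltn_ord orbT.
  by rewrite ltn_add2r.
(* The cut for [b] passes just before the first vertex of path number [b * g] on [V j1]. There is no
   cut before the first group, and [b = 0] gets default values. *)
have cb (b : 'I_s.+1) : exists Cp : {set N} * ('I_v -> nat), #|Cp.1| <= v /\ (0 < b -> Cp.2 j1 = fst (sg (b * g)) /\
   forall a, ~~ has (mem Cp.1) (H a) ->
      (forall j u, u \in H a -> u \in V j -> index u (V j) < Cp.2 j) \/
      (forall j u, u \in H a -> u \in V j -> Cp.2 j <= index u (V j))).
  case: (posnP b) => [->|b0]; first by exists (set0, fun=> 0); rewrite cards0.
  have g0 : 0 < g by apply: leq_ltn_trans gv.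
  have bA : b * g < #|A| by have := bg b 0 g0; rewrite addn0.
  have := LA _ bA; rewrite -/(sg (b * g)) => aA.
  have f0 : 0 < fst (sg (b * g)).
    by apply: leq_ltn_trans (lt_fst 0 (b * g) _ bA) => //; rewrite muln_gt0 b0.
  have lt : fst (sg (b * g)) < size (V j1) by rewrite -has_find; apply: hA.
  have [x [q [E _ un _ _]]] := tpathE (tV j1).
  pose w := nth x (V j1) (fst (sg (b * g))).-1; pose z := nth x (V j1) (fst (sg (b * g))).
  have wz : infix [:: w; z] (V j1).
    apply/infixP; exists (take (fst (sg (b * g))).-1 (V j1)), (drop (fst (sg (b * g))).+1 (V j1)).
    rewrite /= -{1}(cat_take_drop (fst (sg (b * g))).-1 (V j1)); congr (_ ++ _).
    rewrite (drop_nth x); last by apply: leq_trans lt; rewrite ltnS leq_pred.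
    by rewrite prednK // (drop_nth x).
  have zH : z \in H (sg (b * g)) by apply: (nth_find x (hA _ aA)).
  have wH : w \notin H (sg (b * g)).
    by have := @before_find _ x (mem (H (sg (b * g)))) (V j1) (fst (sg (b * g))).-1; rewrite prednK // leqnn => /(_ isT) hf; apply: negbT; exact: hf.
  (* [z] is the first vertex of [V j1] on its path of [H], so its predecessor [w] is not on that
     path, and [z] is on no other path of [H]. *)
  have nwz : ~~ hedge w z.
    apply/existsPn => c; apply/negP => /infix2_mem[wc zc].
    by move: wH; rewrite (dH zH zc) wc.
  have [C [pos [ltC pj sep]]] := cut wz nwz.
  exists (C, pos); split=> [|_]; first exact: ltnW.
  by split=> //; rewrite /= pj index_uniq.
have [Cp CpP] := boolp.choice cb; pose C := \bigcup_(b < s.+1) (Cp b).1.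
(* All the cuts together have at most [s.+1 * v] vertices, so among the [g] disjoint paths of a
   group one avoids them all. *)
have cC : #|C| < g.
  apply: leq_ltn_trans gv; rewrite -[s.+1]card_ord; apply: card_bigcup_le => b.
  by case: (CpP b).
have ib (b : 'I_s.+1) : exists i : 'I_g, ~~ has (mem C) (H (sg (b * g + i))).
  apply: avoid_set; last by rewrite card_ord.
  move=> i i' u ui ui'; have e := dH ui ui'; apply: val_inj => /=.
  have := bg b _ (ltn_ord i); have := bg b _ (ltn_ord i'); rewrite -!sL => h1 h2.
  have /eqP : sg (b * g + i) = sg (b * g + i') by [].
  by rewrite nth_uniq ?sort_uniq ?enum_uniq // eqn_add2l => /eqP.
have [iota iP] := boolp.choice ib.
have tA (b : 'I_s.+1) : sg (b * g + iota b) \in A by apply/LA/bg.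
exists (fun b : 'I_s.+1 => sg (b * g + iota b)); split=> // i b j u u' lt uH uV uH' uV'.
have [_ [|pj sep]] := CpP b; first by apply: leq_ltn_trans lt.
have avoid (c : 'I_s.+1) : ~~ has (mem (Cp b).1) (H (sg (c * g + iota c))).
  apply: contra (iP c); apply: sub_has => y yC; apply/bigcupP; by exists b.
have g0 : 0 < g by apply: leq_ltn_trans gv.
have bA : b * g < #|A| by have := bg b 0 g0; rewrite addn0.
have l1 : fst (sg (i * g + iota i)) < (Cp b).2 j1.
  rewrite pj; apply: lt_fst => //; apply: leq_trans (_ : i.+1 * g <= _); last by rewrite leq_mul2r lt orbT.
  by rewrite mulSn addnC ltn_add2r.
have l2 : (Cp b).2 j1 <= fst (sg (b * g + iota b)).
  rewrite pj; case: (posnP (iota b)) => [->|i0]; first by rewrite addn0.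
  by apply/ltnW/lt_fst; [rewrite -[X in X < _]addn0 ltn_add2l | apply: bg].
have [w wH [wV iw]] := fstP _ (tA i); have [w' wH' [wV' iw']] := fstP _ (tA b).
case: (sep _ (avoid i)) => s1; last by have := s1 _ _ wH wV; rewrite leqNgt iw l1.
case: (sep _ (avoid b)) => s2; first by have := s2 _ _ wH' wV'; rewrite ltnNge iw' l2.
exact: leq_trans (s1 _ _ uH uV) (s2 _ _ uH' uV').
Qed.

End Order.

(** * Brick graphs as minors of ordered segments *)

Section Brick.
Variables r n : nat.

(* The parity is that of [Gamma] shifted by two rows and three columns. *)
Definition barc (x y : 'I_r * 'I_n) : bool :=
  (y.1 == x.1 :> nat) && (y.2 == x.2.+1 :> nat) ||
  [&& y.1 == x.1.+1 :> nat, y.2 == x.2 :> nat & odd (x.1 + x.2)].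

Definition bedge x y := barc x y || barc y x.

Lemma bedge_sym : symmetric bedge. Proof. by move=> x y; rewrite /bedge orbC. Qed.
Lemma bedge_irrefl : irreflexive bedge.
Proof. by move=> x; rewrite /bedge /barc !(ltn_eqF (ltnSn _)) andbF. Qed.

Definition brick := SGraph bedge_sym bedge_irrefl.
End Brick.

Lemma pigeon (I C : finType) (phi : I -> C) (A : {set I}) m : m * #|C| < #|A| ->
  exists c, m < #|[set i in A | phi i == c]|.
Proof.
move=> lt; apply: contrapT => no.
have le c : #|[set i in A | phi i == c]| <= m by rewrite leqNgt; apply/negP => h; apply: no; exists c.
move: lt; rewrite ltnNge => /negP[]; rewrite -sum1_card (partition_big phi predT) //=.
apply: leq_trans (_ : \sum_(c : C) m <= _); last by rewrite sum_nat_const mulnC.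
by apply: leq_sum => c _; apply: leq_trans (le c); rewrite -sum1_card leq_eqVlt; apply/orP; left; apply/eqP/eq_bigl => i; rewrite in_set.
Qed.

Section Slabs.
Variables (N : sgraph) (r n : nat) (seg : nat -> nat -> {set N}) (R : nat -> {set N}).
Hypothesis S0 : forall i a, i < r -> a < n * r -> seg i a != set0.
Hypothesis S1 : forall i a, i < r -> a < n * r -> cset (seg i a).
Hypothesis S2 : forall i i' a a' u, i < r -> i' < r -> a < n * r -> a' < n * r ->
  u \in seg i a -> u \in seg i' a' -> i = i' /\ a = a'.
Hypothesis S3 : forall i a b u, i < r -> a < n * r -> b < n * r -> u \in R a -> u \in seg i b -> False.
Hypothesis S3' : forall a b u, a < n * r -> b < n * r -> u \in R a -> u \in R b -> a = b.
Hypothesis S4 : forall i a, i < r -> a.+1 < n * r -> exists x y, [/\ x \in seg i a, y \in seg i a.+1 & x -- y].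
Hypothesis S5 : forall i a, i.+1 < r -> a < n * r ->
  exists u w, [/\ u \in seg i a, w \in seg i.+1 a & conn (u |: (w |: R a)) u w].

(* Column [j] consists of the slabs [j * r + i], [i < r]; slab [j * r + i] carries the
   rung between rows [i] and [i.+1]. *)
Lemma grid_of_slabs : exists X : brick r n -> {set N}, model X.
Proof.
have [->|n0] := posnP n.
  by exists (fun=> set0); split=> [[i [j]]|[i [j]]|[i [j]]].
have [->|r0] := posnP r.
  by exists (fun=> set0); split=> [[[i] j]|[[i] j]|[[i] j]].
have lt i j : i < r -> j < n -> j * r + i < n * r.
  move=> li lj; apply: leq_trans (_ : j.+1 * r <= _); last by rewrite leq_mul2r lj orbT.
  by rewrite mulSn addnC ltn_add2r.
have dj j j' i i' : i < r -> i' < r -> j * r + i = j' * r + i' -> j = j' /\ i = i'.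
  move=> l l' e; have ej : j = j'.
    by move: (congr1 (divn^~ r) e); rewrite !divnMDl // !divn_small // !addn0.
  by subst j'; split=> //; move/addnI: e.
have /set0Pn[x0 _] := S0 r0 (lt 0 0 r0 n0).
have uex (ia : nat * nat) : exists u, ia.1.+1 < r -> ia.2 < n * r -> exists w, [/\ u \in seg ia.1 ia.2, w \in seg ia.1.+1 ia.2 & conn (u |: (w |: R ia.2)) u w].
  case: ia => i a /=; have [li|li] := boolP (i.+1 < r); last by exists x0.
  have [la|la] := boolP (a < n * r); last by exists x0.
  by have [u [w h]] := S5 li la; exists u => _ _; exists w.
have [u0 u0P] := boolp.choice uex; pose uu i a := u0 (i, a).
(* The part of the rung that is reached from [uu i a] through [R a] joins the branch set of row [i];
   the vertex after it lies in row [i.+1]. Each slab carries one rung only, so these parts do not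
   meet. *)
pose D i a := if i.+1 < r then ccomp (uu i a |: R a) (uu i a) else set0.
pose B i j m := \bigcup_(k < m) seg i (j * r + k).
pose X (x : brick r n) := B x.1 x.2 r :|: D x.1 (x.2 * r + x.1).
have Bc i j m : i < r -> j < n -> 0 < m -> m <= r -> cset (B i j m).
  move=> li lj; elim: m => // -[_ _ _|m IH _ lm].
    by rewrite /B big_ord1 addn0; apply: S1 => //; have := lt 0 j r0 lj; rewrite addn0.
  have l1 : j * r + m.+1 < n * r by apply: lt.
  rewrite /B big_ord_recr /=; have [|x [y [xs ys xy]]] := @S4 i (j * r + m) li; first by rewrite -addnS.
  apply: (@csetU _ _ _ x y); [apply: IH => //; exact: ltnW | exact: S1 | | by rewrite addnS | by rewrite xy orbT].
  by apply/bigcupP; exists ord_max.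
have DS i a u : i.+1 < r -> a < n * r -> u \in D i a -> u = uu i a \/ u \in R a.
  rewrite /D => -> _ /(subsetP (comp_sub _ _)); rewrite in_setU1 => /orP[/eqP|]; by [left|right].
have Xs x u : u \in X x -> (exists2 k, k < r & u \in seg x.1 (x.2 * r + k)) \/ u \in R (x.2 * r + x.1).
  rewrite in_setU => /orP[/bigcupP[k _ uk]|uD]; first by left; exists k.
  have l1 : x.1.+1 < r by move: uD; rewrite /D; case: ifP => //; rewrite in_set0.
  have l2 := lt _ _ (ltn_ord x.1) (ltn_ord x.2).
  case: (DS _ _ _ l1 l2 uD) => [->|]; [left | by right].
  by exists x.1 => //; have [w []] := u0P (x.1 : nat, x.2 * r + x.1) l1 l2.
have sX (x : brick r n) k u : k < r -> u \in seg x.1 (x.2 * r + k) -> u \in X x.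
  by move=> lk us; rewrite in_setU; apply/orP; left; apply/bigcupP; exists (Ordinal lk).
exists X; split.
- move=> x; have l2 := lt _ _ (ltn_ord x.1) (ltn_ord x.2); split.
    have /set0Pn[u us] := S0 (ltn_ord x.1) l2; apply/set0Pn; exists u.
    exact: sX us.
  rewrite /X /D; case: ifP => l1; last by rewrite setU0; apply: Bc.
  have [w [us _ _]] := u0P (x.1 : nat, x.2 * r + x.1) l1 l2.
  apply: (@csetU _ _ _ (uu x.1 (x.2 * r + x.1)) (uu x.1 (x.2 * r + x.1))); rewrite ?eqxx ?cset_comp //.
  - exact: Bc.
  - by apply/bigcupP; exists x.1.
  - by apply: mem_comp; rewrite setU11.
- move=> x y xy; apply/disjP => u ux uy; move/eqP: xy; apply.
  have key (x' y' : brick r n) : x'.1 = y'.1 :> nat -> x'.2 = y'.2 :> nat -> x' = y'.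
    by case: x' y' => [i j] [i' j'] /= /val_inj-> /val_inj->.
  have [lx ly] := (ltn_ord x.1, ltn_ord y.1).
  case: (Xs x u ux) (Xs y u uy) => [[k lk uk]|uR] [[k' lk' uk']|uR'].
  + have [e1 e2] := S2 lx ly (lt _ _ lk (ltn_ord _)) (lt _ _ lk' (ltn_ord _)) uk uk'.
    by apply: key => //; case: (dj _ _ _ _ lk lk' e2).
  + by case: (S3 lx (lt _ _ ly (ltn_ord _)) (lt _ _ lk (ltn_ord _)) uR' uk).
  + by case: (S3 ly (lt _ _ lx (ltn_ord _)) (lt _ _ lk' (ltn_ord _)) uR uk').
  + have e := S3' (lt _ _ lx (ltn_ord _)) (lt _ _ ly (ltn_ord _)) uR uR'.
    by have [e1 e2] := dj _ _ _ _ lx ly e; apply: key.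
have half (x y : brick r n) : barc x y -> exists a b, [/\ a \in X x, b \in X y & a -- b].
  case/orP.
    case/andP=> /eqP e1 /eqP e2; have l : (x.2 * r + r.-1).+1 < n * r.
      by rewrite -addnS prednK // addnC -mulSn -e2; have := lt 0 y.2 r0 (ltn_ord _); rewrite addn0.
    have [a [b [ax by' ab]]] := S4 (ltn_ord x.1) l; exists a, b; split=> //.
      by apply: sX ax; rewrite ltn_predL.
    move: by'; rewrite -addnS prednK // addnC -mulSn -e2 -e1 -[_ * r]addn0 => by'; exact: sX by'.
  case/and3P=> /eqP e1 /eqP e2 _.
  have l1 : x.1.+1 < r by rewrite -e1.
  have l2 := lt _ _ (ltn_ord x.1) (ltn_ord x.2).
  have [w [us ws cn]] := u0P (x.1 : nat, x.2 * r + x.1) l1 l2.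
  rewrite [(_, _).1]/= [(_, _).2]/= in us ws cn.
  have wy : w \in X y by move: ws; rewrite -e1 -e2 => ws; apply: sX ws.
  set U := u0 _ in us cn.
  have [||p [q [pC qC pS qS pq]]] := conn_exit cn (P := mem (ccomp (U |: R (x.2 * r + x.1)) U)).
  - by rewrite /= mem_comp ?setU11.
  - apply/negP => /(subsetP (comp_sub _ _)); rewrite in_setU1 => /orP[/eqP e|wR].
      by subst w; have [/eqP] := S2 (ltn_ord x.1) l1 l2 l2 us ws; rewrite ltn_eqF.
    exact: (S3 l1 l2 l2 wR ws).
  have qw : q = w.
    move: qS; rewrite !in_setU !in_set1 => /or3P[/eqP e|/eqP//|qR].
      by move: qC; rewrite e /= mem_comp ?setU11.
    by move: qC; rewrite /= (comp_step pC _ pq) // in_setU1 qR orbT.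
  exists p, w; split=> //; last by rewrite -qw.
  rewrite /X in_setU; apply/orP; right; rewrite /D l1; exact: pC.
move=> x y /orP[/half//|/half[a [b [? ? ab]]]]; exists b, a; split=> //; by rewrite sedge_sym.
Qed.
End Slabs.

Lemma card_bigcup_in (T I : finType) (A : {set I}) (F : I -> {set T}) m : (forall i, i \in A -> #|F i| <= m) ->
  #|\bigcup_(i in A) F i| <= #|A| * m.
Proof.
move=> le; rewrite -sum_nat_const; elim/big_ind2: _ => [|B a C b h1 h2|i iA]; rewrite ?cards0 //; last exact: le.
exact: leq_trans (leq_card_setU _ _) (leq_add h1 h2).
Qed.

(** Room for up to [r] components below the bound for [m'], for the vertex whose deletion produces
    them, and one more to force a component of at least that bound. *)
Fixpoint chain_size r m := if m is m'.+1 then r * chain_size r m' + 2 else 1.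

(** If [x] has fewer than [r] neighbours in [S], its deletion leaves fewer than [r] components, each
    containing a neighbour of [x]; a large component carries the rest of the path, started at that
    neighbour. *)
Lemma chain (G : sgraph) r m (S : {set G}) x : cset S -> x \in S -> chain_size r m <= #|S| ->
  (exists p, [/\ path sedge x p, uniq (x :: p), {subset x :: p <= S} & size p = m]) \/
  exists2 c, c \in S & r <= #|neighb c :&: S|.
Proof.
elim: m S x => [|m IH] S x cS xS; first by left; exists [::]; split=> // u; rewrite mem_seq1 => /eqP->.
rewrite [chain_size _ _]/= => le.
have [ler|ltr] := leqP r #|neighb x :&: S|; first by right; exists x.
pose C y := ccomp (S :\ x) y.
have cov : S :\ x \subset \bigcup_(y in neighb x :&: S) C y.
  apply/subsetP => u uS; have := uS; rewrite in_setD1 => /andP[ux uS'].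
  have := csetE cS uS' xS => /conn_exit/(_ (mem_comp uS : u \in mem (C u))).
  case; first by apply/negP => /(subsetP (comp_sub _ _)); rewrite in_setD1 eqxx.
  move=> p [q [pC qC pS qS pq]]; have qx : q = x.
    apply: contrapT => /eqP qx; move: qC; rewrite /= (comp_step pC _ pq) // in_setD1 qx //.
  apply/bigcupP; exists p; first by rewrite in_setI in_set -qx sedge_sym pq.
  have : conn (S :\ x) u p by move: pC; rewrite /= in_set => /andP[].
  by rewrite /C => /comp_eq <-; apply: mem_comp.
have [/existsP[y /andP[yN ly]]|/existsPn no] := boolP [exists y, (y \in neighb x :&: S) && (chain_size r m <= #|C y|)].
  have /andP[xy yS] : (x -- y) && (y \in S) by move: yN; rewrite in_setI in_set.
  have yS' : y \in S :\ x by rewrite in_setD1 yS andbT eq_sym sedge_neq.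
  have CS : C y \subset S :\ x by apply: comp_sub.
  case: (IH (C y) y (cset_comp _ _) (mem_comp yS') ly) => [[p [pp up sp sz]]|[c cC lc]].
    left; exists (y :: p); split=> /=; rewrite ?xy ?sz //.
      rewrite (up : (y \notin p) && uniq p) andbT.
      by apply/negP => /sp/(subsetP CS); rewrite in_setD1 eqxx.
    move=> u; rewrite in_cons => /orP[/eqP->//|/sp/(subsetP CS)].
    by rewrite in_setD1 => /andP[].
  have CS' : C y \subset S by apply: subset_trans CS (subsetDl _ _).
  right; exists c; first exact: (subsetP CS').
  by apply: leq_trans lc _; apply/subset_leq_card/setIS.
have : #|S :\ x| <= #|neighb x :&: S| * chain_size r m.
  apply: leq_trans (subset_leq_card cov) (card_bigcup_in _) => y yN.
  by have := no y; rewrite yN -ltnNge => /ltnW.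
have := cardsD1 x S; rewrite xS => e.
have := leq_mul (ltnW ltr) (leqnn (chain_size r m)).
by move: le e; set a := r * _; set b := _ * chain_size r m; lia.
Qed.

Lemma nth_infix (T : eqType) (x : T) s k : k.+1 < size s -> infix [:: nth x s k; nth x s k.+1] s.
Proof.
move=> lt; apply/infixP; exists (take k s), (drop k.+2 s).
by rewrite -[LHS](cat_take_drop k) (drop_nth x (ltnW lt)) (drop_nth x lt).
Qed.

Lemma sorted_enum_ord s (A : {set 'I_s}) : sorted (relpre val ltn) (enum A).
Proof.
have -> : enum A = filter (mem A) (enum 'I_s) by rewrite enumT.
apply: sorted_filter; first by move=> a b c; apply: ltn_trans.
by rewrite -sorted_map val_enum_ord iota_ltn_sorted.
Qed.

(** * Rungs between paths that are crossed in a common order *)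

Section Rungs.
Variables (N : sgraph) (r n v s : nat) (V : 'I_v -> seq N) (J : {set 'I_v}) (K : 'I_s -> seq N).
Hypothesis eV : forall j x y, infix [:: x; y] (V j) -> x -- y.
Hypothesis uV : forall j, uniq (V j).
Hypothesis dV : disjp V.
Hypothesis cK : forall i, cset [set u in K i].
Hypothesis dK : disjp K.
Hypothesis mK : forall i j, j \in J -> has (mem (K i)) (V j).
Hypothesis ord : forall (i i' : 'I_s) j u u', i < i' -> u \in K i -> u \in V j -> u' \in K i' -> u' \in V j ->
  index u (V j) < index u' (V j).
Hypothesis bigJ : chain_size r r <= #|J|.
Hypothesis bigS : n * r * #|{set 'I_v * 'I_v}| < s.

Let VJ := [set u | [exists j in J, u \in V j]].

(** A rung inside [K i] from one path to another whose inner vertices avoid all paths indexed by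
    [J]. *)
Let tpair i (p : 'I_v * 'I_v) := [&& p.1 \in J, p.2 \in J, p.1 != p.2 &
  [exists u, exists w, [&& u \in K i, u \in V p.1, w \in K i, w \in V p.2 &
     conn (u |: (w |: ([set z in K i] :\: VJ))) u w]]].

(** A shortest path inside the connected set [K i] from the paths in [C] to the other paths of [J]
    is a rung. Hence the pairs joined by rungs form a connected graph on [J]. *)
Lemma J_exit i (C : {set 'I_v}) x y : C \subset J -> x \in C -> y \in J -> y \notin C ->
  exists j j', [/\ j \in C, j' \in J, j' \notin C & tpair i (j, j')].
Proof.
move=> CJ xC yJ yC; have xJ := subsetP CJ x xC.
have /hasP[u0 u0V u0K] := mK i xJ; have /hasP[w0 w0V w0K] := mK i yJ.
pose A := [set u | [exists j in C, u \in V j]]; pose B := [set u | [exists j in J :\: C, u \in V j]].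
have u0S : u0 \in [set u in K i] by rewrite in_set.
have w0S : w0 \in [set u in K i] by rewrite in_set.
have [||x1 [p [ip sub x1A lB [HA HB]]]] := @short_path _ _ A B _ _ (csetE (cK i) u0S w0S) u0S.
- by rewrite in_set; apply/existsP; exists x; rewrite xC u0V.
- by rewrite in_set; apply/existsP; exists y; rewrite in_setD yC yJ w0V.
have := x1A; rewrite in_set => /existsP[j /andP[jC x1j]].
have := lB; rewrite in_set => /existsP[j' /andP[]]; rewrite in_setD => /andP[j'C j'J] lj'.
exists j, j'; split=> //; rewrite /tpair /= j'J (subsetP CJ) //=; apply/andP; split.
  by apply: contraNneq j'C => <-.
apply/existsP; exists x1; apply/existsP; exists (last x1 p).
have := sub _ (mem_head _ _); rewrite in_set => ->; have := sub _ (mem_last _ _); rewrite in_set => ->.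
rewrite x1j lj' /=; apply: path_conn; first exact: ich_path.
move=> u us; rewrite !in_setU !in_set1.
have [//|ux] := eqVneq u x1; have [//|ul] := eqVneq u (last x1 p).
rewrite in_setD (sub u us) andbT /= in_set; apply/existsP => -[k /andP[kJ uk]].
have [kC|kC] := boolP (k \in C).
  have up : u \in p by move: us; rewrite in_cons (negPf ux).
  by have := HA u up; rewrite in_set => /existsP[]; exists k; rewrite kC uk.
have uB : u \in B by rewrite in_set; apply/existsP; exists k; rewrite in_setD kC kJ uk.
by move/eqP: ul; apply; apply: last_only HB us uB.
Qed.

(** A common graph of pairs, shared by many of the sets [K i], is connected and large, so it
    contains a long path or a large star. Its vertices, or the leaves of the star, become the rows,
    and every slab between two consecutive sets offers a rung for each pair of consecutive rows. *)
Lemma rungs_grid : exists X : brick r n -> {set N}, model X.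
Proof.
have [->|r0] := posnP r.
  by exists (fun=> set0); split=> [[[i] j]|[[i] j]|[[i] j]].
pose T i := [set p | tpair i p].
(* Keep more than [n * r] of the sets [K i] with the same pairs: [n * r] slabs need one further set
   to end the last of them. *)
have [|c cP] := @pigeon _ _ T setT (n * r); first by rewrite cardsT card_ord.
set A := [set i in _ | _] in cP.
have [i0 i0A] : exists i0, i0 \in A by apply/set0Pn; rewrite -card_gt0; apply: leq_ltn_trans cP.
have AT i : i \in A -> T i = c by rewrite !inE => /eqP.
pose al a := nth i0 (enum A) a.
have szA : size (enum A) = #|A| by rewrite -cardE.
have alA a : al a \in A.
  have [lt|ge] := ltnP a (size (enum A)); first by rewrite -mem_enum mem_nth.
  by rewrite /al nth_default.
have al_lt a b : a < b -> b <= n * r -> al a < al b.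
  move=> ab bl; have lb : b < size (enum A) by rewrite szA; apply: leq_ltn_trans bl cP.
  have tr : transitive (relpre (@nat_of_ord s) ltn) by move=> ? ? ?; apply: ltn_trans.
  have := sorted_ltn_nth tr i0 (sorted_enum_ord A) (a) (b).
  by rewrite !inE => /(_ (ltn_trans ab lb) lb ab).
pose te (j j' : 'I_v) := ((j, j') \in c) || ((j', j) \in c).
have te_sym : symmetric te by move=> j j'; rewrite /te orbC.
have te_irr : irreflexive te.
  by move=> j; rewrite /te orbb -(AT _ i0A) in_set /tpair /= eqxx !andbF.
pose TG := SGraph te_sym te_irr.
have teP (j j' : 'I_v) a : te j j' -> [/\ j \in J, j' \in J & exists u w, [/\ u \in K (al a), u \in V j, w \in K (al a), w \in V j' & conn (u |: (w |: ([set z in K (al a)] :\: VJ))) u w]].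
  rewrite /te -(AT _ (alA a)) !in_set => /orP[]/and4P[/= -> -> _ /existsP[u /existsP[w /and5P[h1 h2 h3 h4 h5]]]].
    by split=> //; exists u, w.
  by split=> //; exists w, u; split=> //; rewrite conn_sym setUCA.
have cJ : @cset TG J.
  apply/(@csetP TG) => x y xJ yJ; rewrite -/(@conn TG J x y); apply: contrapT => nc.
  pose C := [set j in J | @conn TG J x j].
  have xC : x \in C by rewrite in_set xJ; apply: (@conn0 TG).
  have yC : y \notin C by rewrite in_set yJ; apply/negP.
  have CJ : C \subset J by apply/subsetP => j; rewrite in_set => /andP[].
  have [j [j' [jC j'J j'C tj]]] := J_exit i0 CJ xC yJ yC.
  move/negP: j'C; apply; rewrite in_set j'J; move: jC; rewrite in_set => /andP[jJ cj].
  apply: (@conn_trans TG) cj _; apply: (@conn1 TG) => //.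
  by rewrite /= /te -(AT _ i0A) in_set tj.
have [x xJ] : exists x, x \in J.
  by apply/set0Pn; rewrite -card_gt0; apply: leq_trans bigJ; case: (r) => //= r'; rewrite addn2.
have [rho [rJ rinj rP]] : exists rho : nat -> 'I_v, [/\ forall i, i < r -> rho i \in J,
   forall i i', i < r -> i' < r -> rho i = rho i' -> i = i' &
   (forall i, i.+1 < r -> te (rho i) (rho i.+1)) \/
   exists c', c' \in J /\ forall i, i < r -> rho i != c' /\ te (rho i) c'].
  have [[p [pp up sp sz]]|[c' c'J lc]] := @chain TG r r J x cJ xJ bigJ.
    have szp i : i < r -> i < size (x :: p) by move=> li; rewrite /= sz ltnS ltnW.
    exists (nth x (x :: p)); split.
    - by move=> i /szp/mem_nth-/(_ x)/sp.
    - by move=> i i' /szp li /szp li' /eqP; rewrite nth_uniq // => /eqP.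
    - by left=> i /szp; rewrite /= ltnS => li; apply: (pathP x pp).
  exists (nth c' (enum (@neighb TG c' :&: J))).
  have szp i : i < r -> i < size (enum (@neighb TG c' :&: J)) by rewrite -cardE => li; apply: leq_trans lc.
  have mN i : i < r -> te c' (nth c' (enum (@neighb TG c' :&: J)) i) && (nth c' (enum (@neighb TG c' :&: J)) i \in J).
    by move=> /szp/mem_nth-/(_ c'); rewrite mem_enum in_setI in_set.
  split.
  - by move=> i /mN/andP[].
  - by move=> i i' /szp li /szp li' /eqP; rewrite nth_uniq ?enum_uniq // => /eqP.
  right; exists c'; split=> // i /mN/andP[tc _]; rewrite te_sym tc; split=> //.
  by apply: contraTneq tc => ->; rewrite te_irr.
(* A slab of [V j] runs from the first vertex on one chosen set to just before the first vertex on
   the next. By [ord] it contains every vertex of [V j] on the former, which is [F] below. *)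
pose pos a j := find (mem (K (al a))) (V j).
pose segj j a := [set u in V j | pos a j <= index u (V j) < pos a.+1 j].
have posP a j : j \in J -> exists u, [/\ u \in K (al a), u \in V j & index u (V j) = pos a j].
  move=> jJ; have ha := mK (al a) jJ; have /hasP[x0 _ _] := ha.
  have lt : pos a j < size (V j) by rewrite -has_find.
  exists (nth x0 (V j) (pos a j)); split; rewrite ?mem_nth ?index_uniq //.
  exact: (nth_find x0 ha).
have pos_le a j u : u \in K (al a) -> u \in V j -> pos a j <= index u (V j).
  move=> uK uj; rewrite leqNgt; apply/negP => /(before_find u).
  by rewrite nth_index // /= uK.
have pos_lt a b j : j \in J -> a < b -> b <= n * r -> pos a j < pos b j.
  move=> jJ ab bl; have [u [uK uj <-]] := posP a j jJ; have [w [wK wj <-]] := posP b j jJ.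
  exact: ord (al_lt a b ab bl) uK uj wK wj.
have F a j u : j \in J -> a < n * r -> u \in K (al a) -> u \in V j -> u \in segj j a.
  move=> jJ la uK uj; rewrite in_set uj pos_le //=; have [w [wK wj <-]] := posP a.+1 j jJ.
  exact: ord (al_lt a a.+1 (ltnSn a) la) uK uj wK wj.
have segI j a b u : j \in J -> a < n * r -> b < n * r -> u \in segj j a -> u \in segj j b -> a = b.
  move=> jJ la lb; rewrite !in_set => /andP[_ /andP[h1 h2]] /andP[_ /andP[h3 h4]].
  have no c1 c2 : c1 < c2 -> c2 < n * r -> pos c2 j <= index u (V j) -> index u (V j) < pos c1.+1 j -> False.
    move=> cc lc h5 h6; have : pos c1.+1 j <= pos c2 j.
      by move: cc; rewrite leq_eqVlt => /orP[/eqP->//|cc]; apply/ltnW/pos_lt => //; exact: ltnW.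
    by rewrite leqNgt (leq_ltn_trans h5 h6).
  by case: (ltngtP a b) => // h; [case: (no a b) | case: (no b a)].
have segc j a : j \in J -> a < n * r -> cset (segj j a).
  move=> jJ la; have [u0 [_ u0j iu0]] := posP a j jJ; apply: (@cset_star _ _ u0) => w.
  rewrite in_set => /andP[wj /andP[h1 h2]].
  have hs : pos a.+1 j <= size (V j) by apply: find_size.
  suff H d : pos a j + d < pos a.+1 j -> conn (segj j a) u0 (nth u0 (V j) (pos a j + d)).
    by have := H (index w (V j) - pos a j); rewrite subnKC // nth_index // => ->.
  have ms k : pos a j <= k -> k < pos a.+1 j -> nth u0 (V j) k \in segj j a.
    by move=> k1 k2; have lk : k < size (V j) by [apply: leq_trans hs]; rewrite in_set mem_nth // index_uniq // k1 k2.
  elim: d => [|d IH] ld; first by rewrite addn0 -iu0 nth_index // conn0.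
  have ld' : pos a j + d < pos a.+1 j by apply: leq_ltn_trans ld; rewrite leq_add2l.
  apply: conn_trans (IH ld') (conn1 (ms _ _ _) (ms _ _ _) _) => //; rewrite ?leq_addr //.
  by rewrite addnS in ld *; apply: (@eV j); apply: nth_infix; apply: leq_trans hs.
(* The room for rungs in slab [a]. It includes the segments of the paths that are not rows, since in
   the case of a star the rungs run along the centre. *)
pose R a := ([set u in K (al a)] :|: \bigcup_(j in J) segj j a) :\: [set u | [exists i : 'I_r, u \in V (rho i)]].
have Rin a u : u \in R a -> (u \in K (al a) \/ exists2 j, j \in J & u \in segj j a) /\ forall i, i < r -> u \notin V (rho i).
  rewrite in_setD in_set in_setU => /andP[/existsPn no h]; split; last by move=> i li; apply: (no (Ordinal li)).
  by case/orP: h => [|/bigcupP[j jJ uj]]; [rewrite in_set; left | right; exists j].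
have inR a u : (u \in K (al a) \/ exists2 j, j \in J & u \in segj j a) -> (forall i, i < r -> u \notin V (rho i)) -> u \in R a.
  move=> h no; rewrite in_setD in_set in_setU; apply/andP; split; first by apply/existsPn => i; apply: no.
  case: h => [uK|[j jJ uj]]; first by rewrite in_set uK.
  by apply/orP; right; apply/bigcupP; exists j.
have segV j a u : u \in segj j a -> u \in V j by rewrite in_set => /andP[].
apply: (@grid_of_slabs _ _ _ (fun i a => segj (rho i) a) R).
- move=> i a li la; have [u [uK uj _]] := posP a _ (rJ i li); apply/set0Pn; exists u.
  by apply: F => //; apply: rJ.
- by move=> i a li la; apply/segc => //; apply: rJ.
- move=> i i' a a' u li li' la la' us us'; have e := dV (segV _ _ _ us) (segV _ _ _ us').
  have ei := rinj _ _ li li' e; subst i'; split=> //; exact: segI (rJ i li) la la' us us'.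
- by move=> i a b u li _ _ /Rin[_ /(_ i li) no] /segV; apply/negP.
- move=> a b u la lb /Rin[h1 _] /Rin[h2 _].
  have h c1 c2 : c1 < n * r -> c2 < n * r -> u \in K (al c1) -> (exists2 j, j \in J & u \in segj j c2) -> c1 = c2.
    move=> l1 l2 uK [j jJ uj]; apply: (segI j _ _ u) => //; exact: F (segV _ _ _ uj).
  case: h1 h2 => [k1|s1] [k2|s2].
  + have e := dK k1 k2; case: (ltngtP a b) => // ab; first by have := al_lt a b ab (ltnW lb); rewrite e ltnn.
    by have := al_lt b a ab (ltnW la); rewrite e ltnn.
  + exact: h.
  + by symmetry; apply: h.
  + case: s1 s2 => [j jJ uj] [j' j'J uj']; have e := dV (segV _ _ _ uj) (segV _ _ _ uj'); subst j'.
    exact: segI uj uj'.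
- move=> i a li la; have jJ := rJ i li; have [y [yK yj iy]] := posP a.+1 _ jJ.
  have [x0 [x0K x0j ix]] := posP a _ jJ.
  have lt := pos_lt a a.+1 _ jJ (ltnSn a) (ltnW la).
  have p0 : 0 < pos a.+1 (rho i) by apply: leq_ltn_trans lt.
  have ly : pos a.+1 (rho i) < size (V (rho i)) by rewrite -iy index_mem.
  exists (nth y (V (rho i)) (pos a.+1 (rho i)).-1), y; split.
  + have l1 : (pos a.+1 (rho i)).-1 < size (V (rho i)) by apply: leq_ltn_trans ly; apply: leq_pred.
    by rewrite in_set mem_nth // index_uniq //= prednK // leqnn andbT -ltnS prednK.
  + exact: F.
  + have := @nth_infix _ y (V (rho i)) (pos a.+1 (rho i)).-1; rewrite prednK // => /(_ ly)/eV.
    have -> : nth y (V (rho i)) (pos a.+1 (rho i)) = y by rewrite -iy nth_index.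
    by [].
move=> i a li la; have li' := ltnW li.
have VJin : forall u, u \in [set z in K (al a)] :\: VJ -> u \in R a.
  move=> u /setDP[uK no]; apply: inR; first by left; rewrite in_set in uK.
  rewrite in_set in no.
  by move=> k lk; apply: contra no => uk; apply/existsP; exists (rho k); rewrite rJ.
case: rP => [/(_ i li)/teP-/(_ a)[j1 j2 [u [w [uK uj wK wj cn]]]]|[c' [c'J cP']]].
  exists u, w; split; [exact: F | exact: F |].
  by apply: connS cn; apply/setUS/setUS/subsetP.
(* In a star, the rung goes through [K (al a)] to the centre [c'], along the segment of the centre,
   and through [K (al a)] again to the next row. *)
have [n1 /teP-/(_ a)[j1 _ [u [w [uK uj wK wj cn]]]]] := cP' i li'.
have [n2 /teP-/(_ a)[j2 _ [u' [w' [uK' uj' wK' wj' cn']]]]] := cP' _ li.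
have cR z : z \in segj c' a -> z \in R a.
  move=> zs; apply: inR; first by right; exists c'.
  move=> k lk; apply/negP => zk; have [nk _] := cP' k lk.
  by move: nk; rewrite (dV zk (segV _ _ _ zs)) eqxx.
have ws : w \in segj c' a by apply: F.
have ws' : w' \in segj c' a by apply: F.
exists u, u'; split; [exact: F | exact: F |].
apply: (@conn_trans _ _ w).
  apply: connS cn; apply/setUS/subsetP => z; rewrite in_setU1 => /orP[/eqP->|/VJin zR].
    by rewrite in_setU cR ?orbT.
  by rewrite in_setU zR orbT.
apply: (@conn_trans _ _ w').
  apply: connS (csetE (segc _ _ c'J la) ws ws'); apply/subsetP => z /cR zR.
  by rewrite !in_setU zR !orbT.
rewrite conn_sym; apply: connS cn'; apply/subsetP => z; rewrite !in_setU.
case/or3P=> [/set1P->|/set1P->|/VJin->]; rewrite ?set11 ?orbT //.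
by rewrite cR ?orbT.
Qed.

End Rungs.

(** * One path for each pair, or a grid *)

Section Select.
Variables r n : nat.

Lemma min_linked (N : sgraph) (W Y Y' : {set N}) h v (H : 'I_h -> seq N) :
  linked (inS W) Y Y' v -> exists V : 'I_v -> seq N, [/\ forall j, tpath (inS W) Y Y' (V j), disjp V &
    forall V' : 'I_v -> seq N, (forall j, tpath (inS W) Y Y' (V' j)) -> disjp V' -> cost H V <= cost H V'].
Proof.
move=> [V0 [t0 d0]].
pose Q c := `[< exists V : 'I_v -> seq N, [/\ forall j, tpath (inS W) Y Y' (V j), disjp V & cost H V = c] >].
have ex : exists c, Q c by exists (cost H V0); apply/asboolP; exists V0.
case: (ex_minnP ex) => c /asboolP[V1 [tV1 dV1 cV1]] mn; exists V1; split=> // V' tV' dV'.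
by rewrite cV1; apply: mn; apply/asboolP; exists V'.
Qed.

Lemma path_inS (N : sgraph) (W : {set N}) x q : path (inS W) x q -> path sedge x q.
Proof. by apply: sub_path => a b /and3P[]. Qed.

Lemma list_cset (N : sgraph) (x : N) q : path sedge x q -> cset [set u in x :: q].
Proof.
move=> pq; apply: (@cset_star _ _ x) => y; rewrite in_set => yq.
case/splitPl: yq pq => q1 q2 lq; rewrite cat_path => /andP[p1 _]; rewrite -lq.
apply: path_conn => // u uq; rewrite in_set -cat_cons mem_cat uq; done.
Qed.

(* Take a linkage for the last pair.  Either one of its paths avoids many paths of all
   the other linkages, and we delete it, or many of its paths cross one other linkage,
   which was chosen with the fewest edges outside the first. *)
Lemma sel l : exists m, forall (N : sgraph) (W : {set N}) (Y Y' : nat -> {set N}),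
  (forall i, i < l -> Y i \subset W /\ linked (inS W) (Y i) (Y' i) m) ->
  (exists p : nat -> seq N, (forall i, i < l -> apath (inS W) (Y i) (Y' i) (p i) /\ {subset p i <= W}) /\
     forall i i' u, i < l -> i' < l -> u \in p i -> u \in p i' -> i = i') \/
  exists X : brick r n -> {set N}, model X.
Proof.
elim: l => [|l [n' IH]]; first by exists 0 => N W Y Y' _; left; exists (fun=> [::]).
(* Of [v] paths, either [n'] avoid a given path or [chain_size r r] meet it. Then [s] comes from
   [rungs_grid], [g] from [ordered], and the number [h] below makes [s.+1 * g] paths agree on a
   linkage and on the set of its paths that they meet. *)
pose v := n' + chain_size r r; pose s := n * r * #|{set 'I_v * 'I_v}|; pose g := (s.+1 * v).+1.
pose h := (s.+1 * g * #|{: 'I_l * {set 'I_v}}|).+1.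
exists (maxn v h) => N W Y Y' hY.
have YW i : i < l.+1 -> Y i \subset W by case/hY.
have [H [tH dH]] := linked_le (leq_maxr v h) (proj2 (hY l (ltnSn l))).
have WH a : {subset H a <= W}.
  by apply: (inW (W := W) (tH a)); [exact: YW | move=> x y /and3P[]].
have pH a x y : infix [:: x; y] (H a) -> x -- y.
  by have [z [q [-> pq _ _ _]]] := tpathE (tH a) => /(path_infix pq)/and3P[].
have Vex (i : 'I_l) : exists V : 'I_v -> seq N, [/\ forall j, tpath (inS W) (Y i) (Y' i) (V j), disjp V &
    forall V' : 'I_v -> seq N, (forall j, tpath (inS W) (Y i) (Y' i) (V' j)) -> disjp V' -> cost H V <= cost H V'].
  apply: min_linked; apply: linked_le (leq_maxl v h) (proj2 (hY i _)).
  by rewrite ltnS ltnW.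
have [V VP] := boolp.choice Vex.
pose met a i := [set j | has (mem (H a)) (V i j)].
(* A path that misses [n'] paths of every other linkage serves the last pair, and the induction
   continues in the complement of this path. *)
have [[a aP]|no] := EM (exists a, forall i, n' <= #|~: met a i|).
  pose W' := W :\: [set u in H a].
  have inW' u : u \in W' -> u \in W by rewrite in_setD => /andP[].
  have [|[p [pP dp]]|] := IH N W' (fun i => Y i :&: W') (fun i => Y' i :&: W'); last by right.
    move=> i li; split; first exact: subsetIr.
    have [tV dV _] := VP (Ordinal li); have le := aP (Ordinal li).
    exists (fun k => V (Ordinal li) (enum_val (widen_ord le k))); split; last first.
      by move=> k k' z zk zk'; have /enum_val_inj/(congr1 val) /= h1 := dV _ _ _ zk zk'; apply: val_inj.
    move=> k; set j := enum_val _; have jm : ~~ has (mem (H a)) (V (Ordinal li) j).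
      by have := enum_valP (widen_ord le k); rewrite in_setC in_set.
    have sub : {subset V (Ordinal li) j <= W'}.
      move=> u uV; rewrite in_setD in_set (inW (W := W) (tV j)) ?andbT //.
      - exact: (hasPn jm).
      - by apply: YW; rewrite ltnS ltnW.
      - by move=> x y /and3P[].
    have := tV j; rewrite /tpath; case: (V (Ordinal li) j) sub => // x q sub.
    case/andP=> /and4P[pq uq xA lB] /andP[nA nB].
    have m1 : path (inS W') x q.
      apply: (@sub_in_path _ (mem W') _ _ _ x q) pq; last by apply/allP.
      by move=> y z yW zW /and3P[_ _ yz]; apply/and3P.
    rewrite /apath m1 uq !in_setI xA lB !sub ?mem_head ?mem_last //=.
    apply/andP; split; [apply: contra nA | apply: contra nB]; apply: sub_has => y /=; rewrite in_setI => /andP[]//.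
  left; exists (fun i => if i == l then H a else p i); split.
    move=> i; rewrite ltnS leq_eqVlt; case: (eqVneq i l) => [-> _|il /= li].
      by split=> //; apply: tpath_ap.
    have [ap sub] := pP i li; split; last by move=> u /sub/inW'.
    move: ap; case: (p i) => // x q /and4P[pq uq]; rewrite !in_setI => /andP[xA _] /andP[lB _].
    rewrite /apath uq xA lB !andbT; apply: sub_path pq => y z /and3P[/inW' yW /inW' zW yz].
    exact/and3P.
  have key i u : i != l -> i < l.+1 -> u \in p i -> u \in H a -> False.
    move=> il; rewrite ltnS leq_eqVlt (negPf il) /= => li up uH; have [_ sub] := pP i li.
    by have := sub u up; rewrite in_setD in_set uH.
  move=> i i' u li li'; case: (eqVneq i l) => [->|il]; case: (eqVneq i' l) => [->|il'] // h1 h2.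
  - by case: (key i' u).
  - by case: (key i u).
  - by apply: dp h1 h2; [move: li | move: li']; rewrite ltnS leq_eqVlt ?(negPf il) ?(negPf il').
right; have aex a : exists i, chain_size r r <= #|met a i|.
  apply: contrapT => ni; apply: no; exists a => i; have := cardsC (met a i); rewrite card_ord.
  have : #|met a i| < chain_size r r by rewrite ltnNge; apply/negP => le; apply: ni; exists i.
  by rewrite /v; lia.
have [ph phP] := boolp.choice aex.
have [|[i J] cP] := @pigeon _ _ (fun a => (ph a, met a (ph a))) setT (s.+1 * g); first by rewrite cardsT card_ord.
set A := [set _ in _ | _] in cP.
have AP a : a \in A -> ph a = i /\ met a i = J by rewrite !inE => /eqP[<- <-].
have [a0 a0A] : exists a0, a0 \in A by apply/set0Pn; rewrite -card_gt0; apply: leq_ltn_trans cP.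
have bigJ : chain_size r r <= #|J| by have [e <-] := AP a0 a0A; rewrite -e; apply: phP.
have [j1 j1J] : exists j1, j1 \in J.
  by apply/set0Pn; rewrite -card_gt0; apply: leq_trans bigJ; case: (r) => //= r'; rewrite addn2.
have [tV dV minV] := VP i.
have mJ a j : a \in A -> j \in J -> has (mem (H a)) (V i j).
  by move=> /AP[_ <-]; rewrite in_set.
have [||||tau [tA ord]] := ordered WH pH dH tV dV _ minV (s := s) (g := g) (j1 := j1) (A := A).
- by apply: YW; rewrite ltnS ltnW.
- by move=> a aA; apply: mJ.
- by rewrite /g.
- exact: (ltnW cP).
apply: (@rungs_grid _ r n v s.+1 (V i) J (fun k => H (tau k))) => //.
- by move=> j x y; have [z [q [-> pq _ _ _]]] := tpathE (tV j) => /(path_infix pq)/and3P[].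
- by move=> j; have [z [q [_ _ u _ _]]] := tpathE (tV j).
- move=> k; have [z [q [-> pq _ _ _]]] := tpathE (tH (tau k)); exact: list_cset (path_inS pq).
- move=> k k' u uk uk'; have e := dH _ _ _ uk uk'.
  have /hasP[w wV wk] := mJ _ _ (tA k) j1J; have wk' : w \in H (tau k') by rewrite -e.
  case: (ltngtP k k') => [lt|lt|/val_inj//].
    by have := ord k k' j1 w w lt wk wV wk' wV; rewrite ltnn.
  by have := ord k' k j1 w w lt wk' wV wk wV; rewrite ltnn.
- by move=> k j jJ; apply: mJ.
Qed.
End Select.

(** * The grid theorem *)

Section Premesh.
Variables (N : sgraph) (F : {set {set N}}).
Hypothesis bF : bramble F.
Implicit Types (A B C Q S T U Y : {set N}) (a u x y z : N).

Lemma bramble_conn A A' S a a' : A \in F -> A' \in F -> [disjoint A & S] -> [disjoint A' & S] ->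
  a \in A -> a' \in A' -> conn (~: S) a a'.
Proof.
case: bF => ne tc AF AF' dA dA' aA aA'; apply: (@connS _ (A :|: A')).
  by rewrite -disjoints_subset disjoint_subset; apply/subsetP => u /setUP[]; apply/subsetP; rewrite -disjoint_subset.
apply: csetE; rewrite ?in_setU ?aA ?aA' ?orbT //.
by apply: touch_cset (tc _ _ AF AF'); [case: (ne A) | case: (ne A')].
Qed.

Lemma comp_adj S y a : conn (~: S) a y -> a \notin S -> a != y ->
  exists2 v, v \in ccomp (~: (y |: S)) a & y -- v.
Proof.
move=> cn aS ay; have aC : a \in ccomp (~: (y |: S)) a by rewrite mem_comp // in_setC in_setU1 negb_or ay.
have [|u [v [uC vC uS vS uv]]] := conn_exit cn (P := mem (ccomp (~: (y |: S)) a)) aC.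
  by apply/negP => /(subsetP (comp_sub _ _)); rewrite in_setC setU11.
have vy : v = y.
  apply: contrapT => /eqP vy; move: vC; rewrite /= (comp_step uC _ uv) //.
  by rewrite in_setC in_setU1 negb_or vy -in_setC.
by exists u => //; rewrite -vy sedge_sym.
Qed.

(* Depth-first search: the unhit sets all lie in one component of the rest, and that
   component is adjacent to the end of the path. *)
Lemma hitting_path : border 1 F -> exists x q, [/\ path sedge x q, uniq (x :: q) & forall A, A \in F -> has (mem A) (x :: q)].
Proof.
move=> oF; have [A0 A0F _] := oF set0 (eq_leq (congr1 S (cards0 N))).
have [/set0Pn[a0 a0A] _] := proj1 bF A0 A0F.
suff H m x q : #|N| - size q <= m -> path sedge x q -> uniq (x :: q) ->
    (forall A a, A \in F -> [disjoint A & [set u in x :: q]] -> a \in A -> exists2 v, v \in ccomp (~: [set u in x :: q]) a & x -- v) ->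
    exists x q, [/\ path sedge x q, uniq (x :: q) & forall A, A \in F -> has (mem A) (x :: q)].
  apply: (H #|N| a0 [::]) => //; first exact: leq_subr.
  move=> A a AF dA aA.
  have E : [set u in [:: a0]] = a0 |: set0 by apply/setP => u; rewrite in_set mem_seq1 in_setU1 in_set0 orbF.
  rewrite E in dA *; have [|||v vC av] := @comp_adj set0 a0 a; [ | by rewrite in_set0 | | by exists v].
    by apply: (bramble_conn AF A0F); rewrite // disjoint_sym; apply/disjP => u; rewrite in_set0.
  by apply: contraTneq aA => ->; apply/negP => h; move/disjP: dA => /(_ _ h); rewrite setU11; apply.
elim: m x q => [|m IH] x q le pq uq adj.
  have : size (x :: q) <= #|N| by rewrite -(card_uniqP uq) max_card.
  by move: le; rewrite /= leqn0 subn_eq0 => h1 h2; move: (leq_trans h2 h1); rewrite ltnn.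
have [hit|] := EM (forall A, A \in F -> has (mem A) (x :: q)); first by exists x, q.
move=> nh; have [A1 [A1F nA1]] : exists A, A \in F /\ ~~ has (mem A) (x :: q).
  by apply: contrapT => no; apply: nh => A AF; apply: contrapT => /negP h; apply: no; exists A.
have dis A : ~~ has (mem A) (x :: q) -> [disjoint A & [set u in x :: q]].
  move=> /hasPn h; apply/disjP => u uA; rewrite in_set => /h; by rewrite /= uA.
have [_ [/set0Pn[a1 a1A] _]] := (A1F, proj1 bF A1 A1F).
have [v vC xv] := adj A1 a1 A1F (dis _ nA1) a1A.
have vq : v \notin x :: q by have := subsetP (comp_sub _ _) v vC; rewrite in_setC in_set.
apply: (IH v (x :: q)) => /=; first by move: le; rewrite !leq_subLR addSnnS.
- by rewrite sedge_sym xv.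
- by rewrite -[X in is_true X]/((v \notin x :: q) && uniq (x :: q)) vq uq.
move=> A a AF dA aA; have E : [set u in v :: x :: q] = v |: [set u in x :: q].
  by apply/setP => u; rewrite in_setU1 !(in_set (fun _ => _)) in_cons.
rewrite E in dA *; have dA' : [disjoint A & [set u in x :: q]] by apply: disjointWr dA; apply: subsetUr.
have cn : conn (~: [set u in x :: q]) a v.
  apply: (@conn_trans _ _ a1); first by apply: (bramble_conn AF A1F) => //; apply: dis.
  by move: vC; rewrite in_set => /andP[].
have [||w wC vw] := comp_adj cn; last by exists w.
- by apply/negP => h; move/disjP: dA' => /(_ a aA h).
- by apply: contraTneq aA => ->; apply/negP => h; move/disjP: dA => /(_ _ h); rewrite setU11; apply.
Qed.

(* [S] separates [Q] from the bramble. *)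
Definition sepb Q S := exists A a, [/\ A \in F, [disjoint A & S], a \in A & [disjoint ccomp (~: S) a & Q]].

(* [x :: q] is the shortest prefix of a hitting path that fewer than [k] vertices do not
   separate from the bramble. *)
Lemma premesh k : 0 < k -> border (2 * k).+1 F ->
  exists x q U S (P : 'I_k -> seq N), [/\ path sedge x q /\ uniq (x :: q), #|S| = k,
    [/\ [disjoint U & [set u in x :: q]], [disjoint U & S] & forall u v, u \in U -> v \notin U -> u -- v -> v \in S],
    (forall i, tpath (inS (~: U)) [set u in x :: q] S (P i)) /\ disjp P &
    (forall T, #|T| < k -> ~ sepb [set u in x :: q] T) /\ (forall A, A \in F -> [disjoint A & S] -> A \subset U)].
Proof.
move=> k0 oF.
have oF' Y : #|Y| <= 2 * k -> exists2 A, A \in F & [disjoint A & Y] by move=> h; apply: oF.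
have [|x [q [pq uq hit]]] := hitting_path.
  by move=> Y h; apply: oF; apply: leq_trans h _.
pose Q i := [set u in take i (x :: q)].
pose nosep i := `[< forall T, #|T| < k -> ~ sepb (Q i) T >].
have ex : exists i, nosep i.
  exists (size (x :: q)); apply/asboolP => T _ [A [a [AF dA aA dC]]].
  have /hasP[u uq' uA] := hit A AF; move/disjP: dC => /(_ u); case; last by rewrite in_set take_size.
  have cA : cset A by case: (proj1 bF A AF).
  apply: (subsetP (sub_comp cA _ aA)) => //.
  by rewrite -disjoints_subset.
case: (ex_minnP ex) => -[|i] /asboolP nsi mini.
  case: (nsi set0); first by rewrite cards0.
  have [|A AF dA] := oF' set0; first by rewrite cards0.
  have [/set0Pn[a aA] _] := proj1 bF A AF; exists A, a; split=> //.
  by apply/disjP => u _; rewrite /Q take0 in_set in_nil.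
have [S' [cS' [A' [a' [A'F dA' aA' dC']]]]] : exists S', #|S'| < k /\ sepb (Q i) S'.
  apply: contrapT => no; have : nosep i by apply/asboolP => T lt sT; apply: no; exists T.
  by move=> /mini; rewrite ltnn.
have li : i < size (x :: q).
  rewrite ltnNge; apply/negP => h; have : nosep i.
    by apply/asboolP => T lt; have := nsi T lt; rewrite /Q !take_oversize // leqW.
  by move=> /mini; rewrite ltnn.
(* [S'] separates the prefix without [z] from the bramble, so [S] separates the prefix with [z]. By
   the choice of [i], fewer than [k] vertices cannot do so, hence [S] has exactly [k]. *)
pose z := nth x (x :: q) i; pose S := z |: S'.
have QE : Q i.+1 = z |: Q i.
  by apply/setP => u; rewrite /Q (take_nth x li) in_setU1 !(in_set (fun _ => _)) mem_rcons in_cons.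
have cS1 : #|S| <= k by rewrite cardsU1; case: (_ \notin _); rewrite ?add1n ?add0n // ltnW.
have [|A0 A0F dA0] := oF' S; first by lia.
have [/set0Pn[a aA0] _] := proj1 bF A0 A0F.
have dA0' : [disjoint A0 & S'] by apply: disjointWr dA0; apply: subsetUr.
pose U := ccomp (~: S) a.
have Usub : U \subset ~: S by apply: comp_sub.
have dUS : [disjoint U & S] by rewrite disjoints_subset.
have dUQ : [disjoint U & Q i.+1].
  apply/disjP => u uU; rewrite QE in_setU1 => /orP[/eqP e|uQ].
    by move/disjP: dUS => /(_ u uU); rewrite e setU11; apply.
  move/disjP: dC' => /(_ u); case=> //.
  have cn : conn (~: S') a' a by apply: (bramble_conn A'F A0F).
  rewrite (comp_eq cn) in_set; have := uU; rewrite in_set => /andP[uS cu].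
  have sub : ~: S \subset ~: S' by rewrite setCS subsetUr.
  by rewrite (subsetP sub) //= (connS sub).
have sepS : sepb (Q i.+1) S by exists A0, a.
have cS : #|S| = k.
  by apply/eqP; rewrite eqn_leq cS1 leqNgt; apply/negP => lt; apply: (nsi S lt).
have UA A : A \in F -> [disjoint A & S] -> A \subset U.
  move=> AF dA; apply/subsetP => u uA; rewrite in_set in_setC.
  apply/andP; split; first by apply/negP => h; move/disjP: dA => /(_ u uA h).
  exact: (bramble_conn A0F AF).
have UN u v : u \in U -> v \notin U -> u -- v -> v \in S.
  by move=> uU vU uv; apply: contraNT vU => vS; apply: (comp_step uU) => //; rewrite in_setC.
have [e0 [q0 [Et pq0 uq0]]] : exists e0 q0, [/\ take i.+1 (x :: q) = e0 :: q0, path sedge e0 q0 & uniq (e0 :: q0)].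
  exists x, (take i q); split=> //; first by have := pq; rewrite -{1}(cat_take_drop i q) cat_path => /andP[].
  by have := take_uniq i.+1 uq.
have {}Et : Q i.+1 = [set u in e0 :: q0] by rewrite /Q Et.
(* As [U] can be left through [S] only, a set [T] separating the prefix from [S] outside [U] would
   separate the prefix from the bramble. The order [2 * k + 1] provides a bramble set off both [S]
   and [T]. *)
case: (menger (inS (~: U)) (Q i.+1) S k) => [[P [tP dP]]|[T [ltT sT]]].
  by exists e0, q0, U, S, P; rewrite -Et; repeat split => //; case: (tP i).
exfalso; apply: (nsi T ltT).
have [|A1 A1F dA1] := oF' (S :|: T); first by apply: leq_trans (leq_card_setU S T) _; rewrite cS mul2n -addnn leq_add2l ltnW.
have dA1S : [disjoint A1 & S] by apply: disjointWr dA1; apply: subsetUl.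
have dA1T : [disjoint A1 & T] by apply: disjointWr dA1; apply: subsetUr.
have [/set0Pn[a1 a1A] _] := proj1 bF A1 A1F.
exists A1, a1; split=> //; apply/disjP => w wC wQ.
have := wC; rewrite in_set conn_sym => /andP[wT cw].
have a1U : a1 \in U by apply: (subsetP (UA A1 A1F dA1S)).
have [|x1 [p [ip sub /set1P xw lU [_ HB]]]] := @short_path _ _ [set w] U _ _ cw wT _ a1U; first by rewrite inE.
subst x1; have wU : w \notin U by apply/negP => h; move/disjP: dUQ => /(_ w h wQ).
case/lastP: p ip sub lU HB => [|p z'] ip sub; first by rewrite /= (negPf wU).
rewrite last_rcons => zU HB.
have nU u : u \in w :: p -> u \notin U by move=> up; apply: (HB (w :: p) [:: z']) => //; rewrite -cats1.
have := ich_path ip; rewrite rcons_path => /andP[pp lz].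
have lS : last w p \in S by apply: (UN z') => //; [apply/nU/mem_last | rewrite sedge_sym].
have pU : path (inS (~: U)) w p.
  apply: (@sub_in_path _ (mem (w :: p)) sedge) pp; last by apply/allP.
  by move=> u v up vp uv; apply/and3P; split=> //; rewrite in_setC nU.
have /hasP[u up uT] := sT w p pU wQ lS.
have := sub u; rewrite -rcons_cons mem_rcons in_cons up orbT in_setC => /(_ isT)/negP; apply; exact: uT.
Qed.

End Premesh.

Lemma sorting k (f : 'I_k -> nat) (i0 : 'I_k) : injective f ->
  exists sg : nat -> 'I_k, forall a b, a < b -> b < k -> f (sg a) < f (sg b).
Proof.
move=> fi; pose L := sort (relpre f leq) (enum 'I_k).
have sL : size L = k by rewrite size_sort size_enum_ord.
have sorted_L : sorted ltn (map f L).
  rewrite ltn_sorted_uniq_leq map_inj_uniq // sort_uniq enum_uniq /=.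
  by rewrite sorted_map sort_sorted // => a b; apply: leq_total.
exists (nth i0 L) => a b ab bk; have ak := ltn_trans ab bk.
have := sorted_ltn_nth ltn_trans 0 sorted_L; move=> /(_ a b); rewrite !inE !size_map sL => /(_ ak bk ab).
by rewrite !(nth_map i0) ?sL.
Qed.

Lemma apath_cset (N : sgraph) (W A B : {set N}) p : apath (inS W) A B p -> cset [set u in p].
Proof. by case: p => // x q /and4P[pq _ _ _]; apply: list_cset (path_inS pq). Qed.

Section Grid.
Variables (r n : nat).

(** Divide the paths of [premesh] into groups of [nn] consecutive ones, one group for each vertex of
    the brick graph; with a stretch of the hitting path, each group is a connected set outside [U].
    Any two groups are joined by many disjoint paths in [U]. From these linkages [sel] either
    chooses disjoint paths for all pairs, which gives a complete minor and so the brick graph, or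
    finds the brick graph directly. *)
Theorem grid_theorem : exists k, forall (N : sgraph) (F : {set {set N}}), bramble F -> border k F ->
  exists X : brick r n -> {set N}, model X.
Proof.
pose B : finType := brick r n; pose m := #|B|; pose l := #|{: B * B}|.
have [m0|m0] := posnP m.
  exists 0 => N F _ _; exists (fun=> set0); have no (x : B) : False by exact: (fintype0 x m0).
  by split=> x; case: (no x).
have [m1 selm] := sel r n l; pose nn := m1.+1; pose k := m * nn.
have k0 : 0 < k by rewrite muln_gt0 m0.
exists (2 * k).+1 => N F bF oF.
have [x [q [U [S [P [[pq uq] cS [dUQ dUS UN] [tP dP] [nsep FU]]]]]]] := premesh bF k0 oF.
set Q := [set u in x :: q] in dUQ tP nsep.
have QU : Q \subset ~: U by rewrite -disjoints_subset disjoint_sym.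
have PU i : {subset P i <= ~: U} by apply: (inW (W := ~: U) (tP i)) => // y z /and3P[].
pose fo i := head x (P i).
have foP i : fo i \in P i /\ fo i \in Q.
  by rewrite /fo; have [y [p [-> _ _ yQ _]]] := tpathE (tP i); rewrite mem_head.
have Pfo i u : u \in P i -> u \in Q -> u = fo i.
  rewrite /fo; have := tP i; case: (P i) => // y p /andP[_ /andP[/hasPn nA _]].
  by rewrite in_cons => /orP[/eqP//|/nA] /=; move/negbTE ->.
pose la i := last x (P i).
have laP i : la i \in P i /\ la i \in S.
  by rewrite /la; have [y [p [-> _ _ _ h]]] := tpathE (tP i); rewrite /= mem_last.
pose ix i := index (fo i) (x :: q).
have ixi : injective ix.
  move=> i j e; have [fi Qi] := foP i; have [fj Qj] := foP j; apply: dP fi _.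
  by rewrite -(nth_index x (_ : fo i \in x :: q)) -/(ix i) ?e ?nth_index //; move: Qi Qj; rewrite !in_set.
have [sg sgP] := sorting (Ordinal k0) ixi.
pose fx a := ix (sg a).
have fx_le a b : a <= b -> b < k -> fx a <= fx b.
  by rewrite leq_eqVlt => /orP[/eqP->//|ab bk]; apply/ltnW/sgP.
have sgi a b : a < k -> b < k -> sg a = sg b -> a = b.
  move=> ak bk e; case: (ltngtP a b) => // h; first by have := sgP a b h bk; rewrite e ltnn.
  by have := sgP b a h ak; rewrite e ltnn.
have bk (b : 'I_m) t : t < nn -> b * nn + t < k.
  move=> lt; apply: leq_trans (_ : b.+1 * nn <= _); last by rewrite leq_mul2r ltn_ord orbT.
  by rewrite mulSn addnC ltn_add2r.
(* The paths are numbered in the order of their ends on the hitting path, so the stretches of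
   different groups are disjoint; [m1] is the number of the last path in a group. *)
pose G0 (b : 'I_m) := [set u in x :: q | fx (b * nn) <= index u (x :: q) <= fx (b * nn + m1)].
pose A b := G0 b :|: \bigcup_(t < nn) [set u in P (sg (b * nn + t))].
have foG (b : 'I_m) t : t < nn -> fo (sg (b * nn + t)) \in G0 b.
  move=> lt; have [_] := foP (sg (b * nn + t)); rewrite !in_set => -> /=.
  rewrite -/(ix _) -/(fx _) !fx_le ?leq_addr ?leq_add2l ?bk //.
have G0c b : cset (G0 b).
  pose a0 := fo (sg (b * nn)); have a0G : a0 \in G0 b by have := foG b 0 isT; rewrite addn0.
  apply: (@cset_star _ _ a0) => w; rewrite in_set => /andP[wq /andP[h1 h2]].
  have hs : fx (b * nn + m1) < size (x :: q).
    by rewrite index_mem; have [_] := foP (sg (b * nn + m1)); rewrite in_set.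
  have a0q : a0 \in x :: q by have [_] := foP (sg (b * nn)); rewrite in_set.
  suff H d : fx (b * nn) + d <= fx (b * nn + m1) -> conn (G0 b) a0 (nth x (x :: q) (fx (b * nn) + d)).
    by have := H (index w (x :: q) - fx (b * nn)); rewrite subnKC // nth_index // => ->.
  have ms j : fx (b * nn) <= j -> j <= fx (b * nn + m1) -> nth x (x :: q) j \in G0 b.
    by move=> j1 j2; have lj : j < size (x :: q) by [apply: leq_ltn_trans hs]; rewrite in_set mem_nth // index_uniq // j1 j2.
  elim: d => [|d IH] ld; first by rewrite addn0 [nth _ _ _]nth_index ?conn0.
  have ld' : fx (b * nn) + d <= fx (b * nn + m1) by apply: leq_trans ld; rewrite leq_add2l.
  apply: conn_trans (IH ld') (conn1 (ms _ _ _) (ms _ _ _) _) => //; rewrite ?leq_addr //.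
  rewrite addnS in ld *; apply: (pathP x pq); exact: leq_trans ld _.
have Pc i : cset [set u in P i] by apply: apath_cset (tpath_ap (tP i)).
have Ac b : cset (A b).
  rewrite /A; elim/big_rec: _ => [|t V _ IH]; first by rewrite setU0.
  rewrite setUCA setUC; apply: (@csetU _ _ _ (fo (sg (b * nn + t))) (fo (sg (b * nn + t)))); rewrite ?eqxx //.
    by rewrite in_setU foG.
  by rewrite in_set; case: (foP (sg (b * nn + t))).
have AU b u : u \in A b -> u \notin U.
  rewrite in_setU => /orP[|/bigcupP[t _]]; rewrite in_set; last by move=> /PU; rewrite in_setC.
  by case/andP=> uq' _; rewrite -in_setC (subsetP QU) // in_set.
have Adis b b' u : u \in A b -> u \in A b' -> b = b'.
  have lt0 (c c' : 'I_m) : c < c' -> u \in A c -> u \in A c' -> False.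
    move=> cc; have gl : c * nn + m1 < c' * nn.
      by apply: leq_trans (_ : c.+1 * nn <= _); [by rewrite mulSn [nn + _]addnC ltn_add2l /nn | rewrite leq_mul2r cc orbT].
    have c'k : c' * nn < k by have := bk c' 0 isT; rewrite addn0.
    have g1 w : w \in G0 c -> w \in G0 c' -> False.
      rewrite !in_set => /andP[_ /andP[_ h1]] /andP[_ /andP[h2 _]].
      by have := leq_trans h2 h1; rewrite leqNgt sgP.
    have pg (d d' : 'I_m) t : t < nn -> u \in P (sg (d * nn + t)) -> u \in G0 d' -> u \in G0 d.
      move=> lt up ug; have uQ : u \in Q by move: ug; rewrite !in_set => /andP[].
      by rewrite (Pfo _ _ up uQ); apply: foG.
    rewrite !in_setU => /orP[h|/bigcupP[t _ h]] /orP[h'|/bigcupP[t' _ h']].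
    - exact: g1 h h'.
    - by rewrite in_set in h'; have := pg _ _ _ (ltn_ord t') h' h; apply: g1.
    - by rewrite in_set in h; have := pg _ _ _ (ltn_ord t) h h' => /g1; apply.
    - rewrite !in_set in h h'; have := sgi _ _ (bk _ _ (ltn_ord t)) (bk _ _ (ltn_ord t')) (dP _ _ _ h h').
      have := ltn_ord t; move: gl; rewrite ltnS; lia.
  by move=> h h'; case: (ltngtP b b') => [lt|lt|/val_inj//]; [case: (lt0 b b') | case: (lt0 b' b)].
pose Y b := [set u in U | [exists a in A b, a -- u]].
(* If [T], smaller than [nn], separated two groups inside [U], a component of [U :\: T] with a
   bramble set would miss the vertices next to one of them, say group [c]. That component can then
   not be left through the [nn] ends of group [c] in [S], so [T] and the other ends are fewer than
   [k] vertices separating the hitting path from the bramble. *)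
have link b b' : linked (inS U) (Y b) (Y b') nn.
  case: (menger (inS U) (Y b) (Y b') nn) => // -[T [ltT sT]]; exfalso.
  have nk : nn <= k by rewrite leq_pmull.
  have [|A1 A1F dA1] := oF (S :|: T).
    rewrite ltnS; apply: leq_trans (leq_card_setU S T) _; rewrite cS mul2n -addnn leq_add2l.
    by apply: leq_trans (ltnW ltT) _.
  have dA1S : [disjoint A1 & S] by apply: disjointWr dA1; apply: subsetUl.
  have dA1T : [disjoint A1 & T] by apply: disjointWr dA1; apply: subsetUr.
  have [/set0Pn[a1 a1A] _] := proj1 bF A1 A1F.
  have a1U := subsetP (FU A1 A1F dA1S) a1 a1A.
  have a1T : a1 \notin T by apply/negP => h; move/disjP: dA1T => /(_ _ a1A h).
  have a1UT : a1 \in U :\: T by rewrite in_setD a1T.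
  pose C := ccomp (U :\: T) a1.
  suff bad c : (forall u, u \in C -> u \in Y c -> False) -> False.
    apply: (bad b) => u uC uY; apply: (bad b') => u' uC' uY'.
    have : conn (U :\: T) u u'.
      move: uC uC'; rewrite !in_set => /andP[_ c1] /andP[_ c2].
      by apply: conn_trans c2; rewrite conn_sym.
    case/connectP=> p pp e; have p' : path (inS U) u p.
      by apply: sub_path pp => y z /and3P[/setDP[yU _] /setDP[zU _] yz]; apply/and3P.
    have : has (mem T) (u :: p) by apply: sT; rewrite // -e.
    case/hasP=> w; rewrite in_cons => /orP[/eqP->|wp] wT.
      by have := subsetP (comp_sub _ _) u uC; rewrite in_setD [_ \in T]wT.
    case/splitPr: wp pp {e p'} => p1 p2; rewrite cat_path /= => /and3P[_ /and3P[_ /setDP[_]]].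
    by rewrite [_ \in T]wT.
  move=> nY; pose Sc := [set la (sg (c * nn + t)) | t : 'I_nn].
  have ScS : Sc \subset S by apply/subsetP => _ /imsetP[t _ ->]; case: (laP (sg (c * nn + t))).
  have cSc : #|Sc| = nn.
    rewrite card_imset ?card_ord // => t t' e; apply: val_inj => /=.
    have [h1 _] := laP (sg (c * nn + t)); have [h2 _] := laP (sg (c * nn + t')).
    rewrite e in h1; have e1 := dP _ _ _ h1 h2.
    by have /eqP := sgi _ _ (bk _ _ (ltn_ord t)) (bk _ _ (ltn_ord t')) e1; rewrite eqn_add2l => /eqP.
  have ScA u : u \in Sc -> u \in A c.
    move=> /imsetP[t _ ->]; rewrite in_setU; apply/orP; right; apply/bigcupP; exists t => //.
    by rewrite in_set; case: (laP (sg (c * nn + t))).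
  apply: (nsep (S :\: Sc :|: T)).
    apply: leq_ltn_trans (leq_card_setU _ _) _; rewrite cardsD (setIidPr ScS) cS cSc.
    by rewrite -[X in _ < X](subnK nk) ltn_add2l.
  exists A1, a1; split=> //.
    apply/disjP => u uA; rewrite in_setU => /orP[/setDP[uS _]|uT].
      by move/disjP: dA1S => /(_ u uA uS).
    by move/disjP: dA1T => /(_ u uA uT).
  apply/disjP => u; rewrite in_set => /andP[_ cn] uQ.
  suff uC : u \in C.
    have := subsetP (comp_sub _ _) u uC; rewrite in_setD => /andP[_ uU].
    by move/disjP: dUQ => /(_ u uU uQ).
  apply: (conn_closed (P := mem C)) cn _; last exact: mem_comp.
  move=> y z yC _ zT yz; rewrite in_setC in_setU in_setD !negb_or in zT.
  case/andP: zT => zS zT; have := subsetP (comp_sub _ _) y yC; rewrite in_setD => /andP[_ yU].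
  have [zU|zU] := boolP (z \in U); first by apply: (comp_step yC) => //; rewrite in_setD zT.
  have zS' := UN y z yU zU yz; move: zS; rewrite zS' andbT negbK => /ScA zA.
  exfalso; apply: (nY y yC); rewrite in_set yU; apply/existsP; exists z; by rewrite zA sedge_sym.
have lk i j : linked (inS U) (Y i) (Y j) m1 by apply: linked_le (link i j).
have [z0 _] : exists z : B * B, true.
  have [b _] : exists b : B, b \in B by apply/card_gt0P.
  by exists (b, b).
pose pr i := nth z0 (enum {: B * B}) i.
have prE (z : B * B) : exists2 i, i < l & pr i = z.
  exists (index z (enum {: B * B})); last by rewrite /pr nth_index // mem_enum.
  by rewrite /l cardE index_mem mem_enum.
case: (selm N U (fun i => Y (enum_rank (pr i).1)) (fun i => Y (enum_rank (pr i).2))) => [i li||]; last by [].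
  by split; [apply/subsetP => u; rewrite in_set => /andP[] | exact: lk].
case=> p [pP dp].
(* The path selected for an ordered pair joins the branch set of the first entry. *)
pose X (y : B) := A (enum_rank y) :|: \bigcup_(i < l | (pr i).1 == y) [set u in p i].
have XP y u : u \in X y -> u \in A (enum_rank y) \/ exists i, [/\ i < l, (pr i).1 = y & u \in p i].
  rewrite in_setU => /orP[|/bigcupP[i /eqP e]]; first by left.
  by rewrite in_set; right; exists i.
exists X; split.
- move=> y; split.
    apply/set0Pn; exists (fo (sg (enum_rank y * nn + 0))); rewrite in_setU in_setU foG //.
  rewrite /X; elim/big_rec: _ => [|i V /eqP ey IH]; first by rewrite setU0.
  have [ap _] := pP i (ltn_ord i); have pc := apath_cset ap.
  move: ap pc; case: (p i) => // u q' /and4P[_ _ uY _] pc.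
  rewrite ey in_set in uY; case/andP: uY => _ /existsP[a /andP[aA au]].
  rewrite setUCA setUC; apply: (@csetU _ _ _ a u) => //; rewrite ?au ?orbT //.
    by rewrite in_setU aA.
  by rewrite in_set mem_head.
- move=> y y' yy; apply/disjP => u uy uy'; move/eqP: yy; apply.
  case: (XP _ _ uy) (XP _ _ uy') => [h|[i [li e up]]] [h'|[i' [li' e' up']]].
  + exact: (enum_rank_inj (Adis _ _ _ h h')).
  + by have [_ /(_ u up') uU] := pP i' li'; have := AU _ _ h; rewrite uU.
  + by have [_ /(_ u up) uU] := pP i li; have := AU _ _ h'; rewrite uU.
  + by rewrite -e -e' (dp i i' u li li' up up').
move=> y y' _; have [i li e] := prE (y, y'); have [ap _] := pP i li.
move: ap; rewrite e /=; case E: (p i) => [//|u q'] /and4P[_ _ _].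
rewrite in_set => /andP[_ /existsP[a /andP[aA au]]]; exists (last u q'), a; split.
- rewrite in_setU; apply/orP; right; apply/bigcupP; exists (Ordinal li); rewrite /= ?e //.
  by rewrite in_set E mem_last.
- by rewrite in_setU aA.
- by rewrite sedge_sym.
Qed.
End Grid.

(** * Induced subgraphs and contractions *)

Section Induced.
Variables (G : sgraph) (U : {set G}).
Definition ind_edge (x y : {x : G | x \in U}) := val x -- val y.
Lemma ind_sym : symmetric ind_edge. Proof. by move=> x y; apply: sedge_sym. Qed.
Lemma ind_irrefl : irreflexive ind_edge. Proof. by move=> x; apply: sedge_irrefl. Qed.
Definition ind := SGraph ind_sym ind_irrefl.

Lemma ind_sub : induced_subgraph ind G.
Proof. by exists val; split=> //; apply: val_inj. Qed.
End Induced.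

Lemma induced_trans (A B C : sgraph) : induced_subgraph A B -> induced_subgraph B C -> induced_subgraph A C.
Proof.
move=> [f [fi fe]] [g [gi ge]]; exists (g \o f); split; first exact: inj_comp.
by move=> x y; rewrite /= ge fe.
Qed.

Section Embedding.
Variables (H G : sgraph) (f : H -> G).
Hypothesis fi : injective f.
Hypothesis fe : forall x y, f x -- f y = x -- y.

Lemma emb_tfree : tfree G -> tfree H.
Proof. by move=> tf x y z; rewrite -!fe; apply: tf. Qed.

Lemma emb_hole c : hole c -> hole (map f c).
Proof.
move=> [/andP[cy un] sz ch]; split; rewrite ?size_map //.
  by rewrite /ucycle map_inj_uniq // un andbT (mono_cycle (e := sedge)).
move=> _ _ /mapP[u uc ->] /mapP[v vc ->]; rewrite fe => /(ch _ _ uc vc).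
by rewrite !next_map // => -[->|->]; [left|right].
Qed.

Lemma emb_sp1 : sp1 G -> sp1 H.
Proof.
move=> sp c v a b hc vc ac bc va vb; apply: fi.
by apply: (sp _ (f v) _ _ (emb_hole hc)); rewrite ?mem_map ?fe.
Qed.

Lemma emb_conn (A : {set H}) x y : conn A x y -> conn (f @: A) (f x) (f y).
Proof.
move=> cn; apply: (conn_closed (P := [pred u | conn (f @: A) (f x) (f u)])) cn _; last exact: conn0.
move=> u v; rewrite !inE => cu uA vA uv; apply: conn_trans cu (conn1 _ _ _); rewrite ?imset_f ?fe //.
Qed.

Lemma emb_cset (A : {set H}) : cset A -> cset (f @: A).
Proof. by move=> cA; apply: csetI => _ _ /imsetP[x xA ->] /imsetP[y yA ->]; apply/emb_conn/csetE. Qed.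

Lemma emb_cset_pre (B : {set G}) : (forall b, b \in B -> exists x, b = f x) -> cset B -> cset (f @^-1: B).
Proof.
move=> im cB; apply: csetI => x y; rewrite !inE => xB yB.
have := csetE cB xB yB => /(conn_closed (P := [pred b | [exists z, (f z == b) && conn (f @^-1: B) x z]])) h.
have : f y \in [pred b | [exists z, (f z == b) && conn (f @^-1: B) x z]].
  apply: h; last by rewrite inE; apply/existsP; exists x; rewrite eqxx conn0.
  move=> u v; rewrite !inE => /existsP[z /andP[/eqP ez cz]] uB vB uv.
  have [w ew] := im v vB; subst u v; apply/existsP; exists w; rewrite eqxx.
  by apply: conn_trans cz (conn1 _ _ _); rewrite ?inE -?fe.
by rewrite inE => /existsP[z /andP[/eqP/fi-> ]].
Qed.

Lemma emb_touch (A B : {set H}) : touch A B -> touch (f @: A) (f @: B).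
Proof. by case=> x [y [xA yB h]]; exists (f x), (f y); rewrite !imset_f // (inj_eq fi) fe. Qed.

Lemma emb_bramble (F : {set {set H}}) : bramble F -> bramble ((fun A : {set H} => f @: A) @: F).
Proof.
move=> [ne tc]; split=> [_ /imsetP[A AF ->]|_ _ /imsetP[A AF ->] /imsetP[B BF ->]].
  have [/set0Pn[a aA] cA] := ne A AF; split; last exact: emb_cset.
  by apply/set0Pn; exists (f a); rewrite imset_f.
by apply/emb_touch/tc.
Qed.

Lemma emb_border k (F : {set {set H}}) : border k F -> border k ((fun A : {set H} => f @: A) @: F).
Proof.
move=> oF Y lt; have [|A AF dA] := oF (f @^-1: Y).
  by apply: leq_ltn_trans lt; rewrite -(card_imset _ fi); apply/subset_leq_card/subsetP => _ /imsetP[x + ->]; rewrite inE.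
exists (f @: A); first exact: imset_f.
by apply/disjP => _ /imsetP[a aA ->] faY; move/disjP: dA => /(_ a aA); rewrite inE.
Qed.

Lemma emb_bramble_pre (F : {set {set G}}) : (forall A, A \in F -> forall b, b \in A -> exists x, b = f x) ->
  bramble F -> bramble ((fun A : {set G} => f @^-1: A) @: F).
Proof.
move=> im [ne tc]; split=> [_ /imsetP[A AF ->]|_ _ /imsetP[A AF ->] /imsetP[B BF ->]].
  have [/set0Pn[a aA] cA] := ne A AF; split; last by apply: emb_cset_pre => //; apply: im.
  by have [x e] := im A AF a aA; apply/set0Pn; exists x; rewrite inE -e.
have [a [b [aA bB h]]] := tc A B AF BF.
have [x ex] := im A AF a aA; have [y ey] := im B BF b bB; subst a b.
by exists x, y; rewrite !inE -fe -(inj_eq fi).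
Qed.

Lemma emb_border_pre k (F : {set {set G}}) : border k F -> border k ((fun A : {set G} => f @^-1: A) @: F).
Proof.
move=> oF Y lt; have [|A AF dA] := oF (f @: Y); first by rewrite card_imset.
exists (f @^-1: A); first exact: imset_f.
by apply/disjP => a; rewrite inE => aA aY; move/disjP: dA => /(_ _ aA); rewrite imset_f //; apply.
Qed.
End Embedding.

(* Take a bramble of order [k] whose cover is smallest. *)
Lemma critical_sub (G : sgraph) k (F0 : {set {set G}}) : bramble F0 -> border k F0 ->
  exists U : {set G}, critical (ind U) k.
Proof.
move=> b0 o0; pose P n := `[< exists F : {set {set G}}, [/\ bramble F, border k F & #|cover F| = n] >].
have ex : exists n, P n by exists #|cover F0|; apply/asboolP; exists F0.
case: (ex_minnP ex) => n /asboolP[F [bF oF cF]] mn; set U := cover F in cF.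
exists U; have vi := @val_inj _ _ {x : G | x \in U}.
have ve (x y : ind U) : val x -- val y = x -- y by [].
split.
  exists ((fun A : {set G} => val @^-1: A) @: F); split.
    apply: (emb_bramble_pre (H := ind U) (f := val)) => // A AF b bA.
    have bU : b \in U by apply/bigcupP; exists A.
    by exists (Sub b bU); rewrite SubK.
  exact: (emb_border_pre (H := ind U)).
move=> F1 bF1 oF1 x; apply: contrapT => no.
have : P #|cover ((fun A : {set ind U} => val @: A) @: F1)|.
  apply/asboolP; exists ((fun A : {set ind U} => val @: A) @: F1); split=> //.
    exact: (emb_bramble (H := ind U)).
  exact: (emb_border (H := ind U)).
move/mn; rewrite leqNgt -cF => /negP[]; apply: proper_card; apply/properP; split.
  by apply/subsetP => u /bigcupP[_ /imsetP[A _ ->] /imsetP[y _ ->]]; apply: (valP y).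
exists (val x); first exact: (valP x).
apply/negP => /bigcupP[_ /imsetP[A AF ->] /imsetP[y yA e]]; apply: no; exists A => //.
by rewrite (vi _ _ e).
Qed.

Section Quotient.
Variables (G : sgraph) (T : finType) (rho : G -> T) (sg : T -> G).
Hypothesis sgK : forall t, rho (sg t) = t.
Hypothesis fib : forall x y, rho x = rho y -> x = y \/ x -- y.
Hypothesis fib2 : forall t, #|[set x | rho x == t]| <= 2.

Definition qedge r s := (r != s) && [exists x, exists y, [&& rho x == r, rho y == s & x -- y]].
Lemma qedge_sym : symmetric qedge.
Proof.
suff H x y : qedge x y -> qedge y x by move=> x y; apply/idP/idP; apply: H.
case/andP=> xy /existsP[a /existsP[b /and3P[ha hb ab]]]; rewrite /qedge eq_sym xy.
by apply/existsP; exists b; apply/existsP; exists a; rewrite ha hb sedge_sym.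
Qed.
Lemma qedge_irrefl : irreflexive qedge. Proof. by move=> x; rewrite /qedge eqxx. Qed.
Definition quo := SGraph qedge_sym qedge_irrefl.

Lemma quo_edge x y : x -- y -> (rho x == rho y) || qedge (rho x) (rho y).
Proof.
move=> xy; have [//|ne] := eqVneq (rho x) (rho y); rewrite /qedge ne /=.
by apply/existsP; exists x; apply/existsP; exists y; rewrite !eqxx.
Qed.

Lemma quo_cset (A : {set G}) : cset A -> @cset quo (rho @: A).
Proof.
move=> cA; apply: (@csetI quo) => _ _ /imsetP[x xA ->] /imsetP[y yA ->].
apply: (conn_closed (P := [pred u | @conn quo (rho @: A) (rho x) (rho u)])) (csetE cA xA yA) _.
  move=> u v; rewrite !inE => cu uA vA /quo_edge/orP[/eqP<-//|uv].
  by apply: (@conn_trans quo) cu (@conn1 quo _ _ _ _ _ _); rewrite ?imset_f.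
exact: (@conn0 quo).
Qed.

(** Two vertices in the same fibre are adjacent by [fib], so paths of the quotient lift. *)
Lemma quo_pre (B : {set quo}) : cset B -> cset (rho @^-1: B).
Proof.
move=> cB; apply: csetI => x y; rewrite !inE => xB yB.
have st u z : u \in rho @^-1: B -> rho u = rho z -> conn (rho @^-1: B) u z.
  move=> uB e; have zB : z \in rho @^-1: B by move: uB; rewrite !inE e.
  by case: (fib e) => [->|uz]; [exact: conn0 | exact: conn1].
have : (rho y : quo) \in [pred b : quo | [forall z, (rho z == b) ==> conn (rho @^-1: B) x z]].
  apply: (@conn_closed quo B _ (rho x) (rho y) _ (csetE cB xB yB)).
    move=> u v; rewrite !inE => /forallP cu uB vB /andP[_ /existsP[a /existsP[b /and3P[/eqP ea /eqP eb ab]]]].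
    apply/forallP => z; apply/implyP => /eqP ez; have := cu a; rewrite ea eqxx /= => ca.
    apply: conn_trans ca _; apply: (@conn_trans _ _ b); first by apply: conn1; rewrite ?inE ?ea ?eb.
    by apply: st; rewrite ?inE eb.
  by rewrite inE; apply/forallP => z; apply/implyP => /eqP ez; apply: st; rewrite ?inE.
by rewrite inE => /forallP/(_ y); rewrite eqxx.
Qed.

Lemma quo_bramble (F : {set {set G}}) : bramble F -> @bramble quo ((fun A : {set G} => rho @: A) @: F).
Proof.
move=> [ne tc]; split=> [_ /imsetP[A AF ->]|_ _ /imsetP[A AF ->] /imsetP[B BF ->]].
  have [/set0Pn[a aA] cA] := ne A AF; split; last exact: quo_cset.
  by apply/set0Pn; exists (rho a); rewrite imset_f.
have [a [b [aA bB h]]] := tc A B AF BF; exists (rho a), (rho b); split; rewrite ?imset_f //.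
by case/orP: h => [/eqP->|/quo_edge//]; rewrite eqxx.
Qed.

(** The preimage of a hitting set hits the original bramble and is at most twice as large by
    [fib2]. *)
Lemma quo_border k (F : {set {set G}}) : border (2 * k) F -> @border quo k ((fun A : {set G} => rho @: A) @: F).
Proof.
move=> oF Y lt; have [|A AF dA] := oF (rho @^-1: Y).
  have -> : rho @^-1: Y = \bigcup_(t in Y) [set x | rho x == t].
    apply/setP => x; rewrite inE; apply/idP/bigcupP => [xY|[t tY]]; first by exists (rho x); rewrite ?inE.
    by rewrite inE => /eqP->.
  apply: leq_ltn_trans (card_bigcup_in (m := 2) (fun t _ => fib2 t)) _.
  by rewrite mulnC ltn_mul2l.
exists (rho @: A); first exact: imset_f.
by apply/disjP => _ /imsetP[a aA ->] faY; move/disjP: dA => /(_ a aA); rewrite inE.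
Qed.

Lemma quo_model (H : sgraph) (X : H -> {set quo}) : model X -> model (fun x => rho @^-1: (X x : {set T})).
Proof.
move=> [nX dX eX]; split.
- move=> x; have [/set0Pn[t tX] cX] := nX x; split; last exact: quo_pre.
  by apply/set0Pn; exists (sg t); rewrite inE sgK.
- by move=> x y xy; apply/disjP => u; rewrite !inE; apply/disjP/dX.
move=> x y /eX[a [b [aX bX /andP[_ /existsP[u /existsP[v /and3P[/eqP ua /eqP vb uv]]]]]]].
by exists u, v; rewrite !inE ua vb.
Qed.
End Quotient.

(** * Contracting the matching *)

Section Contract.
Variables (G : sgraph) (k : nat).
Hypothesis tf : tfree G.
Hypothesis sp : sp1 G.
Hypothesis cr : critical G (2 * k).

Let blk (x : G) := [set y | (y == x) || mt x y].

Lemma blkP x y : blk x = blk y -> x = y \/ mt x y.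
Proof. by move=> /setP/(_ y); rewrite !inE eqxx /= => /orP[/eqP->|]; [left|right]. Qed.

Lemma mt_block x y : mt x y -> blk x = blk y.
Proof.
case: cr => [[F [bF oF]] crit] xy; have yx : mt y x by rewrite mt_sym.
apply/setP => z; rewrite !inE; apply/idP/idP => /orP[/eqP->|h]; rewrite ?xy ?yx ?orbT //.
  by rewrite (mt_inj tf sp bF oF crit h xy) eqxx.
by rewrite (mt_inj tf sp bF oF crit h yx) eqxx.
Qed.

(** By [mt_inj] the blocks have at most two vertices, so the contracted graph still has a bramble of
    order [k]. Preimages of branch sets are unions of blocks, so no matching edge joins two of
    them. *)
Lemma block_model (H : sgraph) : (forall (N : sgraph) (F : {set {set N}}), bramble F -> border k F -> exists X : H -> {set N}, model X) ->
  exists X : H -> {set G}, model X /\ mclean X.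
Proof.
move=> grid; case: (cr) => [[F [bF oF]] crit].
pose T : finType := {B : {set G} | [exists x, B == blk x]}.
have bT x : [exists y, blk x == blk y] by apply/existsP; exists x.
pose rho x : T := exist _ (blk x) (bT x).
have sgx (t : T) : exists x, rho x = t.
  have /existsP[x /eqP e] := valP t; exists x; apply: val_inj; by rewrite /= -e.
have [sg sgK] := boolp.choice sgx.
have rhoE x y : rho x = rho y -> blk x = blk y by move=> /(congr1 val).
have fib x y : rho x = rho y -> x = y \/ x -- y.
  by move=> /rhoE/blkP[|/and4P[]]; [left|right].
have fib2 t : #|[set x | rho x == t]| <= 2.
  rewrite leqNgt; apply/negP => h.
  have [x xs] : exists x, x \in [set x | rho x == t] by apply/set0Pn; rewrite -card_gt0; apply: ltn_trans h.
  have [y ys] : exists y, y \in [set x | rho x == t] :\ x.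
    by apply/set0Pn; rewrite -card_gt0; move: h; rewrite (cardsD1 x) xs; lia.
  have [z zs] : exists z, z \in [set x | rho x == t] :\ x :\ y.
    by apply/set0Pn; rewrite -card_gt0; move: h; rewrite (cardsD1 x) xs (cardsD1 y) ys; lia.
  move: xs ys zs; rewrite !inE => /eqP xt /andP[yx /eqP yt] /and3P[zy zx /eqP zt].
  have m1 : mt x y by case: (@blkP x y) yx => [|->|]; rewrite ?eqxx //; apply: rhoE; rewrite xt.
  have m2 : mt x z by case: (@blkP x z) zx => [|->|]; rewrite ?eqxx //; apply: rhoE; rewrite xt.
  by move: zy; rewrite (mt_inj tf sp bF oF crit m1 m2) eqxx.
have [X mX] := grid _ _ (quo_bramble rho bF) (quo_border fib2 oF).
have := quo_model sgK fib mX; set X' := fun x => _ => mX'; exists X'; split=> // u w x y uw ux wy.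
have e : rho u = rho w by apply/val_inj/mt_block.
by move: ux wy; rewrite !inE e; apply: model_eq mX.
Qed.
End Contract.

(** * Walls *)

Lemma card_gt1 (T : finType) (A : {set T}) x y : x \in A -> y \in A -> x != y -> 1 < #|A|.
Proof. by move=> xA yA xy; apply/card_gt1P; exists x, y. Qed.

Section WallFacts.
Variable k : nat.
Implicit Types x y z l : Gamma k.

Lemma gam_eq x y : row x = row y -> col x = col y -> x = y.
Proof. by case: x y => [i j] [i' j']; rewrite /row /col /= => -[/val_inj->] /val_inj->. Qed.

Lemma gam_mk i j : 0 < i -> i <= k -> j < 2 * k -> exists y : Gamma k, row y = i /\ col y = j.
Proof.
case: i => // i _ li lj; by exists (Ordinal li, Ordinal lj).
Qed.

Lemma gam_bd x : [/\ 0 < row x, row x <= k & col x < 2 * k].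
Proof. by case: x => [[i li] [j lj]]. Qed.

Lemma gam_adj x y : x -- y -> (row y = row x /\ (col y = (col x).+1 \/ col x = (col y).+1)) \/
  (col y = col x /\ (row y = (row x).+1 /\ odd (row x + col x) \/ row x = (row y).+1 /\ odd (row y + col y))).
Proof.
rewrite /= /gedge /garc; case/orP=> /orP[/andP[/eqP h1 /eqP h2]|/and3P[/eqP h1 /eqP h2 h3]].
- by left; split=> //; left.
- by right; split=> //; left.
- by left; split=> //; right.
- by right; split=> //; right.
Qed.

Lemma adj_h x y : row y = row x -> col y = (col x).+1 -> x -- y.
Proof. by move=> h1 h2; rewrite /= /gedge /garc h1 h2 !eqxx. Qed.

Lemma adj_v x y : row y = (row x).+1 -> col y = col x -> odd (row x + col x) -> x -- y.
Proof. by move=> h1 h2 h3; rewrite /= /gedge /garc h1 h2 h3 !eqxx orbT. Qed.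

Lemma horizontal y : exists h : Gamma k, row h = row y /\ h -- y.
Proof.
have [b1 b2 b3] := gam_bd y; have [e|p] := posnP (col y).
  have [|h [r1 c1]] := gam_mk (j := 1) b1 b2; first by lia.
  by exists h; split=> //; rewrite sedge_sym; apply: adj_h; rewrite ?r1 ?c1 ?e.
have [|h [r1 c1]] := gam_mk (j := (col y).-1) b1 b2; first by lia.
by exists h; split=> //; apply: adj_h; rewrite ?r1 ?c1 ?prednK.
Qed.

(** The definition of [suppressed] constrains remaining neighbours only. A neighbour in another row
    also has a neighbour in its own row, hence is remaining. *)
Lemma supp_row z y : z \in suppressed k -> z -- y -> row y = row z.
Proof.
rewrite in_set => /andP[_ /andP[_ /forallP/(_ y)]] + zy; rewrite zy.
have [yr /=|yr _] := boolP (y \in remaining k); first by move/eqP.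
have e : #|neighb y| = 1 by move: yr; rewrite in_set negbK => /eqP.
apply: contrapT => /eqP ne; have [h [rh hy]] := horizontal y.
suff : 1 < #|neighb y| by rewrite e.
apply: (@card_gt1 _ _ h z); rewrite ?inE ?[y -- _]sedge_sym //.
by apply: contraNneq ne => <-; rewrite rh.
Qed.

Lemma supp_col z : z \in suppressed k -> 0 < col z /\ (col z).+1 < 2 * k.
Proof.
move=> zs; have := zs; rewrite in_set in_set => /andP[d1 _]; have [b1 b2 b3] := gam_bd z.
have [h [rh hz]] := horizontal z.
have [y zy yh] : exists2 y, z -- y & y != h.
  apply: contrapT => no; move/eqP: d1; apply; apply/eqP/cards1P; exists h.
  apply/setP => y; rewrite !inE; apply/idP/eqP => [zy|->]; last by rewrite sedge_sym.
  by apply: contrapT => /eqP yh; apply: no; exists y.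
have ry := supp_row zs zy; have hy : col y <> col h by move=> e; move/eqP: yh; apply; apply: gam_eq => //; rewrite ry.
have [_ _ b4] := gam_bd y; have [_ _ b5] := gam_bd h.
case: (gam_adj zy) => [[_ h1]|[_ h1]]; last by lia.
case: (gam_adj hz) => [[_ h2]|[_ h2]]; lia.
Qed.

(** Vertical edges between two rows occur in every second column. As [z] lacks one towards the
    inside, its neighbours in the row have one. *)
Lemma supp_next z l : z \in suppressed k -> z -- l -> l \in remaining k :\: suppressed k.
Proof.
move=> zs zl; have [c1 c2] := supp_col zs; have [b1 b2 b3] := gam_bd z.
have rl := supp_row zs zl.
have cl : col l = (col z).+1 \/ col z = (col l).+1 by case: (gam_adj zl) => [[_]|[]] //; lia.
have [y ly ry] : exists2 y, l -- y & row y <> row l.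
  have := zs; rewrite in_set => /andP[_ /andP[/orP[]/eqP rz _]].
    have [|||y [ry cy]] := @gam_mk 2 (col z); [by [] | by lia | by [] |].
    have od : ~~ odd (row z + col z).
      apply/negP => od; have := @supp_row z y zs; rewrite ry rz => h; have := h (adj_v _ _ od); rewrite ry rz cy.
      by move=> /(_ erefl erefl).
    have [_ _ bl] := gam_bd l; have [|||w [rw cw]] := @gam_mk 2 (col l); [by [] | by lia | by [] |].
    by exists w; [apply: adj_v; rewrite ?rw ?rl ?rz ?cw //; move: od; rewrite rz; case: cl => ->; lia | rewrite rw; lia].
  have [|||y [ry cy]] := @gam_mk k.-1 (col z); [by lia | by lia | by [] |].
  have od : ~~ odd (row y + col y).
    apply/negP => od; have yz : y -- z by apply: adj_v; rewrite ?ry ?cy ?rz; lia.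
    by have := @supp_row z y zs; rewrite sedge_sym => /(_ yz); rewrite ry rz; lia.
  have [_ _ bl] := gam_bd l; have [|||w [rw cw]] := @gam_mk k.-1 (col l); [by lia | by lia | by [] |].
  exists w; last by rewrite rw rl rz; lia.
  rewrite sedge_sym; apply: adj_v; rewrite ?rw ?rl ?rz ?cw //; first by lia.
  by move: od; rewrite ry cy; case: cl => ->; lia.
rewrite in_setD; apply/andP; split; first by apply/negP => /supp_row/(_ ly).
rewrite inE; have : 1 < #|neighb l|.
  apply: (@card_gt1 _ _ y z); rewrite ?inE //; first by rewrite sedge_sym.
  by apply/eqP => e; apply: ry; rewrite e rl.
by case: #|_| => [|[]].
Qed.

Lemma wall_edge (w w' : wall k) : w -- w' <-> w != w' /\ (val w -- val w' \/ exists z, [/\ z \in suppressed k, val w -- z & z -- val w']).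
Proof.
split.
  case/andP=> ne /orP[h|/existsP[z /and3P[h1 h2 h3]]]; split=> //; [by left | by right; exists z].
case=> ne [h|[z [h1 h2 h3]]]; rewrite /= /wedge; apply/andP; split=> //; apply/orP; first by left.
by right; apply/existsP; exists z; apply/and3P.
Qed.

Lemma wall_not (w : wall k) z : z \in suppressed k -> val w <> z.
Proof. by move=> zs e; have := valP w; rewrite /= in_setD e zs. Qed.

Lemma supp_two w z c : w != c -> z \in suppressed k -> w -- z -> z -- c ->
  [/\ row c = row w, row z = row w &
    (col z = (col w).+1 /\ col c = (col w).+2) \/ (col w = (col z).+1 /\ col z = (col c).+1)].
Proof.
move=> wc zs wz zc; have rc := supp_row zs zc; have zw : z -- w by rewrite sedge_sym.
have rw := supp_row zs zw; split; [by rewrite rc rw | by rewrite rw |].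
have ne : col c <> col w by move=> h; move/eqP: wc; apply; apply: gam_eq => //; rewrite rc rw.
have h1 : col c = (col z).+1 \/ col z = (col c).+1.
  by case: (gam_adj zc) => [[_ h1]|[_ [[h _]|[h _]]]] //; move: h; rewrite rc => /n_Sn.
have h2 : col w = (col z).+1 \/ col z = (col w).+1.
  by case: (gam_adj zw) => [[_ h2]|[_ [[h _]|[h _]]]] //; move: h; rewrite rw => /n_Sn.
move: ne h1 h2; clear; lia.
Qed.

(** A neighbour of [w] in the wall lies to the left, to the right or in the same column, and each
    direction contains at most one, be it adjacent in [Gamma] or beyond a suppressed vertex. *)
Lemma wall_deg (w : wall k) : #|neighb w| <= 3.
Proof.
pose ps (w' : wall k) : 'I_3 := if col (val w') < col (val w) then ord0 else if col (val w) < col (val w') then inord 1 else inord 2.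
rewrite -[3]card_ord -(card_in_imset (f := ps)); first exact: max_card.
move=> a b; rewrite !inE => /wall_edge[na ha] /wall_edge[nb hb] e.
have e' : (col (val a) < col (val w)) = (col (val b) < col (val w)) /\ (col (val w) < col (val a)) = (col (val w) < col (val b)).
  move: (congr1 val e); rewrite /ps.
  by case: (ltngtP (col (val a)) (col (val w))); case: (ltngtP (col (val b)) (col (val w))); rewrite /= ?inordK.
clear ps e; apply: val_inj; case: e' => e1 e2.
have na' : val w != val a by apply: contraNneq na => /val_inj->.
have nb' : val w != val b by apply: contraNneq nb => /val_inj->.
have adjE (c : wall k) : val w -- val c -> (row (val c) = row (val w) /\ (col (val c) = (col (val w)).+1 \/ col (val w) = (col (val c)).+1)) \/
    (col (val c) = col (val w) /\ row (val c) = if odd (row (val w) + col (val w)) then (row (val w)).+1 else (row (val w)).-1).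
  move/gam_adj; case; [by left | case=> h [[h1 od]|[h1 od]]; right; split=> //].
    by rewrite od.
  have -> : odd (row (val w) + col (val w)) = false by rewrite h1 -h addSn oddS od.
  by rewrite h1.
have mix (c d : wall k) z : val w != val d -> val w -- val c -> z \in suppressed k -> val w -- z -> z -- val d ->
    (col (val c) < col (val w)) = (col (val d) < col (val w)) -> (col (val w) < col (val c)) = (col (val w) < col (val d)) -> False.
  move=> nd wc zs wz zd; have [r1 r2 h1] := supp_two nd zs wz zd.
  have nz : val c <> z by apply: wall_not.
  have nz' : row (val c) = row z -> col (val c) = col z -> False by move=> h2 h3; apply/nz/gam_eq.
  move: (adjE c wc) r1 r2 h1 nz'; clear; lia.
case: ha hb => [ha|[z [zs wz zc]]] [hb|[z' [zs' wz' zc']]].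
- apply: gam_eq; move: (adjE a ha) (adjE b hb) e1 e2; clear; case: (odd _); lia.
- by case: (mix a b z').
- by case: (mix b a z).
have [r1 r2 h1] := supp_two na' zs wz zc; have [r3 r4 h2] := supp_two nb' zs' wz' zc'.
apply: gam_eq; first by rewrite r1 r3.
by move: h1 h2 e1 e2; clear; lia.
Qed.
End WallFacts.

(** Shrink the branch sets to smallest total size and pass to the subgraph induced on their union;
    then the covering and minimality hypotheses of [extract] hold. *)
Lemma extract_sub (W G : sgraph) (Y : W -> {set G}) : tfree G -> model Y ->
  (forall w w' a b, w != w' -> a \in Y w -> b \in Y w' -> a -- b ->
    w -- w' /\ forall a' b', a' \in Y w -> b' \in Y w' -> a' -- b' -> a' = a /\ b' = b) ->
  (forall w : W, #|neighb w| <= 3) ->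
  exists S, is_subdivision W S /\ induced_subgraph S G.
Proof.
move=> tf mY clY dW.
pose P n := `[< exists Y' : W -> {set G}, [/\ model Y', forall w, Y' w \subset Y w & \sum_w #|Y' w| = n] >].
have ex : exists n, P n by exists (\sum_w #|Y w|); apply/asboolP; exists Y.
case: (ex_minnP ex) => n /asboolP[Y' [mY' sub cn]] mn.
have {}clY w w' a b : w != w' -> a \in Y' w -> b \in Y' w' -> a -- b ->
    w -- w' /\ forall a' b', a' \in Y' w -> b' \in Y' w' -> a' -- b' -> a' = a /\ b' = b.
  move=> ne aY bY ab; have [h1 h2] := clY w w' a b ne (subsetP (sub w) a aY) (subsetP (sub w') b bY) ab.
  by split=> // a' b' aY' bY'; apply: h2; apply: (subsetP (sub _)).
have [nY dY eY] := mY'.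
have minY w (Z : {set G}) : Z \subset Y' w -> Z != set0 -> cset Z ->
    (forall w', w -- w' -> exists a b, [/\ a \in Z, b \in Y' w' & a -- b]) -> Z = Y' w.
  move=> ZY Z0 cZ eZ; apply/eqP; rewrite eqEcard ZY leqNgt; apply/negP => lt.
  pose Y2 x := if x == w then Z else Y' x.
  have Y2s x : Y2 x \subset Y' x by rewrite /Y2; case: eqP => [->|].
  have : P (\sum_x #|Y2 x|).
    apply/asboolP; exists Y2; split=> //; last by move=> x; apply: subset_trans (Y2s x) (sub x).
    split.
    - by move=> x; rewrite /Y2; case: (x =P w) => _; [split | exact: (nY x)].
    - move=> x y xy; apply/disjP => u /(subsetP (Y2s x)) ux /(subsetP (Y2s y)) uy.
      by move/disjP: (dY x y xy) => /(_ u ux uy).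
    move=> x y xy; rewrite /Y2; case: eqP => [ex'|_]; case: eqP => [ey|_].
    - by move: xy; rewrite ex' ey sedge_irrefl.
    - by apply: eZ; rewrite -ex'.
    - have [|a [b [aZ bY ab]]] := eZ x; first by rewrite sedge_sym -ey.
      by exists b, a; rewrite sedge_sym.
    - exact: eY.
  move/mn; rewrite -cn leqNgt => /negP; apply; rewrite (bigD1 w) //= [X in _ < X](bigD1 w) //= /Y2 eqxx.
  rewrite (eq_bigr (fun x => #|Y' x|)) ?ltn_add2r // => x /negPf xw; by rewrite xw.
pose U := \bigcup_w Y' w.
have inU w u : u \in Y' w -> u \in U by move=> h; apply/bigcupP; exists w.
have vi := @val_inj _ _ {x : G | x \in U}.
have ve (x y : ind U) : val x -- val y = x -- y by [].
pose Yi w : {set ind U} := val @^-1: Y' w.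
have lift w u : u \in Y' w -> exists2 x : ind U, x \in Yi w & val x = u.
  by move=> h; exists (Sub u (inU w u h) : ind U); rewrite ?in_preim ?inE ?SubK.
have YiP w (x : ind U) : (x \in Yi w) = (val x \in Y' w) by rewrite inE.
exists (ind U); split; last exact: ind_sub.
apply: (@extract W (ind U) (emb_tfree ve tf) Yi).
- split.
  + move=> w; have [/set0Pn[u uY] cY] := nY w; split.
      by have [x xY _] := lift w u uY; apply/set0Pn; exists x.
    by apply: (emb_cset_pre (H := ind U) (f := val)) => // b /lift[x _ <-]; exists x.
  + by move=> x y xy; apply/disjP => u; rewrite !YiP; apply/disjP/dY.
  + move=> x y /eY[a [b [/lift[a' aY <-] /lift[b' bY <-] ab]]].
    by exists a', b'.
- move=> w w' a b ne; rewrite !YiP => aY bY ab; have [h1 h2] := clY w w' _ _ ne aY bY ab.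
  split=> // a' b'; rewrite !YiP => aY' bY' ab'.
  by have [e1 e2] := h2 _ _ aY' bY' ab'; split; apply: vi.
- by move=> u; have /bigcupP[w _ uw] := valP u; exists w; rewrite YiP.
- move=> w Z ZY Z0 cZ eZ; have E : val @: Z = Y' w.
    apply: minY.
    + by apply/subsetP => _ /imsetP[x xZ ->]; rewrite -YiP (subsetP ZY).
    + by have [x xZ] := set0Pn _ Z0; apply/set0Pn; exists (val x); rewrite imset_f.
    + exact: (emb_cset (H := ind U) (f := val)).
    + move=> w' /eZ[a [b [aZ bY ab]]]; exists (val a), (val b); split; rewrite ?imset_f //.
      by rewrite -YiP.
  apply/setP => x; rewrite YiP -E mem_imset //.
- exact: dW.
Qed.

(** * Merging the suppressed vertices *)

Section WallOfGamma.
Variables (k : nat) (G : sgraph) (Z : Gamma k -> {set G}).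
Hypothesis tf : tfree G.
Hypothesis mZ : model Z.
Hypothesis clZ : forall x y a b, x != y -> a \in Z x -> b \in Z y -> a -- b ->
  x -- y /\ forall a' b', a' \in Z x -> b' \in Z y -> a' -- b' -> a' = a /\ b' = b.

Let wv (w : wall k) : Gamma k := val w.

Let wv_inj : injective wv. Proof. exact: val_inj. Qed.

Let wv_edge (w w' : wall k) : w -- w' <-> w != w' /\ (wv w -- wv w' \/ exists z, [/\ z \in suppressed k, wv w -- z & z -- wv w']).
Proof. exact: wall_edge. Qed.

Let wv_not (w : wall k) z : z \in suppressed k -> wv w <> z. Proof. exact: wall_not. Qed.

Let own (w : wall k) (u : Gamma k) :=
  (u == wv w) || [&& u \in suppressed k, wv w -- u & col u == (col (wv w)).+1].

Lemma ownP w u : own w u -> u = wv w \/ [/\ u \in suppressed k, wv w -- u, row u = row (wv w) & col u = (col (wv w)).+1].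
Proof.
case/orP=> [/eqP->|/and3P[us wu /eqP cu]]; [by left | right; split=> //].
by rewrite -(supp_row us (y := wv w)) // sedge_sym.
Qed.

Lemma own_self w : own w (wv w). Proof. by rewrite /own eqxx. Qed.

Lemma own_inj w w' u : own w u -> own w' u -> w = w'.
Proof.
move=> /ownP[->|[us wu r1 c1]] /ownP[e|[us' wu' r2 c2]].
- exact: wv_inj.
- by case: (wv_not (w := w) us').
- by case: (wv_not (w := w') us).
by apply/wv_inj/gam_eq; rewrite -?r1 -?r2 //; move: c1 c2; clear; lia.
Qed.

(* Two adjacent branch sets are joined at a single place: directly, or through the
   suppressed vertex on the right of one of them. *)
Lemma own_edge w w' u u' : w != w' -> own w u -> own w' u' -> u -- u' -> w -- w' /\
  [\/ [/\ u = wv w, u' = wv w' & wv w -- wv w'],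
      [/\ u <> wv w, u' = wv w', row (wv w') = row (wv w) & col (wv w') = (col (wv w)).+2] |
      [/\ u = wv w, u' <> wv w', row (wv w') = row (wv w) & col (wv w) = (col (wv w')).+2]].
Proof.
move=> ne; have ne' : wv w != wv w' by apply: contraNneq ne => /wv_inj->.
move=> /ownP[->|[us wu r1 c1]] /ownP[->|[us' wu' r2 c2]] uu.
- by split; [apply/wv_edge; split=> //; left | constructor 1].
- have uw : u' -- wv w' by rewrite sedge_sym.
  split; first by apply/wv_edge; split=> //; right; exists u'.
  have [h1 h2 h3] := supp_two ne' us' uu uw; constructor 3; split=> //.
    by move=> e; apply: (wv_not (w := w') us').
  by move: h3 c2; clear; lia.
- split; first by apply/wv_edge; split=> //; right; exists u.
  have [h1 h2 h3] := supp_two ne' us wu uu; constructor 2; split=> //.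
    by move=> e; apply: (wv_not (w := w) us).
  by move: h3 c1; clear; lia.
by have := supp_next us uu; rewrite in_setD us'.
Qed.

Lemma own_uniq w u v : own w u -> own w v -> u <> wv w -> v <> wv w -> u = v.
Proof.
move=> /ownP[//|[_ _ r1 c1]] /ownP[//|[_ _ r2 c2]] _ _.
by apply: gam_eq; rewrite ?r1 ?r2 ?c1 ?c2.
Qed.

Lemma wall_of_gamma : exists S, is_subdivision (wall k) S /\ induced_subgraph S G.
Proof.
have [nZ dZ eZ] := mZ.
pose Y w := \bigcup_(u | own w u) Z u.
have YP w a : a \in Y w -> exists2 u, own w u & a \in Z u by case/bigcupP => u; exists u.
have inY w u a : own w u -> a \in Z u -> a \in Y w by move=> h1 h2; apply/bigcupP; exists u.
have sY w u : own w u -> Z u \subset Y w by move=> h; apply/subsetP => a; apply: inY.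
apply: (@extract_sub (wall k) G Y tf); last exact: wall_deg.
- split.
  + move=> w; have [/set0Pn[a aZ] cZ] := nZ (wv w); split.
      by apply/set0Pn; exists a; apply: inY aZ; apply: own_self.
    apply: (@cset_star _ _ a) => b /YP[u ou bu].
    have := ou; case/ownP=> [e|[us wu _ _]].
      by subst u; apply: connS (sY _ _ ou) (csetE cZ aZ bu).
    have [c [d [cw du cd]]] := eZ _ _ wu; have [_ cu] := nZ u.
    apply: (@connS _ (Z (wv w) :|: Z u)); first by rewrite subUset !sY // own_self.
    apply: csetE; rewrite ?in_setU ?aZ ?bu ?orbT //.
    by apply: (csetU cZ cu cw du); rewrite cd orbT.
  + move=> w w' ne; apply/disjP => a /YP[u ou au] /YP[u' ou' au'].
    have e := model_eq mZ au au'; subst u'.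
    by move: ne; rewrite (own_inj ou ou') eqxx.
  + move=> w w' /wv_edge[ne [h|[z [zs wz zw]]]].
      have [a [b [aZ bZ ab]]] := eZ _ _ h.
      by exists a, b; split=> //; [apply: inY aZ | apply: inY bZ]; apply: own_self.
    have ne' : wv w != wv w' by apply: contraNneq ne => /wv_inj->.
    have [_ _ [[c1 _]|[_ c2]]] := supp_two ne' zs wz zw.
      have [a [b [aZ bZ ab]]] := eZ _ _ zw; exists a, b; split=> //.
        by apply: inY aZ; rewrite /own zs wz c1 eqxx orbT.
      by apply: inY bZ; apply: own_self.
    have [a [b [aZ bZ ab]]] := eZ _ _ wz; exists a, b; split=> //.
      by apply: inY aZ; apply: own_self.
    by apply: inY bZ; rewrite /own zs c2 eqxx sedge_sym zw orbT.
move=> w w' a b ne /YP[u ou au] /YP[u' ou' bu'] ab.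
have uu : u != u' by apply: contraNneq ne => e; subst u'; rewrite (own_inj ou ou').
have [euu un] := clZ uu au bu' ab.
have [ww ty] := own_edge ne ou ou' euu; split=> // a' b' /YP[v ov av] /YP[v' ov' bv'] ab'.
have vv : v != v' by apply: contraNneq ne => e; subst v'; rewrite (own_inj ov ov').
have [evv _] := clZ vv av bv' ab'.
have [_ ty'] := own_edge ne ov ov' evv.
have two (x y : Gamma k) : x -- y -> row y = row x -> col y = (col x).+2 \/ col x = (col y).+2 -> False.
  by move=> /gam_adj h1 h2; move: h1 h2; clear; lia.
(* The two edges are of the same kind in [own_edge]: the columns of [w] and [w'] within a row differ
   by two exactly when a suppressed vertex lies between them, and the sign of the difference tells
   which of the two owns it. *)
suff [e1 e2] : v = u /\ v' = u' by subst v v'; apply: un.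
case: ty ty' => [[e1 e2 h]|[n1 e2 h1 h2]|[e1 n2 h1 h2]] [[e3 e4 h']|[n3 e4 h3 h4]|[e3 n4 h3 h4]].
- by rewrite e1 e2.
- by case: (two _ _ h h3); left.
- by case: (two _ _ h h3); right.
- by case: (two _ _ h' h1); left.
- by rewrite e2 e4; split=> //; apply: own_uniq ov ou n3 n1.
- by exfalso; move: h2 h4; clear; lia.
- by case: (two _ _ h' h1); right.
- by exfalso; move: h2 h4; clear; lia.
- by rewrite e1 e3; split=> //; apply: own_uniq ov' ou' n4 n2.
Qed.
End WallOfGamma.

(** * The interior of a brick graph *)

Section BrickFacts.
Variable t : nat.
Let r := t + 4.
Let n := 2 * t + 6.

Lemma brick_mk i j : i < r -> j < n -> exists x : brick r n, x.1 = i :> nat /\ x.2 = j :> nat.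
Proof. by move=> li lj; exists (Ordinal li, Ordinal lj). Qed.

Lemma brick_h (x y : brick r n) : y.1 = x.1 :> nat -> y.2 = x.2.+1 :> nat -> x -- y.
Proof. by move=> h1 h2; rewrite /= /bedge /barc h1 h2 !eqxx. Qed.

Lemma brick_v (x y : brick r n) : y.1 = x.1.+1 :> nat -> y.2 = x.2 :> nat -> odd (x.1 + x.2) -> x -- y.
Proof. by move=> h1 h2 h3; rewrite /= /bedge /barc h1 h2 h3 !eqxx orbT. Qed.

Lemma brick_adj (x y : brick r n) : x -- y -> (y.1 = x.1 :> nat /\ (y.2 = x.2.+1 :> nat \/ x.2 = y.2.+1 :> nat)) \/
  (y.2 = x.2 :> nat /\ (y.1 = x.1.+1 :> nat \/ x.1 = y.1.+1 :> nat)).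
Proof.
rewrite /= /bedge /barc; case/orP=> /orP[/andP[/eqP h1 /eqP h2]|/and3P[/eqP h1 /eqP h2 h3]].
- by left; split=> //; left.
- by right; split=> //; left.
- by left; split=> //; right.
- by right; split=> //; right.
Qed.

Lemma brick_deg (x : brick r n) : 0 < x.1 -> x.1.+1 < r -> 0 < x.2 -> x.2.+1 < n -> 2 < #|neighb x|.
Proof.
move=> a1 a2 b1 b2.
have [|y [y1 y2]] := @brick_mk x.1 x.2.-1 (ltn_ord _); first by apply: ltn_trans b2; rewrite prednK.
have [|z [z1 z2]] := @brick_mk x.1 x.2.+1 (ltn_ord _); first by [].
have xy : x -- y by rewrite sedge_sym; apply: brick_h; rewrite ?y1 ?y2 ?prednK.
have xz : x -- z by apply: brick_h; rewrite ?z1 ?z2.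
have [w xw nw] : exists2 w : brick r n, x -- w & w.1 <> x.1 :> nat.
  have [od|od] := boolP (odd (x.1 + x.2)).
    have [||w [w1 w2]] := @brick_mk x.1.+1 x.2 => //.
    by exists w; [apply: brick_v; rewrite ?w1 ?w2 | rewrite w1 => /esym/n_Sn].
  have [||w [w1 w2]] := @brick_mk x.1.-1 x.2 => //; first by apply: ltn_trans a2; rewrite prednK.
  exists w; last by rewrite w1 => h; move: a1 h; case: (nat_of_ord _) => // m _ /n_Sn.
  rewrite sedge_sym; apply: brick_v; rewrite ?w1 ?w2 ?prednK //.
  by move: od; rewrite -{1}(prednK a1) addSn oddS negbK.
apply/card_gt2P; exists y, z, w; split; rewrite ?inE //.
split; apply/eqP => e.
- by move: z2; rewrite -e y2; move: b1; clear; case: (nat_of_ord _) => // m _ /=; lia.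
- by apply: nw; rewrite -e z1.
- by apply: nw; rewrite e y1.
Qed.

Lemma brick_good (x : brick r n) : 1 < x.1 -> x.1.+2 < r -> 1 < x.2 -> x.2.+2 < n -> good x.
Proof.
move=> a1 a2 b1 b2; split; first by apply: brick_deg; lia.
by move=> y /brick_adj h; apply: brick_deg; lia.
Qed.

Lemma brick_cset : cset [set: brick r n].
Proof.
have r0 : 0 < r by rewrite /r addn4.
have n1 : 1 < n by rewrite /n addnC.
have n0 := ltnW n1.
have ro (x : brick r n) : conn setT ((x.1, Ordinal n0) : brick r n) x.
  case: x => i [j lj]; elim: j lj => [|j IH] lj /=.
    by rewrite (_ : Ordinal lj = Ordinal n0) ?conn0 //; apply: val_inj.
  apply: conn_trans (IH (ltnW lj)) (conn1 _ _ _); rewrite ?inE //; exact: brick_h.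
apply: (@cset_star (brick r n) _ (Ordinal r0, Ordinal n0)) => x _; apply: conn_trans (ro x).
case: x => [[i li] j] /= {j}; elim: i li => [|i IH] li.
  by rewrite (_ : Ordinal li = Ordinal r0) ?conn0 //; apply: val_inj.
apply: conn_trans (IH (ltnW li)) _.
pose j : 'I_n := if odd i then Ordinal n0 else Ordinal n1.
apply: (@conn_trans (brick r n) _ (Ordinal (ltnW li), j)); first exact: (ro (Ordinal (ltnW li), j)).
apply: (@conn_trans (brick r n) _ (Ordinal li, j)); last by rewrite conn_sym; exact: (ro (Ordinal li, j)).
apply: conn1; rewrite ?inE //; apply: brick_v => //=.
by rewrite /j; case: ifP => /= od; rewrite ?addn0 ?addn1 ?oddS ?od.
Qed.

Lemma wall_subdivision (G : sgraph) (X : brick r n -> {set G}) : tfree G -> model X -> mclean X ->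
  (forall X' : brick r n -> {set G}, model X' -> mclean X' -> msize X <= msize X') ->
  exists S, is_subdivision (wall t) S /\ induced_subgraph S G.
Proof.
move=> tf mX cX minX.
have e1 (x : Gamma t) : x.1 + 2 < r by rewrite /r; have := ltn_ord x.1; lia.
have e2 (x : Gamma t) : x.2 + 3 < n by rewrite /n; have := ltn_ord x.2; lia.
(* A margin of two rows and two columns on every side makes the images [good]; the third column of
   the shift adjusts the parity of the vertical edges. *)
pose e (x : Gamma t) : brick r n := (Ordinal (e1 x), Ordinal (e2 x)).
have ee x y : e x -- e y = x -- y.
  rewrite /= /bedge /barc /gedge /garc /row /col /= !eqSS -!addSn !eqn_add2r.
  have od (z : Gamma t) : odd (z.1 + 2 + (z.2 + 3)) = odd (z.1.+1 + z.2) by lia.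
  by rewrite !od.
have ei x y : x != y -> e x != e y.
  case: x y => [i j] [i' j']; apply: contraNneq => -[/addIn h1 /addIn h2].
  by apply/eqP; congr (_, _); apply: val_inj.
have eg x : good (e x).
  case: x => [[i li] [j lj]]; apply: brick_good; rewrite /= ?addn2 ?addn3 //.
    by rewrite /r addn4 !ltnS.
  by rewrite /n !addnS addn0 !ltnS ltnW.
apply: (@wall_of_gamma t G (fun x => X (e x)) tf).
  have [nX dX eX] := mX; split=> [x|x y /ei|x y xy]; [exact: nX | exact: dX | by apply: eX; rewrite ee].
move=> x y a b ne aX bX ab; rewrite -ee.
exact: (needed brick_cset mX cX minX (ei x y ne) (eg x) (eg y) aX bX ab).
Qed.
End BrickFacts.

(** * Treewidth and brambles *)

Section Treewidth.
Variable G : sgraph.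
Implicit Types (D E : seq {set G}) (A B K R S U W : {set G}) (u v x y : G).

Definition cov D v := has (fun B : {set G} => v \in B) D.

(* The running intersection property: each bag meets the union of the earlier ones
   inside a single earlier bag, its parent. *)
Definition runint D := forall i, 0 < i -> i < size D -> exists p, p < i /\
  forall j v, j < i -> v \in nth set0 D i -> v \in nth set0 D j -> v \in nth set0 D p.

Lemma runint_rcons D R B : runint D -> R \in D -> (forall v, v \in B -> cov D v -> v \in R) -> runint (rcons D B).
Proof.
move=> rD RD h i i0; rewrite size_rcons ltnS leq_eqVlt => /orP[/eqP->|lt].
  exists (index R D); rewrite index_mem RD; split=> // j v lj.
  rewrite !nth_rcons ltnn eqxx lj index_mem RD nth_index // => vB vj.
  by apply: h => //; apply/hasP; exists (nth set0 D j); rewrite ?mem_nth.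
have [p [lp hp]] := rD i i0 lt; exists p; split=> // j v lj; rewrite !nth_rcons lt.
by rewrite (ltn_trans lj lt) (ltn_trans lp lt); apply: hp.
Qed.

Section NoBramble.
Variable k : nat.
Hypothesis k0 : 0 < k.
Hypothesis nobr : ~ exists F : {set {set G}}, bramble F /\ border k F.

(** Otherwise the connected sets with more than half of [W] form a bramble of order at least [k],
    any two of them meeting in [W]. *)
Lemma balanced W : exists S, #|S| < k /\ forall x, x \notin S -> 2 * #|ccomp (~: S) x :&: W| <= #|W|.
Proof.
apply: contrapT => no; apply: nobr; pose F := [set A : {set G} | cset A && (#|W| < 2 * #|A :&: W|)].
exists F; split; first split.
- move=> A; rewrite in_set => /andP[cA lt]; split=> //; apply/negP => /eqP A0.
  by move: lt; rewrite A0 set0I cards0 muln0.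
- move=> A B; rewrite !in_set => /andP[_ lA] /andP[_ lB].
  have [x xAB] : exists x, x \in (A :&: W) :&: (B :&: W).
    apply/set0Pn; apply/negP => /eqP e.
    have := subset_leq_card (_ : (A :&: W) :|: (B :&: W) \subset W); rewrite subUset !subsetIr => /(_ isT).
    have := cardsU (A :&: W) (B :&: W); rewrite e cards0 subn0 => ->.
    by move: lA lB; clear; lia.
  move: xAB; rewrite !in_setI => /andP[/andP[xA _] /andP[xB _]]; exists x, x; split; rewrite ?eqxx //.
move=> Y lt; have [x [xY lx]] : exists x, x \notin Y /\ #|W| < 2 * #|ccomp (~: Y) x :&: W|.
  apply: contrapT => no'; apply: no; exists Y; split=> // x xY; rewrite leqNgt; apply/negP => h.
  by apply: no'; exists x.
exists (ccomp (~: Y) x); first by rewrite in_set cset_comp.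
by rewrite disjoints_subset comp_sub.
Qed.

Lemma nbs_sub U K R u : K = ccomp U u -> nbs U \subset R -> nbs K \subset R.
Proof.
move=> -> UR; apply/subsetP => y /nbsP[yK [x xK xy]]; apply: (subsetP UR); apply/nbsP; split.
  by apply: contra yK => yU; apply: comp_step xK yU xy.
by exists x => //; apply: (subsetP (comp_sub _ _)) xK.
Qed.

(* Add [u] to [W := nbs K] for a component [K] of [U]; a balanced separator of [u |: W]
   keeps the neighbourhoods of the new components below [2 * k]. *)
Lemma bags m U D R : #|U| <= m -> runint D -> R \in D -> (forall v, v \in U -> ~~ cov D v) -> nbs U \subset R ->
  (forall u, u \in U -> #|nbs (ccomp U u)| <= 2 * k) ->
  exists E, [/\ runint (D ++ E), (forall v, cov E v -> v \in U \/ v \in nbs U), (forall v, v \in U -> cov E v),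
     (forall B, B \in E -> #|B| <= 3 * k) &
     forall x y, x \in U -> x -- y -> exists B, [/\ B \in E, x \in B & y \in B]].
Proof.
elim: m U D R => [|m IH] U D R le rD RD dU NR small.
  have U0 : U = set0 by apply/eqP; rewrite -cards_eq0 -leqn0.
  by exists [::]; rewrite cats0; split=> // v; rewrite U0 in_set0.
have [->|/set0Pn[u uU]] := eqVneq U set0.
  by exists [::]; rewrite cats0; split=> // v; rewrite in_set0.
pose K := ccomp U u; pose W := nbs K.
have KU : K \subset U by apply: comp_sub.
have uK : u \in K by apply: mem_comp.
have WR : W \subset R by apply: nbs_sub NR.
have cW : #|W| <= 2 * k by apply: small.
have WK v : v \in W -> v \notin K by move=> /nbsP[].
have WU v : v \in W -> v \notin U.
  by move=> /nbsP[vK [x xK xv]]; apply: contra vK => vU; apply: comp_step xK vU xv.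
have KN x y : x \in K -> x -- y -> y \in K \/ y \in W.
  move=> xK xy; have [yK|yK] := boolP (y \in K); [by left | right; apply/nbsP; split=> //; by exists x].
have [S [cS bal]] := balanced (u |: W).
(* The new bag has at most [2 * k + 1 + (k - 1)] vertices, and [u] is included so that the rest of
   [K] is smaller than [U]. *)
pose R' := (u |: W) :|: (S :&: K).
have uR' : u \in R' by rewrite in_setU in_setU1 eqxx.
have WR' : W \subset R' by apply/subsetP => v vW; rewrite in_setU in_setU1 vW orbT.
have R'KW v : v \in R' -> v \in K \/ v \in W.
  by rewrite in_setU in_setU1 in_setI => /orP[/orP[/eqP->|]|/andP[]]; [left|right|left].
have cR' : #|R'| <= 3 * k.
  apply: leq_trans (leq_card_setU _ _) _; apply: leq_trans (leq_add (_ : _ <= 2 * k + 1) (_ : _ <= k.-1)) _.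
  - by rewrite cardsU1 addnC leq_add // leq_b1.
  - by apply: leq_trans (subset_leq_card (subsetIl _ _)) _; rewrite -ltnS prednK.
  - by move: k0; clear; lia.
have rD1 : runint (rcons D R').
  apply: runint_rcons RD _ => // v /R'KW[vK|vW] cv; last exact: (subsetP WR).
  by have := dU v (subsetP KU v vK); rewrite cv.
pose U1 := K :\: R'.
have lt1 : #|U1| <= m.
  rewrite -ltnS; apply: leq_trans le; apply: leq_ltn_trans (_ : #|U :\ u| < _).
    apply/subset_leq_card/subsetP => v /setDP[vK vR]; rewrite in_setD1 (subsetP KU) // andbT.
    by apply: contraNneq vR => ->.
  by rewrite [X in _ < X](cardsD1 u) uU.
have N1 : nbs U1 \subset R'.
  apply/subsetP => y /nbsP[yU1 [x /setDP[xK _] xy]]; case: (KN x y xK xy) => [yK|/(subsetP WR')//].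
  by move: yU1; rewrite in_setD yK andbT negbK.
have small1 v : v \in U1 -> #|nbs (ccomp U1 v)| <= 2 * k.
  move=> vU1; have vS : v \notin S.
    move: vU1 => /setDP[vK]; apply: contra => vS; by rewrite in_setU in_setI vS vK orbT.
  pose C := ccomp (~: S) v; have sub : ccomp U1 v \subset C.
    apply: sub_comp; [exact: cset_comp | | exact: mem_comp].
    apply: subset_trans (comp_sub _ _) _; apply/subsetP => w /setDP[wK wR]; rewrite in_setC.
    by apply: contra wR => wS; rewrite in_setU in_setI wS wK orbT.
  have : nbs (ccomp U1 v) \subset (C :&: (u |: W)) :|: S.
    apply/subsetP => y yN; have yR' := subsetP (nbs_sub erefl N1) y yN.
    have [yS|yS] := boolP (y \in S); first by rewrite in_setU yS orbT.
    have /nbsP[_ [x xC xy]] := yN; rewrite in_setU in_setI; apply/orP; left; apply/andP; split.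
      by apply: comp_step (subsetP sub x xC) _ xy; rewrite in_setC.
    by case/setUP: yR' => // /setIP[]; rewrite (negPf yS).
  move=> /subset_leq_card /leq_trans; apply; apply: leq_trans (leq_card_setU _ _) _.
  (* At most half of [2 * k + 1], that is [k], plus fewer than [k] vertices of [S]. *)
  have := bal v vS; rewrite -/C => h.
  have h2 : #|u |: W| <= (2 * k).+1 by rewrite cardsU1 -add1n leq_add // leq_b1.
  by move: h h2 cS; clear; lia.
have dU1 v : v \in U1 -> ~~ cov (rcons D R') v.
  by move=> /setDP[vK vR]; rewrite /cov has_rcons (negPf vR) /= dU // (subsetP KU).
have RD1 : R' \in rcons D R' by rewrite mem_rcons mem_head.
have [E1 [rE1 cE1 sE1 bE1 eE1]] := IH U1 _ R' lt1 rD1 RD1 dU1 N1 small1.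
(* The other components of [U] still have their neighbours in the old bag [R], which serves as
   parent for them. *)
pose U2 := U :\: K; have lt2 : #|U2| <= m.
  rewrite -ltnS; apply: leq_trans le; apply: leq_ltn_trans (_ : #|U :\ u| < _).
    by apply/subset_leq_card/setDS; rewrite sub1set.
  by rewrite [X in _ < X](cardsD1 u) uU.
have U2K x y : x \in U2 -> x -- y -> y \notin K.
  move=> /setDP[xU xK] xy; apply: contra xK => yK; apply: comp_step yK xU _; by rewrite sedge_sym.
have N2 : nbs U2 \subset nbs U.
  apply/subsetP => y /nbsP[yU2 [x xU2 xy]]; apply/nbsP; split; last by exists x => //; case/setDP: xU2.
  by apply: contra yU2 => yU; rewrite in_setD yU andbT (U2K x y xU2 xy).
have comp2 v : v \in U2 -> ccomp U2 v = ccomp U v.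
  move=> vU2; apply/eqP; rewrite eqEsubset; apply/andP; split.
    apply: sub_comp; [exact: cset_comp | | exact: mem_comp].
    exact: subset_trans (comp_sub _ _) (subsetDl _ _).
  apply/subsetP => w; rewrite in_set => /andP[wU cvw].
  apply: (conn_closed (P := mem (ccomp U2 v))) cvw _; last exact: mem_comp.
  move=> a b aC aU bU ab; apply: (comp_step aC) => //; rewrite in_setD bU andbT.
  by apply: U2K ab; apply: (subsetP (comp_sub _ _)) aC.
have small2 v : v \in U2 -> #|nbs (ccomp U2 v)| <= 2 * k.
  by move=> vU2; rewrite comp2 //; apply: small; case/setDP: vU2.
have NU1 v : v \in nbs U1 -> v \in K \/ v \in W by move=> /(subsetP N1)/R'KW.
have dU2 v : v \in U2 -> ~~ cov (rcons D R' ++ E1) v.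
  move=> /setDP[vU vK]; apply/negP; rewrite /cov has_cat has_rcons => /orP[/orP[/R'KW[]|cv]|/cE1[/setDP[]|/NU1[]]].
  - by rewrite (negPf vK).
  - by move/WU; rewrite vU.
  - by have := dU v vU; rewrite /cov cv.
  - by rewrite (negPf vK).
  - by rewrite (negPf vK).
  - by move/WU; rewrite vU.
have RD2 : R \in rcons D R' ++ E1 by rewrite mem_cat mem_rcons in_cons RD !orbT.
have [E2 [rE2 cE2 sE2 bE2 eE2]] := IH U2 _ R lt2 rE1 RD2 dU2 (subset_trans N2 NR) small2.
have WN v : v \in W -> v \in nbs U by apply/subsetP/(@nbs_sub U _ _ u).
exists (R' :: E1 ++ E2); split.
- by rewrite -cat_rcons catA.
- move=> v; rewrite /cov /= has_cat => /or3P[/R'KW[vK|/WN vN]|/cE1[/setDP[vK _]|/NU1[vK|/WN vN]]|/cE2[/setDP[vU _]|/(subsetP N2) vN]].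
  + by left; apply: (subsetP KU).
  + by right.
  + by left; apply: (subsetP KU).
  + by left; apply: (subsetP KU).
  + by right.
  + by left.
  + by right.
- move=> v vU; rewrite /cov /= has_cat; have [vK|vK] := boolP (v \in K); last first.
    by have := sE2 v; rewrite /cov in_setD vK vU => -> //; rewrite !orbT.
  have [//|vR] := boolP (v \in R').
  by have := sE1 v; rewrite /cov in_setD vR vK => ->.
- by move=> B; rewrite in_cons mem_cat => /or3P[/eqP->//|/bE1|/bE2].
have wrap B x y : B \in E1 ++ E2 -> x \in B -> y \in B -> exists B, [/\ B \in R' :: E1 ++ E2, x \in B & y \in B].
  by move=> h xB yB; exists B; rewrite in_cons h orbT.
move=> x y xU xy; have [xK|xK] := boolP (x \in K); last first.
  have [|B [BE xB yB]] := eE2 x y _ xy; first by rewrite in_setD xK.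
  by apply: (wrap B); rewrite // mem_cat BE orbT.
have [xR|xR] := boolP (x \in R'); last first.
  have [|B [BE xB yB]] := eE1 x y _ xy; first by rewrite in_setD xR.
  by apply: (wrap B); rewrite // mem_cat BE.
have [yR|yR] := boolP (y \in R'); first by exists R'; rewrite mem_head.
have yK : y \in K by case: (KN x y xK xy) => // /(subsetP WR'); rewrite (negPf yR).
have [||B [BE yB xB]] := eE1 y x; [by rewrite in_setD yR | by rewrite sedge_sym |].
by apply: (wrap B); rewrite // mem_cat BE.
Qed.

Lemma small_treewidth : treewidth G <= 3 * k.
Proof.
(* An empty bag is the root, so that the recursion always has a parent. *)
have rD : runint [:: set0] by move=> i i0; rewrite /= ltnNge i0.
have NT : nbs [set: G] \subset set0 by apply/subsetP => y /nbsP[]; rewrite in_setT.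
have [||E [rE _ sE bE eE]] := @bags #|[set: G]| setT [:: set0] set0 (leqnn _) rD (mem_head _ _) _ NT.
- by move=> v _; rewrite /cov /= in_set0.
- move=> u uT; rewrite (_ : nbs _ = set0) ?cards0 //; apply/setP => y; rewrite in_set0; apply/negP => /nbsP[yC [x xC xy]].
  by move: yC; rewrite (comp_step xC _ xy).
pose D := set0 :: E; pose n := size D; pose B (i : 'I_n) := nth set0 D i.
have pex (i : nat) : exists p, 0 < i -> i < n -> p < i /\ forall j v, j < i -> v \in nth set0 D i -> v \in nth set0 D j -> v \in nth set0 D p.
  have [->|i0] := posnP i; first by exists 0.
  have [lt|] := ltnP i n; last by exists 0.
  by have [p hp] := rE i i0 lt; exists p.
have [par parP] := boolp.choice pex.
pose te (i j : 'I_n) := ((0 < i) && (par i == j)) || ((0 < j) && (par j == i)).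
have te_sym : symmetric te by move=> i j; rewrite /te orbC.
have te_irr : irreflexive te.
  move=> i; rewrite /te orbb; apply/negP => /andP[i0 /eqP e].
  by have [] := parP i i0 (ltn_ord i); rewrite e ltnn.
pose T := SGraph te_sym te_irr.
have te_lt (i j : 'I_n) : te i j -> j < i -> par i = j.
  case/orP=> /andP[h /eqP e] // ji; have [] := parP j h (ltn_ord j); by rewrite e ltnNge ltnW.
have tree : is_tree T.
  split; first by rewrite card_ord.
  - apply/(@csetP T); apply: (@cset_star T _ (ord0 : 'I_n)) => -[i li] _.
    elim/ltn_ind: i li => i IH li; have [i0|i0] := posnP i.
      by subst i; rewrite (_ : Ordinal li = ord0) ?(@conn0 T) //; apply: val_inj.
    have [pi _] := parP i i0 li; apply: (@conn_trans T _ (Ordinal (ltn_trans pi li))); first exact: IH.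
    by apply: (@conn1 T); rewrite ?inE // /= /te /= i0 eqxx orbT.
  (* The largest index on a cycle would have two smaller neighbours there, both equal to its
     parent. *)
  move=> c /andP[cy un]; rewrite ltnNge; apply/negP => sz.
  have [m mc mmax] : exists2 m : 'I_n, m \in c & forall j : 'I_n, j \in c -> j <= m.
    case: c sz {cy un} => // a c _; have aP : a \in a :: c by rewrite mem_head.
    by case: (arg_maxnP (P := mem (a :: c)) (fun j : 'I_n => val j) aP) => m mc mm; exists m.
  have [i q rq] := rot_to mc; move: cy un sz; rewrite -(rot_cycle i) -(rot_uniq i) -(size_rot i) rq /=.
  have mem_q j : j \in q -> j \in c by move=> jq; rewrite -(mem_rot i) rq in_cons jq orbT.
  case: q mem_q {rq} => [|a q] // mem_q; case/lastP: q mem_q => [|q b] // mem_q.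
  rewrite /= rcons_path last_rcons => /and3P[ma _ bm] /andP[mn /andP[an _]] _.
  have lt (j : 'I_n) : j \in a :: rcons q b -> j < m.
    move=> jq; rewrite ltn_neqAle mmax ?mem_q // andbT; apply: contraNneq mn => /val_inj <-; exact: jq.
  have ha : par m = a by apply: te_lt ma (lt _ (mem_head _ _)).
  have hb : par m = b by apply: te_lt; [rewrite -/(te m b) te_sym | apply: lt; rewrite in_cons mem_rcons mem_head orbT].
  have ab : a = b by apply: val_inj; rewrite /= -ha -hb.
  by move: an; rewrite ab mem_rcons mem_head.
have mD (A : {set G}) : A \in E -> exists i : 'I_n, B i = A.
  move=> AE; have lt : index A D < n by rewrite index_mem in_cons AE orbT.
  by exists (Ordinal lt); rewrite /B /= nth_index // in_cons AE orbT.
have dec : tree_decomposition (B : T -> {set G}).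
  split=> //.
  - move=> v; have /hasP[A AE vA] := sE v (in_setT v); have [i e] := mD A AE; by exists i; rewrite e.
  - move=> u v uv; have [A [AE uA vA]] := eE u v (in_setT u) uv; have [i e] := mD A AE; by exists i; rewrite e.
  move=> v; have [->|/set0Pn[i0 i0S]] := eqVneq [set i : T | v \in B i] set0; first by move=> x y; rewrite in_set0.
  (* By [runint], the parent of a bag containing [v] contains [v] too, unless the bag is the first
     one with [v]; so parents lead to the first. *)
  apply/(@csetP T); case: (arg_minnP (P := mem [set i : T | v \in B i]) (fun j : 'I_n => val j) i0S) => m mS mm.
  apply: (@cset_star T _ m) => -[i li]; elim/ltn_ind: i li => i IH li iS.
  have [e|ne] := eqVneq (Ordinal li) m; first by rewrite e (@conn0 T).
  have mi : m < i by rewrite ltn_neqAle (mm _ iS) andbT; apply: contraNneq ne => e; apply/eqP/val_inj.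
  have i1 : 0 < i by apply: leq_ltn_trans mi.
  have [pi hp] := parP i i1 li.
  have pS : Ordinal (ltn_trans pi li) \in [set i : T | v \in B i].
    rewrite in_set /B /=; apply: (hp m) => //; first by move: iS; rewrite in_set.
    by move: mS; rewrite /= in_set.
  apply: (@conn_trans T _ (Ordinal (ltn_trans pi li))); first exact: IH.
  by apply: (@conn1 T) => //; rewrite /= /te /= i1 eqxx orbT.
have wd : width (B : T -> {set G}) <= 3 * k.
  apply: leq_trans (leq_pred _) _; apply/bigmax_leqP => i _; rewrite /B.
  case: i => [[|i] li] /=; first by rewrite cards0.
  by apply: bE; apply: mem_nth.
rewrite /treewidth; case: ex_minnP => w _ mn; apply: leq_trans wd; apply: mn.
by apply/asboolP; exists T, B.
Qed.
End NoBramble.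

Theorem tw_bramble k : 0 < k -> 3 * k < treewidth G -> exists F : {set {set G}}, bramble F /\ border k F.
Proof. by move=> k0 lt; apply: contrapT => no; move: lt; rewrite ltnNge small_treewidth. Qed.
End Treewidth.

(** * Triangles *)

Section Triangles.
Variable G : sgraph.
Implicit Types (u v w x y z a b t : G) (K D S : {set G}) (o p q s T : seq G).

Lemma ich_cons b x p : ich (x :: p) -> b -- x -> (forall u, u \in x :: p -> b -- u -> u = x) ->
  b \notin x :: p -> ich (b :: x :: p).
Proof.
move=> ip bx un bp; rewrite ichE bx ip andbT /=; apply/allP => u up.
have us : u \in x :: p by rewrite in_cons up orbT.
apply/andP; split; first by apply: contraNneq bp => <-.
apply/negP => /(un u us) e; have := ich_uniq ip; by rewrite /= -e up.
Qed.

Lemma ich_rcons b x p : ich (x :: p) -> b -- last x p -> (forall u, u \in x :: p -> b -- u -> u = last x p) ->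
  b \notin x :: p -> ich (rcons (x :: p) b).
Proof.
move=> ip bx un bp; rewrite -ich_rev rev_rcons.
have [y [q E]] : exists y q, rev (x :: p) = y :: q by rewrite lastI rev_rcons; exists (last x p), (rev (belast x p)).
have ey : y = last x p by rewrite -[last x p]/(last x (x :: p)) -[x :: p]revK E rev_cons last_rcons.
have mE u : (u \in y :: q) = (u \in x :: p) by rewrite -E mem_rev.
rewrite E; apply: ich_cons; rewrite -?E ?ich_rev ?mem_rev ?ey //.
by move=> u; rewrite mem_rev; apply: un.
Qed.

Lemma ich_sep s1 a s2 u v : ich (s1 ++ a :: s2) -> u \in s1 -> v \in s2 -> nadj u v.
Proof.
move=> ic u1 v2; have h : has (pred1 u) s1 by rewrite has_pred1.
have [t1 [u' [t2 [E /eqP e _]]]] := split_first h; subst u'.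
by move: ic; rewrite E -catA cat_cons => /ich_nadj/(_ v2).
Qed.

(** The path closes with the edge [b1b2] to a hole, as [fan_hole] shows. *)
Definition fan b1 b2 x p := [/\ ich (x :: p), b1 -- x /\ b2 -- last x p,
  forall u, u \in x :: p -> b1 -- u -> u = x, forall u, u \in x :: p -> b2 -- u -> u = last x p &
  [/\ b1 \notin x :: p, b2 \notin x :: p, p != [::] & b1 -- b2] ].

Lemma fan_hole b1 b2 x p : fan b1 b2 x p -> hole (b1 :: x :: rcons p b2).
Proof.
case=> ip [b1x b2l] u1 u2 [n1 n2 p0 bb].
have b2b1 : b2 -- b1 by rewrite sedge_sym.
have ne : b1 != b2 by apply: sedge_neq.
apply: hole_of; rewrite ?last_rcons //.
- by rewrite -rcons_cons; apply: ich_rcons.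
- by rewrite size_rcons; case: (p) p0.
- by rewrite -rcons_cons mem_rcons in_cons negb_or ne.
move=> u; rewrite -rcons_cons mem_rcons in_cons => /orP[/eqP->|uo]; first by right.
by move=> /(u1 u uo) ->; left.
Qed.

(** By sparsity, the three neighbours [b1], [b2] and [u] of [b3] on the hole would lie in a single
    edge. *)
Lemma no_third b1 b2 b3 x p u : sparse G -> fan b1 b2 x p -> b1 -- b3 -> b2 -- b3 -> b3 \notin x :: p ->
  u \in x :: p -> ~~ b3 -- u.
Proof.
move=> sp fn b13 b23 n3 uo; have [ip _ _ _ [n1 n2 p0 bb]] := fn; apply/negP => b3u.
have n3' : b3 \notin b1 :: x :: rcons p b2.
  rewrite in_cons -rcons_cons mem_rcons in_cons 2!negb_or n3 andbT; apply/andP; split.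
    by rewrite eq_sym sedge_neq.
  by rewrite eq_sym sedge_neq.
have [a [b [_ _ ab /subsetP sub]]] := sp _ b3 (fan_hole fn) n3'.
have inH w : w \in x :: p \/ w = b1 \/ w = b2 -> b3 -- w -> w \in [set a; b].
  move=> h bw; apply: sub; rewrite in_setI !(in_set (fun _ => _)) bw /= in_cons -rcons_cons mem_rcons in_cons.
  by case: h => [->|[->|->]]; rewrite ?eqxx ?orbT.
have h1 : b1 \in [set a; b] by apply: inH; [right; left | rewrite sedge_sym].
have h2 : b2 \in [set a; b] by apply: inH; [right; right | rewrite sedge_sym].
have h3 : u \in [set a; b] by apply: inH; [left |].
have e1 : b1 != u by apply: contraNneq n1 => ->.
have e2 : b2 != u by apply: contraNneq n2 => ->.
have e3 : b1 != b2 by apply: sedge_neq.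
move: h1 h2 h3; rewrite !in_set2 => /orP[]/eqP E1 /orP[]/eqP E2 /orP[]/eqP E3; subst; by rewrite ?eqxx in e1 e2 e3.
Qed.

Definition conn3 b1 b2 b3 K D := [/\ cset D, [disjoint D & K], hits D b1, hits D b2 & hits D b3].

Section Attach.
Variables (b1 b2 b3 : G) (K D : {set G}) (x1 : G) (p : seq G) (t1 : G) (q : seq G).
Hypothesis sp : sparse G.
Hypothesis min : forall D', conn3 b1 b2 b3 K D' -> #|D| <= #|D'|.
Hypothesis DK : [disjoint D & K].
Hypothesis b12 : b1 -- b2.
Hypothesis b13 : b1 -- b3.
Hypothesis b23 : b2 -- b3.
Hypothesis bD : [/\ b1 \notin D, b2 \notin D & b3 \notin D].
Hypothesis h12 : forall u, u \in D -> b1 -- u -> b2 -- u -> False.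
Hypothesis h13 : forall u, u \in D -> b1 -- u -> b3 -- u -> False.
Hypothesis h23 : forall u, u \in D -> b2 -- u -> b3 -- u -> False.
Hypothesis fn : fan b1 b2 x1 p.
Hypothesis oD : {subset x1 :: p <= D}.
Hypothesis it : ich (t1 :: q).
Hypothesis tD : {subset t1 :: q <= D}.
Hypothesis ot : forall u, u \in t1 :: q -> u \notin x1 :: p.
Hypothesis bt : b3 -- t1.
Hypothesis bt_un : forall u, u \in t1 :: q -> b3 -- u -> u = t1.
Hypothesis bo : forall u, u \in x1 :: p -> ~~ b3 -- u.
Hypothesis tlo : exists2 w, w \in x1 :: p & last t1 q -- w.
Hypothesis to_un : forall u w, u \in t1 :: q -> w \in x1 :: p -> u -- w -> u = last t1 q.

(** If [b1] is attached to the path from [b3], then [D] contains a smaller set, without [x1],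
    attached to all of [b1], [b2], [b3]. *)
Lemma no_attach t : t \in t1 :: q -> ~~ b1 -- t.
Proof.
move=> tt; apply/negP => b1t; have [io [b1x b2l] un1 un2 [n1 n2 p0 _]] := fn.
have sub_lt (D' : {set G}) : D' \subset D -> x1 \notin D' -> conn3 b1 b2 b3 K D' -> False.
  move=> sub nx c3; have := min c3; rewrite leqNgt => /negP; apply; apply: proper_card.
  by apply/properP; split=> //; exists x1 => //; apply: oD; rewrite mem_head.
have dis (D' : {set G}) : D' \subset D -> [disjoint D' & K] by move=> sub; apply: disjointWl DK.
have x1T : x1 \notin t1 :: q by apply/negP => /ot; rewrite mem_head.
have x1p : x1 \notin p by have := ich_uniq io => /= /andP[].
have t1t : t1 \in t1 :: q by rewrite mem_head.
(* If the path from [b3] is joined to [p], the vertex [x1] can be left out. *)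
have [[w wp tw]|no] := EM (exists2 w, w \in p & last t1 q -- w).
  pose D' := [set u in p] :|: [set u in t1 :: q].
  have sub : D' \subset D.
    apply/subsetP => u; rewrite in_setU !(in_set (fun _ => _)) => /orP[h|/tD//].
    by apply: oD; rewrite in_cons h orbT.
  apply: (sub_lt D') => //; first by rewrite in_setU !(in_set (fun _ => _)) negb_or x1p.
  split; [| exact: dis | | |].
  - apply: (@csetU _ _ _ w (last t1 q)).
    + exact: ich_cset (ich_behead io).
    + exact: ich_cset.
    + by rewrite in_set.
    + by rewrite in_set mem_last.
    by rewrite sedge_sym tw orbT.
  - by apply/hitsP; exists t => //; rewrite in_setU !(in_set (fun _ => _)) tt orbT.
  - apply/hitsP; exists (last x1 p) => //; rewrite in_setU !(in_set (fun _ => _)).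
    by case: (p) p0 => // a p' _; rewrite /= mem_last.
  - by apply/hitsP; exists t1 => //; rewrite in_setU !(in_set (fun _ => _)) t1t orbT.
have tx : last t1 q -- x1.
  case: tlo => w; rewrite in_cons => /orP[/eqP->//|wp tw]; by case: no; exists w.
have iM : ich (t1 :: q ++ x1 :: p).
  apply: ich_cat => //.
    move=> u v uT vo; have [uv|uv] := boolP (u -- v); last first.
      by right; rewrite /nadj uv andbT; apply: contraNneq (ot uT) => <-.
    left; have e := to_un uT vo uv; split=> //.
    move: vo; rewrite in_cons => /orP[/eqP//|vp]; case: no; exists v => //; by rewrite -e.
  rewrite -cat_cons cat_uniq (ich_uniq it) (ich_uniq io) andbT andTb.
  by apply/hasPn => u uo; apply/negP => /ot; rewrite uo.
(* Otherwise both paths concatenate at [x1] to a chordless path. Up to its first neighbour [y] of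
   [b2] it is a fan for [b3] and [b2], where [b1] has no neighbour by [no_third]. So [y] comes
   before [x1], and the path from [b3] alone is attached to all three. *)
have hM : has (fun u => b2 -- u) (t1 :: q ++ x1 :: p).
  apply/hasP; exists (last x1 p) => //.
  by rewrite -cat_cons mem_cat mem_last orbT.
have [m1 [y [m2 [E b2y nm1]]]] := split_first hM.
have b2t1 : ~~ b2 -- t1 by apply/negP => h; apply: (h23 (tD t1t) h bt).
case: m1 E nm1 => [[e _]|t1' m1 [e E] nm1]; first by move: b2t1; rewrite e b2y.
subst t1'; have mM u : u \in t1 :: q ++ x1 :: p -> u \in t1 :: q \/ u \in x1 :: p.
  by rewrite -cat_cons mem_cat => /orP.
have sub1 u : u \in t1 :: rcons m1 y -> u \in t1 :: q ++ x1 :: p.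
  by rewrite E -cat_rcons !(in_cons t1) mem_cat => /orP[->//|->]; rewrite orbT.
have MD u : u \in t1 :: q ++ x1 :: p -> u \in D by move/mM => [/tD|/oD].
have [nD1 nD2 nD3] := bD.
have fn' : fan b3 b2 t1 (rcons m1 y).
  split.
  - by move: iM; rewrite E -cat_rcons -cat_cons; apply: ich_catl.
  - by rewrite last_rcons.
  - move=> u /sub1/mM[uT|uo]; first exact: bt_un.
    by rewrite (negPf (bo uo)).
  - move=> u; rewrite last_rcons -rcons_cons mem_rcons in_cons => /orP[/eqP//|um] bu.
    by move/hasPn: nm1 => /(_ u um); rewrite bu.
  split.
  - by apply: contra nD3 => /sub1/MD.
  - by apply: contra nD2 => /sub1/MD.
  - by case: (m1).
  - by rewrite sedge_sym.
have n1' : b1 \notin t1 :: rcons m1 y by apply: contra nD1 => /sub1/MD.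
have nb1 u : u \in t1 :: rcons m1 y -> ~~ b1 -- u.
  by apply: (no_third sp fn'); rewrite // sedge_sym.
have x1m : x1 \notin t1 :: rcons m1 y by apply/negP => /nb1; rewrite b1x.
have yT : y \in t1 :: q.
  have : y \in t1 :: q ++ x1 :: p by apply: sub1; rewrite -rcons_cons mem_rcons mem_head.
  rewrite -cat_cons mem_cat => /orP[//|yo]; exfalso.
  have uM := ich_uniq iM; have := uM; rewrite E.
  have ix : index x1 (t1 :: q ++ x1 :: p) = size (t1 :: q).
    by rewrite -cat_cons index_cat (negPf x1T) [index x1 (x1 :: p)]/= eqxx addn0.
  have iy : size (t1 :: q) <= index y (t1 :: q ++ x1 :: p).
    rewrite -cat_cons index_cat ifN ?leq_addr //.
    by apply/negP => /ot; rewrite yo.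
  have iy' : index y (t1 :: q ++ x1 :: p) = size (t1 :: m1).
    have := uM; rewrite E -cat_cons cat_uniq => /and3P[_ /hasPn/(_ y (mem_head _ _)) ny _].
    by rewrite index_cat (negPf ny) [index y (y :: _)]/= eqxx addn0.
  have ix' : size (t1 :: rcons m1 y) <= index x1 (t1 :: q ++ x1 :: p).
    by rewrite E -cat_rcons -cat_cons index_cat (negPf x1m) leq_addr.
  by move=> _; move: ix' iy; rewrite ix iy' /= size_rcons => h1 h2; have := leq_trans h1 h2; rewrite ltnn.
pose D' := [set u in t1 :: q].
have sub : D' \subset D by apply/subsetP => u; rewrite in_set; apply: tD.
apply: (sub_lt D') => //; first by rewrite in_set.
split; [exact: ich_cset | exact: dis | | |].
- by apply/hitsP; exists t; rewrite // in_set.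
- by apply/hitsP; exists y; rewrite // in_set.
- by apply/hitsP; exists t1; rewrite // in_set.
Qed.
End Attach.

Definition crossR (R : G -> G -> Prop) s s' := {in s & s', forall u v, u <> v /\ (u -- v <-> R u v)}.

Lemma cross_rcons (R : G -> G -> Prop) s s' b b' : crossR R s s' -> (forall u v, R u v -> u \in s /\ v \in s') ->
  b \notin s -> b' \notin s' ->
  (forall u, u \in s -> ~~ b' -- u /\ u <> b') -> (forall v, v \in s' -> ~~ b -- v /\ v <> b) -> b -- b' ->
  crossR (fun u v => R u v \/ (u = b /\ v = b')) (rcons s b) (rcons s' b').
Proof.
move=> cr RS bs bs' hs hs' bb u v; rewrite !mem_rcons !in_cons => /orP[/eqP->|us] /orP[/eqP->|vs].
- split; first by move=> e; move: bb; rewrite e sedge_irrefl.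
  by split=> // _; right.
- have [nv vb] := hs' v vs; split; first by move=> e; apply: vb.
  split; first by rewrite (negPf nv).
  case=> [/RS[h _]|[_ e]]; first by rewrite h in bs.
  by move: bs'; rewrite -e vs.
- have [nv vb] := hs u us; split=> //.
  split; first by rewrite sedge_sym (negPf nv).
  case=> [/RS[_ h]|[e _]]; first by rewrite h in bs'.
  by move: bs; rewrite -e us.
have [h1 h2] := cr u v us vs; split=> //; rewrite h2; split; first by left.
by case=> // -[e _]; move: bs; rewrite -e us.
Qed.

Lemma crossR_sym R R' s s' : (forall u v, R u v <-> R' v u) -> crossR R s s' -> crossR R' s' s.
Proof.
move=> RR cr u v us vs; have [h1 h2] := cr v u vs us; split; first by move=> e; apply: h1.
by rewrite sedge_sym h2 RR.
Qed.

Lemma crossR_ext (R R' : G -> G -> Prop) s s' : (forall u v, R u v <-> R' u v) -> crossR R s s' -> crossR R' s s'.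
Proof. by move=> RR cr u v us vs; have [h1 h2] := cr u v us vs; split=> //; rewrite h2 RR. Qed.

Definition tri (T : Type) (x y z : T) (i : 'I_3) : T := match nat_of_ord i with 0 => x | 1 => y | _ => z end.

Lemma tri_pair (P : 'I_3 -> 'I_3 -> Prop) : (forall i j, P i j -> P j i) ->
  P (inord 0) (inord 1) -> P (inord 0) (inord 2) -> P (inord 1) (inord 2) -> forall i j, i != j -> P i j.
Proof.
move=> sy h1 h2 h3 i j ne.
have E (k : 'I_3) : [\/ k = inord 0, k = inord 1 | k = inord 2].
  case: k => [[|[|[|k]]] lk] //; [constructor 1|constructor 2|constructor 3]; by apply: val_inj; rewrite /= inordK.
case: (E i) (E j) ne => -> [] ->; rewrite ?eqxx // => _; by [|apply: sy].
Qed.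

Lemma tri_all (P : 'I_3 -> Prop) : P (inord 0) -> P (inord 1) -> P (inord 2) -> forall i, P i.
Proof.
move=> h1 h2 h3 i.
have [->|->|->] : [\/ i = inord 0, i = inord 1 | i = inord 2] => //.
case: i => [[|[|[|k]]] lk] //; [constructor 1|constructor 2|constructor 3]; by apply: val_inj; rewrite /= inordK.
Qed.

Lemma triE (T : Type) (x y z : T) : [/\ tri x y z (inord 0) = x, tri x y z (inord 1) = y & tri x y z (inord 2) = z].
Proof. by rewrite /tri !inordK. Qed.

(** The disjunct [False] matches the output of [cross_rcons] when there is no edge besides the last
    one. *)
Let cr0 s s' b b' := crossR (fun u v => False \/ (u = b /\ v = b')) s s'.

Lemma mk_pyramid a b1 b2 b3 s1 s2 s3 : b1 -- b2 -> b1 -- b3 -> b2 -- b3 ->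
  [/\ ich (a :: rcons s1 b1), ich (a :: rcons s2 b2) & ich (a :: rcons s3 b3)] ->
  cr0 (rcons s1 b1) (rcons s2 b2) b1 b2 -> cr0 (rcons s1 b1) (rcons s3 b3) b1 b3 -> cr0 (rcons s2 b2) (rcons s3 b3) b2 b3 ->
  (s1 != [::] \/ s2 != [::]) -> s3 != [::] -> exists (a : G) (b : 'I_3 -> G) P, @induced_pyramid G a b P.
Proof.
move=> b12 b13 b23 [i1 i2 i3] c12 c13 c23 n12 n3.
have [B0 B1 B2] := triE b1 b2 b3; have [P0 P1 P2] := triE (rcons s1 b1) (rcons s2 b2) (rcons s3 b3).
exists a, (tri b1 b2 b3), (tri (rcons s1 b1) (rcons s2 b2) (rcons s3 b3)); split.
- by apply: tri_pair; rewrite ?B0 ?B1 ?B2 // => i j; rewrite sedge_sym.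
- have h s b : ich (a :: rcons s b) -> induced_path a (rcons s b) b /\ 1 <= size (rcons s b).
    by move=> /ich_induced; rewrite last_rcons size_rcons.
  by apply: tri_all; rewrite ?B0 ?B1 ?B2 ?P0 ?P1 ?P2; apply: h.
- have ext s s' b b' : cr0 s s' b b' -> crossR (fun u v => u = b /\ v = b') s s'.
    by apply: crossR_ext => u v; split=> [[]//|]; right.
  apply: (tri_pair (P := fun i j => crossR (fun u v => u = tri b1 b2 b3 i /\ v = tri b1 b2 b3 j) (tri (rcons s1 b1) (rcons s2 b2) (rcons s3 b3) i) (tri (rcons s1 b1) (rcons s2 b2) (rcons s3 b3) j))).
  + by move=> i j; apply: crossR_sym => u v; split=> -[].
  + by rewrite B0 B1 P0 P1; apply: ext.
  + by rewrite B0 B2 P0 P2; apply: ext.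
  + by rewrite B1 B2 P1 P2; apply: ext.
have s0 s b : size (rcons s b) = 1 -> s = [::] by rewrite size_rcons => -[/size0nil].
move=> i j hi hj; apply: contrapT => /eqP ne; move: ne hi hj.
apply: (tri_pair (P := fun i j => size (tri (rcons s1 b1) (rcons s2 b2) (rcons s3 b3) i) = 1 -> size (tri (rcons s1 b1) (rcons s2 b2) (rcons s3 b3) j) = 1 -> False)).
- by move=> i' j' h h1 h2; apply: h.
- by rewrite P0 P1 => /s0 e /s0 e'; move: n12; rewrite e e' !eqxx => -[].
- by rewrite P0 P2 => _ /s0 e; move: n3; rewrite e eqxx.
- by rewrite P1 P2 => _ /s0 e; move: n3; rewrite e eqxx.
Qed.

Let cr1 a a' s s' b b' := crossR (fun u v => (u = a /\ v = a') \/ (u = b /\ v = b')) (a :: s) (a' :: s').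

Lemma mk_prism a1 a2 a3 b1 b2 b3 s1 s2 s3 : b1 -- b2 -> b1 -- b3 -> b2 -- b3 -> a1 -- a2 -> a1 -- a3 -> a2 -- a3 ->
  [/\ ich (a1 :: rcons s1 b1), ich (a2 :: rcons s2 b2) & ich (a3 :: rcons s3 b3)] ->
  cr1 a1 a2 (rcons s1 b1) (rcons s2 b2) b1 b2 -> cr1 a1 a3 (rcons s1 b1) (rcons s3 b3) b1 b3 ->
  cr1 a2 a3 (rcons s2 b2) (rcons s3 b3) b2 b3 -> exists (a b : 'I_3 -> G) P, @induced_prism G a b P.
Proof.
move=> b12 b13 b23 a12 a13 a23 [i1 i2 i3] c12 c13 c23.
have [B0 B1 B2] := triE b1 b2 b3; have [P0 P1 P2] := triE (rcons s1 b1) (rcons s2 b2) (rcons s3 b3).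
have [A0 A1 A2] := triE a1 a2 a3.
exists (tri a1 a2 a3), (tri b1 b2 b3), (tri (rcons s1 b1) (rcons s2 b2) (rcons s3 b3)).
have cr : forall i j, i != j -> crossR (fun u v => (u = tri a1 a2 a3 i /\ v = tri a1 a2 a3 j) \/ (u = tri b1 b2 b3 i /\ v = tri b1 b2 b3 j))
     (tri a1 a2 a3 i :: tri (rcons s1 b1) (rcons s2 b2) (rcons s3 b3) i) (tri a1 a2 a3 j :: tri (rcons s1 b1) (rcons s2 b2) (rcons s3 b3) j).
  apply: tri_pair; rewrite ?A0 ?A1 ?A2 ?B0 ?B1 ?B2 ?P0 ?P1 ?P2 //.
  by move=> i j; apply: crossR_sym => u v; split=> -[[]|[]]; by [left|right].
have ip : forall i, induced_path (tri a1 a2 a3 i) (tri (rcons s1 b1) (rcons s2 b2) (rcons s3 b3) i) (tri b1 b2 b3 i) /\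
    1 <= size (tri (rcons s1 b1) (rcons s2 b2) (rcons s3 b3) i).
  have h s a b : ich (a :: rcons s b) -> induced_path a (rcons s b) b /\ 1 <= size (rcons s b).
    by move=> /ich_induced; rewrite last_rcons size_rcons.
  by apply: tri_all; rewrite ?A0 ?A1 ?A2 ?B0 ?B1 ?B2 ?P0 ?P1 ?P2; apply: h.
have bP j : tri b1 b2 b3 j \in tri (rcons s1 b1) (rcons s2 b2) (rcons s3 b3) j.
  by move: j; apply: tri_all; rewrite ?B0 ?B1 ?B2 ?P0 ?P1 ?P2 mem_rcons mem_head.
split=> //.
- apply: tri_pair; rewrite ?A0 ?A1 ?A2 ?B0 ?B1 ?B2 // => i j [h1 h2].
  by rewrite sedge_sym h1 sedge_sym h2.
- move=> i j e; have [ij|ne] := eqVneq i j.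
    subst j; have [[_ _ un _] _] := ip i; move: un; rewrite /= e bP //.
  have [|h _] := cr i j ne (tri a1 a2 a3 i) (tri b1 b2 b3 j) (mem_head _ _); first by rewrite in_cons bP orbT.
  exact: h.
Qed.
End Triangles.

(** * Graphs without star cutset *)

Section TriangleFree.
Variable G : sgraph.
Hypothesis vs : very_sparse G.
Hypothesis nsc : ~ has_star_cutset G.
Implicit Types (u v w x y z t : G) (K C D S : {set G}) (o p q s T : seq G).

Let sp : sparse G. Proof. by case: vs. Qed.

Lemma star_cset v C : v \in C -> C \subset cneighb v -> cset (~: C).
Proof.
move=> vC CN; apply: csetI => x y xC yC; apply: contrapT => /negP nc; apply: nsc.
pose A := ccomp (~: C) x; pose B := ~: C :\: A.
have AC : A \subset ~: C by apply: comp_sub.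
have sep : separation A C B.
  split.
  - apply/setP => u; rewrite !in_setU in_setD in_setC in_setT.
    by case: (u \in A); case: (u \in C).
  - split; first by rewrite disjoints_subset.
      by rewrite disjoint_sym disjoints_subset subsetDl.
    by apply/disjP => u uA; rewrite in_setD uA.
  move=> u w uA; rewrite in_setD => /andP[wA wC]; apply: contra wA => uw.
  exact: comp_step uA wC uw.
exists A, C, B; split; [split=> //; by exists v | split=> //].
  by apply/set0Pn; exists x; apply: mem_comp.
by apply/set0Pn; exists y; rewrite in_setD yC andbT /A in_set yC.
Qed.

(** Otherwise delete [u] and its neighbours except [x] and [y]; the rest is connected, and a
    shortest path from [x] to [y] in it closes through [u] to a hole. On this hole [v] sees [u], [x]
    and [y], which do not lie in one edge. *)
Lemma no_diamond u v x y : u -- v -> u -- x -> u -- y -> v -- x -> v -- y -> x != y -> x -- y.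
Proof.
move=> uv ux uy vx vy xy; apply: contrapT => /negP nxy.
pose C := cneighb u :\ x :\ y.
have uC : u \in C by rewrite !in_setD1 in_setU1 eqxx !sedge_neq.
have vC : v \in C by rewrite !in_setD1 in_setU1 in_set uv orbT !sedge_neq.
have cC : cset (~: C) by apply: star_cset uC (subset_trans (subD1set _ _) (subD1set _ _)).
have xC : x \in ~: C by rewrite in_setC !in_setD1 eqxx andbF.
have yC : y \in ~: C by rewrite in_setC !in_setD1 eqxx.
have [||x' [p [ip sub /set1P ex /set1P lp _]]] := @short_path _ _ [set x] [set y] _ _ (csetE cC xC yC) xC; rewrite ?inE //.
subst x'; have un w : w \in x :: p -> u -- w -> w = x \/ w = last x p.
  move=> /sub; rewrite lp in_setC !in_setD1 in_setU1 in_set => nw uw; move: nw; rewrite uw orbT andbT negb_and !negbK.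
  by case/orP=> /eqP; [right|left].
have szp : 1 < size p.
  case: (p) lp ip => [|a [|b p']] //= e; first by move: xy; rewrite e eqxx.
  by rewrite ichE e (negPf nxy).
have hu : u \notin x :: p by apply/negP => /sub; rewrite in_setC uC.
have hl : hole (u :: x :: p) by apply: hole_of => //; rewrite lp.
have hv : v \notin u :: x :: p.
  rewrite in_cons negb_or eq_sym sedge_neq //=; apply/negP => /sub; by rewrite in_setC vC.
have [a [b [_ _ ab /subsetP sb]]] := sp hl hv.
have inH w : w \in u :: x :: p -> v -- w -> w \in [set a; b].
  by move=> h vw; apply: sb; rewrite in_setI !(in_set (fun _ => _)) vw.
have h1 : u \in [set a; b] by apply: inH; rewrite ?mem_head // sedge_sym.
have h2 : x \in [set a; b] by apply: inH; rewrite // !in_cons eqxx orbT.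
have h3 : y \in [set a; b] by apply: inH; rewrite // in_cons -lp mem_last orbT.
have e1 : u != x by apply: sedge_neq.
have e2 : u != y by apply: sedge_neq.
by move: h1 h2 h3; rewrite !in_set2 => /orP[]/eqP E1 /orP[]/eqP E2 /orP[]/eqP E3; move: e1 e2 xy; rewrite E1 E2 E3 ?eqxx.
Qed.

Lemma conn3C b1 b2 b3 K D : conn3 b1 b2 b3 K D -> conn3 b2 b1 b3 K D.
Proof. by case. Qed.

Lemma fan_rev b1 b2 x p : fan b1 b2 x p -> fan b2 b1 (last x p) (rev (belast x p)).
Proof.
case=> ip [b1x b2l] u1 u2 [n1 n2 p0 bb].
have E : last x p :: rev (belast x p) = rev (x :: p) by rewrite [in RHS]lastI rev_rcons.
have l : last (last x p) (rev (belast x p)) = x.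
  by rewrite -[last _ _]/(last x (last x p :: rev (belast x p))) E rev_cons last_rcons.
split; rewrite ?l ?E ?ich_rev //.
- by move=> u; rewrite mem_rev; apply: u2.
- by move=> u; rewrite mem_rev; apply: u1.
split; rewrite ?mem_rev // 1?sedge_sym //.
by case: (p) p0 => // a p' _; rewrite /= rev_cons; case: (rev _).
Qed.

Lemma maximal_clique K0 : clique K0 -> exists K, [/\ clique K, K0 \subset K & forall u, u \notin K -> exists2 b, b \in K & ~~ b -- u].
Proof.
move=> cK0; pose P K := `[< clique K >] && (K0 \subset K).
have P0 : P K0 by rewrite /P subxx andbT; apply/asboolP.
case: (arg_maxnP (P := P) (fun K : {set G} => #|K|) P0) => K /andP[/asboolP cK sK] mx.
exists K; split=> // u uK; apply: contrapT => no.
have adj b : b \in K -> b -- u by move=> bK; apply: contrapT => /negP h; apply: no; exists b.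
have : P (u |: K).
  rewrite /P (subset_trans sK (subsetUr _ _)) andbT; apply/asboolP => a b /setU1P[->|aK] /setU1P[->|bK] ne.
  - by rewrite eqxx in ne.
  - by rewrite sedge_sym adj.
  - exact: adj.
  - exact: cK.
by move/mx; rewrite /= cardsU1 uK ltnn.
Qed.

Lemma triangle_free : ~ clique [set: G] -> tfree G.
Proof.
move=> ncl b1 b2 b3 b12 b23 b13.
have b21 : b2 -- b1 by rewrite sedge_sym.
have b31 : b3 -- b1 by rewrite sedge_sym.
have b32 : b3 -- b2 by rewrite sedge_sym.
have [|K [cK sK mK]] := @maximal_clique [set b1; b2; b3].
  move=> x y; rewrite !inE -!orbA => /or3P[]/eqP-> /or3P[]/eqP->; by rewrite ?eqxx.
have [k1 k2 k3] : [/\ b1 \in K, b2 \in K & b3 \in K].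
  by split; apply: (subsetP sK); rewrite !inE eqxx ?orbT.
(* With a vertex [c] of [K] not adjacent to [u], two neighbours of [u] in [K] would form a
   diamond. *)
have onb u b b' : u \notin K -> b \in K -> b' \in K -> b -- u -> b' -- u -> b = b'.
  move=> uK bK bK' bu bu'; apply: contrapT => /eqP ne; have [c cK' ncu] := mK u uK.
  have bc : b -- c by apply: cK => //; apply: contraNneq ncu => <-.
  have bc' : b' -- c by apply: cK => //; apply: contraNneq ncu => <-.
  have uc : u != c by apply: contraNneq uK => ->.
  have bb : b -- b' by apply: cK.
  by move: ncu; rewrite sedge_sym (no_diamond bb bu bc bu' bc' uc).
have cKC : cset (~: K).
  apply: (star_cset k1); apply/subsetP => u uK; rewrite in_setU1 in_set; have [//|ne] := eqVneq u b1.
  by rewrite cK // eq_sym.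
have [s0 s0K] : exists s0 : G, s0 \notin K.
  apply: contrapT => no; apply: ncl; rewrite (_ : [set: G] = K) //; apply/setP => u; rewrite in_setT.
  by symmetry; apply: contrapT => /negP h; apply: no; exists u.
(* [K :\ b] lies in the star of [c], so it is no cutset and [b] still reaches the vertex [s0]
   outside [K]. *)
have nbK b c : b \in K -> c \in K -> c != b -> exists2 u, u \notin K & b -- u.
  move=> bK cK' cb; have cD : cset (~: (K :\ b)).
    apply: (@star_cset c); first by rewrite in_setD1 cb.
    apply/subsetP => u; rewrite in_setD1 => /andP[_ uK]; rewrite in_setU1 in_set; have [//|ne] := eqVneq u c.
    by rewrite cK // eq_sym.
  have bD : b \in ~: (K :\ b) by rewrite in_setC in_setD1 eqxx.
  have sD : s0 \in ~: (K :\ b) by rewrite in_setC in_setD1 (negPf s0K) andbF.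
  have [||u [v [/eqP ub vb _ vS uv]]] := conn_exit (csetE cD bD sD) (P := pred1 b).
  - by rewrite unfold_in /= eqxx.
  - by rewrite unfold_in /=; apply: contraNneq s0K => ->.
  have {}vb : v != b by [].
  exists v; last by rewrite -ub.
  by move: vS; rewrite in_setC in_setD1 vb.
have hK b c : b \in K -> c \in K -> c -- b -> hits (~: K) b.
  move=> bK cK' cb; have [u uK bu] := nbK b c bK cK' (sedge_neq cb); apply/hitsP; by exists u; rewrite ?in_setC.
pose P n := `[< exists D, conn3 b1 b2 b3 K D /\ #|D| = n >].
have ex : exists n, P n.
  exists #|~: K|; apply/asboolP; exists (~: K); split=> //; split=> //.
  - by rewrite disjoints_subset.
  - exact: (hK b1 b2).
  - exact: (hK b2 b1).
  - exact: (hK b3 b1).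
case: (ex_minnP ex) => n /asboolP[D [cD nD]] mn.
have minD D' : conn3 b1 b2 b3 K D' -> #|D| <= #|D'|.
  by move=> c3; rewrite nD; apply: mn; apply/asboolP; exists D'.
case: (cD) => csD DK /hitsP[e1 e1D b1e] /hitsP[e2 e2D b2e] /hitsP[e3 e3D b3e].
have nDK u : u \in D -> u \notin K by move=> uD; apply/negP => uK; move/disjP: DK => /(_ u uD uK).
have bD b : b \in K -> b \notin D by apply: contraL => /nDK.
have no2 b c u : b \in K -> c \in K -> b -- c -> u \in D -> b -- u -> c -- u -> False.
  by move=> bK cK' bc uD bu cu; have := onb u b c (nDK u uD) bK cK' bu cu => e; move: bc; rewrite e sedge_irrefl.
have [||x1 [p [io oD b1x b2l [HA HB]]]] := @short_path _ _ [set u | b1 -- u] [set u | b2 -- u] _ _ (csetE csD e1D e2D) e1D.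
- by rewrite in_set.
- by rewrite in_set.
rewrite !in_set in b1x b2l.
have x1D : x1 \in D by apply: oD; rewrite mem_head.
have fn : fan b1 b2 x1 p.
  split=> //.
  - move=> u; rewrite in_cons => /orP[/eqP//|/HA]; rewrite in_set => /negPf-> //.
  - by move=> u uo b2u; apply: (last_only HB uo); rewrite in_set.
  split; [by apply: contra (bD _ k1) => /oD | by apply: contra (bD _ k2) => /oD | | by []].
  by apply/eqP => p0; apply: (no2 b1 b2 x1); rewrite // -[x1]/(last x1 [::]) -p0.
have n3 : b3 \notin x1 :: p by apply: contra (bD _ k3) => /oD.
have bo u : u \in x1 :: p -> ~~ b3 -- u by apply: (no_third sp fn b13 b23 n3).
have p0 : p != [::] by case: fn => _ _ _ _ [].
have onbr u : u \in x1 :: p -> exists2 w, w \in x1 :: p & u -- w.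
  move=> uo; have [w wo wu] : exists2 w, w \in x1 :: p & w != u.
    have [e|ne] := eqVneq x1 u; last by exists x1; rewrite ?mem_head.
    case: (p) p0 io => // a p' _ io; exists a; first by rewrite !in_cons eqxx orbT.
    by rewrite -e eq_sym; apply: sedge_neq; move: io; rewrite ichE => /andP[/andP[]].
  have uS : u \in [set u in x1 :: p] by rewrite in_set.
  have wS : w \in [set u in x1 :: p] by rewrite in_set.
  have [||a [b [/eqP ea _ _ bS ab]]] := conn_exit (csetE (ich_cset io) uS wS) (P := pred1 u).
  - by rewrite unfold_in /= eqxx.
  - by rewrite unfold_in /=.
  by exists b; [move: bS; rewrite in_set | rewrite -ea].
(* The path from [b3] stops at its first vertex with a neighbour on the path between [b1] and [b2];
   the vertices of the latter path are in [B] as well, so it is not met. *)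
pose B := [set u | has (fun w => u -- w) (x1 :: p)].
have oB u : u \in x1 :: p -> u \in B by move=> /onbr[w wo uw]; rewrite in_set; apply/hasP; exists w.
have [||t1 [q [it tD b3t lB [HA3 HB3]]]] := @short_path _ _ [set u | b3 -- u] B _ _ (csetE csD e3D x1D) e3D.
- by rewrite in_set.
- by apply: oB; rewrite mem_head.
rewrite in_set in b3t.
have BP u w : w \in x1 :: p -> u -- w -> u \in B by move=> wo uw; rewrite in_set; apply/hasP; exists w.
have ot u : u \in t1 :: q -> u \notin x1 :: p.
  move=> ut; apply/negP => uo; have ul : u = last t1 q by apply: (last_only HB3 ut (oB u uo)).
  case/lastP: (q) ul HB3 it => [|q' l] ul HB' it'.
    by have := bo u uo; rewrite ul /= b3t.
  rewrite last_rcons in ul; subst l.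
  have lu : last t1 q' -- u by move: it' => /ich_path; rewrite rcons_path => /andP[].
  have := HB' (t1 :: q') [:: u]; rewrite -cats1 => /(_ erefl isT (last t1 q') (mem_last _ _))/negP; apply.
  exact: BP lu.
have bt_un u : u \in t1 :: q -> b3 -- u -> u = t1.
  by rewrite in_cons => /orP[/eqP//|/HA3]; rewrite in_set => /negPf->.
have to_un u w : u \in t1 :: q -> w \in x1 :: p -> u -- w -> u = last t1 q.
  by move=> ut wo uw; apply: (last_only HB3 ut); apply: BP uw.
have tlo : exists2 w, w \in x1 :: p & last t1 q -- w.
  by move: lB; rewrite in_set => /hasP[w wo lw]; exists w.
have a1 t : t \in t1 :: q -> ~~ b1 -- t.
  apply: (no_attach sp minD DK b12 b13 b23 _ _ fn) => //; first by split; apply: bD.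
  by move=> u uD bu cu; apply: (no2 b2 b3 u).
have a2 t : t \in t1 :: q -> ~~ b2 -- t.
  have mR u : (u \in last x1 p :: rev (belast x1 p)) = (u \in x1 :: p) by rewrite -[_ :: _]rev_rcons -lastI mem_rev.
  have minD' D' : conn3 b2 b1 b3 K D' -> #|D| <= #|D'| by move=> /conn3C/minD.
  have bD' : [/\ b2 \notin D, b1 \notin D & b3 \notin D] by split; apply: bD.
  have h13 u : u \in D -> b1 -- u -> b3 -- u -> False by move=> uD bu cu; apply: (no2 b1 b3 u).
  apply: (no_attach sp minD' DK b21 b23 b13 bD' h13 (fan_rev fn)) => //.
  - by move=> u; rewrite mR; apply: oD.
  - by move=> u /ot; rewrite mR.
  - by move=> u; rewrite mR; apply: bo.
  - by case: tlo => w wo lw; exists w; rewrite ?mR.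
  - by move=> u w ut; rewrite mR; apply: to_un.
set tl := last t1 q in tlo to_un.
have tlT : tl \in t1 :: q by apply: mem_last.
have [nb1 nb2 nb3] : [/\ b1 \notin t1 :: q, b2 \notin t1 :: q & b3 \notin t1 :: q].
  by split; [apply: contra (bD _ k1) => /tD | apply: contra (bD _ k2) => /tD | apply: contra (bD _ k3) => /tD].
have hh := fan_hole fn; have ntl : tl \notin b1 :: x1 :: rcons p b2.
  rewrite in_cons -rcons_cons mem_rcons in_cons 2!negb_or ot // andbT; apply/andP; split.
    by apply: contraNneq nb1 => <-.
  by apply: contraNneq nb2 => <-.
have [a [b [_ _ ab /subsetP sb]]] := sp hh ntl.
have inab w : w \in x1 :: p -> tl -- w -> w \in [set a; b].
  move=> wo tw; apply: sb; rewrite in_setI !(in_set (fun _ => _)) tw /= in_cons -rcons_cons mem_rcons in_cons wo.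
  by rewrite !orbT.
have [_ _ un1 un2 [no1 no2' _ _]] := fn.
have uo := ich_uniq io; have ut := ich_uniq it.
have L1 l1 l2 v : x1 :: p = l1 ++ l2 -> l1 != [::] -> v \in l2 -> ~~ b1 -- v /\ v <> b1.
  move=> E l10 vl; have vo : v \in x1 :: p by rewrite E mem_cat vl orbT.
  split; last by move=> e; move: no1; rewrite -e vo.
  apply/negP => /(un1 v vo) e; move: uo; rewrite E; case: (l1) l10 E => // c l1' _ [ec _].
  by rewrite cat_uniq => /and3P[_ /hasPn/(_ v vl)]; rewrite e ec /= mem_head.
have L2 l1 l2 v : x1 :: p = l1 ++ l2 -> l2 != [::] -> v \in l1 -> ~~ b2 -- v /\ v <> b2.
  move=> E l20 vl; have vo : v \in x1 :: p by rewrite E mem_cat vl.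
  split; last by move=> e; move: no2'; rewrite -e vo.
  apply/negP => /(un2 v vo) e; move: uo; rewrite E cat_uniq => /and3P[_ /hasPn h _].
  have : last x1 p \in l2.
    rewrite -[last x1 p]/(last x1 (x1 :: p)) E last_cat; by case: (l2) l20 => // c l2' _; rewrite /= mem_last.
  by rewrite -e => /h; rewrite /= vl.
have L3 v : v \in x1 :: p -> ~~ b3 -- v /\ v <> b3 by move=> vo; split; [exact: bo | move=> e; move: n3; rewrite -e vo].
have T1 v : v \in t1 :: q -> ~~ b1 -- v /\ v <> b1 by move=> vt; split; [exact: a1 | move=> e; move: nb1; rewrite -e vt].
have T2 v : v \in t1 :: q -> ~~ b2 -- v /\ v <> b2 by move=> vt; split; [exact: a2 | move=> e; move: nb2; rewrite -e vt].
have ib1 : ich (b1 :: x1 :: p) by case: fn => _ [h _] _ _ _; apply: ich_cons.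
have ib2 : ich (rcons (x1 :: p) b2) by case: fn => _ [_ h] _ _ _; apply: ich_rcons.
have ib3 : ich (b3 :: t1 :: q) by apply: ich_cons.
have I1 s w r : x1 :: p = rcons s w ++ r -> ich (w :: rcons (rev s) b1).
  move=> E; have := ib1; rewrite E -cat_cons => /ich_catl.
  by rewrite -ich_rev rev_cons rev_rcons.
have I2 s w r : x1 :: p = s ++ w :: r -> ich (w :: rcons r b2).
  by move=> E; have := ib2; rewrite E rcons_cat => /ich_catr.
have wP u v : u \in x1 :: p -> v \in t1 :: q -> u -- v -> v = tl /\ tl -- u.
  rewrite sedge_sym => uo' vt vu; have e := to_un v u vt uo' vu; by split; last rewrite -e.
have neoT u v : u \in x1 :: p -> v \in t1 :: q -> u <> v by move=> uo' vt e; move: (ot v vt); rewrite -e uo'.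
(* By sparsity the neighbours of [tl] on the path lie in one edge. A single neighbour is the apex of
   a pyramid; two of them form with [tl] the second triangle of a prism. *)
have [one|two] := EM (forall w w', w \in x1 :: p -> w' \in x1 :: p -> tl -- w -> tl -- w' -> w = w').
  case: tlo => w wo tw; have hw : has (pred1 w) (x1 :: p) by rewrite has_pred1.
  have [s1 [w' [s2 [E /eqP ew _]]]] := split_first hw; subst w'.
  have E' : x1 :: p = rcons s1 w ++ s2 by rewrite cat_rcons.
  case: vs => _ npy _; apply: npy.
  have s1o u : u \in s1 -> u \in x1 :: p by rewrite E mem_cat => ->.
  have s2o u : u \in s2 -> u \in x1 :: p by rewrite E mem_cat in_cons => ->; rewrite !orbT.
  have w1 : w \notin s1.
    by move: uo; rewrite E cat_uniq => /and3P[_ /hasPn/(_ w (mem_head _ _))].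
  have w2 : w \notin s2 by move: uo; rewrite E cat_uniq => /and3P[_ _ /andP[]].
  have s12 u : u \in s1 -> u \in s2 -> False.
    by move=> u1 u2; move: uo; rewrite E' cat_uniq => /and3P[_ /hasPn/(_ u u2)]; rewrite /= mem_rcons in_cons u1 orbT.
  have so u : u \in x1 :: p -> forall v, v \in t1 :: q -> u -- v -> u = w.
    move=> uo' v vt uv; have [_ tu] := wP u v uo' vt uv; exact: one.
  apply: (@mk_pyramid G w b1 b2 b3 (rev s1) s2 (rev (t1 :: q))) => //.
  - split; [exact: I1 E' | exact: I2 E |].
    have : ich (rcons (b3 :: t1 :: q) w).
      apply: ich_rcons; rewrite // ?[last _ _]/= 1?sedge_sym //.
        move=> u; rewrite in_cons => /orP[/eqP->|ut'] wu; first by have [] := L3 w wo; rewrite sedge_sym wu.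
        by apply: (to_un u w) => //; rewrite sedge_sym.
      rewrite (in_cons b3) 1!negb_or; apply/andP; split; first by apply: contraNneq n3 => <-.
      by apply/negP => /ot; rewrite wo.
    by rewrite -ich_rev rev_rcons rev_cons.
  - apply: cross_rcons => //.
    + move=> u v; rewrite mem_rev => u1 v2; split; first by move=> e; subst v; apply: s12 u1 v2.
      have /andP[_ nuv] : nadj u v by apply: (@ich_sep G s1 w s2); rewrite // -E.
      by split=> //; rewrite (negPf nuv).
    + by rewrite mem_rev; apply: contra no1 => /s1o.
    + by apply: contra no2' => /s2o.
    + by move=> u; rewrite mem_rev; apply: L2 E _.
    + by move=> v; apply: L1 E' _; case: (s1).
  - apply: cross_rcons => //.
    + move=> u v; rewrite !mem_rev => u1 vt; split; first exact: neoT (s1o u u1) vt.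
      split=> // uv; have e := so u (s1o u u1) v vt uv; by rewrite e (negPf w1) in u1.
    + by rewrite mem_rev; apply: contra no1 => /s1o.
    + by rewrite mem_rev.
    + by move=> u; rewrite mem_rev => /s1o; apply: L3.
    + by move=> v; rewrite mem_rev; apply: T1.
  - apply: cross_rcons => //.
    + move=> u v; rewrite !mem_rev => u1 vt; split; first exact: neoT (s2o u u1) vt.
      split=> // uv; have e := so u (s2o u u1) v vt uv; by rewrite e (negPf w2) in u1.
    + by apply: contra no2' => /s2o.
    + by rewrite mem_rev.
    + by move=> u /s2o; apply: L3.
    + by move=> v; rewrite mem_rev; apply: T2.
  - move: E p0; case: (s1) => [[_ <-]|c s1' _ _]; first by right.
    by left; rewrite rev_cons; case: (rev s1').
  - by rewrite rev_cons; case: (rev q).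
have [w [w' [wo wo' tw tw' ww]]] : exists w w', [/\ w \in x1 :: p, w' \in x1 :: p, tl -- w, tl -- w' & w -- w'].
  apply: contrapT => no; apply: two => w w' wo wo' tw tw'; apply: contrapT => /eqP ne; apply: no.
  exists w, w'; split=> //; have := inab w wo tw; have := inab w' wo' tw'; rewrite !in_set2.
  by move=> /orP[]/eqP e' /orP[]/eqP e; move: ne; rewrite e e' ?eqxx // => _; rewrite sedge_sym.
have [v1 [v2 [s1 [s2 [E tv1 tv2]]]]] : exists w w' s1 s2, [/\ x1 :: p = s1 ++ w :: w' :: s2, tl -- w & tl -- w'].
  by case/orP: (ich_infix io wo wo' ww) => /infixP[s1 [s2 E]]; [exists w, w', s1, s2 | exists w', w, s1, s2].
clear w w' wo wo' tw tw' ww.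
rename v1 into w; rename v2 into w'; rename tv1 into tw; rename tv2 into tw'.
have E' : x1 :: p = rcons s1 w ++ w' :: s2 by rewrite cat_rcons.
have wo : w \in x1 :: p by rewrite E mem_cat mem_head orbT.
have wo' : w' \in x1 :: p by rewrite E mem_cat !in_cons eqxx !orbT.
have s1o u : u \in w :: rev s1 -> u \in x1 :: p by rewrite E' mem_cat mem_rcons !in_cons mem_rev => ->.
have s2o u : u \in w' :: s2 -> u \in x1 :: p by rewrite E' mem_cat => ->; rewrite orbT.
have ww : w -- w' by apply: (path_infix (ich_path io)); apply/infixP; exists s1, s2.
have s12 u : u \in w :: rev s1 -> u \in w' :: s2 -> False.
  by rewrite in_cons mem_rev -in_cons -mem_rcons => u1 u2; move: uo; rewrite E' cat_uniq => /and3P[_ /hasPn/(_ u u2)]; rewrite /= u1.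
have so u v : u \in x1 :: p -> v \in t1 :: q -> u -- v -> v = tl /\ (u = w \/ u = w').
  move=> uo' vt uv; have [e tu] := wP u v uo' vt uv; split=> //.
  have ne : w != w' by apply: sedge_neq.
  have := inab u uo' tu; have := inab w wo tw; have := inab w' wo' tw'; rewrite !in_set2.
  by move=> /orP[]/eqP e1' /orP[]/eqP e2' /orP[]/eqP e3'; move: ne; rewrite ?e1' ?e2' ?e3' ?eqxx // => _; by [left | right].
have rTE : rev (t1 :: q) = tl :: rev (belast t1 q) by rewrite lastI rev_rcons.
case: vs => _ _ npr; apply: npr.
apply: (@mk_prism G w w' tl b1 b2 b3 (rev s1) s2 (rev (belast t1 q))) => //; try by rewrite sedge_sym.
- split; [exact: I1 E' | exact: I2 E' |].
  by rewrite -rcons_cons -rTE -rev_cons ich_rev.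
- rewrite -!rcons_cons; apply: cross_rcons => //.
  + move=> u v u1 v2; split; first by move=> e; subst v; apply: s12 u1 v2.
    split; last by case=> -> ->.
    move=> uv; move: u1; rewrite in_cons => /orP[/eqP eu|u1].
      subst u; move: v2; rewrite in_cons => /orP[/eqP//|v2].
      have /andP[_] : nadj w v by apply: (@ich_sep G (rcons s1 w) w' s2); rewrite -?E' // mem_rcons mem_head.
      by rewrite uv.
    have /andP[_] : nadj u v by apply: (@ich_sep G s1 w (w' :: s2)); rewrite -?E // -mem_rev.
    by rewrite uv.
  + by move=> u v [-> ->]; rewrite !mem_head.
  + by apply: contra no1 => /s1o.
  + by apply: contra no2' => /s2o.
  + move=> u; rewrite in_cons mem_rev -in_cons -mem_rcons; exact: L2 E' _.
  + by move=> v; apply: L1 E' _; case: (s1).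
- rewrite -!rcons_cons -rTE; apply: cross_rcons => //.
  + move=> u v u1; rewrite mem_rev => vt; split; first exact: neoT (s1o u u1) vt.
    split; last by case=> -> ->; rewrite sedge_sym.
    move=> uv; have [ev [eu|eu]] := so u v (s1o u u1) vt uv; first by [].
    by exfalso; apply: (s12 u u1); rewrite eu mem_head.
  + by move=> u v [-> ->]; rewrite mem_head mem_rev.
  + by apply: contra no1 => /s1o.
  + by rewrite mem_rev.
  + by move=> u /s1o; apply: L3.
  + by move=> v; rewrite mem_rev; apply: T1.
rewrite -!rcons_cons -rTE; apply: cross_rcons => //.
- move=> u v u1; rewrite mem_rev => vt; split; first exact: neoT (s2o u u1) vt.
  split; last by case=> -> ->; rewrite sedge_sym.
  move=> uv; have [ev [eu|eu]] := so u v (s2o u u1) vt uv; last by [].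
  by exfalso; apply: (s12 u _ u1); rewrite eu mem_head.
- by move=> u v [-> ->]; rewrite mem_head mem_rev.
- by apply: contra no2' => /s2o.
- by rewrite mem_rev.
- by move=> u /s2o; apply: L3.
- by move=> v; rewrite mem_rev; apply: T2.
Qed.
End TriangleFree.

Lemma border_le (G : sgraph) k k' (F : {set {set G}}) : k' <= k -> border k F -> border k' F.
Proof. by move=> le oF Y lt; apply: oF; apply: leq_trans lt le. Qed.

(** Such a graph has at most [t] vertices, and all of them together hit every bramble. *)
Lemma complete_treewidth (G : sgraph) t : clique [set: G] ->
  ~ (exists K : {set G}, clique K /\ #|K| = t.+1) -> treewidth G <= 3 * t.+1.
Proof.
move=> cl no; rewrite leqNgt; apply/negP => lt.
have lG : #|G| < t.+1.
  rewrite ltnNge; apply/negP => le; apply: no; exists [set x in take t.+1 (enum G)]; split.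
    by move=> x y _ _; apply: cl; rewrite in_setT.
  by rewrite cardsE (card_uniqP (take_uniq _ (enum_uniq _))) size_takel // -cardE.
have [F [bF oF]] := tw_bramble (ltn0Sn t) lt.
have [|A AF dA] := oF [set: G]; first by rewrite cardsT.
have [/set0Pn[a aA] _] := proj1 bF A AF.
by move/disjP: dA => /(_ a aA); rewrite in_setT; apply.
Qed.

Lemma wall_of_bramble (t k : nat) (G : sgraph) (F : {set {set G}}) : tfree G -> sp1 G ->
  (forall (N : sgraph) (F : {set {set N}}), bramble F -> border k F -> exists X : brick (t + 4) (2 * t + 6) -> {set N}, model X) ->
  bramble F -> border (2 * k) F -> exists S, is_subdivision (wall t) S /\ induced_subgraph S G.
Proof.
move=> tf sp grid bF oF; have [U cr] := critical_sub bF oF.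
have ve (x y : ind U) : val x -- val y = x -- y by [].
have tf' : tfree (ind U) := emb_tfree ve tf.
have sp' : sp1 (ind U) by apply: (emb_sp1 (H := ind U) (f := val)) sp => //; apply: val_inj.
pose P n := `[< exists X : brick (t + 4) (2 * t + 6) -> {set ind U}, [/\ model X, mclean X & msize X = n] >].
have ex : exists n, P n.
  by have [X [mX cX]] := block_model tf' sp' cr grid; exists (msize X); apply/asboolP; exists X.
case: (ex_minnP ex) => n /asboolP[X [mX cX sX]] mn.
have [|S [sub ind_S]] := wall_subdivision tf' mX cX.
  by move=> X' mX' cX'; rewrite sX; apply: mn; apply/asboolP; exists X'.
by exists S; split=> //; apply: induced_trans ind_S (ind_sub U).
Qed.

Theorem theorem2p2 (t : nat) (ht : 0 < t) :
  exists c : nat, forall G : sgraph,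
    classF t G -> c < treewidth G -> ~ has_star_cutset G ->
    exists S : sgraph, is_subdivision (wall t) S /\ induced_subgraph S G.
Proof.
have [k grid] := grid_theorem (t + 4) (2 * t + 6).
(* The grid theorem needs order [k] after the contraction of the matching, hence [2 * k] before it;
   the summand [t.+1] takes care of complete graphs. *)
exists (3 * (2 * k + t.+1)) => G [vs ncl] lt nsc.
have [cl|nc] := EM (clique [set: G]).
  have := complete_treewidth cl ncl; rewrite leqNgt => /negP[]; apply: leq_ltn_trans lt.
  by rewrite leq_mul2l leq_addl orbT.
have tf := triangle_free vs nsc nc.
have sp : sp1 G by apply: sparse_sp1 tf; case: vs.
have [|F [bF oF]] := tw_bramble _ lt; first by rewrite addnS.
by apply: (wall_of_bramble tf sp grid bF (border_le (leq_addr _ _) oF)).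
Qed.
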